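(* Let $N\ge 2$, let $B_1\subset\mathbb{R}^N$ be the open unit ball, and let $p>1$. Then for every integer $k\ge 2$, $$\lambda_k(B_1;p)<\mu_k(p).$$
   Context: For a bounded Lipschitz domain $\Omega\subset\mathbb{R}^N$ and $p>1$, let $\mathcal{S}=\{u\in W_0^{1,p}(\Omega):\|u\|_{L^p(\Omega)}=1\}$, and for $k\in\mathbb{N}$ let $\mathcal{F}_k$ be the family of sets $\mathcal{A}\subset\mathcal{S}$ of the form $\mathcal{A}=h(\mathcal{S}^{k-1})$, where $\mathcal{S}^{k-1}$ is the unit sphere in $\mathbb{R}^k$ and $h:\mathcal{S}^{k-1}\to\mathcal{S}$ is continuous and odd. Define the variational eigenvalues of the Dirichlet $p$-Laplacian $-\Delta_p u=-\mathrm{div}(|\nabla u|^{p-2}\nabla u)$ by $$\lambda_k(\Omega;p)=\inf_{\mathcal{A}\in\mathcal{F}_k}\sup_{u\in\mathcal{A}}\int_\Omega|\nabla u|^p\,dx.$$ The radial eigenvalues $\mu_1(p)<\mu_2(p)<\dots$ are the numbers $\mu$ for which the problem $-(r^{N-1}|u'|^{p-2}u')'=\mu r^{N-1}|u|^{p-2}u$ on $(0,1)$, $u'(0)=0$, $u(1)=0$, has a nontrivial solution, listed in increasing order; an eigenfunction of $\mu_k(p)$ has exactly $k-1$ zeros in $(0,1)$. *)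

(* Defs.v *)
From HB Require Import structures.
From mathcomp Require Import all_boot all_order all_algebra.
From mathcomp Require Import all_classical all_reals all_analysis.
Set Implicit Arguments. Unset Strict Implicit. Unset Printing Implicit Defensive.
Import Order.TTheory GRing.Theory Num.Theory.
Import numFieldNormedType.Exports.
Local Open Scope classical_set_scope.
Local Open Scope ring_scope.

Section Defs.
Variable R : realType.

Definition sqnorm (n : nat) (x : 'rV[R]_n) : R := \sum_(i < n) (x ord0 i) ^+ 2.

Definition unit_ball (N : nat) : set 'rV[R]_N := [set x | sqnorm x < 1].

Definition unit_sphere (k : nat) : set 'rV[R]_k := [set y | sqnorm y = 1].

Definition partial (N : nat) (i : 'I_N) (u : 'rV[R]_N -> R) (x : 'rV[R]_N) : R :=
  'D_(delta_mx 0 i) u x.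

Definition gradnorm (N : nat) (u : 'rV[R]_N -> R) (x : 'rV[R]_N) : R :=
  Num.sqrt (\sum_(i < N) (partial i u x) ^+ 2).

Definition Cc1 (N : nat) (Omega : set 'rV[R]_N) (u : 'rV[R]_N -> R) : Prop :=
  (forall x, differentiable u x) /\
  (forall i : 'I_N, continuous (partial i u)) /\
  exists K : set 'rV[R]_N, [/\ compact K, K `<=` Omega & forall x, ~ K x -> u x = 0].

Definition setcoord (N : nat) (v : 'rV[R]_N) (m : nat) (t : R) : 'rV[R]_N :=
  \row_(j < N) (if (j : nat) == m then t else v ord0 j).

Fixpoint iint (N : nat) (n : nat) (F : 'rV[R]_N -> \bar R) (v : 'rV[R]_N) : \bar R :=
  match n with
  | 0 => F v
  | n'.+1 => (\int[@lebesgue_measure R]_t iint n' F (setcoord v n' t))%E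
  end.

(* integral over R^N (used only for nonnegative continuous compactly
   supported integrands, where it is the Lebesgue integral) *)
Definition intRN (N : nat) (F : 'rV[R]_N -> \bar R) : \bar R := iint N F 0.

Definition Lpp (N : nat) (p : R) (u : 'rV[R]_N -> R) : \bar R :=
  intRN (fun x => (`|u x| `^ p)%:E).

Definition energy (N : nat) (p : R) (u : 'rV[R]_N -> R) : \bar R :=
  intRN (fun x => (gradnorm u x `^ p)%:E).

(* W_0^{1,p}(Omega) is realised as the completion of C_c^1(Omega) for the
   W^{1,p} norm: its elements are represented by W^{1,p}-Cauchy sequences
   of C_c^1(Omega) functions. *)
Definition W0seq (N : nat) (p : R) (Omega : set 'rV[R]_N)
    (s : nat -> 'rV[R]_N -> R) : Prop :=
  (forall n, Cc1 Omega (s n)) /\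
  forall e : R, 0 < e -> exists M : nat, forall m n : nat, (M <= m)%N -> (M <= n)%N ->
    (Lpp p (fun x => (s m x - s n x)%R) < e%:E)%E /\ (energy p (fun x => (s m x - s n x)%R) < e%:E)%E.

(* the W^{1,p}-distance between the represented elements is < e
   (up to the usual limit/eventually identification, uniformly in e) *)
Definition W_close (N : nat) (p : R) (s t : nat -> 'rV[R]_N -> R) (e : R) : Prop :=
  exists M : nat, forall n : nat, (M <= n)%N ->
    (Lpp p (fun x => (s n x - t n x)%R) < e%:E)%E /\ (energy p (fun x => (s n x - t n x)%R) < e%:E)%E.

Definition admissible (N : nat) (p : R) (Omega : set 'rV[R]_N) (k : nat)
    (h : 'rV[R]_k -> nat -> 'rV[R]_N -> R) : Prop :=
  [/\
      forall y, @unit_sphere k y -> W0seq p Omega (h y),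
      forall y, @unit_sphere k y -> (fun n => Lpp p (h y n)) @ \oo --> 1%:E,
      forall y, @unit_sphere k y -> forall e : R, 0 < e -> exists2 d : R, 0 < d &
        forall y', @unit_sphere k y' -> sqnorm (y - y') < d -> W_close p (h y) (h y') e
    &
      forall y, @unit_sphere k y -> forall e : R, 0 < e ->
        W_close p (h (- y)) (fun n => - (h y n)) e].

Definition W_energy (N : nat) (p : R) (s : nat -> 'rV[R]_N -> R) : \bar R :=
  limn (fun n => energy p (s n)).

Definition lambda_var (N : nat) (Omega : set 'rV[R]_N) (p : R) (k : nat) : \bar R :=
  ereal_inf [set ereal_sup [set W_energy p (h y) | y in @unit_sphere k]
            | h in [set h | @admissible N p Omega k h]].

Definition phip (p : R) (t : R) : R := Num.sg t * `|t| `^ (p - 1).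

(* mu is a radial eigenvalue of the Dirichlet p-Laplacian on the unit ball of R^N *)
Definition radial_eig (N : nat) (p : R) (mu : R) : Prop :=
  exists u : R -> R,
    [/\ forall r : R, 0 <= r <= 1 -> derivable u r 1,
        {within `[0, 1], continuous (derive1 u)},
        derive1 u 0 = 0 /\ u 1 = 0,
        (exists2 r : R, 0 < r < 1 & u r != 0)
      & forall r : R, 0 < r < 1 ->
          derivable (fun s : R => s ^+ N.-1 * phip p (derive1 u s)) r 1 /\
          - derive1 (fun s : R => s ^+ N.-1 * phip p (derive1 u s)) r
            = mu * r ^+ N.-1 * phip p (u r)].

Definition radial_kth (N : nat) (p : R) (k : nat) (mu : R) : Prop :=
  radial_eig N p mu /\
  exists s : seq R, [/\ uniq s, size s = k.-1 &
    forall nu, (radial_eig N p nu /\ nu < mu) <-> nu \in s].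

End Defs.

(* Main.v *)
Require Import Defs.
From HB Require Import structures.
From mathcomp Require Import all_boot all_order all_algebra.
From mathcomp Require Import all_classical all_reals all_analysis.
From mathcomp Require Import ring lra.

(* Let u be the radial profile of the eigenvalue mu_k(p) = mu, with zeros
   z_1 < ... < z_k = 1.  If k nonnegative C^1 functions with pairwise disjoint supports in the
   open ball satisfy int |grad v|^p < mu int v^p, then their signed L^p combinations form an
   admissible odd image of the sphere on which the energy stays below a number < mu.

   Restricting |u| to its nodal domains gives equality.  Strictness on an annulus
   A < |x| < z_j, with A slightly below z_(j-1), is free: enlarging the domain lowers the first
   eigenvalue, so there is room to spare towards the origin and each support may be kept
   strictly inside |x| < z_j.  This propagates outwards to z_k = 1 once the first two functions
   have been placed inside some |x| < R with R < z_2.  There symmetry is broken.  The restriction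
   of |u| to z_1 < |x| < z_2 is polarized with respect to a hyperplane x_1 = s/2, with s the
   distance between two radii tau < sigma on either side of the maximum where |u| agrees.  The
   result has no more energy, the same L^p norm, and vanishes on the translated ball
   |x - s e_1| < rho for some rho > z_1, which carries a translated ball test function.  It is
   not an eigenfunction: where the graphs of the two reflected copies cross, the maximum has
   a kink, and a small bump there makes the quotient drop strictly below mu.  All the maxima,
   minima and positive parts are smoothed at scale d, and d is chosen last. *)

Set Implicit Arguments. Unset Strict Implicit. Unset Printing Implicit Defensive.
Import Order.TTheory GRing.Theory Num.Theory.
Import numFieldNormedType.Exports.
Local Open Scope classical_set_scope.
Local Open Scope ring_scope.

(** * Powers and the odd power function *)

(** Two obstacles shape the development. First, the ball |x| < z_1 and the annulus z_1 < |x| < z_2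
    compete for the sphere between them: enlarging one radially shrinks the other, so both quotients
    cannot be made strict in that way. Polarization moves the hole of the annulus off centre, and
    the strict gain of the bump pays for truncating the annulus to a hole slightly larger than |x| <
    z_1. Second, for p different from 2 one equation of the first-order system has a right-hand side
    that is not Lipschitz, and the coefficient (N-1)/r is singular at 0. Existence therefore comes
    from a delayed equation and compactness, uniqueness from Picone's inequality; both are required,
    since listing the eigenvalues below mu_k needs every radial eigenfunction to be a multiple of
    one rescaled profile. Energies are bounded by testing the equation of u with truncations whose
    slope is a fraction s in [0, 1] of u', for which |s u'|^p <= s |u'|^p. All test functions are
    C^1 with compact support in the ball, so elements of W_0^{1,p} enter only as constant
    sequences. *)

Section Powers.
Variable R : realType.
Implicit Types p q t x y a b : R.

Lemma near_is_derive1 (f g : R -> R) (x df : R) :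
  (\forall y \near x, f y = g y) -> is_derive x 1 f df -> is_derive x 1 g df.
Proof. by move=> fg H; exact: (@near_eq_is_derive R R^o R^o f g x 1 df fg H). Qed.

Lemma phip_ge0E p t : 1 < p -> 0 <= t -> phip p t = t `^ (p - 1).
Proof.
move=> p1; rewrite le_eqVlt => /predU1P[<-|t0].
  by rewrite /phip sgr0 mul0r powR0// gt_eqF// subr_gt0.
by rewrite /phip gtr0_sg// mul1r gtr0_norm.
Qed.

Lemma phipN p t : phip p (- t) = - phip p t.
Proof. by rewrite /phip sgrN normrN mulNr. Qed.

Lemma phip0 p : phip p 0 = 0.
Proof. by rewrite /phip sgr0 mul0r. Qed.

Lemma phip_gt0 p t : 0 < t -> 0 < phip p t.
Proof. by move=> t0; rewrite /phip gtr0_sg// mul1r powR_gt0// normr_gt0 gt_eqF. Qed.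

Lemma phip_lt0 p t : t < 0 -> phip p t < 0.
Proof. by move=> t0; rewrite -oppr_gt0 -phipN phip_gt0// oppr_gt0. Qed.

Lemma phip_sg p t : Num.sg (phip p t) = Num.sg t.
Proof.
case: (ltrgtP t 0) => t0.
- by rewrite !ltr0_sg// phip_lt0.
- by rewrite !gtr0_sg// phip_gt0.
- by rewrite t0 phip0.
Qed.

Lemma normr_phip p t : 1 < p -> `|phip p t| = `|t| `^ (p - 1).
Proof.
move=> p1; wlog t0 : t / 0 <= t => [hw|].
  have [/hw//|t0] := leP 0 t.
  by rewrite -normrN -phipN hw ?normrN// oppr_ge0 ltW.
by rewrite phip_ge0E// (ger0_norm (powR_ge0 _ _)) ger0_norm.
Qed.

Lemma mul_phip p t : 1 < p -> t * phip p t = `|t| `^ p.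
Proof.
move=> p1; rewrite /phip mulrA [t * _]mulrC -normrEsg mulr_powRB1//.
by rewrite (lt_trans ltr01).
Qed.

Lemma phipM p x y : phip p (x * y) = phip p x * phip p y.
Proof. by rewrite /phip sgrM normrM powRM//; ring. Qed.

Lemma phip_mono p : 1 < p -> {mono phip p : x y / x <= y}.
Proof.
move=> p1; apply: le_mono => x y xy.
have pos u v : 0 <= u -> u < v -> phip p u < phip p v.
  move=> u0 uv; have v0 := ltW (le_lt_trans u0 uv).
  by rewrite !phip_ge0E// gt0_ltr_powR// ?subr_gt0 ?nnegrE.
have [x0|x0] := leP 0 x; first exact: pos.
have [y0|y0] := leP 0 y.
  rewrite (lt_le_trans (phip_lt0 p x0))// phip_ge0E// powR_ge0//.
by rewrite -ltrN2 -!phipN pos ?ltrN2// oppr_ge0 ltW.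
Qed.

Lemma phip_smono p : 1 < p -> {mono phip p : x y / x < y}.
Proof. by move=> p1; apply/leW_mono/phip_mono. Qed.

Lemma phip_eq0 p t : 1 < p -> (phip p t == 0) = (t == 0).
Proof. by move=> p1; rewrite -{1}(phip0 p) (inj_eq (inc_inj (phip_mono p1))). Qed.

(** The Hoelder conjugate exponent. It is introduced because [phip (conjp p)] inverts [phip p], so
    that the slope can be recovered from the flux. *)
Definition conjp p := p / (p - 1).

Lemma conjp_gt1 p : 1 < p -> 1 < conjp p.
Proof. by move=> p1; rewrite /conjp ltr_pdivlMr ?subr_gt0// mul1r ltrBlDr ltrDl. Qed.

Lemma conjpK p : 1 < p -> conjp (conjp p) = p.
Proof.
move=> p1; rewrite /conjp.
have h : p - 1 != 0 by rewrite gt_eqF// subr_gt0.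
have h1 : p / (p - 1) - 1 = (p - 1)^-1 by field.
by rewrite h1 invrK divfK.
Qed.

Lemma conjpB1 p : 1 < p -> (p - 1) * (conjp p - 1) = 1.
Proof.
move=> p1; have h : p - 1 != 0 by rewrite gt_eqF// subr_gt0.
rewrite /conjp; by field.
Qed.

Lemma conjpV p : 1 < p -> p^-1 + (conjp p)^-1 = 1.
Proof.
move=> p1; have h : p - 1 != 0 by rewrite gt_eqF// subr_gt0.
have h2 : p != 0 by rewrite gt_eqF// (lt_trans ltr01).
by rewrite /conjp; field; rewrite h2 h.
Qed.

Lemma phipK p : 1 < p -> cancel (phip p) (phip (conjp p)).
Proof.
move=> p1 t; rewrite {1}/phip phip_sg normr_phip// -powRrM conjpB1// powRr1//.
by rewrite [RHS]numEsg.
Qed.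

Lemma phip_conjpK p : 1 < p -> cancel (phip (conjp p)) (phip p).
Proof. by move=> p1 t; have := phipK (conjp_gt1 p1) t; rewrite conjpK. Qed.

Lemma is_derive_phip p t : 1 < p -> t != 0 ->
  is_derive t 1 (phip p) ((p - 1) * `|t| `^ (p - 2)).
Proof.
move=> p1; have pos (u : R) : 0 < u -> is_derive u 1 (phip p) ((p - 1) * `|u| `^ (p - 2)).
  move=> u0; apply: (@near_is_derive1 (fun x : R => x `^ (p - 1))).
    by near=> z; rewrite phip_ge0E//; apply: ltW; near: z; exact: lt_nbhsr.
  rewrite gtr0_norm//; have := is_derive1_powR (p - 1) u0.
  by rewrite -addrA -opprD.
case: (ltrgtP t 0) => // t0 _; last exact: pos.
rewrite (_ : phip p = fun x => - phip p (- x)); last first.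
  by apply/funext => x; rewrite phipN opprK.
have H : is_derive (- t) 1 (phip p) ((p - 1) * `|- t| `^ (p - 2)).
  by apply: pos; rewrite oppr_gt0.
rewrite normrN in H.
have H2 := @is_derive1_comp _ (phip p) -%R t _ (-1) H (is_deriveNid _ _).
have H3 := is_deriveN H2.
by rewrite /= mulrN1 opprK in H3.
Unshelve. all: by end_near. Qed.

Lemma phip_continuous0 p : 1 < p -> phip p x @[x --> 0] --> 0.
Proof.
move=> p1; apply/cvgrPdist_lt => e e0.
have q0 : 0 < conjp p - 1 by rewrite subr_gt0 conjp_gt1.
near=> x; rewrite sub0r normrN normr_phip//.
have -> : e = (e `^ (conjp p - 1)) `^ (p - 1).
  by rewrite -powRrM mulrC conjpB1// powRr1// ltW.
apply: gt0_ltr_powR; rewrite ?subr_gt0 ?nnegrE ?powR_ge0//.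
near: x; have := @nbhs0_lt R R (e `^ (conjp p - 1)).
by apply; rewrite powR_gt0.
Unshelve. all: by end_near. Qed.

Lemma phip_continuous p : 1 < p -> continuous (phip p).
Proof.
move=> p1 t; have [->|t0] := eqVneq t 0.
  by rewrite /continuous_at phip0; exact: phip_continuous0.
apply: differentiable_continuous; apply/derivable1_diffP.
by case: (is_derive_phip p1 t0).
Qed.

Lemma is_derive_powr_norm p t : 1 < p ->
  is_derive t 1 (fun x : R => `|x| `^ p) (p * phip p t).
Proof.
move=> p1; have p0 : 0 < p by rewrite (lt_trans ltr01).
have pos (u : R) : 0 < u -> is_derive u 1 (fun x : R => `|x| `^ p) (p * phip p u).
  move=> u0; apply: (@near_is_derive1 (fun x : R => x `^ p)).
    by near=> z; rewrite ger0_norm//; apply: ltW; near: z; exact: lt_nbhsr.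
  by rewrite phip_ge0E ?ltW//; exact: is_derive1_powR.
case: (ltrgtP t 0) => t0; last 2 first.
- exact: pos.
- rewrite t0 phip0 mulr0.
  (* At 0 the difference quotient of |x|^p is exactly [phip p h], which tends to 0. *)
  have key : h^-1 *: ((`|h *: (1 : R) + 0| `^ p : R) - `|0 : R| `^ p) @[h --> (0:R)^'] --> (0 : R).
    apply: (@cvg_trans _ (phip p x @[x --> (0:R)^'])).
      apply: near_eq_cvg; near=> h.
      have h0 : h != 0 by near: h; exact: nbhs_dnbhs_neq.
      rewrite addr0 normr0 powR0 ?gt_eqF// subr0 [_%:A]mulr1.
      by rewrite -mul_phip// /GRing.scale/= mulrA mulVf// mul1r.
    apply: (cvg_trans _ (phip_continuous0 p1)); apply: cvg_app.
    exact: cvg_within.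
  apply: DeriveDef; first by apply/cvg_ex; exists 0.
  exact/cvg_lim.
rewrite (_ : (fun x : R => `|x| `^ p) = (fun x : R => `|x| `^ p) \o -%R); last first.
  by apply/funext => x /=; rewrite normrN.
have -> : p * phip p t = p * phip p (- t) * -1 by rewrite phipN; ring.
apply: is_derive1_comp; apply: pos; by rewrite oppr_gt0.
Unshelve. all: by end_near. Qed.

Lemma powr_norm_continuous p : 1 < p -> continuous (fun x : R => `|x| `^ p).
Proof.
move=> p1 t; apply: differentiable_continuous; apply/derivable1_diffP.
by case: (is_derive_powr_norm t p1).
Qed.

Lemma young_phip p x y : 1 < p -> 0 <= x -> 0 <= y ->
  p * (y `^ (p - 1) * x) <= x `^ p + (p - 1) * y `^ p.
Proof.
move=> p1 x0 y0; have p0 : 0 < p by rewrite (lt_trans ltr01).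
have q0 : 0 < conjp p by rewrite (lt_trans ltr01)// conjp_gt1.
have := conjugate_powR x0 (powR_ge0 y (p - 1)) p0 q0 (conjpV p1).
have h : p - 1 != 0 by rewrite gt_eqF// subr_gt0.
rewrite -powRrM (_ : (p - 1) * conjp p = p); last by rewrite /conjp mulrC divfK.
rewrite -(ler_pM2l p0) mulrDr [_ * (x * _)]mulrCA => H.
rewrite mulrC -mulrA [_ * (x * p)]mulrCA; move: H.
rewrite [p * (x `^ p / p)]mulrC divfK ?gt_eqF// => H.
have E : p * (y `^ p / conjp p) = (p - 1) * y `^ p.
  by rewrite /conjp; field; rewrite h gt_eqF.
by rewrite E in H; apply: le_trans H; rewrite le_eqVlt; apply/orP; left; apply/eqP; ring.
Qed.

(** Convexity of |t|^p, read off from Young's inequality. It serves as the positivity in Picone's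
    identity and as the one-sided control of first variations. *)
Lemma phip_tangent p a b : 1 < p ->
  `|b| `^ p + p * (phip p b * (a - b)) <= `|a| `^ p.
Proof.
move=> p1; have p0 : 0 < p by rewrite (lt_trans ltr01).
have := young_phip p1 (normr_ge0 a) (normr_ge0 b).
rewrite -normr_phip// -normrM => H.
have : p * (phip p b * a) <= p * `|phip p b * a|.
  by rewrite ler_pM2l// ler_norm.
have -> : p * (phip p b * (a - b)) = p * (phip p b * a) - p * (b * phip p b) by ring.
rewrite mul_phip//; lra.
Qed.

End Powers.

(** * Calculus on the line *)

Section RealCalculus.
Variable R : realType.
Implicit Types (f g F G df : R -> R) (a b x : R).

Lemma MVT_closed f df a b : a <= b ->
  (forall x, a <= x <= b -> is_derive x 1 f (df x)) ->
  exists2 c, a <= c <= b & f b - f a = df c * (b - a).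
Proof.
move=> ab H.
have [x /itvP xab||c /itvP cab E] := @MVT_segment R f df a b ab.
- by apply: H; rewrite !ltW ?xab.
- apply: continuous_in_subspaceT => y; rewrite inE/= => /itvP yab.
  apply: differentiable_continuous; apply/derivable1_diffP.
  by have [] : is_derive y 1 f (df y) by apply: H; rewrite !yab.
- by exists c => //; rewrite !cab.
Qed.

Lemma derive_ge0_le f df a b : a <= b ->
  (forall x, a <= x <= b -> is_derive x 1 f (df x)) ->
  (forall x, a <= x <= b -> 0 <= df x) -> f a <= f b.
Proof.
move=> ab H H0; have [c cab E] := MVT_closed ab H.
by rewrite -subr_ge0 E mulr_ge0 ?H0// subr_ge0.
Qed.

Lemma derive_gt0_lt f df a b : a < b ->
  (forall x, a <= x <= b -> is_derive x 1 f (df x)) ->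
  (forall x, a <= x <= b -> 0 < df x) -> f a < f b.
Proof.
move=> ab H H0; have [c cab E] := MVT_closed (ltW ab) H.
by rewrite -subr_gt0 E mulr_gt0 ?H0// subr_gt0.
Qed.

Lemma derive_bound f df a b c : a <= b ->
  (forall x, a <= x <= b -> is_derive x 1 f (df x)) ->
  (forall x, a <= x <= b -> `|df x| <= c) -> `|f b - f a| <= c * (b - a).
Proof.
move=> ab H H0; have [d dab ->] := MVT_closed ab H.
by rewrite normrM (@ger0_norm _ (b - a)) ?subr_ge0// ler_wpM2r ?subr_ge0// H0.
Qed.

Lemma derive0_eq f a b : a <= b ->
  (forall x, a <= x <= b -> is_derive x 1 f 0) -> f b = f a.
Proof.
move=> ab H; have [d _ E] := @MVT_closed f (cst 0) a b ab H.
by apply/eqP; rewrite -subr_eq0 E mul0r.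
Qed.

Lemma derive_eq f g df a b : a <= b ->
  (forall x, a <= x <= b -> is_derive x 1 f (df x)) ->
  (forall x, a <= x <= b -> is_derive x 1 g (df x)) -> f a = g a -> f b = g b.
Proof.
move=> ab Hf Hg fg; apply: subr0_eq.
rewrite -[0](subrr (f a)) {2}fg; apply: (@derive0_eq (fun x => f x - g x)) => // x xab.
rewrite -(subrr (df x)).
exact: (@is_deriveB R R^o R^o f g x 1 (df x) (df x) (Hf x xab) (Hg x xab)).
Qed.

Lemma is_derive_continuous f x (df : R) : is_derive x 1 f df -> {for x, continuous f}.
Proof.
by move=> [d _]; apply: differentiable_continuous; apply/derivable1_diffP.
Qed.

Lemma is_derive1_val f x (u v : R) : is_derive x 1 f u -> u = v -> is_derive x 1 f v.
Proof. by move=> H <-. Qed.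

Lemma is_derive1D f g x (u v : R) : is_derive x 1 f u -> is_derive x 1 g v ->
  is_derive x 1 (fun y => f y + g y) (u + v).
Proof. by move=> Hf Hg; exact: (@is_deriveD R R^o R^o f g x 1 u v). Qed.

Lemma is_derive1B f g x (u v : R) : is_derive x 1 f u -> is_derive x 1 g v ->
  is_derive x 1 (fun y => f y - g y) (u - v).
Proof. by move=> Hf Hg; exact: (@is_deriveB R R^o R^o f g x 1 u v). Qed.

Lemma is_derive1N f x (u : R) : is_derive x 1 f u -> is_derive x 1 (fun y => - f y) (- u).
Proof. by move=> Hf; exact: (@is_deriveN R R^o R^o f x 1 u). Qed.

Lemma is_derive1M f g x (u v : R) : is_derive x 1 f u -> is_derive x 1 g v ->
  is_derive x 1 (fun y => f y * g y) (u * g x + f x * v).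
Proof.
move=> Hf Hg; apply: (is_derive1_val (@is_deriveM R R^o f g x 1 u v Hf Hg)).
by rewrite /GRing.scale/= [g x * u]mulrC addrC.
Qed.

Lemma is_derive1_cst (c : R) x : is_derive x 1 (fun=> c) 0.
Proof. exact: (@is_derive_cst R R^o R^o). Qed.

Lemma is_derive1_id x : is_derive x 1 (fun y : R => y) 1.
Proof. exact: (@is_derive_id R R^o). Qed.

Lemma derive_dist f g df dg a b (c : R) : a <= b ->
  (forall x, a <= x <= b -> is_derive x 1 f (df x)) ->
  (forall x, a <= x <= b -> is_derive x 1 g (dg x)) -> f a = g a ->
  (forall x, a <= x <= b -> `|df x - dg x| <= c) -> `|f b - g b| <= c * (b - a).
Proof.
move=> ab Hf Hg fga H.
have := @derive_bound (fun x => f x - g x) (fun x => df x - dg x) a b c ab.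
rewrite fga subrr subr0; apply => // x xab; exact: is_derive1B (Hf x xab) (Hg x xab).
Qed.

Lemma is_derive1_Mc f (c : R) x (u : R) : is_derive x 1 f u ->
  is_derive x 1 (fun y => c * f y) (c * u).
Proof.
move=> Hf; apply: (is_derive1_val (is_derive1M (is_derive1_cst c x) Hf)).
by rewrite mul0r add0r.
Qed.

Lemma is_derive1_comp' f g x (u v : R) : is_derive (g x) 1 f u -> is_derive x 1 g v ->
  is_derive x 1 (fun y => f (g y)) (u * v).
Proof. by move=> Hf Hg; exact: (@is_derive1_comp R f g x u v Hf Hg). Qed.

Lemma is_derive1_X (m : nat) x : is_derive x 1 (fun y : R => y ^+ m) (m%:R * x ^+ m.-1).
Proof.
elim: m => [|m IH]; first by rewrite mul0r; exact: is_derive1_cst.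
rewrite (_ : (fun y : R => y ^+ m.+1) = fun y => y * y ^+ m); last first.
  by apply/funext => y; rewrite exprS.
apply: is_derive1_val (is_derive1M (is_derive1_id x) IH) _ => /=.
by case: m {IH} => [|m] /=; rewrite ?exprS; ring.
Qed.

Lemma is_derive1_V f x (u : R) : f x != 0 -> is_derive x 1 f u ->
  is_derive x 1 (fun y => (f y)^-1) (- u / f x ^+ 2).
Proof.
move=> fx Hf; apply: (is_derive1_val (is_deriveV fx Hf)).
by rewrite /GRing.scale/= mulNr mulNr mulrC.
Qed.

Lemma continuous_itv f a b : continuous f -> {within `[a, b], continuous f}.
Proof. by move=> cf; apply: continuous_subspaceT. Qed.

(** Uniform continuity at the points of [K], the second point being arbitrary: this form yields
    global uniform continuity of compactly supported functions. *)
Lemma heine (T : pseudoMetricType R) (K : set T) (f : T -> R) : compact K ->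
  (forall x : T, K x -> {for x, continuous f}) ->
  forall e : R, 0 < e -> exists2 d : R, 0 < d &
    forall x y : T, K x -> ball x d y -> `|f x - f y| < e.
Proof.
move=> /compact_near_coveringP cK cf e e0.
have e2 : 0 < e / 2 by rewrite divr_gt0.
have /= := cK R (0^'+) (fun d (x : T) => forall y : T, ball x d y -> `|f x - f y| < e) _.
have K1 : forall x : T, K x -> \forall x' \near x & i \near (0 : R)^'+,
    forall y : T, ball x' i y -> `|f x' - f y| < e.
  move=> x Kx; have /cvgrPdist_lt/(_ _ e2) := cf x Kx.
  move=> /nbhs_ballP[d /= d0 dP].
  near=> x' i => y x'y.
  have xx' : ball x (d / 2) x' by near: x'; apply: nbhsx_ballx; rewrite divr_gt0.
  have id : i <= d / 2 by near: i; apply: nbhs_right_le; rewrite divr_gt0.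
  have h1 : `|f x - f x'| < e / 2.
    by apply: dP; apply: le_ball xx'; rewrite ler_pdivrMr// ler_pMr// ler1n.
  have h2 : `|f x - f y| < e / 2.
    apply: dP; rewrite (splitr d); apply: ball_triangle xx' _.
    exact: le_ball x'y.
  rewrite (splitr e) -(subrK (f x) (f x')) -addrA.
  by rewrite (le_lt_trans (ler_normD _ _))// ltrD// distrC.
move=> /(_ _ K1) H.
have [d [d0 dP]] : exists d : R, 0 < d /\ K `<=` (fun x : T => forall y : T, ball x d y -> `|f x - f y| < e).
  near (0 : R)^'+ => d; exists d; split; first by near: d; exact: nbhs_right_gt.
  by near: d.
by exists d => // x y Kx; exact: dP.
Unshelve. all: by end_near. Qed.

Lemma heine_itv f a b : (forall x, a <= x <= b -> {for x, continuous f}) ->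
  forall e : R, 0 < e -> exists2 d : R, 0 < d &
    forall x y, a <= x <= b -> a <= y <= b -> `|x - y| < d -> `|f x - f y| < e.
Proof.
move=> cf e e0; have [|d d0 H] := @heine R `[a, b]%classic f (@segment_compact R a b) _ _ e0.
  by move=> x /=; rewrite in_itv/=; exact: cf.
by exists d => // x y xab yab xy; apply: H => //; rewrite /= in_itv.
Qed.

Lemma near_dist x (e : R) : 0 < e -> \forall y \near x, `|x - y| < e.
Proof. by move=> e0; apply: nbhsx_ballx. Qed.

Definition is_prim f F := F 0 = 0 /\ forall x, is_derive x 1 F (f x).

Lemma prim_exists f : continuous f -> exists F, is_prim f F.
Proof.
have Kn (x : R) k : 1 <= k -> [/\ - (`|x| + k) < x, x < `|x| + k, - (`|x| + k) < 0 & 0 < `|x| + k].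
  move=> k1; have h := normr_ge0 x; have := ler_norm x; have := ler_norm (- x); rewrite normrN.
  by split; lra.
have Kxy (x y : R) : `|x - y| < 1 -> - (`|x| + 2) < y /\ y < `|x| + 2.
  move=> xy; have h1 : `|y| < `|x| + 1.
    have := ler_normD (y - x) x; rewrite subrK distrC; lra.
  have := ler_norm y; have := ler_norm (- y); rewrite normrN => h2 h3; split; lra.
move=> cf; pose mu := @lebesgue_measure R.
pose P (K x : R) : R := (\int[mu]_(t in `[(- K)%R, x]) f t)%R.
have dP K x : - K < x -> x < K -> is_derive x 1 (P K) (f x).
  move=> Kx xK; have [|d e] := @continuous_FTC1_closed R f (- K) x K xK _ Kx (cf x).
  - apply: continuous_compact_integrable; first exact: segment_compact.
    exact: continuous_itv.
  - by apply: DeriveDef; [exact: d|rewrite -derive1E; exact: e].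
have agree K L x y : - K < x -> x < K -> - K < y -> y < K ->
    - L < x -> x < L -> - L < y -> y < L -> P K x - P K y = P L x - P L y.
  wlog xy : x y / y <= x.
    move=> hw *; have [/hw->//|/ltW/hw E] := leP y x.
    by rewrite -[LHS]opprB -[RHS]opprB E.
  move=> Kx xK Ky yK Lx xL Ly yL.
  have := @derive0_eq (fun z => P K z - P L z) y x xy.
  have sw (u v s t : R) : u - s = v - t -> u - v = s - t by lra.
  move=> D; apply: sw; apply: D => z /andP[yz zx].
  have := @is_deriveB R R^o R^o (P K) (P L) z 1 (f z) (f z).
  rewrite subrr; apply; apply: dP.
  - exact: lt_le_trans Ky yz.
  - exact: le_lt_trans zx xK.
  - exact: lt_le_trans Ly yz.
  - exact: le_lt_trans zx xL.
(* The base point -K has to move with [x]. By [agree] the increment from 0 to [x] does not depend on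
   K, so near [x] the single value |x| + 2 can be used. *)
exists (fun x => P (`|x| + 1) x - P (`|x| + 1) 0); split; first by rewrite subrr.
move=> x; apply: (@near_is_derive1 _ (fun y => P (`|x| + 2) y - P (`|x| + 2) 0)).
  near=> y.
  have [a1 a2 a3 a4] := Kn y 1 (lexx _).
  have [b1 b2 b3 b4] := Kn x 2 (ler1n _ _).
  have xy : `|x - y| < 1 by near: y; apply: near_dist.
  have [c1 c2] := Kxy _ _ xy.
  exact: agree.
have [b1 b2 _ _] := Kn x 2 (ler1n _ _).
have := @is_deriveB R R^o R^o (P (`|x| + 2)) (cst (P (`|x| + 2) 0)) x 1 (f x) 0.
by rewrite subr0; apply; exact: dP.
Unshelve. all: by end_near. Qed.

Fact prim_sig f : {F : R -> R | continuous f -> is_prim f F}.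
Proof.
apply: cid; have [/prim_exists[F FP]|] := pselect (continuous f); first by exists F.
by exists (cst 0).
Qed.

Definition prim f : R -> R := sval (prim_sig f).

Lemma primP f : continuous f -> is_prim f (prim f).
Proof. exact: (svalP (prim_sig f)). Qed.

Lemma prim0 f : continuous f -> prim f 0 = 0.
Proof. by move=> /primP[]. Qed.

Lemma is_derive_prim f x : continuous f -> is_derive x 1 (prim f) (f x).
Proof. by move=> /primP[]. Qed.

End RealCalculus.

(** * Existence of the radial profile *)

Section RadialExistence.
Variables (R : realType) (n : nat) (p : R).
Hypothesis p1 : 1 < p.
Implicit Types (f g : R -> R) (r s t : R).

Local Notation q := (conjp p).

Let pm1 : 0 < p - 1. Proof. by rewrite subr_gt0. Qed.
Let qm1 : 0 < q - 1. Proof. by rewrite subr_gt0 conjp_gt1. Qed.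

(** Right-hand side of the equation with eigenvalue 1, -(r^n |u'|^(p-2) u')' = r^n |u|^(p-2) u,
    where n = N - 1. The radius is clamped at 0 so that the operators below act on functions on the
    whole line, as delayed arguments require. *)
Definition rweight f t := Num.max 0 t ^+ n * phip p (f t).

Lemma rweight_continuous f : continuous f -> continuous (rweight f).
Proof.
move=> cf t; apply: cvgM; last exact: (continuous_comp (cf t) (@phip_continuous R p p1 (f t))).
apply: (@continuous_comp _ _ _ (fun t : R => Num.max 0 t) (fun x => x ^+ n)).
  by apply: continuous_max; [exact: cvg_cst|exact: cvg_id].
exact: exprn_continuous.
Qed.

Definition flux f := prim (rweight f).

(** The value 0 for s <= 0 is the limit at the singular point, since [flux f s] is of order s^(n+1)
    there ([flux_bound]). *)
Definition mflux f s := if s <= 0 then 0 else flux f s / s ^+ n.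

Lemma flux_bound f r (B : R) : continuous f -> 0 <= r ->
  (forall t, 0 <= t <= r -> `|phip p (f t)| <= B) -> `|flux f r| <= r ^+ n * B * r.
Proof.
move=> cf r0 H; have cw := rweight_continuous cf.
have := @derive_bound R (flux f) (rweight f) 0 r (r ^+ n * B) r0 _ _.
rewrite /flux prim0// !subr0; apply.
  by move=> x _; exact: is_derive_prim.
move=> x /andP[x0 xr]; rewrite /rweight normrM ler_pM ?normr_ge0// ?H ?x0//.
by rewrite (max_idPr x0) ger0_norm ?exprn_ge0// lerXn2r// nnegrE (le_trans x0).
Qed.

Lemma mflux_bound f r (B : R) : continuous f ->
  (forall t, 0 <= t <= r -> `|phip p (f t)| <= B) -> `|mflux f r| <= Num.max 0 r * B.
Proof.
move=> cf H; rewrite /mflux; case: (leP r 0) => r0; first by rewrite mul0r normr0.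
have rn0 : 0 < r ^+ n by rewrite exprn_gt0.
rewrite normrM normfV (gtr0_norm rn0) ler_pdivrMr//.
by apply: le_trans (flux_bound cf (ltW r0) H) _; rewrite le_eqVlt; apply/orP; left; apply/eqP; ring.
Qed.

Lemma continuous_bounded_itv f (a b : R) : continuous f ->
  exists2 B : R, 0 < B & forall t, a <= t <= b -> `|f t| <= B.
Proof.
move=> cf; have [ba|ab] := ltP b a.
  by exists 1 => // t /andP[h1 h2]; have := lt_le_trans ba (le_trans h1 h2); rewrite ltxx.
have cf' : continuous (fun t => `|f t|).
  by move=> t; apply: cvg_norm; exact: cf.
have [c _ H] := EVT_max ab (continuous_itv cf').
exists (`|f c| + 1); first by rewrite ltr_wpDl.
by move=> t tab; rewrite (le_trans (H t _)) ?lerDl// in_itv.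
Qed.

Lemma mflux_continuous f : continuous f -> continuous (mflux f).
Proof.
move=> cf s; case: (ltrgtP s 0) => s0.
- have E : mflux f s = 0 by rewrite /mflux (ltW s0).
  rewrite /continuous_at E; apply: cvg_near_cst.
  near=> t; rewrite /mflux ifT//.
  by apply: ltW; near: t; exact: lt_nbhsl.
- have sn0 : s ^+ n != 0 by rewrite expf_neq0// gt_eqF.
  have D := is_derive1M (is_derive_prim s (rweight_continuous cf))
    (@is_derive1_V R (fun t : R => t ^+ n) s _ sn0 (is_derive1_X n s)).
  apply: is_derive_continuous (near_is_derive1 _ D).
  near=> t; rewrite /mflux leNgt ifF//.
  by apply/negbTE; rewrite negbK; near: t; exact: lt_nbhsr.
- rewrite s0; have [B B0 HB] := continuous_bounded_itv 0 1 (fun t => continuous_comp (cf t) (@phip_continuous R p p1 (f t))).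
  apply/cvgrPdist_lt => e e0; near=> t.
  have e1 : `|0 - t| < Num.min 1 (e / B).
    by near: t; apply: near_dist; rewrite lt_min ltr01 divr_gt0.
  rewrite {1}/mflux lexx sub0r normrN.
  have t1 : `|t| < 1 by move: e1; rewrite sub0r normrN lt_min => /andP[].
  have te : `|t| < e / B by move: e1; rewrite sub0r normrN lt_min => /andP[].
  apply: le_lt_trans (mflux_bound (B:=B) cf _) _.
    move=> u /andP[u0 ut]; apply: HB.
    by rewrite u0 (le_trans ut)// (le_trans (ler_norm t))// ltW.
  rewrite -ltr_pdivlMr//; apply: le_lt_trans te.
  by rewrite ge_max normr_ge0 ler_norm.
Unshelve. all: by end_near. Qed.

Definition rslope f s := phip q (mflux f s).

Lemma rslope_continuous f : continuous f -> continuous (rslope f).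
Proof.
move=> cf s; apply: (continuous_comp (@mflux_continuous f cf s)).
exact/phip_continuous/conjp_gt1.
Qed.

(* u is a radial solution with u(0) = 1 and eigenvalue 1 iff it is a fixed point of rshoot. *)
Definition rshoot f r := 1 - prim (rslope f) r.

Lemma is_derive_rshoot f r : continuous f -> is_derive r 1 (rshoot f) (- rslope f r).
Proof.
move=> cf; apply: is_derive1_val (is_derive1B (is_derive1_cst 1 r)
  (is_derive_prim r (rslope_continuous cf))) _.
by rewrite sub0r.
Qed.

Lemma rshoot_continuous f : continuous f -> continuous (rshoot f).
Proof. by move=> cf r; exact: is_derive_continuous (is_derive_rshoot r cf). Qed.

Lemma rshoot0 f : continuous f -> rshoot f 0 = 1.
Proof. by move=> cf; rewrite /rshoot (prim0 (rslope_continuous cf)) subr0. Qed.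

Lemma rshoot_le0 f r : continuous f -> r <= 0 -> rshoot f r = 1.
Proof.
move=> cf r0; rewrite -(rshoot0 cf); apply/esym/(@derive0_eq R _ r 0) => // x /andP[_ x0].
by have := is_derive_rshoot x cf; rewrite /rslope /mflux x0 phip0 oppr0.
Qed.

Lemma mflux_local f g r : continuous f -> continuous g ->
  (forall t, t <= r -> f t = g t) -> forall s, s <= r -> mflux f s = mflux g s.
Proof.
move=> cf cg fg s sr; rewrite /mflux; case: leP => // s0; congr (_ / _).
have cwf := rweight_continuous cf; have cwg := rweight_continuous cg.
apply: (@derive_eq R (flux f) (flux g) (rweight f) 0 s (ltW s0)).
- by move=> x _; exact: is_derive_prim.
- move=> x /andP[x0 xs]; rewrite /rweight fg ?(le_trans xs)//; exact: is_derive_prim.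
- by rewrite /flux (prim0 cwf) (prim0 cwg).
Qed.

Lemma rshoot_local f g r : continuous f -> continuous g ->
  (forall t, t <= r -> f t = g t) -> rshoot f r = rshoot g r.
Proof.
move=> cf cg fg; have [r0|r0] := leP r 0; first by rewrite !rshoot_le0.
apply: (@derive_eq R (rshoot f) (rshoot g) (fun s => - rslope f s) 0 r (ltW r0)).
- by move=> x _; exact: is_derive_rshoot.
- move=> x /andP[x0 xr]; rewrite /rslope (mflux_local cf cg fg xr); exact: is_derive_rshoot.
- by rewrite (rshoot0 cf) (rshoot0 cg).
Qed.

(** The maps [phip p] and [phip q] are uniformly continuous on bounded sets but in general not
    Lipschitz, so the shooting map need not be a contraction. Uniform continuity on bounded sets of
    functions is what the passage to the limit uses. *)
Lemma rslope_stable (M r : R) : 0 <= r -> forall e : R, 0 < e -> exists2 d : R, 0 < d &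
  forall f g, continuous f -> continuous g ->
    (forall t, 0 <= t <= r -> `|f t| <= M) -> (forall t, 0 <= t <= r -> `|g t| <= M) ->
    (forall t, 0 <= t <= r -> `|f t - g t| < d) ->
    forall s, 0 <= s <= r -> `|rslope f s - rslope g s| < e.
Proof.
move=> r0 e e0.
have phiB t : `|t| <= M -> `|phip p t| <= M `^ (p - 1).
  move=> tM; rewrite normr_phip// ge0_ler_powR ?nnegrE ?(ltW pm1)//.
  exact: le_trans (normr_ge0 t) tM.
pose B := r * M `^ (p - 1).
have [e1 e10 H1] := @heine_itv R (phip q) (- B) B
  (fun x _ => @phip_continuous R q (conjp_gt1 p1) x) e e0.
have e2 : 0 < e1 / (r + 1) by rewrite divr_gt0// ltr_wpDl.
have [d d0 H2] := @heine_itv R (phip p) (- M) M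
  (fun x _ => @phip_continuous R p p1 x) _ e2.
exists d => // f g cf cg fM gM fg s /andP[s0 sr].
have mB h : continuous h -> (forall t, 0 <= t <= r -> `|h t| <= M) -> - B <= mflux h s <= B.
  move=> ch hM; rewrite -ler_norml.
  apply: le_trans (mflux_bound (B := M `^ (p - 1)) ch _) _.
    by move=> t /andP[t0 ts]; apply/phiB/hM; rewrite t0 (le_trans ts).
  by rewrite (max_idPr s0) ler_wpM2r// powR_ge0.
apply: H1; [exact: mB|exact: mB|].
have [s00|s0'] := leP s 0; first by rewrite /mflux s00 subrr normr0.
rewrite /mflux leNgt s0'/= -mulrBl normrM normfV.
have sn0 : 0 < s ^+ n by rewrite exprn_gt0.
rewrite (gtr0_norm sn0) ltr_pdivrMr//.
have cwf := rweight_continuous cf; have cwg := rweight_continuous cg.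
have := @derive_bound R (fun x => flux f x - flux g x) (fun x => rweight f x - rweight g x) 0 s
  (s ^+ n * (e1 / (r + 1))) s0 _ _.
rewrite /flux (prim0 cwf) (prim0 cwg) !subr0 => H.
apply: le_lt_trans (H _ _) _.
- by move=> x _; apply: is_derive1B; exact: is_derive_prim.
- move=> x /andP[x0 xs]; rewrite /rweight -mulrBr normrM ler_pM//.
    by rewrite (max_idPr x0) ger0_norm ?exprn_ge0// lerXn2r// nnegrE.
  have xr : 0 <= x <= r by rewrite x0 (le_trans xs).
  by apply: ltW; apply: H2; rewrite -?ler_norml ?fM ?gM ?fg.
- rewrite -mulrA mulrC ltr_pM2r// -mulrA gtr_pMr// mulrC ltr_pdivrMr ?mul1r.
    by rewrite (le_lt_trans sr)// ltrDl.
  by rewrite ltr_wpDl.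
Qed.

Lemma rshoot_stable (M r : R) : 0 <= r -> forall e : R, 0 < e -> exists2 d : R, 0 < d &
  forall f g, continuous f -> continuous g ->
    (forall t, 0 <= t <= r -> `|f t| <= M) -> (forall t, 0 <= t <= r -> `|g t| <= M) ->
    (forall t, 0 <= t <= r -> `|f t - g t| < d) -> `|rshoot f r - rshoot g r| < e.
Proof.
move=> r0 e e0; have e1 : 0 < e / (r + 1) by rewrite divr_gt0// ltr_wpDl.
have [d d0 H] := rslope_stable M r0 e1; exists d => // f g cf cg fM gM fg.
have D := @derive_dist R (rshoot f) (rshoot g) (fun x => - rslope f x) (fun x => - rslope g x)
  0 r (e / (r + 1)) r0 (fun x _ => is_derive_rshoot x cf) (fun x _ => is_derive_rshoot x cg).
apply: le_lt_trans (D _ _) _.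
- by rewrite (rshoot0 cf) (rshoot0 cg).
- by move=> x xr; rewrite -opprD normrN; apply: ltW; exact: H.
- rewrite subr0 -mulrA gtr_pMr// mulrC ltr_pdivrMr ?mul1r ?ltrDl//.
  by rewrite ltr_wpDl.
Qed.

Definition rgrowth r := Num.max 0 r `^ (q - 1).

(** Origin of the exponential barrier: if |f| <= exp(C t), the mean flux is at most s exp(C
    s)^(p-1), and (p-1)(q-1) = 1 turns the slope bound into s^(q-1) exp(C s) <= C exp(C s), the
    derivative of exp(C t). *)
Lemma rshoot_growth f (K : R) : continuous f -> 0 <= K ->
  (forall t, t <= 0 -> `|f t| <= 1) ->
  (forall t, 0 <= t <= K -> `|f t| <= expR (rgrowth K * t)) ->
  (forall s, s <= K -> `|rslope f s| <= rgrowth K * expR (rgrowth K * Num.max 0 s)) /\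
  (forall s, 0 <= s <= K -> `|rshoot f s| <= expR (rgrowth K * s)).
Proof.
move=> cf K0 f1 fK; set C := rgrowth K.
have C0 : 0 <= C by exact: powR_ge0.
have dE (x : R) : is_derive x 1 (fun t : R => expR (C * t)) (C * expR (C * x)).
  apply: is_derive1_val (is_derive1_comp' (is_derive_expR (C * x)) (is_derive1_Mc C (is_derive1_id x))) _.
  by rewrite mulr1 mulrC.
have slp s : s <= K -> `|rslope f s| <= C * expR (C * Num.max 0 s).
  move=> sK; rewrite /rslope.
  have [s0|s0] := leP s 0.
    by rewrite /mflux s0 phip0 normr0 mulr_ge0// expR_ge0.
  rewrite normr_phip ?conjp_gt1//.
  have Y : `|mflux f s| <= s * expR (C * s) `^ (p - 1).
    apply: le_trans (mflux_bound (B := expR (C * s) `^ (p - 1)) cf _) _.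
      move=> t /andP[t0 ts]; rewrite normr_phip// ge0_ler_powR ?nnegrE ?expR_ge0 ?(ltW pm1)//.
      apply: le_trans (fK t _) _; first by rewrite t0 (le_trans ts).
      by rewrite ler_expR ler_wpM2l.
    by rewrite (max_idPr (ltW s0)).
  have -> : C * expR (C * s) = C * (expR (C * s) `^ (p - 1)) `^ (q - 1).
    by rewrite -powRrM conjpB1// powRr1// expR_ge0.
  apply: (@le_trans _ _ ((s * expR (C * s) `^ (p - 1)) `^ (q - 1))).
    by rewrite ge0_ler_powR ?nnegrE ?(ltW qm1)// mulr_ge0 ?powR_ge0// ltW.
  rewrite powRM ?powR_ge0 ?(ltW s0)// ler_wpM2r ?powR_ge0//.
  rewrite /C /rgrowth (max_idPr K0) ge0_ler_powR ?nnegrE ?(ltW qm1)// ltW//.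
split=> // s /andP[s0 sK].
have slp' x : 0 <= x <= s -> `|rslope f x| <= C * expR (C * x).
  by move=> /andP[x0 xs]; have := slp x (le_trans xs sK); rewrite (max_idPr x0).
rewrite ler_norml; apply/andP; split.
- have := @derive_ge0_le R (fun t => expR (C * t) + rshoot f t) (fun t => C * expR (C * t) + - rslope f t) 0 s s0 _ _.
  rewrite (rshoot0 cf) mulr0 expR0 => H.
  rewrite -subr_ge0 opprK addrC; apply: le_trans (H _ _); first by rewrite addr_ge0.
    by move=> x _; apply: is_derive1D (dE x) _; exact: is_derive_rshoot.
  by move=> x /slp'; rewrite subr_ge0; apply: le_trans; exact: ler_norm.
- have := @derive_ge0_le R (fun t => expR (C * t) - rshoot f t) (fun t => C * expR (C * t) - - rslope f t) 0 s s0 _ _.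
  rewrite (rshoot0 cf) mulr0 expR0 subrr => H.
  rewrite -subr_ge0; apply: H.
    by move=> x _; apply: is_derive1B (dE x) _; exact: is_derive_rshoot.
  move=> x /slp'; rewrite -normrN subr_ge0; apply: le_trans; exact: ler_norm.
Qed.

End RadialExistence.

(** * Existence by Tonelli's delayed equation *)

Section Tonelli.
Variables (R : realType) (n : nat) (p : R).
Hypothesis p1 : 1 < p.
Implicit Types (f g : R -> R) (r s t h : R) (j : nat).

Local Notation rshoot := (rshoot n p).
Local Notation rslope := (rslope n p).
Local Notation rgrowth := (rgrowth p).

(** Tonelli's scheme: with the argument delayed by h > 0 the equation is solved by plain iteration,
    each step gaining an interval of length h ([delayed_fix]). *)
Fixpoint delayed h j : R -> R :=
  if j is j'.+1 then rshoot (fun t => delayed h j' (t - h)) else fun=> 1.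

Lemma shift_continuous f h : continuous f -> continuous (fun t => f (t - h)).
Proof.
move=> cf t; apply: (@continuous_comp _ _ _ (fun t : R => t - h) f); last exact: cf.
by apply: (@continuousB R R^o); [exact: cvg_id|exact: cvg_cst].
Qed.

Lemma delayed_continuous h j : continuous (delayed h j).
Proof.
elim: j => [|j IH] /=; first by move=> x; exact: cvg_cst.
exact/(rshoot_continuous p1)/shift_continuous.
Qed.

Lemma delayed_le0 h j r : r <= 0 -> delayed h j r = 1.
Proof.
case: j => // j r0 /=; apply: rshoot_le0 => //.
exact/shift_continuous/delayed_continuous.
Qed.

Lemma delayed_fix h j r : 0 <= h -> r <= j%:R * h -> delayed h j.+1 r = delayed h j r.
Proof.
move=> h0; elim: j r => [r|j IH r rj].
  by rewrite mul0r => r0; rewrite delayed_le0.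
rewrite -[LHS]/(rshoot (fun t => delayed h j.+1 (t - h)) r) -[RHS]/(rshoot (fun t => delayed h j (t - h)) r).
have := rshoot_local n p1 (@shift_continuous _ h (@delayed_continuous h j.+1))
  (@shift_continuous _ h (@delayed_continuous h j)).
apply => t tr.
apply: IH; rewrite lerBlDr (le_trans tr)// (le_trans rj)//.
by rewrite -natr1 mulrDl mul1r.
Qed.

Lemma delayed_growth h j (K : R) : 0 <= h -> 0 <= K ->
  forall t, 0 <= t <= K -> `|delayed h j t| <= expR (rgrowth K * t).
Proof.
move=> h0 K0; elim: j => [|j IH] t tK /=.
  rewrite normr1 -[leLHS]expR0 ler_expR mulr_ge0 ?powR_ge0//.
  by case/andP: tK.
have cf := @shift_continuous _ h (@delayed_continuous h j).
have [|s sK|_ H] := rshoot_growth n p1 cf K0; last exact: H.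
  by move=> s s0; rewrite delayed_le0 ?normr1// subr_le0 (le_trans s0).
have [sh|sh] := leP (s - h) 0.
  rewrite delayed_le0// normr1 -[leLHS]expR0 ler_expR mulr_ge0 ?powR_ge0//.
  by case/andP: sK.
apply: le_trans (IH _ _) _.
  by rewrite (ltW sh)/=; case/andP: sK => _; apply: le_trans; rewrite lerBlDr lerDl.
by rewrite ler_expR ler_wpM2l ?powR_ge0// lerBlDr lerDl.
Qed.

Lemma delayed_lip h j (K : R) : 0 <= h -> 0 <= K -> forall s t, s <= K -> t <= K ->
  `|delayed h j s - delayed h j t| <= rgrowth K * expR (rgrowth K * K) * `|s - t|.
Proof.
move=> h0 K0 s t; wlog ts : s t / t <= s => [hw sK tK|sK _].
  by have [/hw->//|/ltW/hw H] := leP t s; rewrite distrC [`|s - t|]distrC H.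
case: j => [|j] /=.
  by rewrite subrr normr0 mulr_ge0 ?normr_ge0// mulr_ge0 ?powR_ge0 ?expR_ge0.
have cf := @shift_continuous _ h (@delayed_continuous h j).
rewrite (@ger0_norm _ (s - t)) ?subr_ge0//.
apply: (derive_bound ts) => [x _|x /andP[tx xs]].
  exact: is_derive_rshoot.
rewrite normrN.
have [|u uK|H _] := rshoot_growth n p1 cf K0.
- by move=> u u0; rewrite delayed_le0 ?normr1// subr_le0 (le_trans u0).
- have [sh|sh] := leP (u - h) 0.
    rewrite delayed_le0// normr1 -[leLHS]expR0 ler_expR mulr_ge0 ?powR_ge0//.
    by case/andP: uK.
  apply: le_trans (delayed_growth j h0 K0 _) _.
    by rewrite (ltW sh)/=; case/andP: uK => _; apply: le_trans; rewrite lerBlDr lerDl.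
  by rewrite ler_expR ler_wpM2l ?powR_ge0// lerBlDr lerDl.
- apply: le_trans (H x (le_trans xs sK)) _.
  rewrite ler_wpM2l ?powR_ge0// ler_expR ler_wpM2l ?powR_ge0//.
  by rewrite ge_max K0 (le_trans xs).
Qed.

(** (m+1)^2 steps of length 1/(m+1) reach the radius m+1. *)
Definition tonelli (m : nat) := delayed (m.+1%:R^-1) (m.+1 * m.+1)%N.

Let hinv0 (m : nat) : 0 <= m.+1%:R^-1 :> R.
Proof. by rewrite invr_ge0. Qed.

Lemma tonelli_fix m r : r <= m.+1%:R ->
  tonelli m r = rshoot (fun t => tonelli m (t - m.+1%:R^-1)) r.
Proof.
move=> rm; rewrite -[RHS]/(delayed _ (m.+1 * m.+1).+1 r) delayed_fix//.
by rewrite natrM mulfK.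
Qed.

(** The values at each radius stay in a compact interval, so along one ultrafilter finer than [\oo]
    they converge at all radii at once; this replaces the extraction of a subsequence. *)
Lemma tonelli_ultra_cvg : exists2 F : set_system nat, UltraFilter F /\ \oo `<=` F &
  exists w : R -> R, forall r, tonelli m r @[m --> F] --> w r.
Proof.
have [F [FU Foo]] := @ultraFilterLemma nat \oo _.
exists F => //.
suff H r : exists w : R, tonelli m r @[m --> F] --> w by have [w wP] := choice H; exists w.
pose K := Num.max 0 r.
have K0 : 0 <= K by rewrite le_max lexx.
pose B := expR (rgrowth K * K).
have FF : ProperFilter F by case: FU.
have GP : ProperFilter (fmap (fun m => tonelli m r) F) by exact: fmap_proper_filter.
have GU : UltraFilter (fmap (fun m => tonelli m r) F).
  split=> // G GG FG; rewrite eqEsubset; split=> // A GA.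
  have [//|FC] := in_ultra_setVsetC ((fun m => tonelli m r) @^-1` A) FU.
  have GC : G (~` A) by apply: FG.
  by have /filter_ex[? []] : G (A `&` ~` A) by exact: filterI.
have := @segment_compact R (- B) B; rewrite compact_ultra => /(_ _ GU).
case=> [|w [_ ww]]; last by exists w.
apply: (@filterS _ F _ setT _ _ filterT) => m _ /=; rewrite in_itv/= -ler_norml.
have [r0|r0] := leP r 0.
  rewrite /tonelli delayed_le0// normr1 /B -[leLHS]expR0 ler_expR mulr_ge0 ?powR_ge0//.
apply: le_trans (delayed_growth _ (hinv0 m) K0 _) _.
  by rewrite (ltW r0) le_max lexx orbT.
by rewrite ler_expR ler_wpM2l ?powR_ge0// le_max lexx orbT.
Qed.

(** The common Lipschitz bound passes to the pointwise limit and makes the convergence uniform on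
    [0, r]; [rshoot_stable] then turns the delayed equation into the fixed point equation. *)
Lemma radial_exists : exists2 w : R -> R, continuous w & forall r, w r = rshoot w r.
Proof.
have [F [FU Foo] [w wP]] := tonelli_ultra_cvg.
have FF : ProperFilter F by case: FU.
have fex (A B : set nat) : F A -> F B -> exists m, A m /\ B m.
  by move=> FA FB; have /filter_ex[m [Am Bm]] : F (A `&` B) by [exact: filterI]; exists m.
have wd (r e : R) : 0 < e -> F [set m | `|w r - tonelli m r| < e].
  by move=> e0; have /cvgrPdist_lt := wP r; exact.
have wlip (K s t : R) : 0 <= K -> s <= K -> t <= K ->
    `|w s - w t| <= rgrowth K * expR (rgrowth K * K) * `|s - t|.
  move=> K0 sK tK; apply/ler_addgt0Pl => e e0.
  have e2 : 0 < e / 2 by rewrite divr_gt0.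
  have [m [/= h1 h2]] := fex _ _ (wd s _ e2) (wd t _ e2).
  have := delayed_lip (m.+1 * m.+1)%N (hinv0 m) K0 sK tK; rewrite -/(tonelli m) => h3.
  have -> : w s - w t = (w s - tonelli m s) + (tonelli m s - tonelli m t) - (w t - tonelli m t) by ring.
  apply: le_trans (ler_normB _ _) _; apply: le_trans (lerD (ler_normD _ _) (lexx _)) _.
  by rewrite [e]splitr addrAC lerD// lerD// ltW.
have wc : continuous w.
  move=> s; pose K := Num.max 0 (s + 1).
  have K0 : 0 <= K by rewrite le_max lexx.
  set L := rgrowth K * expR (rgrowth K * K).
  have L0 : 0 <= L by rewrite mulr_ge0 ?powR_ge0 ?expR_ge0.
  apply/cvgrPdist_lt => e e0; near=> t.
  have h1 : `|s - t| < Num.min 1 (e / (L + 1)).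
    by near: t; apply: near_dist; rewrite lt_min ltr01 divr_gt0// ltr_wpDl.
  move: h1; rewrite lt_min => /andP[h1 h2].
  have tK : t <= K.
    rewrite le_max -lerBlDl (le_trans _ (ltW h1)) ?orbT// distrC.
    exact: ler_norm.
  apply: le_lt_trans (wlip K s t K0 _ tK) _; first by rewrite le_max lerDl ler01 orbT.
  apply: (@le_lt_trans _ _ ((L + 1) * `|s - t|)); first by rewrite ler_wpM2r// lerDl.
  by rewrite mulrC -ltr_pdivlMr// ltr_wpDl.
exists w => // r.
have w1 (t : R) : t <= 0 -> w t = 1.
  move=> t0; apply/eqP; rewrite -subr_eq0 -normr_le0; apply/ler_addgt0Pl => e e0.
  have /filter_ex[m /= h1] := wd t _ e0.
  by rewrite addr0 -(delayed_le0 (m.+1%:R^-1) (m.+1 * m.+1)%N t0) ltW.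
have [r0|r0] := leP r 0; first by rewrite w1// rshoot_le0.
pose L := rgrowth r * expR (rgrowth r * r).
have L0 : 0 <= L by rewrite mulr_ge0 ?powR_ge0 ?expR_ge0.
pose M := expR (rgrowth r * r) + 1.
apply/eqP; rewrite -subr_eq0 -normr_le0; apply/ler_addgt0Pl => e e0; rewrite addr0.
have e2 : 0 < e / 2 by rewrite divr_gt0.
have [d d0 stab] := @rshoot_stable R n p p1 M r (ltW r0) _ e2.
have d2 : 0 < d / 2 by rewrite divr_gt0.
have d4 : 0 < d / 2 / 2 by rewrite divr_gt0.
(* The Lipschitz bounds transfer closeness at x to all nearby y, uniformly in m; compactness of
   [0, r] in its near-covering form does the rest. *)
have unif : F [set m | forall t, 0 <= t <= r -> `|w t - tonelli m t| < d / 2].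
  have := @segment_compact R 0 r; move/compact_near_coveringP => /(_ nat F
    (fun m t => `|w t - tonelli m t| < d / 2) _).
  move=> H; have {}H : \forall m \near F, `[0, r] `<=` (fun t => `|w t - tonelli m t| < d / 2).
    apply: H => x /=; rewrite in_itv/= => xr.
    have e3 : 0 < d / 2 / 2 / 2 by rewrite divr_gt0.
    have b0 : 0 < d / 2 / 2 / (rgrowth (r + 1) * expR (rgrowth (r + 1) * (r + 1)) + 1) / 2.
      by rewrite !divr_gt0// ltr_wpDl// mulr_ge0 ?powR_ge0 ?expR_ge0.
    set L1 := rgrowth (r + 1) * _ in b0.
    near=> y m.
    have L10 : 0 < L1 + 1 by rewrite ltr_wpDl// mulr_ge0 ?powR_ge0 ?expR_ge0.
    have xy : `|x - y| < Num.min 1 (d / 2 / 2 / (L1 + 1) / 2).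
      by near: y; apply: near_dist; rewrite lt_min ltr01.
    move: xy; rewrite lt_min => /andP[xy1 xy2].
    have xr1 : x <= r + 1 by case/andP: xr => _ /le_trans; apply; rewrite lerDl.
    have yr1 : y <= r + 1.
      case/andP: xr => _ xr; rewrite -(subrK x y) addrC lerD//.
      by rewrite (le_trans (ler_norm _))// distrC ltW.
    have r10 : 0 <= r + 1 by rewrite addr_ge0// ltW.
    have c1 := wlip _ _ _ r10 xr1 yr1.
    have c2 := delayed_lip (m.+1 * m.+1)%N (hinv0 m) r10 xr1 yr1.
    rewrite -/(tonelli m) -/L1 in c1 c2.
    have c3 : `|w x - tonelli m x| < d / 2 / 2 by near: m; exact: wd.
    have c4 : L1 * `|x - y| <= d / 2 / 2 / 2.
      apply: (@le_trans _ _ ((L1 + 1) * `|x - y|)); first by rewrite ler_wpM2r// lerDl.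
      rewrite mulrC -ler_pdivlMr//; apply: ltW; apply: lt_le_trans xy2 _.
      by rewrite mulrAC.
    have -> : w y - tonelli m y = (w x - tonelli m x) + (tonelli m x - tonelli m y) - (w x - w y) by ring.
    apply: le_lt_trans (ler_normB _ _) _; apply: le_lt_trans (lerD (ler_normD _ _) (lexx _)) _.
    rewrite -addrA [ltRHS]splitr ltr_leD// [leRHS]splitr lerD//.
      exact: le_trans c2 c4.
    exact: le_trans c1 c4.
  by apply: filterS H => m Hm t tr; apply: Hm; rewrite /= in_itv.
(* For such m the delay moves [tonelli m] by less than d/2, and r lies in the range where the
   delayed equation holds. *)
have small : F [set m | L * m.+1%:R^-1 < d / 2 /\ r <= m.+1%:R].
  apply: Foo; near=> m; split.
    have [->|LN] := eqVneq L 0; first by rewrite mul0r.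
    have Lp : 0 < L by rewrite lt_neqAle eq_sym LN.
    rewrite -ltr_pdivlMl// invf_plt ?posrE ?mulr_gt0 ?invr_gt0//.
    apply: (@lt_le_trans _ _ m%:R); last by rewrite ler_nat.
    by near: m; exact: nbhs_infty_gtr.
  apply: (@le_trans _ _ m%:R); last by rewrite ler_nat.
  by near: m; apply: nbhs_infty_ger.
have [m [[/= wm um] [sm rm]]] := fex _ _ (filterI (wd r _ e2) unif) small.
have bd (t : R) : t <= r -> `|tonelli m t| <= expR (rgrowth r * r).
  move=> tr; have [t0|t0] := leP t 0.
    rewrite /tonelli delayed_le0// normr1 -[leLHS]expR0 ler_expR mulr_ge0 ?powR_ge0// ltW//.
  apply: le_trans (delayed_growth _ (hinv0 m) (ltW r0) _) _; first by rewrite (ltW t0).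
  by rewrite ler_expR ler_wpM2l// powR_ge0.
have -> : w r - rshoot w r = (w r - tonelli m r) +
    (rshoot (fun t => tonelli m (t - m.+1%:R^-1)) r - rshoot w r).
  by rewrite -(tonelli_fix rm) addrA subrK.
apply: le_trans (ler_normD _ _) _; rewrite [leRHS]splitr; apply: ltW; apply: (ltrD wm).
have tc : continuous (tonelli m) by exact: delayed_continuous.
have dw (t : R) : 0 <= t <= r -> `|tonelli m (t - m.+1%:R^-1) - w t| < d.
  move=> tr; have tr' : t <= r by case/andP: tr.
  have -> : tonelli m (t - m.+1%:R^-1) - w t =
    (tonelli m (t - m.+1%:R^-1) - tonelli m t) - (w t - tonelli m t) by ring.
  apply: le_lt_trans (ler_normB _ _) _; rewrite [ltRHS]splitr ltrD ?um//.
  have tr2 : t - m.+1%:R^-1 <= r by rewrite lerBlDr (le_trans tr')// lerDl.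
  apply: le_lt_trans (delayed_lip _ (hinv0 m) (ltW r0) tr2 tr') _.
  by rewrite addrAC subrr sub0r normrN ger0_norm.
apply: (stab _ _ (@shift_continuous _ (m.+1%:R^-1) tc) wc _ _ dw).
- move=> t /andP[_ tr]; apply: (@le_trans _ _ (expR (rgrowth r * r))); last by rewrite lerDl.
  by apply: bd; rewrite lerBlDr (le_trans tr)// lerDl.
- move=> t /andP[t0 tr]; have /filter_ex[k /= h1] := wd t 1 ltr01.
  have -> : w t = (w t - tonelli k t) + tonelli k t by ring.
  apply: le_trans (ler_normD _ _) _; rewrite addrC lerD ?(ltW h1)//.
  have [t00|t00] := leP t 0.
    rewrite /tonelli delayed_le0// normr1 -[leLHS]expR0 ler_expR mulr_ge0 ?powR_ge0// ltW//.
  apply: le_trans (delayed_growth _ (hinv0 k) (ltW r0) _) _; first by rewrite (ltW t00).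
  by rewrite ler_expR ler_wpM2l// powR_ge0.
Unshelve. all: by end_near. Qed.

End Tonelli.

(** * Energy and oscillation of radial solutions *)

Section HalfLinear.
Variables (R : realType) (n : nat) (p : R).
Hypothesis p1 : 1 < p.
Implicit Types (u v x y : R -> R) (r s t mu nu c k : R).

Local Notation q := (conjp p).
Local Notation phi := (phip p).
Local Notation phq := (phip q).

Let p0 : 0 < p. Proof. by rewrite (lt_trans ltr01). Qed.
Let q1 : 1 < q. Proof. exact: conjp_gt1. Qed.
Let q0 : 0 < q. Proof. by rewrite (lt_trans ltr01). Qed.

(* The radial equation as a first-order system, with y = |u'|^(p-2) u'. *)
Definition rsol mu u y r :=
  is_derive r 1 u (phq (y r)) /\
  is_derive r 1 y (- (n%:R / r * y r) - mu * phi (u r)).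

Lemma rsol_opp mu u y r : rsol mu u y r -> rsol mu (fun t => - u t) (fun t => - y t) r.
Proof.
move=> [Hu Hy]; split.
  by rewrite phipN; exact: is_derive1N.
by apply: is_derive1_val (is_derive1N Hy) _; rewrite phipN; ring.
Qed.

Lemma rsol_scale mu u y k r : 0 < k -> r != 0 -> rsol mu u y (k * r) ->
  rsol (mu * k `^ p) (fun t => u (k * t)) (fun t => phi k * y (k * t)) r.
Proof.
move=> k0 r0 [Hu Hy]; have Dk := is_derive1_Mc k (is_derive1_id r).
split.
  apply: is_derive1_val (is_derive1_comp' Hu Dk) _.
  by rewrite phipM (phipK p1) mulr1 mulrC.
apply: is_derive1_val (is_derive1_Mc (phi k) (is_derive1_comp' Hy Dk)) _.
have -> : k `^ p = k * phi k by rewrite mul_phip// gtr0_norm.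
have kn : k != 0 by rewrite gt_eqF.
by field; rewrite r0 kn.
Qed.

Lemma is_derive_rflux mu u y r : 0 < r -> rsol mu u y r ->
  is_derive r 1 (fun t => t ^+ n * y t) (- (mu * r ^+ n * phi (u r))).
Proof.
move=> r0 [_ Hy]; apply: is_derive1_val (is_derive1M (is_derive1_X n r) Hy) _.
have rn : r != 0 by rewrite gt_eqF.
by case: n => [|m] /=; rewrite ?expr0 ?exprS; field; rewrite ?rn.
Qed.

(** Energy of the undamped equation: the term n y / r only dissipates it, and for mu > 0 it vanishes
    only where u and y both do. *)
Definition renergy mu u y r := `|y r| `^ q / q + mu * (`|u r| `^ p / p).

Lemma is_derive_renergy mu u y r : r != 0 -> rsol mu u y r ->
  is_derive r 1 (renergy mu u y) (- (n%:R / r * `|y r| `^ q)).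
Proof.
move=> r0 [Hu Hy].
have D1 := is_derive1_comp' (is_derive_powr_norm (y r) q1) Hy.
have D2 := is_derive1_comp' (is_derive_powr_norm (u r) p1) Hu.
have := is_derive1D (is_derive1_Mc q^-1 D1) (is_derive1_Mc mu (is_derive1_Mc p^-1 D2)).
rewrite (_ : (fun _ => _) = renergy mu u y); last first.
  by apply/funext => t; rewrite /renergy ![_^-1 * _]mulrC.
move=> H; apply: is_derive1_val H _.
rewrite -(mul_phip (y r) q1).
have pn : p != 0 by rewrite gt_eqF.
have qn : q != 0 by rewrite gt_eqF.
by field; rewrite r0 pn qn.
Qed.

Lemma renergy_eq0 mu u y r : 0 < mu -> renergy mu u y r <= 0 -> u r = 0 /\ y r = 0.
Proof.
move=> m0 H.
have a0 : 0 <= `|y r| `^ q / q by rewrite divr_ge0 ?powR_ge0 ?(ltW q0).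
have b0 : 0 <= mu * (`|u r| `^ p / p).
  by rewrite mulr_ge0 ?(ltW m0)// divr_ge0 ?powR_ge0 ?(ltW p0).
move: H; rewrite /renergy => H.
have a1 : `|y r| `^ q / q = 0 by apply/eqP; rewrite eq_le a0 andbT; lra.
have b1 : mu * (`|u r| `^ p / p) = 0 by apply/eqP; rewrite eq_le b0 andbT; lra.
move/eqP: a1; rewrite mulf_eq0 invr_eq0 (gt_eqF q0) orbF powR_eq0 normr_eq0 => /andP[/eqP ya _].
move/eqP: b1; rewrite !mulf_eq0 invr_eq0 (gt_eqF p0) (gt_eqF m0) orbF powR_eq0 normr_eq0.
by move=> /andP[/eqP ua _].
Qed.

(* r ^ m E is nondecreasing for m large, so a degenerate zero propagates backwards. *)
Lemma rsol_zero_backward mu u y (a b : R) : 0 < mu -> 0 < a -> a <= b ->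
  (forall r, a <= r <= b -> rsol mu u y r) -> u b = 0 -> y b = 0 -> u a = 0.
Proof.
move=> m0 a0 ab H ub yb.
(* With m >= n q the factor r^m outweighs the dissipation: m |y|^q / q absorbs n |y|^q. *)
pose m := (Num.truncn (n%:R * q)).+1.
have nm : n%:R * q <= m%:R by rewrite ltW// truncnS_gt.
have := @derive_ge0_le R (fun r => r ^+ m * renergy mu u y r)
  (fun r => m%:R * r ^+ m.-1 * renergy mu u y r + r ^+ m * (- (n%:R / r * `|y r| `^ q))) a b ab.
have -> : renergy mu u y b = 0.
  by rewrite /renergy ub yb !normr0 !powR0 ?gt_eqF// !mul0r mulr0 addr0.
rewrite mulr0 => D.
have {}D : a ^+ m * renergy mu u y a <= 0.
  apply: D => r rab; have r0 : 0 < r by case/andP: rab => /(lt_le_trans a0).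
    by apply: is_derive1M (is_derive1_X m r) _; apply: is_derive_renergy (H r rab); rewrite gt_eqF.
  have rn : r != 0 by rewrite gt_eqF.
  have -> : m%:R * r ^+ m.-1 * renergy mu u y r + r ^+ m * - (n%:R / r * `|y r| `^ q) =
     r ^+ m.-1 * (m%:R * renergy mu u y r - n%:R * `|y r| `^ q).
    by rewrite /m /= exprS; field.
  rewrite mulr_ge0 ?exprn_ge0 ?(ltW r0)// subr_ge0 /renergy mulrDr.
  apply: (@le_trans _ _ (m%:R * (`|y r| `^ q / q))).
    by rewrite mulrCA mulrC ler_wpM2l ?powR_ge0// ler_pdivlMr.
  by rewrite lerDl mulr_ge0// mulr_ge0 ?(ltW m0)// divr_ge0 ?powR_ge0 ?(ltW p0).
move: D; rewrite pmulr_rle0 ?exprn_gt0// => /(renergy_eq0 m0)[].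
by [].
Qed.

(** Once y is negative, V = - u / phq(y) > 0 solves the Riccati equation V' = -1 + (q-1) (n/r) V -
    (q-1) V^p, whose right-hand side is at most -1/2 for large r, so V cannot stay positive. *)
Lemma rsol_no_eventual_sign u y (a : R) : 0 < a ->
  (forall r, a <= r -> rsol 1 u y r) -> ~ (forall r, a <= r -> 0 < u r).
Proof.
move=> a0 H up.
have Z0 (r : R) : a <= r -> 0 < r by exact: lt_le_trans.
have Zd s t : a <= s -> s < t -> t ^+ n * y t < s ^+ n * y s.
  move=> as_ st; rewrite -ltrN2.
  have := @derive_gt0_lt R (fun r => - (r ^+ n * y r)) (fun r => - - (1 * r ^+ n * phi (u r))) s t st.
  apply => r /andP[sr rt]; have ar : a <= r by exact: le_trans as_ sr.
    by apply: is_derive1N; apply: is_derive_rflux (Z0 _ ar) _; exact: H.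
  by rewrite opprK mul1r mulr_gt0 ?exprn_gt0 ?phip_gt0 ?up ?Z0.
(* As long as y >= 0, u is nondecreasing, so r^n y falls at least at the constant rate K and cannot
   remain nonnegative. *)
have [r1 ar1 yr1] : exists2 r1, a <= r1 & y r1 < 0.
  apply: contrapT => nex.
  have yp r : a <= r -> 0 <= y r.
    by move=> ar; rewrite leNgt; apply/negP => yr; apply: nex; exists r.
  have um r : a <= r -> u a <= u r.
    move=> ar; apply: (@derive_ge0_le R u (fun t => phq (y t)) a r ar).
      by move=> t /andP[at_ _]; have [] := H t at_.
    by move=> t /andP[at_ _]; rewrite phip_ge0E ?powR_ge0 ?yp.
  pose K := a ^+ n * phi (u a).
  have K0 : 0 < K by rewrite mulr_gt0 ?exprn_gt0 ?phip_gt0 ?up.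
  pose b := a + (a ^+ n * y a + 1) / K.
  have ab : a <= b.
    by rewrite lerDl divr_ge0 ?(ltW K0)// addr_ge0// mulr_ge0 ?exprn_ge0 ?yp// ltW.
  have := @derive_ge0_le R (fun r => - (r ^+ n * y r) - K * r)
    (fun r => - - (1 * r ^+ n * phi (u r)) - K * 1) a b ab.
  have D : - (a ^+ n * y a) - K * a <= - (b ^+ n * y b) - K * b -> False.
    have -> : K * b = K * a + (a ^+ n * y a + 1).
      by rewrite /b mulrDr mulrCA divff ?mulr1// gt_eqF.
    have : 0 <= b ^+ n * y b by rewrite mulr_ge0 ?exprn_ge0 ?yp// ltW// Z0.
    lra.
  move=> DD; apply: D; apply: DD => r /andP[ar rb].
    exact: (is_derive1B (is_derive1N (is_derive_rflux (Z0 _ ar) (H r ar))) (is_derive1_Mc K (is_derive1_id r))).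
  rewrite opprK mul1r mulr1 subr_ge0 /K ler_pM ?exprn_ge0 ?(ltW a0)//.
  - by rewrite ltW// phip_gt0// up.
  - by rewrite lerXn2r// nnegrE ltW// Z0.
  - by rewrite phip_mono// um.
have yn r : r1 <= r -> y r < 0.
  rewrite le_eqVlt => /predU1P[<-//|r1r].
  have := Zd _ _ ar1 r1r; have rp : 0 < r by apply/Z0/(le_trans ar1)/ltW.
  move=> h; have : r ^+ n * y r < 0.
    by rewrite (lt_trans h)// pmulr_rlt0// exprn_gt0// Z0.
  by rewrite pmulr_rlt0// exprn_gt0.
pose V r := - (u r / phq (y r)).
have Vpos r : r1 <= r -> 0 < V r.
  move=> r1r; rewrite /V -mulrN -invrN mulr_gt0 ?up ?(le_trans ar1)//.
  by rewrite invr_gt0 oppr_gt0 phip_lt0// yn.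
pose dV r := - 1 + (q - 1) * (n%:R / r) * V r - (q - 1) * V r `^ p.
have VD r : r1 <= r -> is_derive r 1 V (dV r).
  move=> r1r; have ar : a <= r by exact: le_trans ar1 r1r.
  have [Hu Hy] := H r ar; have y0 := yn r r1r; have yn0 : y r != 0 by rewrite lt_eqF.
  have rn : r != 0 by rewrite gt_eqF// Z0.
  have Dq := is_derive1_comp' (is_derive_phip q1 yn0) Hy.
  have qn : phq (y r) != 0 by rewrite phip_eq0.
  have := is_derive1N (is_derive1M Hu (@is_derive1_V R (fun t => phq (y t)) r _ qn Dq)).
  move=> DV; apply: is_derive1_val DV _.
  have := up r ar; rewrite /dV /V.
  have -> : phq (y r) = - (- y r) `^ (q - 1).
    by rewrite -[y r]opprK phipN phip_ge0E ?opprK// oppr_ge0 ltW.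
  rewrite ltr0_norm//; set e := - y r; have e0 : 0 < e by rewrite oppr_gt0.
  have -> : y r = - e by rewrite opprK.
  move=> u0; rewrite phip_ge0E ?(ltW u0)//.
  set s := e `^ (q - 1); have s0 : 0 < s by rewrite powR_gt0.
  have E1 : e `^ (q - 2) = s / e.
    have -> : q - 2 = (q - 1) - 1 by ring.
    by rewrite powRB ?(gt_eqF e0) ?implybT// powRr1 ?ltW.
  have E2 : (- (u r / - s)) `^ p = u r * u r `^ (p - 1) / (s * e).
    rewrite invrN mulrN opprK powRM ?invr_ge0 ?(ltW u0) ?(ltW s0)//.
    rewrite mulr_powRB1 ?(ltW u0)//; congr (_ * _).
    rewrite -powR_inv1 ?(ltW s0)// -powRrM mulN1r powRN; congr (_^-1).
    rewrite /s -powRrM [in RHS]mulrC mulr_powRB1 ?(ltW e0)//; congr (_ `^ _).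
    have pm : p - 1 != 0 by rewrite gt_eqF// subr_gt0.
    by rewrite /conjp; field.
  rewrite E1 E2; have en : e != 0 by rewrite gt_eqF.
  have sn : s != 0 by rewrite gt_eqF.
  by field; rewrite sn en rn.
(* Beyond b, the bound (q-1) n/r <= 1/2 settles V <= 1, and n/r <= 1 together with V <= V^p settles
   V > 1. *)
pose b := Num.max r1 (Num.max (2 * (q - 1) * n%:R) n%:R).
have r1b : r1 <= b by rewrite le_max lexx.
have qm1 : 0 < q - 1 by rewrite subr_gt0.
have dVle r : b <= r -> dV r <= - (1 / 2).
  rewrite !ge_max => /and3P[r1r r2 r3].
  have rp : 0 < r by apply/Z0/(le_trans ar1).
  have v0 := Vpos r r1r.
  suff : (q - 1) * (n%:R / r) * V r <= 1 / 2 + (q - 1) * V r `^ p by rewrite /dV; lra.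
  have [V1|V1] := leP (V r) 1.
    apply: (@le_trans _ _ (1 / 2)); last first.
      by rewrite lerDl mulr_ge0 ?powR_ge0 ?(ltW qm1).
    have h : (q - 1) * (n%:R / r) <= 1 / 2.
      by rewrite mulrA ler_pdivrMr//; lra.
    apply: le_trans (h); rewrite ler_piMr// mulr_ge0 ?(ltW qm1)//.
    by rewrite divr_ge0 ?(ltW rp).
  apply: (@le_trans _ _ ((q - 1) * V r `^ p)); last by rewrite lerDr.
  rewrite -mulrA ler_wpM2l ?(ltW qm1)//.
  apply: (@le_trans _ _ (V r)); last by rewrite le1r_powR ?(ltW V1) ?(ltW p1).
  by rewrite ler_piMl ?(ltW v0)// ler_pdivrMr// mul1r.
(* At slope at most -1/2, V has lost the whole of V(b) when it reaches c. *)
pose c := b + 2 * V b.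
have bc : b <= c by rewrite lerDl mulr_ge0// ltW// Vpos.
have := @derive_ge0_le R (fun r => - V r - 1 / 2 * r) (fun r => - dV r - 1 / 2 * 1) b c bc.
have D : - V b - 1 / 2 * b <= - V c - 1 / 2 * c -> False.
  have : 0 < V c by apply/Vpos/(le_trans r1b).
  have : 0 < V b by exact: Vpos.
  rewrite /c; lra.
move=> DD; apply: D; apply: DD => r /andP[br rc].
  exact: (is_derive1B (is_derive1N (VD r (le_trans r1b br))) (is_derive1_Mc (1 / 2) (is_derive1_id r))).
by have := dVle r br; lra.
Qed.

End HalfLinear.

(** * Picone's inequality and uniqueness *)

Section PiconeUniqueness.
Variables (R : realType) (n : nat) (p : R).
Hypothesis p1 : 1 < p.
Implicit Types (u v x y g : R -> R) (r s t S T mu nu c k : R).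

Local Notation q := (conjp p).
Local Notation phi := (phip p).
Local Notation phq := (phip q).
Local Notation rsol := (rsol n p).

Let p0 : 0 < p. Proof. by rewrite (lt_trans ltr01). Qed.

Lemma ge0_of_right_lim0 g (dg : R -> R) S T :
  (forall r, S < r < T -> is_derive r 1 g (dg r)) ->
  (forall r, S < r < T -> 0 <= dg r) -> g r @[r --> S^'+] --> (0 : R) ->
  forall r, S < r < T -> 0 <= g r.
Proof.
move=> Dg dg0 lg r /andP[Sr rT]; rewrite leNgt; apply/negP => gr.
have e0 : 0 < - g r by rewrite oppr_gt0.
have /cvgrPdist_lt/(_ _ e0) H := lg.
near S^'+ => t.
have St : S < t by near: t; exact: nbhs_right_gt.
have tr : t < r by near: t; exact: nbhs_right_lt.
have : g t <= g r.
  apply: (@derive_ge0_le R g dg t r (ltW tr)) => z /andP[tz zr].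
    by apply: Dg; rewrite (lt_le_trans St tz) (le_lt_trans zr rT).
  by apply: dg0; rewrite (lt_le_trans St tz) (le_lt_trans zr rT).
have : `|0 - g t| < - g r by near: t.
rewrite sub0r normrN => h1 h2; have := ler_norm (- g t); rewrite normrN => h3.
have := lt_le_trans h1 (lexx _); lra.
Unshelve. all: by end_near. Qed.

(** Picone's quantity for two solutions with the same mu: in its derivative the mu terms cancel, and
    what is left is r^n times the gap between |u'|^p and the tangent of |t|^p at u v'/v. *)
Definition picone u y v x r := r ^+ n * (u r * y r - `|u r| `^ p * (x r / phi (v r))).

Lemma is_derive_picone mu u y v x r : 0 < r -> v r != 0 ->
  rsol mu u y r -> rsol mu v x r ->
  is_derive r 1 (picone u y v x)
    (r ^+ n * (`|phq (y r)| `^ p - p * (phi (u r * (phq (x r) / v r)) * phq (y r))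
       + (p - 1) * `|u r * (phq (x r) / v r)| `^ p)).
Proof.
move=> r0 v0 Su Sv; have [Hu Hy] := Su; have [Hv Hx] := Sv.
have phv : phi (v r) != 0 by rewrite phip_eq0.
have D1 := is_derive1M Hu (is_derive_rflux r0 Su).
have D2 := is_derive1_comp' (is_derive_powr_norm (u r) p1) Hu.
have D3 := is_derive1_comp' (is_derive_phip p1 v0) Hv.
have D4 := is_derive1M (is_derive_rflux r0 Sv) (@is_derive1_V R (fun t => phi (v t)) r _ phv D3).
have := is_derive1B D1 (is_derive1M D2 D4).
rewrite (_ : (fun _ => _) = picone u y v x); last first.
  by apply/funext => t; rewrite /picone; ring.
move=> D; apply: is_derive1_val D _.
have E1 : `|phq (y r)| `^ p = phq (y r) * y r by rewrite -mul_phip// phip_conjpK.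
have E2 : phi (u r * (phq (x r) / v r)) = phi (u r) * (x r / phi (v r)).
  rewrite phipM phipM phip_conjpK//; congr (_ * (_ * _)).
  apply: (mulfI phv); rewrite divff// -phipM divff//.
  by rewrite phip_ge0E// powR1.
have E3 : `|u r * (phq (x r) / v r)| `^ p = `|u r| `^ p * (x r * phq (x r) / (phi (v r) * v r)).
  rewrite -(mul_phip (u r * (phq (x r) / v r)) p1) E2 -(mul_phip (u r) p1); field.
  by rewrite phv v0.
have E4 : `|v r| `^ (p - 2) = phi (v r) / v r.
  have vn : 0 < `|v r| by rewrite normr_gt0.
  have -> : p - 2 = (p - 1) - 1 by ring.
  rewrite powRB ?(gt_eqF vn) ?implybT// powRr1// /phip.
  have sg0 : Num.sg (v r) != 0 by rewrite sgr_eq0.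
  have -> : Num.sg (v r) * `|v r| `^ (p - 1) / v r =
    Num.sg (v r) * `|v r| `^ (p - 1) / (Num.sg (v r) * `|v r|) by rewrite -numEsg.
  by field; rewrite sg0 normr_eq0 v0.
rewrite E1 E2 E3 E4 -(mul_phip (u r) p1); field.
by rewrite v0 phv.
Qed.

Lemma picone_le mu u y v x S T : 0 <= S ->
  (forall r, S < r < T -> rsol mu u y r) -> (forall r, S < r < T -> rsol mu v x r) ->
  (forall r, S < r < T -> v r != 0) ->
  picone u y v x r @[r --> S^'+] --> (0 : R) ->
  forall r, S < r < T -> `|u r| `^ p * (x r / phi (v r)) <= u r * y r.
Proof.
move=> S0 Su Sv v0 lim r rST.
have rp : 0 < r by case/andP: rST => /(le_lt_trans S0).
have : 0 <= picone u y v x r.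
  apply: (ge0_of_right_lim0 _ _ lim rST) => t tST; have tp : 0 < t by case/andP: tST => /(le_lt_trans S0).
    exact: is_derive_picone tp (v0 t tST) (Su t tST) (Sv t tST).
  rewrite mulr_ge0 ?exprn_ge0 ?(ltW tp)//.
  set A := phq (y t); set B := u t * _.
  have := phip_tangent A B p1; rewrite mulrBr mulrBr [phi B * B]mulrC (mul_phip B p1); lra.
by rewrite pmulr_rge0 ?exprn_gt0// subr_ge0.
Qed.

(** Picone's inequality in both directions forces y / phi(u) = x / phi(v), that is u'/u = v'/v, so
    u/v has zero derivative. *)
Lemma rsol_proportional mu u y v x S T : 0 <= S -> S < T ->
  (forall r, S < r < T -> rsol mu u y r) -> (forall r, S < r < T -> rsol mu v x r) ->
  (forall r, S < r < T -> u r != 0) -> (forall r, S < r < T -> v r != 0) ->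
  picone u y v x r @[r --> S^'+] --> (0 : R) ->
  picone v x u y r @[r --> S^'+] --> (0 : R) ->
  exists k, forall r, S < r < T -> u r = k * v r /\ y r = phi k * x r.
Proof.
move=> S0 ST Su Sv u0 v0 l1 l2.
have E r : S < r < T -> y r / phi (u r) = x r / phi (v r).
  move=> rST; have := picone_le S0 Su Sv v0 l1 rST; have := picone_le S0 Sv Su u0 l2 rST.
  have un := u0 r rST; have vn := v0 r rST.
  have pu : phi (u r) != 0 by rewrite phip_eq0.
  have pv : phi (v r) != 0 by rewrite phip_eq0.
  have ->: u r * y r = `|u r| `^ p * (y r / phi (u r)).
    by rewrite -(mul_phip _ p1); field.
  have ->: v r * x r = `|v r| `^ p * (x r / phi (v r)).
    by rewrite -(mul_phip _ p1); field.
  rewrite !ler_pM2l ?powR_gt0 ?normr_gt0// => h1 h2.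
  by apply/eqP; rewrite eq_le h1 h2.
pose m := (S + T) / 2.
have mST : S < m < T by apply/andP; split; rewrite /m; lra.
have quot r : S < r < T -> is_derive r 1 (fun t => u t / v t) 0.
  move=> rST; have [Hu _] := Su r rST; have [Hv _] := Sv r rST.
  apply: is_derive1_val (is_derive1M Hu (@is_derive1_V R v r _ (v0 r rST) Hv)) _.
  have un := u0 r rST; have vn := v0 r rST.
  have : phq (y r / phi (u r)) = phq (x r / phi (v r)) by rewrite E.
  have inv t : t != 0 -> phq (phi t)^-1 = t^-1.
    move=> tn; apply: (mulfI tn); rewrite divff//.
    rewrite -{1}(phipK p1 t) -phipM divff ?phip_eq0// phip_ge0E ?powR1//.
    exact: conjp_gt1.
  rewrite !phipM !inv// => e.
  have -> : phq (x r) = phq (y r) / u r * v r by rewrite e divfK.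
  by field; rewrite un vn.
exists (u m / v m) => r rST.
have uv : u r / v r = u m / v m.
  have [rm|mr] := leP r m.
    apply/esym/(@derive0_eq R (fun t => u t / v t) r m rm) => z /andP[rz zm]; apply: quot.
    case/andP: rST => Sr _; case/andP: mST => _ mT.
    by rewrite (lt_le_trans Sr) ?(le_lt_trans zm).
  apply: (@derive0_eq R (fun t => u t / v t) m r (ltW mr)) => z /andP[mz zr]; apply: quot.
  case/andP: rST => _ rT; case/andP: mST => Sm _.
  by rewrite (lt_le_trans Sm) ?(le_lt_trans zr).
have un := u0 r rST; have vn := v0 r rST.
have ur : u r = u m / v m * v r by rewrite -uv divfK.
split => //.
have pu : phi (u r) != 0 by rewrite phip_eq0.
have pv : phi (v r) != 0 by rewrite phip_eq0.
have -> : y r = phi (u r) * (x r / phi (v r)) by rewrite -E// mulrCA divff// mulr1.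
by rewrite {1}ur phipM; field.
Qed.

Lemma is_derive1_near (f : R -> R) S d : is_derive S 1 f d -> forall e, 0 < e ->
  \forall t \near S, `|f t - f S - d * (t - S)| <= e * `|t - S|.
Proof.
move=> [df fd] e e0.
have : h^-1 *: (f (h *: (1 : R) + S) - f S) @[h --> 0^'] --> d.
  by move: df => /cvg_ex[l fl]; rewrite -fd /derive; have /cvg_lim -> := fl.
move=> /cvgrPdist_le/(_ _ e0); rewrite near_withinE => H.
have {}H : \forall h \near (0 : R), h != 0 -> `|d - h^-1 *: (f (h *: (1 : R) + S) - f S)| <= e by [].
have HS : \forall t \near S, t - S != 0 ->
    `|d - (t - S)^-1 *: (f ((t - S) *: (1 : R) + S) - f S)| <= e.
  move/nbhs_ballP: H => [z /= z0 Hz]; apply/nbhs_ballP; exists z => //= t tz.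
  by apply: Hz; rewrite /ball/= sub0r opprB.
apply: filterS HS => t; have [->|tS] := eqVneq t S.
  by move=> _; rewrite !subrr mulr0 subrr normr0 mulr0.
have tS0 : t - S != 0 by rewrite subr_eq0.
move=> /(_ tS0); rewrite /GRing.scale/= mulr1 subrK => h.
have -> : f t - f S - d * (t - S) = - (d - (t - S)^-1 * (f t - f S)) * (t - S) by field.
by rewrite normrM normrN ler_wpM2r.
Qed.

(** The delicate case is a common zero at S, simple for v: there |u|^p is O((t-S)^p) while |v|^(p-1)
    is at least of order (t-S)^(p-1), so the quotient is O(t-S). *)
Lemma picone_right_lim mu u y v x S c (vS xS : R) : 0 <= S -> c != 0 ->
  u r @[r --> S^'+] --> c * vS -> v r @[r --> S^'+] --> vS ->
  y r @[r --> S^'+] --> phi c * xS -> x r @[r --> S^'+] --> xS ->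
  vS != 0 \/ [/\ vS = 0, u S = 0, v S = 0, rsol mu u y S & rsol mu v x S /\ x S != 0 ] ->
  picone u y v x r @[r --> S^'+] --> (0 : R).
Proof.
move=> S0 c0 lu lv ly lx [v0|[v0 uS0 vS0 [Hu _] [[Hv _] xn0]]].
  have -> : 0 = S ^+ n * (c * vS * (phi c * xS) - `|c * vS| `^ p * (xS / phi vS)).
    have pv : phi vS != 0 by rewrite phip_eq0.
    rewrite -(mul_phip _ p1) phipM; field.
    by rewrite pv.
  apply: cvgM.
    have := @exprn_continuous R n S; apply: cvg_trans; apply: cvg_app; exact: cvg_within.
  apply: cvgB; first exact: cvgM.
  apply: cvgM.
    exact: (cvg_comp _ _ lu (@powr_norm_continuous R p p1 (c * vS))).
  apply: cvgM => //; apply: cvgV; first by rewrite phip_eq0.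
  exact: (cvg_comp _ _ lv (@phip_continuous R p p1 vS)).
pose a := `|phq (x S)|; have a0 : 0 < a by rewrite normr_gt0 phip_eq0// conjp_gt1.
have a20 : 0 < a / 2 by rewrite divr_gt0.
pose b := `|phq (y S)| + 1; have b0 : 0 < b by rewrite ltr_wpDl.
have bnd : \forall t \near S^'+, `|u t| <= b * (t - S) /\ a / 2 * (t - S) <= `|v t|.
  have Nu := is_derive1_near Hu ltr01; have Nv := is_derive1_near Hv a20.
  near=> t.
  have St : 0 < t - S by rewrite subr_gt0; near: t; exact: nbhs_right_gt.
  have h1 : `|u t - u S - phq (y S) * (t - S)| <= 1 * `|t - S| by near: t; exact: cvg_within Nu.
  have h2 : `|v t - v S - phq (x S) * (t - S)| <= a / 2 * `|t - S| by near: t; exact: cvg_within Nv.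
  rewrite uS0 subr0 (gtr0_norm St) mul1r in h1; rewrite vS0 subr0 (gtr0_norm St) in h2.
  split.
    rewrite -(subrK (phq (y S) * (t - S)) (u t)); apply: le_trans (ler_normD _ _) _.
    by rewrite normrM (gtr0_norm St) /b mulrDl mul1r addrC lerD2l.
  have : a * (t - S) <= a / 2 * (t - S) + `|v t|.
    rewrite {1}/a -{1}(gtr0_norm St) -normrM.
    have -> : phq (x S) * (t - S) = - (v t - phq (x S) * (t - S)) + v t by ring.
    by apply: le_trans (ler_normD _ _) _; rewrite normrN lerD2r.
  rewrite -lerBlDl; apply: le_trans; lra.
have main : (fun r => `|u r| `^ p * (x r / phi (v r))) r @[r --> S^'+] --> (0 : R).
  pose X := `|xS| + 1; have X0 : 0 < X by rewrite ltr_wpDl.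
  pose C := b `^ p / (a / 2) `^ (p - 1) * X.
  have C0 : 0 < C by rewrite mulr_gt0// divr_gt0// powR_gt0.
  apply/cvgrPdist_le => e e0; near=> t.
  rewrite sub0r normrN.
  have St : 0 < t - S by rewrite subr_gt0; near: t; exact: nbhs_right_gt.
  have [h1 h2] : `|u t| <= b * (t - S) /\ a / 2 * (t - S) <= `|v t| by near: t.
  have h3 : `|x t| <= X.
    have : `|xS - x t| < 1 by near: t; move/cvgrPdist_lt: lx; apply.
    move=> /ltW; rewrite distrC => h; rewrite /X -(subrK xS (x t)) addrC.
    by apply: le_trans (ler_normD _ _) _; rewrite lerD2l.
  have h4 : t - S <= e / C.
    rewrite lerBlDl; near: t; apply: nbhs_right_le; rewrite ltrDl divr_gt0//.
  have vt0 : 0 < `|v t| by rewrite (lt_le_trans _ h2)// mulr_gt0.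
  rewrite normrM normrM normfV normr_phip// (ger0_norm (powR_ge0 _ _)).
  apply: (@le_trans _ _ ((b * (t - S)) `^ p * (X / (a / 2 * (t - S)) `^ (p - 1)))).
    rewrite ler_pM ?powR_ge0 ?mulr_ge0 ?invr_ge0 ?powR_ge0//.
      by rewrite ge0_ler_powR ?nnegrE ?(ltW p0)// mulr_ge0 ?(ltW b0) ?(ltW St).
    rewrite ler_pM ?invr_ge0 ?powR_ge0// lef_pV2 ?posrE ?powR_gt0 ?mulr_gt0//.
    by rewrite ge0_ler_powR ?nnegrE ?subr_ge0 ?(ltW p1)// mulr_ge0 ?(ltW a20) ?(ltW St).
  rewrite (powRM _ (ltW b0) (ltW St)) (powRM _ (ltW a20) (ltW St)).
  rewrite -(mulr_powRB1 (ltW St) p0).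
  have w10 : (t - S) `^ (p - 1) != 0 by rewrite gt_eqF// powR_gt0.
  have w20 : (a / 2) `^ (p - 1) != 0 by rewrite gt_eqF// powR_gt0.
  have : (t - S) * C <= e by rewrite -ler_pdivlMr.
  move: w10 w20; rewrite /C; set w1 := (t - S) `^ (p - 1); set w2 := (a / 2) `^ (p - 1).
  move=> w10 w20; apply: le_trans; rewrite le_eqVlt; apply/orP; left; apply/eqP.
  by field; rewrite w10 w20.
rewrite v0 mulr0 in lu.
have -> : 0 = S ^+ n * (0 * (phi c * xS) - 0) by ring.
apply: cvgM.
  have := @exprn_continuous R n S; apply: cvg_trans; apply: cvg_app; exact: cvg_within.
by apply: cvgB main; exact: cvgM.
Unshelve. all: by end_near. Qed.

End PiconeUniqueness.

(** * Uniqueness of the radial solution up to a factor *)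

Section RadialUniqueness.
Variables (R : realType) (n : nat) (p : R).
Hypothesis p1 : 1 < p.
Implicit Types (u v x y : R -> R) (r s t S T mu nu c k : R).

Local Notation q := (conjp p).
Local Notation phi := (phip p).
Local Notation phq := (phip q).
Local Notation rsol := (rsol n p).

Let p0 : 0 < p. Proof. by rewrite (lt_trans ltr01). Qed.

Lemma near_right_neq0 u S l : u r @[r --> S^'+] --> l -> l != 0 ->
  \forall r \near S^'+, u r != 0.
Proof.
move=> lu l0; have l0' : 0 < `|l| by rewrite normr_gt0.
have /cvgrPdist_lt/(_ _ l0') := lu; apply: filterS => r.
by apply: contraTneq => ->; rewrite subr0 ltxx.
Qed.

Lemma near_right_neq0_deriv u S d : is_derive S 1 u d -> u S = 0 -> d != 0 ->
  \forall r \near S^'+, u r != 0.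
Proof.
move=> Du uS d0; have e0 : 0 < `|d| / 2 by rewrite divr_gt0// normr_gt0.
have N := is_derive1_near Du e0; near=> r.
have Sr : 0 < r - S by rewrite subr_gt0; near: r; exact: nbhs_right_gt.
have : `|u r - u S - d * (r - S)| <= `|d| / 2 * `|r - S| by near: r; exact: cvg_within N.
rewrite uS subr0; apply: contraTneq => ->; rewrite sub0r normrN normrM.
by rewrite ler_pM2r ?normr_gt0 ?gt_eqF// -ltNge ltr_pdivrMr// ltr_pMr ?normr_gt0// ltr1n.
Unshelve. all: by end_near. Qed.

Lemma right_interval (P : R -> Prop) S B : S < B -> (\forall r \near S^'+, P r) ->
  exists T, [/\ S < T, T <= B & forall r, S < r < T -> P r].
Proof.
move=> SB; rewrite near_withinE => /nbhs_ballP[d /= d0 dP].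
exists (Num.min B (S + d)); split.
- by rewrite lt_min SB ltrDl.
- by rewrite ge_min lexx.
move=> r; rewrite lt_min => /andP[Sr /andP[_ rd]]; apply: dP => //.
by rewrite /ball/= distrC gtr0_norm ?subr_gt0// ltrBlDl.
Qed.

(** Local uniqueness to the right of S in the absence of a Lipschitz condition: just after S neither
    function vanishes, Picone gives u = k v, and the limits at S identify k with c, through the
    values if vS is nonzero and through the fluxes at a simple zero. *)
Lemma rsol_extend mu u y v x S B c (vS xS : R) : 0 <= S -> S < B -> c != 0 ->
  (forall r, S < r < B -> rsol mu u y r) -> (forall r, S < r < B -> rsol mu v x r) ->
  u r @[r --> S^'+] --> c * vS -> v r @[r --> S^'+] --> vS ->
  y r @[r --> S^'+] --> phi c * xS -> x r @[r --> S^'+] --> xS ->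
  vS != 0 \/ [/\ vS = 0, u S = 0, v S = 0, rsol mu u y S & rsol mu v x S /\
                [/\ xS != 0, x S = xS & y S = phi c * xS]] ->
  exists2 T, S < T & forall r, S < r < T -> u r = c * v r /\ y r = phi c * x r.
Proof.
move=> S0 SB c0 Su Sv lu lv ly lx cases.
have q1 := conjp_gt1 p1.
have ci0 : c^-1 != 0 by rewrite invr_eq0.
have cc : c^-1 * (c * vS) = vS by rewrite mulKf.
have pc : phi c^-1 * (phi c * xS) = xS.
  by rewrite mulrA -phipM mulVf// phip_ge0E// powR1 mul1r.
have pc0 : phi c != 0 by rewrite phip_eq0.
have nz : \forall r \near S^'+, u r != 0 /\ v r != 0.
  have [v0|[v0 uS0 vS0 [Hu _] [[Hv _] [xn0 xE yE]]]] := cases.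
    near=> r; split; near: r.
      by apply: near_right_neq0 lu _; rewrite mulf_neq0.
    exact: near_right_neq0 lv _.
  near=> r; split; near: r.
    by apply: near_right_neq0_deriv Hu uS0 _; rewrite phip_eq0// yE mulf_neq0.
  by apply: near_right_neq0_deriv Hv vS0 _; rewrite phip_eq0// xE.
have [T [ST TB TP]] := right_interval SB nz.
have sub r : S < r < T -> S < r < B by case/andP=> -> /lt_le_trans ->.
have L1 : picone n p u y v x r @[r --> S^'+] --> (0 : R).
  apply: (@picone_right_lim _ n _ p1 mu u y v x S c vS xS S0 c0 lu lv ly lx).
  have [v0|[v0 uS0 vS0 Hu [Hv [xn0 xE yE]]]] := cases; [by left|right].
  by split=> //; split=> //; rewrite xE.
have L2 : picone n p v x u y r @[r --> S^'+] --> (0 : R).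
  apply: (@picone_right_lim _ n _ p1 mu v x u y S c^-1 (c * vS) (phi c * xS)) => //.
  - by rewrite cc.
  - by rewrite pc.
  have [v0|[v0 uS0 vS0 Hu [Hv [xn0 xE yE]]]] := cases; [left|right].
    by rewrite mulf_neq0.
  by split=> //; [rewrite v0 mulr0|split=> //; rewrite yE mulf_neq0].
have [k kP] := rsol_proportional p1 S0 ST (fun r h => Su r (sub r h)) (fun r h => Sv r (sub r h))
  (fun r h => (TP r h).1) (fun r h => (TP r h).2) L1 L2.
have nearT : \forall r \near S^'+, S < r < T.
  near=> r; apply/andP; split; near: r; [exact: nbhs_right_gt|exact: nbhs_right_lt].
have e1 : k * vS = c * vS.
  apply: (@cvg_unique _ _ (u r @[r --> S^'+]) _ _ _ _ lu); [exact: norm_hausdorff|].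
  apply: (@cvg_trans _ ((fun r => k * v r) r @[r --> S^'+])).
    by apply: near_eq_cvg; apply: filterS nearT => r /kP[].
  by apply: cvgM lv; exact: cvg_cst.
have e2 : phi k * xS = phi c * xS.
  apply: (@cvg_unique _ _ (y r @[r --> S^'+]) _ _ _ _ ly); [exact: norm_hausdorff|].
  apply: (@cvg_trans _ ((fun r => phi k * x r) r @[r --> S^'+])).
    by apply: near_eq_cvg; apply: filterS nearT => r /kP[].
  by apply: cvgM lx; exact: cvg_cst.
have kc : k = c.
  have [v0|[_ _ _ _ [_ [xn0 _ _]]]] := cases; first exact: (mulIf v0).
  by apply: (can_inj (phipK p1)); exact: (mulIf xn0).
by exists T => // r rT; rewrite -kc; exact: kP.
Unshelve. all: by end_near. Qed.

Lemma continuous_right u S : {for S, continuous u} -> u r @[r --> S^'+] --> u S.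
Proof. by move=> h; apply: cvg_trans h; apply: cvg_app; exact: cvg_within. Qed.

(** Continuation argument: S is the supremum of the radii up to which both pairs agree. If S < 1,
    [rsol_extend] continues the agreement past S; the last hypothesis excludes a degenerate zero of
    v there. *)
Lemma rsol_unique mu u y v x c : c != 0 ->
  (forall r, 0 < r < 1 -> rsol mu u y r) -> (forall r, 0 < r < 1 -> rsol mu v x r) ->
  u r @[r --> 0^'+] --> c -> v r @[r --> 0^'+] --> (1 : R) ->
  y r @[r --> 0^'+] --> (0 : R) -> x r @[r --> 0^'+] --> (0 : R) ->
  (forall r, 0 < r < 1 -> v r = 0 -> x r != 0) ->
  forall r, 0 < r < 1 -> u r = c * v r.
Proof.
move=> c0 Su Sv lu lv ly lx nd.
pose eqn t := u t = c * v t /\ y t = phi c * x t.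
pose A := [set r : R | 0 <= r <= 1 /\ forall t, 0 < t < r -> eqn t].
have A0 : A 0.
  split=> [|t /andP[t0 /(lt_trans t0)]]; last by rewrite ltxx.
  by rewrite lexx ler01.
have hsA : has_sup A by split; [exists 0|exists 1 => r [/andP[]]].
pose S := sup A.
have S0 : 0 <= S by apply: (ub_le_sup hsA.2).
have S1 : S <= 1 by apply: ge_sup; [exists 0|move=> r [/andP[]]].
have ES t : 0 < t < S -> eqn t.
  move=> /andP[t0 tS]; have St0 : 0 < S - t by rewrite subr_gt0.
  have [r [_ rP] tr] := sup_adherent St0 hsA.
  by apply: rP; rewrite t0; move: tr; rewrite opprB addrC subrK.
move: S1; rewrite le_eqVlt => /predU1P[S1 r|S1]; first by rewrite -S1 => /ES[].
exfalso.
have [T ST TP] : exists2 T, S < T & forall r, S < r < T -> eqn r.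
  move: S0; rewrite le_eqVlt => /predU1P[S0|S0].
    rewrite -S0 in S1 *; apply: (@rsol_extend mu u y v x 0 1 c 1 0) => //.
    - by rewrite mulr1.
    - by rewrite mulr0.
    - by left; rewrite oner_eq0.
  have S01 : 0 < S < 1 by rewrite S0.
  have [Hu Hy] := Su S S01; have [Hv Hx] := Sv S S01.
  have zero_at (f : R -> R) : {for S, continuous f} -> (forall t, 0 < t < S -> f t = 0) -> f S = 0.
    move=> cf f0; apply/eqP; apply: contraT => fS.
    have fS0 : 0 < `|f S| by rewrite normr_gt0.
    have /cvgrPdist_lt/(_ _ fS0) := cf => /nbhs_ballP[d /= d0 dP].
    pose t := Num.max (S / 2) (S - d / 2).
    have tS : t < S by rewrite gt_max; apply/andP; split; lra.
    have t0 : 0 < t by rewrite lt_max divr_gt0.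
    have : `|f S - f t| < `|f S|.
      apply: dP; rewrite /ball/= gtr0_norm ?subr_gt0// ltrBlDl.
      by rewrite -ltrBlDr lt_max; apply/orP; right; lra.
    by rewrite (f0 t) ?t0// subr0 ltxx.
  have uS : u S = c * v S.
    apply: subr0_eq; apply: (zero_at (fun t => u t - c * v t)) => [|t /ES[-> _]]; last by rewrite subrr.
    exact: is_derive_continuous (is_derive1B Hu (is_derive1_Mc c Hv)).
  have yS : y S = phi c * x S.
    apply: subr0_eq; apply: (zero_at (fun t => y t - phi c * x t)) => [|t /ES[_ ->]]; last by rewrite subrr.
    exact: is_derive_continuous (is_derive1B Hy (is_derive1_Mc (phi c) Hx)).
  have sub r : S < r < 1 -> 0 < r < 1 by case/andP=> /(lt_trans S0) -> ->.
  apply: (@rsol_extend mu u y v x S 1 c (v S) (x S)) => //.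
  - exact: ltW.
  - by move=> r /sub; exact: Su.
  - by move=> r /sub; exact: Sv.
  - by rewrite -uS; apply: continuous_right; exact: is_derive_continuous Hu.
  - by apply: continuous_right; exact: is_derive_continuous Hv.
  - by rewrite -yS; apply: continuous_right; exact: is_derive_continuous Hy.
  - by apply: continuous_right; exact: is_derive_continuous Hx.
  - have [vS|vS] := eqVneq (v S) 0; [right|by left].
    by rewrite uS vS mulr0; split=> //; split=> //; split=> //; exact: nd.
have : Num.min T 1 <= S.
  apply: (ub_le_sup hsA.2); split.
    by rewrite le_min ler01 ge_min lexx orbT (ltW (le_lt_trans S0 ST)).
  move=> t; rewrite lt_min => /andP[t0 /andP[tT t1]].
  have [tS|] := ltP t S; first by apply: ES; rewrite t0.
  rewrite le_eqVlt => /predU1P[St|St]; last by apply: TP; rewrite St.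
  subst t.
  have S01 : 0 < S < 1 by rewrite t0.
  have [Hu Hy] := Su S S01; have [Hv Hx] := Sv S S01.
  have zr (f : R -> R) : {for S, continuous f} -> (forall t, S < t < T -> f t = 0) -> f S = 0.
    move=> cf f0; apply: (@cvg_unique _ _ (f r @[r --> S^'+])); [exact: norm_hausdorff| |].
      exact: continuous_right.
    apply: cvg_near_cst; near=> r; apply: f0; apply/andP; split; near: r.
      exact: nbhs_right_gt.
    exact: nbhs_right_lt.
  split; apply: subr0_eq.
    apply: (zr (fun t => u t - c * v t)) => [|t /TP[-> _]]; last by rewrite subrr.
    exact: is_derive_continuous (is_derive1B Hu (is_derive1_Mc c Hv)).
  apply: (zr (fun t => y t - phi c * x t)) => [|t /TP[_ ->]]; last by rewrite subrr.
  exact: is_derive_continuous (is_derive1B Hy (is_derive1_Mc (phi c) Hx)).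
by rewrite leNgt lt_min ST S1.
Unshelve. all: by end_near. Qed.

End RadialUniqueness.

(** * The radial spectrum *)

Section RadialSpectrum.
Variables (R : realType) (p : R).
Hypothesis p1 : 1 < p.
Implicit Types (u : R -> R) (r s t mu nu c k : R).

Local Notation q := (conjp p).
Local Notation phi := (phip p).
Local Notation phq := (phip q).

Let p0 : 0 < p. Proof. by rewrite (lt_trans ltr01). Qed.
Let q1 : 1 < q. Proof. exact: conjp_gt1. Qed.

(** The function y is minus the mean flux. The bound |y r| <= r B near 0 is recorded because it lets
    the weak equation in space hold across the origin. *)
Lemma profile_exists (n : nat) : exists w y : R -> R,
  [/\ forall r, is_derive r 1 w (phq (y r)), continuous y,
      forall r, r <= 0 -> w r = 1 /\ y r = 0,
      forall r, 0 < r -> rsol n p 1 w y r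
    & exists2 B : R, 0 < B & forall r, 0 <= r <= 1 -> `|y r| <= r * B].
Proof.
have [w cw wE] := @radial_exists R n p p1.
have wE' : w = rshoot n p w by exact/funext.
exists w, (fun r => - mflux n p w r).
have Dw r : is_derive r 1 w (phq (- mflux n p w r)).
  by rewrite {1}wE' phipN; exact: is_derive_rshoot.
split=> //.
- by move=> r; apply: cvgN; exact: mflux_continuous.
- by move=> r r0; rewrite wE rshoot_le0// /mflux r0 oppr0.
- move=> r r0; split=> //.
  have rn : r != 0 by rewrite gt_eqF.
  have rn0 : r ^+ n != 0 by rewrite expf_neq0.
  have D := is_derive1N (is_derive1M (is_derive_prim r (rweight_continuous (n:=n) p1 cw))
    (@is_derive1_V R (fun t : R => t ^+ n) r _ rn0 (is_derive1_X n r))).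
  apply: (@near_is_derive1 _ (fun t => - (flux n p w t / t ^+ n))).
    near=> t; have t0 : 0 < t by near: t; exact: lt_nbhsr.
    by rewrite /mflux leNgt t0.
  apply: is_derive1_val D _; rewrite /rweight (max_idPr (ltW r0)) /mflux leNgt r0/= -/(flux n p w).
  have aux (m : nat) (F a : R) : - (r ^+ m * a / r ^+ m + F * (- (m%:R * r ^+ m.-1) / r ^+ m ^+ 2)) =
      - (m%:R / r * - (F / r ^+ m)) - 1 * a.
    by case: m => [|m] /=; rewrite ?expr0 ?exprS; field; rewrite ?rn ?expf_neq0.
  exact: aux.
- have [B B0 HB] := continuous_bounded_itv 0 1 (fun t => continuous_comp (cw t) (@phip_continuous R p p1 (w t))).
  exists B => // r /andP[r0 r1]; rewrite normrN.
  have := @mflux_bound R n p p1 w r B cw; rewrite (max_idPr r0); apply.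
  by move=> t /andP[t0 tr]; apply: HB; rewrite t0 (le_trans tr).
Unshelve. all: by end_near. Qed.

Variables (n : nat) (w y : R -> R).
Hypothesis Dw : forall r, is_derive r 1 w (phq (y r)).
Hypothesis cy : continuous y.
Hypothesis wy0 : forall r, r <= 0 -> w r = 1 /\ y r = 0.
Hypothesis Sw : forall r, 0 < r -> rsol n p 1 w y r.

Let cw : continuous w.
Proof. by move=> r; exact: is_derive_continuous (Dw r). Qed.

Let w0 : w 0 = 1. Proof. by have [] := wy0 (lexx 0). Qed.
Let y0 : y 0 = 0. Proof. by have [] := wy0 (lexx 0). Qed.

(** A degenerate zero would propagate backwards to every smaller positive radius, whereas w is
    nonzero near 0. *)
Lemma profile_zero_simple z : 0 < z -> w z = 0 -> y z != 0.
Proof.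
move=> z0 wz; apply/negP => /eqP yz.
have : \forall r \near 0^'+, w r != 0.
  apply: (@near_right_neq0 _ _ _ 1); last exact: oner_neq0.
  by rewrite -w0; apply: continuous_right; exact: cw.
move=> /(right_interval z0)[T [T0 Tz TP]].
have aT : 0 < T / 2 < T by apply/andP; split; lra.
have /negP := TP _ aT; apply; apply/eqP.
case/andP: aT => a0 aT.
apply: (rsol_zero_backward p1 ltr01 a0 _ _ wz yz); first exact/ltW/(lt_le_trans aT).
by move=> r /andP[ar _]; apply: Sw; exact: lt_le_trans ar.
Qed.

Lemma profile_zero_after a : 0 <= a -> exists2 z, a < z & w z = 0.
Proof.
move=> a0; pose b := a + 1; have b0 : 0 < b by rewrite ltr_wpDl.
have ab : a < b by rewrite ltrDl.
apply: contrapT => nz.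
have wn r : b <= r -> w r != 0.
  by move=> br; apply/negP => /eqP wr; apply: nz; exists r => //; exact: lt_le_trans br.
have sgn r : b <= r -> 0 < w b * w r.
  move=> br; rewrite ltNge; apply/negP => h.
  have wb := wn b (lexx _); have wr := wn r br.
  have [|c cI wc] := @IVT R w b r 0 br (continuous_itv cw).
    rewrite ge_min le_max; case: (ltrgtP (w b) 0) wb h => //= h1 _.
      by rewrite nmulr_rle0// => ->; rewrite orbT.
    by rewrite pmulr_rle0// => ->.
  by have := wn c; rewrite (itvP cI) wc eqxx => /(_ isT).
have [wb|wb|wb] := ltrgtP (w b) 0.
- apply: (@rsol_no_eventual_sign R n p p1 (fun t => - w t) (fun t => - y t) b b0).
    by move=> r br; apply: rsol_opp; apply: Sw; exact: lt_le_trans br.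
  by move=> r /sgn; rewrite nmulr_rgt0// oppr_gt0.
- apply: (@rsol_no_eventual_sign R n p p1 w y b b0).
    by move=> r br; apply: Sw; exact: lt_le_trans br.
  by move=> r /sgn; rewrite pmulr_rgt0.
- by have := wn b (lexx _); rewrite wb eqxx.
Qed.

(** The next zero is the infimum of the zeros beyond a. It exceeds a because w does not vanish just
    after a: by w(0) = 1 if a = 0, by simplicity of the zero a otherwise. *)
Lemma profile_next_zero a : 0 <= a -> a = 0 \/ w a = 0 ->
  exists z, [/\ a < z, w z = 0 & forall t, a < t < z -> w t != 0].
Proof.
move=> a0 aP; pose Z := [set z | a < z /\ w z = 0].
have [b ab wb] := profile_zero_after a0.
have hi : has_inf Z by split; [exists b|exists a => z [/ltW]].
have nz : \forall r \near a^'+, w r != 0.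
  have [ae|an] := eqVneq a 0.
    apply: (@near_right_neq0 _ _ _ 1); last exact: oner_neq0.
    by rewrite -w0 ae; apply: continuous_right; exact: cw.
  have wa : w a = 0 by case: aP => // ae; rewrite ae eqxx in an.
  apply: (near_right_neq0_deriv (Dw a) wa); rewrite phip_eq0//.
  by apply: profile_zero_simple => //; rewrite lt_neqAle eq_sym an.
have [T [aT _ TP]] := right_interval ab nz.
have Tle z : Z z -> T <= z.
  by move=> [az wz]; rewrite leNgt; apply/negP => zT; have := TP z; rewrite az zT wz eqxx => /(_ isT).
have TI : T <= inf Z by apply: lb_le_inf => //; exists b.
exists (inf Z); split.
- exact: lt_le_trans TI.
- apply/eqP; apply: contraT => wI.
  have wI0 : 0 < `|w (inf Z)| by rewrite normr_gt0.
  have /cvgrPdist_lt/(_ _ wI0) := @cw (inf Z) => /nbhs_ballP[d /= d0 dP].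
  have [z [az wz] zd] := inf_adherent d0 hi.
  have Iz : inf Z <= z by apply: (ge_inf hi.2).
  have : `|w (inf Z) - w z| < `|w (inf Z)|.
    by apply: dP; rewrite /ball/= distrC ger0_norm ?subr_ge0// ltrBlDl.
  by rewrite wz subr0 ltxx.
- move=> t /andP[at_ tI]; apply/negP => /eqP wt.
  by have := ge_inf hi.2 (conj at_ wt : Z t); rewrite leNgt tI.
Qed.

Lemma profile_zeros : exists z : nat -> R, [/\ 0 < z 0%N, forall i, z i < z i.+1,
  forall i, w (z i) = 0, forall t, 0 < t < z 0%N -> w t != 0
  & forall i t, z i < t < z i.+1 -> w t != 0].
Proof.
have /choice[f fP] : forall a : R, exists z : R, 0 <= a -> a = 0 \/ w a = 0 ->
    [/\ a < z, w z = 0 & forall t, a < t < z -> w t != 0].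
  move=> a; have [a0|a0] := leP 0 a; last by exists 0.
  have [aP|aP] := pselect (a = 0 \/ w a = 0); last by exists 0.
  by have [z zP] := profile_next_zero a0 aP; exists z.
pose z i := iter i.+1 f 0.
have zP i : 0 < z i /\ w (z i) = 0.
  elim: i => [|i [IH1 IH2]]; first by have [] := fP 0 (lexx _) (or_introl erefl).
  have [h1 h2 _] := fP (z i) (ltW IH1) (or_intror IH2).
  by split => //; exact: lt_trans h1.
exists z; split.
- by have [] := zP 0%N.
- by move=> i; have [h1 h2] := zP i; have [] := fP (z i) (ltW h1) (or_intror h2).
- by move=> i; have [] := zP i.
- by have [] := fP 0 (lexx _) (or_introl erefl).
- by move=> i; have [h1 h2] := zP i; have [] := fP (z i) (ltW h1) (or_intror h2).
Qed.

Lemma profile_scaled z r : 0 < z -> 0 < r ->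
  rsol n p (z `^ p) (fun t => w (z * t)) (fun t => phi z * y (z * t)) r.
Proof.
move=> z0 r0; rewrite -[z `^ p]mul1r; apply: rsol_scale => //; first by rewrite gt_eqF.
by apply: Sw; rewrite mulr_gt0.
Qed.

Lemma is_derive_profile_scaled z r :
  is_derive r 1 (fun t => w (z * t)) (z * phq (y (z * r))).
Proof.
apply: is_derive1_val (is_derive1_comp' (Dw (z * r)) (is_derive1_Mc z (is_derive1_id r))) _.
by rewrite mulr1 mulrC.
Qed.

Lemma radial_eig_of_zero (N : nat) z : n = N.-1 -> 0 < z -> w z = 0 ->
  radial_eig N p (z `^ p).
Proof.
move=> nN z0 wz; exists (fun t => w (z * t)).
have D1 : derive1 (fun t => w (z * t)) = (fun t => z * phq (y (z * t))).
  by apply/funext => t; rewrite derive1E; have [_ ->] := is_derive_profile_scaled z t.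
split.
- by move=> r _; have [] := is_derive_profile_scaled z r.
- rewrite D1; apply: continuous_itv => t; apply: cvgM; first exact: cvg_cst.
  apply: (@continuous_comp _ _ _ (fun t => y (z * t)) phq); last exact: phip_continuous.
  apply: (@continuous_comp _ _ _ (fun t : R => z * t) y); last exact: cy.
  by apply: cvgM; [exact: cvg_cst|exact: cvg_id].
- by rewrite D1 mulr0 y0 phip0 mulr0 mulr1.
- have : \forall r \near 0^'+, w r != 0.
    apply: (@near_right_neq0 _ _ _ 1); last exact: oner_neq0.
    by rewrite -w0; apply: continuous_right; exact: cw.
  move=> /(right_interval z0)[T [T0 Tz TP]]; exists (T / 2 / z).
    rewrite !divr_gt0//= ltr_pdivrMr// mul1r; apply: lt_le_trans Tz.
    by rewrite ltr_pdivrMr// ltr_pMr// ltr1n.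
  have zn : z != 0 by rewrite gt_eqF.
  have -> : z * (T / 2 / z) = T / 2 by field.
  by apply: TP; apply/andP; split; lra.
- move=> r /andP[r0 r1].
  have E : (fun s => s ^+ N.-1 * phi (derive1 (fun t => w (z * t)) s)) = (fun s => s ^+ n * (phi z * y (z * s))).
    by apply/funext => s; rewrite D1 phipM phip_conjpK// nN.
  have [d dE] := is_derive_rflux r0 (profile_scaled z0 r0).
  by rewrite E; split=> //; rewrite derive1E dE opprK nN.
Qed.

(** Converse half of the description of the spectrum. After nu > 0 and u(0) <> 0 are known,
    uniqueness makes u a multiple of the rescaled profile, and u(1) = 0 makes nu^(1/p) one of the
    zeros of w. *)
Lemma radial_eig_zero (N : nat) nu : n = N.-1 -> radial_eig N p nu ->
  exists z, [/\ 0 < z, w z = 0 & nu = z `^ p].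
Proof.
move=> nN [u [du cu1 [u10 u1] [r0 r0I ur0] ode]].
have Du r : 0 <= r <= 1 -> is_derive r 1 u (derive1 u r).
  by move=> /du d; apply: DeriveDef => //; rewrite derive1E.
pose Y r := phi (derive1 u r).
have [cu1i cu1l cu1r] := (continuous_within_itvP _ ltr01).1 cu1.
have S r : 0 < r < 1 -> rsol n p nu u Y r.
  move=> rI; have rI' : 0 <= r <= 1 by case/andP: rI => /ltW -> /ltW ->.
  split; first by rewrite /Y (phipK p1); exact: Du.
  have [/= dd dE] := ode r rI.
  have rp : 0 < r by case/andP: rI.
  have rn : r != 0 by rewrite gt_eqF.
  have rn0 : r ^+ n != 0 by rewrite expf_neq0.
  have DD : is_derive r 1 (fun s => s ^+ n * Y s) (- (nu * r ^+ n * phi (u r))).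
    by rewrite nN; apply: DeriveDef => //; rewrite -derive1E -dE opprK.
  have D := is_derive1M DD (@is_derive1_V R (fun t : R => t ^+ n) r _ rn0 (is_derive1_X n r)).
  apply: (@near_is_derive1 _ (fun t => t ^+ n * Y t * (t ^+ n)^-1)).
    near=> t; have t0 : 0 < t by near: t; exact: lt_nbhsr.
    by rewrite mulrAC divff ?mul1r// expf_neq0// gt_eqF.
  apply: is_derive1_val D _; move: (Y r) rn0.
  by case: n => [|m] F rn0 /=; rewrite ?expr0 ?exprS; field; rewrite ?rn ?expf_neq0.
have lu0 : u r @[r --> 0^'+] --> u 0.
  by apply: continuous_right; apply: is_derive_continuous (Du 0 _); rewrite lexx ler01.
have lu1 : u r @[r --> 1^'-] --> (0 : R).
  rewrite -u1; have := is_derive_continuous (Du 1 _); rewrite ler01 lexx => /(_ isT) h.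
  by apply: cvg_trans h; apply: cvg_app; exact: cvg_within.
have lY0 : Y r @[r --> 0^'+] --> (0 : R).
  have : Y r @[r --> 0^'+] --> phi (derive1 u 0).
    exact: (cvg_comp _ _ cu1l (@phip_continuous R p p1 (derive1 u 0))).
  by rewrite u10 phip0.
have lY1 : Y r @[r --> 1^'-] --> Y 1.
  exact: (cvg_comp _ _ cu1r (@phip_continuous R p p1 (derive1 u 1))).
have lX (a : R) (F : set_system R) : F --> a -> t ^+ n @[t --> F] --> a ^+ n.
  by move=> Fa; apply: (cvg_comp _ _ Fa (@exprn_continuous R n a)).
(* For nu <= 0 the function u r^n Y is nondecreasing and tends to 0 at both ends, so it vanishes
   identically; then u' = 0 and u is the constant u(1) = 0. *)
have nup : 0 < nu.
  rewrite ltNge; apply/negP => nu0.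
  pose f r := u r * (r ^+ n * Y r).
  pose df r := r ^+ n * (`|phq (Y r)| `^ p + (- nu) * `|u r| `^ p).
  have Df r : 0 < r < 1 -> is_derive r 1 f (df r).
    move=> rI; have rp : 0 < r by case/andP: rI.
    have [Hu _] := S r rI.
    apply: is_derive1_val (is_derive1M Hu (is_derive_rflux rp (S r rI))) _.
    by rewrite /df -(mul_phip (u r) p1) -(mul_phip (phq (Y r)) p1) phip_conjpK//; ring.
  have df0 r : 0 < r < 1 -> 0 <= df r.
    move=> /andP[rp _]; rewrite mulr_ge0 ?exprn_ge0 ?(ltW rp)// addr_ge0 ?powR_ge0//.
    by rewrite mulr_ge0 ?powR_ge0// oppr_ge0.
  have f_ge0 : forall r, 0 < r < 1 -> 0 <= f r.
    apply: (ge0_of_right_lim0 Df df0).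
    have : f r @[r --> 0^'+] --> u 0 * (0 ^+ n * 0).
      by apply: cvgM => //; apply: cvgM => //; apply: lX; exact: cvg_within.
    by rewrite !mulr0.
  have f_le0 : forall r, 0 < r < 1 -> f r <= 0.
    move=> r rI.
    (* The limit at 1 is turned into a right limit at 0 by the substitution r = 1 - t. *)
    have := @ge0_of_right_lim0 R (fun t => - f (1 - t)) (fun t => df (1 - t)) 0 1 _ _ _ (1 - r).
    have -> : 1 - (1 - r) = r by ring.
    rewrite oppr_ge0; apply.
    - move=> t /andP[t0 t1]; have h : 0 < 1 - t < 1 by apply/andP; split; lra.
      have D := is_derive1B (is_derive1_cst 1 t) (is_derive1_id t).
      have D2 := @is_derive1_comp' R f (fun s => 1 - s) t _ _ (Df _ h) D.
      have E : - (df (1 - t) * (0 - 1)) = df (1 - t) by ring.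
      exact: is_derive1_val (is_derive1N D2) E.
    - by move=> t /andP[t0 t1]; apply: df0; apply/andP; split; lra.
    - have lf : f r @[r --> 1^'-] --> (0 : R).
        have -> : (0 : R) = 0 * (1 ^+ n * Y 1) by rewrite mul0r.
        by apply: cvgM => //; apply: cvgM => //; apply: lX; exact: cvg_within.
      apply/cvgrPdist_lt => e e0.
      have /cvgrPdist_lt/(_ _ e0) := lf; rewrite near_withinE => /nbhs_ballP[d /= d0 dP].
      rewrite near_withinE; apply/nbhs_ballP; exists d => //= t td t0.
      rewrite sub0r opprK -normrN -sub0r; apply: dP.
        by move: td; rewrite /ball/= sub0r normrN => td; have -> : 1 - (1 - t) = t by ring.
      by rewrite /= ltrBlDr ltrDl.
    - by case/andP: rI => h1 h2; apply/andP; split; lra.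
  have f0 r : 0 < r < 1 -> f r = 0 by move=> rI; apply/eqP; rewrite eq_le f_ge0// f_le0.
  have df_0 r : 0 < r < 1 -> df r = 0.
    move=> rI; have [_ <-] := Df r rI.
    rewrite (@near_eq_derive R R^o R^o f (cst 0)) ?derive_cst//.
    have : \forall t \near r, t \in `]0, 1[ by apply: near_in_itvoo; rewrite in_itv.
    by apply: filterS => t; rewrite in_itv/= => /f0.
  have du0 r : 0 < r < 1 -> is_derive r 1 u 0.
    move=> rI; have [Hu _] := S r rI; apply: is_derive1_val Hu _.
    have rp : 0 < r by case/andP: rI.
    move/eqP: (df_0 r rI); rewrite mulf_eq0 gt_eqF ?exprn_gt0//=.
    rewrite paddr_eq0 ?powR_ge0//; last by rewrite mulr_ge0 ?powR_ge0// oppr_ge0.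
    by move=> /andP[]; rewrite powR_eq0 normr_eq0 => /andP[/eqP].
  have uc r : 0 < r < 1 -> u r = u r0.
    move=> rI; have [h|/ltW h] := leP r r0.
      apply/esym/(derive0_eq h) => t /andP[rt tr]; apply: du0.
      case/andP: rI => r1 _; case/andP: r0I => _ r2.
      by rewrite (lt_le_trans r1 rt) (le_lt_trans tr r2).
    apply: (derive0_eq h) => t /andP[rt tr]; apply: du0.
    case/andP: rI => _ r2; case/andP: r0I => r1 _.
    by rewrite (lt_le_trans r1 rt) (le_lt_trans tr r2).
  move/negP: ur0; apply; apply/eqP.
  apply: (@cvg_unique _ _ (u r @[r --> 1^'-]) _ _ _ _ lu1); [exact: norm_hausdorff|].
  apply: cvg_near_cst; near=> t; apply: uc; apply/andP; split; near: t.
    exact: nbhs_left_gt.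
  exact: nbhs_left_lt.
(* The energy does not increase and would start from 0, so u would vanish throughout (0, 1). *)
have c0 : u 0 != 0.
  apply/negP => /eqP u00; move/negP: ur0; apply; apply/eqP.
  have := @ge0_of_right_lim0 R (fun r => - renergy p nu u Y r) (fun r => - - (n%:R / r * `|Y r| `^ q)) 0 1 _ _ _ r0 r0I.
  move=> H; have [|//] := @renergy_eq0 R p p1 nu u Y r0 nup.
  rewrite -oppr_ge0; apply: H.
  - by move=> r rI; apply/is_derive1N/(is_derive_renergy p1 _ (S r rI)); rewrite gt_eqF//; case/andP: rI.
  - by move=> r /andP[rp _]; rewrite opprK mulr_ge0 ?powR_ge0// divr_ge0// ltW.
  - suff : - renergy p nu u Y r @[r --> 0^'+] --> - (`|0 : R| `^ q / q + nu * (`|u 0| `^ p / p)).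
      by rewrite u00 normr0 !powR0 ?gt_eqF// ?(lt_trans ltr01)// !mul0r mulr0 addr0 oppr0.
    apply: cvgN; apply: cvgD.
      apply: cvgM; last exact: cvg_cst.
      exact: (cvg_comp _ _ lY0 (@powr_norm_continuous R q q1 0)).
    apply: cvgM; first exact: cvg_cst.
    apply: cvgM; last exact: cvg_cst.
    exact: (cvg_comp _ _ lu0 (@powr_norm_continuous R p p1 (u 0))).
pose z := nu `^ p^-1.
have z0 : 0 < z by rewrite powR_gt0.
have zp : z `^ p = nu by rewrite -powRrM mulVf ?gt_eqF// powRr1// ltW.
have cs r : {for r, continuous (fun t => w (z * t))}.
  exact: is_derive_continuous (is_derive_profile_scaled z r).
have uE := @rsol_unique R n p p1 nu u Y (fun t => w (z * t)) (fun t => phi z * y (z * t)) (u 0) c0 S.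
have {}uE : forall r, 0 < r < 1 -> u r = u 0 * w (z * r).
  apply: uE; [|exact: lu0| |exact: lY0| |].
  - by move=> r /andP[rp _]; rewrite -zp; exact: profile_scaled.
  - by have := continuous_right (cs 0); rewrite mulr0 w0.
  - suff : phi z * y (z * r) @[r --> 0^'+] --> phi z * y (z * 0) by rewrite mulr0 y0 mulr0.
    apply: (@continuous_right R (fun r => phi z * y (z * r)) 0).
    apply: cvgM; first exact: cvg_cst.
    apply: (@continuous_comp _ _ _ (fun t : R => z * t) y); last exact: cy.
    by apply: cvgM; [exact: cvg_cst|exact: cvg_id].
  - move=> r /andP[rp _] wr; apply: mulf_neq0; first by rewrite phip_eq0// gt_eqF.
    by apply: profile_zero_simple wr; rewrite mulr_gt0.
exists z; split => //.
have : u 0 * w (z * 1) = 0.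
  apply: (@cvg_unique _ _ (u r @[r --> 1^'-]) _ _ _ _ lu1); [exact: norm_hausdorff|].
  apply: (@cvg_trans _ ((fun r => u 0 * w (z * r)) r @[r --> 1^'-])).
    apply: near_eq_cvg; near=> t; suff tI : 0 < t < 1 by rewrite (uE t tI).
    by apply/andP; split; near: t; [exact: nbhs_left_gt|exact: nbhs_left_lt].
  apply: cvgM; first exact: cvg_cst.
  by apply: cvg_trans (cs 1); apply: cvg_app; exact: cvg_within.
by move/eqP; rewrite mulf_eq0 (negPf c0) mulr1 => /eqP.
Unshelve. all: by end_near. Qed.

(** Zeros are numbered from 0, so the k-th one is [z k.-1]; the k - 1 smaller eigenvalues are the
    p-th powers of the earlier zeros. *)
Lemma radial_kth_zero (N k : nat) (z : nat -> R) : n = N.-1 ->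
  0 < z 0%N -> (forall i, z i < z i.+1) -> (forall i, w (z i) = 0) ->
  (forall t, 0 < t < z 0%N -> w t != 0) -> (forall i t, z i < t < z i.+1 -> w t != 0) ->
  (0 < k)%N -> radial_kth N p k (z k.-1 `^ p).
Proof.
move=> nN z0 zS wz w0z wiz k0.
have zlt : {homo z : i j / (i < j)%N >-> i < j} by apply: (homo_ltn lt_trans).
have zpos i : 0 < z i by case: i => // i; exact: lt_trans (zlt 0%N i.+1 isT).
have pw a b : 0 < a -> 0 < b -> (a `^ p < b `^ p) = (a < b).
  move=> a0 b0; apply/idP/idP => [|ab]; last by rewrite gt0_ltr_powR// nnegrE ltW.
  by apply: contraTT; rewrite -!leNgt => ba; rewrite ge0_ler_powR// ?nnegrE ltW.
have zall j t : 0 < t -> w t = 0 -> t < z j -> exists2 i, (i < j)%N & t = z i.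
  move=> t0 wt; elim: j => [tz|j IH tz].
    by have := w0z t; rewrite t0 tz wt eqxx => /(_ isT).
  have [tj|jt|->] := ltrgtP t (z j); last by exists j.
    by have [i ij ->] := IH tj; exists i => //; exact: ltnW.
  by have := wiz j t; rewrite jt tz wt eqxx => /(_ isT).
split; first exact: radial_eig_of_zero.
exists [seq z i `^ p | i <- iota 0 k.-1]; split.
- rewrite map_inj_in_uniq ?iota_uniq// => i j _ _ e.
  case: (ltngtP i j) => // /zlt; rewrite -pw// e ltxx //.
- by rewrite size_map size_iota.
- move=> nu; split=> [[/(radial_eig_zero nN)[t [t0 wt ->]]]|].
    rewrite pw// => /(zall _ _ t0 wt)[i ik ->].
    by apply: map_f; rewrite mem_iota.
  move=> /mapP[i]; rewrite mem_iota add0n => /andP[_ ik] ->.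
  by split; [exact: radial_eig_of_zero|rewrite pw// zlt].
Qed.

End RadialSpectrum.

(** * Integration of compactly supported functions *)

Section LineIntegral.
Variable R : realType.
Implicit Types (g G : R -> R) (t h : R).

Local Notation mu := (@lebesgue_measure R).

Definition lineint g : R := (\int[mu]_t g t)%R.

Definition linecc g := continuous g /\ exists M : R, forall t, M < `|t| -> g t = 0.

Lemma lineint_prim_EFin g G (A B : R) : continuous g -> A < B ->
  (forall t, t < A \/ B < t -> g t = 0) -> (forall t, is_derive t 1 G (g t)) ->
  (\int[mu]_t (g t)%:E = (G B - G A)%:E)%E.
Proof.
move=> cg AB g0 DG.
have <- : (\int[mu]_(t in `[A, B]) (g t)%:E = (G B - G A)%:E)%E.
  rewrite (continuous_FTC2 AB (continuous_itv cg) (F := G)) //.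
  - have cG t : {for t, continuous G} by exact: is_derive_continuous (DG t).
    split.
    + by move=> t _; have [] := DG t.
    + by apply: cvg_trans (cG A); apply: cvg_app; exact: cvg_within.
    + by apply: cvg_trans (cG B); apply: cvg_app; exact: cvg_within.
  - by move=> t _; rewrite derive1E; have [_ ->] := DG t.
rewrite [RHS]integral_mkcond; apply: eq_integral => t _.
rewrite restrict_EFin /= /patch; case: ifPn => // /negP tAB.
rewrite g0//; have [|At] := ltP t A; [by left|right].
by rewrite ltNge; apply/negP => tB; apply: tAB; rewrite inE/= in_itv/= At.
Qed.

Lemma lineint_prim g G (A B : R) : continuous g -> A < B ->
  (forall t, t < A \/ B < t -> g t = 0) -> (forall t, is_derive t 1 G (g t)) ->
  lineint g = G B - G A.
Proof. by move=> cg AB g0 DG; rewrite /lineint /Rintegral (lineint_prim_EFin cg AB g0 DG). Qed.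

Lemma linecc_bound g : linecc g -> exists2 M : R, 0 < M & forall t, t < - M \/ M < t -> g t = 0.
Proof.
move=> [_ [M HM]]; exists (Num.max M 1); first by rewrite lt_max ltr01 orbT.
move=> t tM; apply: HM; apply: (@le_lt_trans _ _ (Num.max M 1)); first by rewrite le_max lexx.
by case: tM; [rewrite ltrNr => h; apply: (lt_le_trans h); rewrite -normrN ler_norm|move=> h; apply: (lt_le_trans h); exact: ler_norm].
Qed.

Lemma lineint_EFin g : linecc g -> (\int[mu]_t (g t)%:E = (lineint g)%:E)%E.
Proof.
move=> cg; have [M M0 gM] := linecc_bound cg.
have MM : - M < M by lra.
have D t := is_derive_prim t cg.1.
by rewrite (lineint_prim cg.1 MM gM D) (lineint_prim_EFin cg.1 MM gM D).
Qed.

Lemma lineint_lin g1 g2 (a b : R) : linecc g1 -> linecc g2 ->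
  lineint (fun t => a * g1 t + b * g2 t) = a * lineint g1 + b * lineint g2.
Proof.
move=> c1 c2; have [M M0 gM] := linecc_bound c1; have [L L0 gL] := linecc_bound c2.
pose K := M + L; have KK : - K < K by rewrite /K; lra.
have g1K t : t < - K \/ K < t -> g1 t = 0.
  by rewrite /K => h; apply: gM; case: h => h; [left|right]; lra.
have g2K t : t < - K \/ K < t -> g2 t = 0.
  by rewrite /K => h; apply: gL; case: h => h; [left|right]; lra.
have D1 t := is_derive_prim t c1.1; have D2 t := is_derive_prim t c2.1.
rewrite (lineint_prim c1.1 KK g1K D1) (lineint_prim c2.1 KK g2K D2).
rewrite (@lineint_prim _ (fun t => a * prim g1 t + b * prim g2 t) (- K) K) //.
- ring.
- by move=> t; apply: cvgD; apply: cvgM; [exact: cvg_cst|exact: c1.1|exact: cvg_cst|exact: c2.1].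
- by move=> t h; rewrite g1K// g2K// !mulr0 addr0.
Qed.

Lemma lineint_bound g (M c : R) : continuous g -> 0 < M ->
  (forall t, M < `|t| -> g t = 0) -> (forall t, `|g t| <= c) -> `|lineint g| <= 2 * M * c.
Proof.
move=> cg M0 gM gc; have MM : - M < M by lra.
have gM' t : t < - M \/ M < t -> g t = 0.
  by case=> h; apply: gM; rewrite ?(lt_le_trans h) ?ler_norm// -normrN (lt_le_trans _ (ler_norm _))// ltrNr.
have D t := is_derive_prim t cg.
rewrite (lineint_prim cg MM gM' D).
have := @derive_bound R (prim g) g (- M) M c (ltW MM) (fun x _ => D x) (fun x _ => gc x).
by move=> H; apply: le_trans H _; rewrite le_eqVlt; apply/orP; left; apply/eqP; ring.
Qed.

Lemma lineint_ge0 g : (forall t, 0 <= g t) -> 0 <= lineint g.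
Proof. by move=> g0; rewrite /lineint; exact: Rintegral_ge0. Qed.

Lemma lineint_gt0 g t0 : linecc g -> (forall t, 0 <= g t) -> 0 < g t0 -> 0 < lineint g.
Proof.
move=> cg g0 gt0; have [M M0 gM] := linecc_bound cg.
have MM : - M < M by lra.
have D t := is_derive_prim t cg.1.
rewrite lt_neqAle lineint_ge0// andbT; apply/negP => /eqP.
rewrite (lineint_prim cg.1 MM gM D) => /esym/subr0_eq e.
have tM : - M <= t0 <= M.
  apply/andP; split; rewrite leNgt; apply/negP => h; move: gt0; rewrite gM ?ltxx//.
    by left. by right.
have mono a b : a <= b -> prim g a <= prim g b.
  by move=> ab; apply: (derive_ge0_le ab) => x _.
have [d d0 dP] : exists2 d : R, 0 < d & forall t, `|t0 - t| < d -> 0 < g t.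
  have /cvgrPdist_lt/(_ _ gt0)/nbhs_ballP[d /= d0 dP] := @cg.1 t0.
  exists d => // t td; have := dP t td.
  by rewrite /= ltr_norml => /andP[_]; rewrite ltrBlDr ltrDl.
have key a b : - M <= a -> a < b -> b <= M -> (forall t, a <= t <= b -> 0 < g t) -> False.
  move=> Ma ab bM gp; have := @derive_gt0_lt R (prim g) g a b ab (fun x _ => D x) gp.
  by rewrite ltNge (le_trans (mono _ _ bM))// e mono.
have [t0M|t0M] := ltP t0 M.
  apply: (key t0 (Num.min M (t0 + d / 2))).
  - by case/andP: tM.
  - by rewrite lt_min t0M ltrDl divr_gt0.
  - by rewrite ge_min lexx.
  - move=> t; rewrite le_min => /andP[h1 /andP[_ h2]]; apply: dP.
    by rewrite distrC ger0_norm ?subr_ge0//; lra.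
apply: (key (Num.max (- M) (t0 - d / 2)) t0).
- by rewrite le_max lexx.
- by rewrite gt_max; apply/andP; split; [exact: lt_le_trans MM t0M|lra].
- by case/andP: tM.
- move=> t; rewrite ge_max => /andP[/andP[_ h1] h2]; apply: dP.
  by rewrite ger0_norm ?subr_ge0//; lra.
Qed.

Lemma lineint_shift g h : linecc g -> lineint (fun t => g (t + h)) = lineint g.
Proof.
move=> cg; have [M M0 gM] := linecc_bound cg.
pose K := M + `|h|; have hh := normr_ge0 h; have h1 := ler_norm h.
have h2 : - h <= `|h| by rewrite -normrN ler_norm.
have KK : - K < K by rewrite /K; lra.
have KK2 : - K + h < K + h by lra.
have D t := is_derive_prim t cg.1.
have out t : t < - K + h \/ K + h < t -> g t = 0.
  by rewrite /K; case=> ht; apply: gM; [left|right]; lra.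
rewrite (lineint_prim cg.1 KK2 out D).
apply: (@lineint_prim _ (fun t => prim g (t + h)) (- K) K) => //.
- move=> t; apply: (@continuous_comp _ _ _ (fun t => t + h) g); last exact: cg.1.
  by apply: cvgD; [exact: cvg_id|exact: cvg_cst].
- by move=> t ht; apply: out; case: ht => ht; [left|right]; lra.
- move=> t; have E : g (t + h) = g (t + h) * (1 + 0) by rewrite addr0 mulr1.
  rewrite E; exact: (@is_derive1_comp' R (prim g) (fun t => t + h) t _ _ (D (t + h))
    (is_derive1D (is_derive1_id t) (is_derive1_cst h t))).
Qed.

Lemma lineint_opp g : linecc g -> lineint (fun t => g (- t)) = lineint g.
Proof.
move=> cg; have [M M0 gM] := linecc_bound cg.
have MM : - M < M by lra.
have D t := is_derive_prim t cg.1.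
rewrite (lineint_prim cg.1 MM gM D).
have D' t : is_derive t 1 (fun t => - prim g (- t)) (g (- t)).
  have E : g (- t) = - (g (- t) * - 1) by ring.
  rewrite E; exact: is_derive1N (@is_derive1_comp' R (prim g) (fun t => - t) t _ _ (D (- t))
    (is_derive1N (is_derive1_id t))).
have cg' : continuous (fun t => g (- t)).
  by move=> t; apply: (@continuous_comp _ _ _ -%R g); [exact: opp_continuous|exact: cg.1].
have gM' t : t < - M \/ M < t -> g (- t) = 0.
  by move=> ht; apply: gM; case: ht => ht; [right|left]; lra.
by rewrite (lineint_prim cg' MM gM' D') !opprK addrC.
Qed.

End LineIntegral.

(** * Iterated integrals over R^N *)

Section SpaceIntegral.
Variables (R : realType) (N : nat).
Local Notation V := 'rV[R]_N.
Implicit Types (F G : V -> R) (x y v : V) (i j : 'I_N) (M c e h t : R).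

Lemma rV_norm_le x e : 0 <= e -> (forall j, `|x ord0 j| <= e) -> `|x| <= e.
Proof.
move=> e0 H; rewrite /Num.norm/= mx_normrE; apply/bigmax_leP; split => // -[a j] _ /=.
by rewrite (ord1 a).
Qed.

Lemma rV_coord_le x j : `|x ord0 j| <= `|x|.
Proof.
rewrite [leRHS]/Num.norm/= mx_normrE; apply: (@le_bigmax_cond _ _ _ _ (ord0, j) predT (fun ij => `|x ij.1 ij.2|)).
by [].
Qed.

Lemma lineint0 : lineint (fun _ : R => 0) = 0.
Proof.
have c0 : linecc (fun _ : R => 0) by split; [move=> t; exact: cvg_cst|exists 0].
have := @lineint_lin R _ _ 0 0 c0 c0; rewrite !mul0r addr0 => H.
by rewrite -[RHS]H; congr lineint; apply/funext => t; rewrite mul0r addr0.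
Qed.

Definition ucont F := forall e : R, 0 < e -> exists2 d : R, 0 < d &
  forall x y, `|x - y| < d -> `|F x - F y| < e.

Definition boxsupp M F := forall x j, M < `|x ord0 j| -> F x = 0.

Definition spacecc F := continuous F /\ exists M, forall x, M < `|x| -> F x = 0.

Lemma spacecc_box F : spacecc F -> exists2 M : R, 0 < M & boxsupp M F /\ forall x, M < `|x| -> F x = 0.
Proof.
move=> [_ [M HM]]; exists (Num.max M 1); first by rewrite lt_max ltr01 orbT.
split=> [x j|x]; rewrite gt_max => /andP[h _]; apply: HM => //.
exact: lt_le_trans h (rV_coord_le x j).
Qed.

Lemma closed_ball_compact M : compact [set x : V | `|x| <= M].
Proof.
apply: bounded_closed_compact.
  by exists M; split; rewrite ?num_real// => m Mm x /= /le_trans; apply; exact: ltW.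
apply: (@closed_comp _ _ (fun x : V => `|x|) [set r : R | r <= M]); last exact: closed_le.
by move=> x _; exact: norm_continuous.
Qed.

Lemma spacecc_ucont F : spacecc F -> ucont F.
Proof.
move=> cF e e0; have [M M0 [_ FM]] := spacecc_box cF.
have [d d0 dP] := heine (@closed_ball_compact M) (fun x _ => cF.1 x) e0.
exists d => // x y xy.
have [xM|xM] := leP `|x| M; first by apply: dP => //; rewrite -ball_normE.
have [yM|yM] := leP `|y| M; last by rewrite !FM// subrr normr0.
by rewrite distrC; apply: dP => //; rewrite -ball_normE /= distrC.
Qed.

Lemma nonexp_continuous (g : V -> V) : (forall x y, `|g x - g y| <= `|x - y|) -> continuous g.
Proof.
move=> gn x A /nbhs_ballP[e /= e0 eA]; apply/nbhs_ballP; exists e => //= y.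
rewrite -ball_normE /= => xy; apply: eA; rewrite -ball_normE /=.
exact: le_lt_trans (gn _ _) xy.
Qed.

Lemma setcoord_sub v w (n : nat) t s :
  setcoord v n t - setcoord w n s = setcoord (v - w) n (t - s).
Proof. by apply/rowP => j; rewrite !mxE; case: ifP => _; rewrite ?mxE. Qed.

Lemma setcoord_dist v w (n : nat) t s :
  `|setcoord v n t - setcoord w n s| <= Num.max `|v - w| `|t - s|.
Proof.
rewrite setcoord_sub; apply: rV_norm_le; first by rewrite le_max normr_ge0.
move=> j; rewrite mxE; case: ifP => _; rewrite le_max ?lexx ?orbT//.
by rewrite rV_coord_le.
Qed.

Fixpoint boxint (n : nat) F v : R :=
  if n is n'.+1 then lineint (fun t => boxint n' F (setcoord v n' t)) else F v.

Definition spaceint F : R := boxint N F 0.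

(** Uniform continuity and bounded support survive the integration of one coordinate. The induction
    can thus show at every stage that slices are continuous with compact support and that the
    extended-real integral is finite. *)
Lemma boxint_reg M F (n : nat) : 0 < M -> ucont F -> boxsupp M F -> (n <= N)%N ->
  [/\ ucont (boxint n F),
      forall v j, (n <= j)%N -> M < `|v ord0 j| -> boxint n F v = 0,
      forall v, (0 < n)%N -> linecc (fun t => boxint n.-1 F (setcoord v n.-1 t))
    & forall v, iint n (EFin \o F) v = (boxint n F v)%:E].
Proof.
move=> M0 uF bF; elim: n => [|n IH] nN.
  by split => // v j _ vj; exact: (bF v j vj).
have [uI bI _ EI] := IH (ltnW nN).
have sl0 v t : M < `|t| -> boxint n F (setcoord v n t) = 0.
  move=> tM; apply: (bI _ (Ordinal nN)) => //.
  by rewrite mxE/= eqxx.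
have slc v : continuous (fun t => boxint n F (setcoord v n t)).
  move=> t; apply/cvgrPdist_lt => e /uI[d d0 dP]; near=> s; apply: dP.
  apply: le_lt_trans (setcoord_dist _ _ _ _ _) _; rewrite subrr normr0 gt_max d0.
  by near: s; apply: near_dist.
have cc v : linecc (fun t => boxint n F (setcoord v n t)).
  by split; [exact: slc|exists M; exact: sl0].
split=> [|v j nj vj|v _|v].
- move=> e e0; have e2 : 0 < e / (2 * M) / 2 by rewrite !divr_gt0// mulr_gt0.
  have [d d0 dP] := uI _ e2; exists d => // x y xy /=.
  have := @lineint_lin R _ _ 1 (-1) (cc x) (cc y); rewrite mul1r mulN1r => <-.
  apply: (@le_lt_trans _ _ (2 * M * (e / (2 * M) / 2))).
    apply: lineint_bound => //.
    + move=> t; apply: cvgD; apply: cvgM; [exact: cvg_cst|exact: slc|exact: cvg_cst|exact: slc].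
    + by move=> t tM; rewrite !sl0// !mulr0 addr0.
    + move=> t; rewrite mul1r mulN1r; apply/ltW/dP.
      apply: le_lt_trans (setcoord_dist _ _ _ _ _) _.
      by rewrite subrr normr0 gt_max xy.
  have -> : 2 * M * (e / (2 * M) / 2) = e / 2.
    by field; rewrite gt_eqF.
  by rewrite ltr_pdivrMr// ltr_pMr// ltr1n.
- rewrite /= (_ : (fun t => _) = fun=> 0) ?lineint0//.
  apply/funext => t; apply: (bI _ j); first exact: ltnW.
  by rewrite mxE gtn_eqF.
- exact: cc.
- rewrite /= -(lineint_EFin (cc v)); apply: eq_integral => t _; exact: EI.
Unshelve. all: by end_near. Qed.

Lemma boxint_slice F v (n : nat) : spacecc F -> (n < N)%N ->
  linecc (fun t => boxint n F (setcoord v n t)).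
Proof.
move=> cF nN; have [M M0 [bF _]] := spacecc_box cF.
by have [_ _ H _] := boxint_reg M0 (spacecc_ucont cF) bF nN; exact: (H v isT).
Qed.

Lemma intRN_EFin F : spacecc F -> intRN (EFin \o F) = (spaceint F)%:E.
Proof.
move=> cF; have [M M0 [bF _]] := spacecc_box cF.
by have [_ _ _ H] := boxint_reg M0 (spacecc_ucont cF) bF (leqnn N); rewrite /intRN H.
Qed.

Lemma spacecc_lin F G (a b : R) : spacecc F -> spacecc G -> spacecc (fun x => a * F x + b * G x).
Proof.
move=> cF cG; split.
  move=> x; apply: (@continuousD _ _ _ (fun x => a * F x) (fun x => b * G x)).
    by apply: (@continuousM _ _ (cst a) F); [exact: cst_continuous|exact: cF.1].
  by apply: (@continuousM _ _ (cst b) G); [exact: cst_continuous|exact: cG.1].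
have [M _ [_ FM]] := spacecc_box cF; have [L _ [_ GL]] := spacecc_box cG.
exists (Num.max M L) => x; rewrite gt_max => /andP[h1 h2].
by rewrite FM// GL// !mulr0 addr0.
Qed.

Lemma boxint_lin F G (a b : R) (n : nat) : spacecc F -> spacecc G -> (n <= N)%N ->
  forall v, boxint n (fun x => a * F x + b * G x) v = a * boxint n F v + b * boxint n G v.
Proof.
move=> cF cG; elim: n => // n IH nN v /=.
rewrite -lineint_lin; do ?exact: boxint_slice.
by congr lineint; apply/funext => t; rewrite IH// ltnW.
Qed.

Lemma spaceint_lin F G (a b : R) : spacecc F -> spacecc G ->
  spaceint (fun x => a * F x + b * G x) = a * spaceint F + b * spaceint G.
Proof. by move=> cF cG; exact: boxint_lin. Qed.

Lemma boxint_ge0 F (n : nat) v : (forall x, 0 <= F x) -> 0 <= boxint n F v.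
Proof. by move=> F0; elim: n v => //= n IH v; apply: lineint_ge0. Qed.

Lemma spaceint_le F G : spacecc F -> spacecc G -> (forall x, F x <= G x) ->
  spaceint F <= spaceint G.
Proof.
move=> cF cG FG; rewrite -subr_ge0.
have -> : spaceint G - spaceint F = 1 * spaceint G + (-1) * spaceint F by ring.
by rewrite -spaceint_lin//; apply: boxint_ge0 => x; rewrite mul1r mulN1r subr_ge0.
Qed.

Lemma spaceint_bound F M c : spacecc F -> 0 < M -> boxsupp M F -> (forall x, `|F x| <= c) ->
  `|spaceint F| <= (2 * M) ^+ N * c.
Proof.
move=> cF M0 bF Fc; rewrite /spaceint.
have uF := spacecc_ucont cF.
suff H n : (n <= N)%N -> forall v, `|boxint n F v| <= (2 * M) ^+ n * c by exact: H.
elim: n => [_ v|n IH nN v]; first by rewrite expr0 mul1r.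
rewrite /= exprS -mulrA; apply: lineint_bound => //.
- exact: (boxint_slice v cF nN).1.
- move=> t tM; have [_ bI _ _] := boxint_reg M0 uF bF (ltnW nN).
  by apply: (bI _ (Ordinal nN)) => //; rewrite mxE/= eqxx.
- by move=> t; apply: IH; exact: ltnW.
Qed.

Lemma spaceint_gt0 F x0 : spacecc F -> (forall x, 0 <= F x) -> 0 < F x0 -> 0 < spaceint F.
Proof.
move=> cF F0 Fx0.
suff H n : (n <= N)%N -> forall v, (forall j, (n <= j)%N -> v ord0 j = x0 ord0 j) -> 0 < boxint n F v.
  by apply: H => // j; rewrite leqNgt ltn_ord.
elim: n => [_ v vx|n IH nN v vx].
  by rewrite /= (_ : v = x0)//; apply/rowP => j; exact: vx.
apply: (@lineint_gt0 _ _ (x0 ord0 (Ordinal nN))).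
- exact: boxint_slice.
- by move=> t; exact: boxint_ge0.
- apply: IH; first exact: ltnW.
  move=> j nj; rewrite mxE; case: eqP => [jn|/eqP jn].
    by congr (x0 _ _); exact/val_inj.
  by apply: vx; rewrite ltn_neqAle eq_sym jn.
Qed.

Definition shiftc i h x : V := x + h *: delta_mx ord0 i.

Lemma shiftcE i h x j : shiftc i h x ord0 j = x ord0 j + (if j == i then h else 0).
Proof.
by rewrite !mxE eqxx/= eq_sym; case: eqP => _; rewrite ?mulr1 ?mulr0.
Qed.

(** The shift travels through the iterated integrals as a shift of the base point until coordinate
    [i] is integrated, where invariance of the line integral absorbs it. *)
Lemma spaceint_shift F i h : spacecc F -> spaceint (fun x => F (shiftc i h x)) = spaceint F.
Proof.
move=> cF.
suff H n : (n <= N)%N -> forall v, boxint n (fun x => F (shiftc i h x)) v =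
    if (i < n)%N then boxint n F v else boxint n F (shiftc i h v).
  by rewrite /spaceint H// ltn_ord.
elim: n => // n IH nN v /=.
rewrite (_ : (fun t => _) = (fun t => if (i < n)%N then boxint n F (setcoord v n t)
    else boxint n F (shiftc i h (setcoord v n t)))); last first.
  by apply/funext => t; rewrite IH// ltnW.
case: (ltngtP i n) => [ni|ni|ni].
- by rewrite ltnS (ltnW ni).
- rewrite ltnS leqNgt ni/=; congr lineint; apply/funext => t; congr boxint.
  apply/rowP => j; rewrite !(shiftcE, mxE); case: (eqVneq j i) => [->|ji].
    by rewrite gtn_eqF// !(shiftcE, mxE) eqxx.
  by case: ifP => _; rewrite ?addr0.
- rewrite ni ltnSn; rewrite -(lineint_shift h (boxint_slice v cF nN)).
  congr lineint; apply/funext => t; congr boxint; apply/rowP => j.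
  rewrite !(shiftcE, mxE); have -> : (j == i) = (j == n :> nat) by rewrite -val_eqE/= ni.
  by case: ifP => _; rewrite ?addr0.
Qed.

Definition flipc i x : V := \row_j (if j == i then - x ord0 j else x ord0 j).

Lemma spaceint_flip F i : spacecc F -> spaceint (fun x => F (flipc i x)) = spaceint F.
Proof.
move=> cF.
suff H n : (n <= N)%N -> forall v, boxint n (fun x => F (flipc i x)) v =
    if (i < n)%N then boxint n F v else boxint n F (flipc i v).
  by rewrite /spaceint H// ltn_ord.
elim: n => // n IH nN v /=.
rewrite (_ : (fun t => _) = (fun t => if (i < n)%N then boxint n F (setcoord v n t)
    else boxint n F (flipc i (setcoord v n t)))); last first.
  by apply/funext => t; rewrite IH// ltnW.
case: (ltngtP i n) => [ni|ni|ni].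
- by rewrite ltnS (ltnW ni).
- rewrite ltnS leqNgt ni/=; congr lineint; apply/funext => t; congr boxint.
  apply/rowP => j; rewrite !mxE; case: (eqVneq j i) => [->|ji].
    by rewrite gtn_eqF.
  by [].
- rewrite ni ltnSn; rewrite -(lineint_opp (boxint_slice v cF nN)).
  congr lineint; apply/funext => t; congr boxint; apply/rowP => j.
  rewrite !mxE; have -> : (j == i) = (j == n :> nat) by rewrite -val_eqE/= ni.
  by case: (j == n :> nat).
Qed.

Lemma is_derive_line F x v (dF : V -> R) t :
  is_derive (x + t *: v) v F (dF (x + t *: v)) ->
  is_derive t 1 (fun s => F (x + s *: v)) (dF (x + t *: v)).
Proof.
have E : (fun h : R => h^-1 *: ((F (x + (h *: (1 : R) + t) *: v) : R) - F (x + t *: v))) =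
    (fun h => h^-1 *: (F (h *: v + (x + t *: v)) - F (x + t *: v))).
  apply/funext => h; congr (_ *: (F _ - _)).
  by rewrite [_%:A]mulr1 scalerDl addrCA.
move=> [d e]; apply: DeriveDef.
  by move: d; rewrite /derivable E.
by move: e; rewrite /derive E.
Qed.

(** Difference quotients of F have integral 0 by translation invariance, and they converge uniformly
    to dF on a fixed box. *)
Lemma spaceint_derive0 F (dF : V -> R) i : spacecc F -> spacecc dF ->
  (forall x, is_derive x (delta_mx ord0 i) F (dF x)) -> spaceint dF = 0.
Proof.
move=> cF cdF D.
have [M M0 [_ FM]] := spacecc_box cF; have [L L0 [_ GL]] := spacecc_box cdF.
pose K := M + L + 1; have K0 : 0 < K by rewrite /K; lra.
(* The summand 1 in K leaves room inside the box for a shift by h <= 1. *)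
have K2 : 0 < (2 * K) ^+ N by rewrite exprn_gt0// mulr_gt0.
apply/eqP; rewrite -normr_le0; apply/ler_addgt0Pl => e e0; rewrite addr0.
have e2 : 0 < e / (2 * K) ^+ N by rewrite divr_gt0.
have [d d0 dP] := spacecc_ucont cdF e2.
pose h := Num.min 1 (d / 2).
have h0 : 0 < h by rewrite lt_min ltr01 divr_gt0.
have h1 : h <= 1 by rewrite ge_min lexx.
have hd : h < d.
  by apply: (@le_lt_trans _ _ (d / 2)); rewrite ?ge_min ?lexx ?orbT// ltr_pdivrMr// ltr_pMr// ltr1n.
have nd : `|delta_mx ord0 i : V| <= 1.
  apply: rV_norm_le => // j; rewrite mxE eqxx/=; case: eqP => _; rewrite ?normr1 ?normr0//.
have far x (a : R) : 0 <= a <= 1 -> K < `|x| -> M + L < `|x + a *: delta_mx ord0 i|.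
  move=> /andP[a0 a1] Kx.
  have : `|a *: (delta_mx ord0 i : V)| <= 1.
    by rewrite normrZ (ger0_norm a0) -[leRHS]mulr1 ler_pM.
  have := ler_normB (x + a *: delta_mx ord0 i) (a *: (delta_mx ord0 i : V)).
  rewrite addrK /K in Kx *; lra.
have cS : spacecc (fun x => F (shiftc i h x)).
  split.
    move=> x; apply: (@continuous_comp _ _ _ (shiftc i h) F); last exact: cF.1.
    by apply: nonexp_continuous => y z; rewrite /shiftc opprD addrACA subrr addr0.
  exists K => x Kx; apply: FM; apply: lt_trans (far x h _ Kx); last by rewrite (ltW h0).
  by rewrite ltrDl.
(* dF minus the difference quotient: it has the integral of dF and is small by the mean value
   theorem. *)
pose Gq x := (- h^-1) * (1 * F (shiftc i h x) + (-1) * F x) + 1 * dF x.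
have cG1 := spacecc_lin 1 (-1) cS cF.
have cG : spacecc Gq by exact: (spacecc_lin (- h^-1) 1 cG1 cdF).
have -> : spaceint dF = spaceint Gq.
  rewrite (spaceint_lin (- h^-1) 1 cG1 cdF) (spaceint_lin 1 (-1) cS cF) spaceint_shift//.
  by ring.
have -> : e = (2 * K) ^+ N * (e / (2 * K) ^+ N) by rewrite mulrCA divff ?mulr1// gt_eqF.
apply: spaceint_bound => //.
  move=> x j Kx; have {}Kx := lt_le_trans Kx (rV_coord_le x j).
  have F1 : F (shiftc i h x) = 0.
    by apply: FM; apply: lt_trans (far x h _ Kx); rewrite ?(ltW h0)// ltrDl.
  have F2 : F x = 0 by apply: FM; apply: le_lt_trans Kx; rewrite /K; lra.
  have F3 : dF x = 0 by apply: GL; apply: le_lt_trans Kx; rewrite /K; lra.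
  by rewrite /Gq F1 F2 F3; ring.
move=> x.
have [c /andP[c0 ch] cE] := @MVT_closed R (fun s => F (x + s *: delta_mx ord0 i))
  (fun s => dF (x + s *: delta_mx ord0 i)) 0 h (ltW h0) (fun s _ => is_derive_line (D _)).
have -> : Gq x = dF x - dF (x + c *: delta_mx ord0 i).
  rewrite /Gq /shiftc; move: cE; rewrite scale0r addr0 subr0 => cE.
  have -> : 1 * F (x + h *: delta_mx ord0 i) + -1 * F x = F (x + h *: delta_mx ord0 i) - F x by ring.
  by rewrite cE; field; rewrite gt_eqF.
apply/ltW/dP; rewrite opprD addrA subrr sub0r normrN normrZ (ger0_norm c0).
apply: le_lt_trans hd; rewrite -[leRHS]mulr1 ler_pM//.
Qed.

End SpaceIntegral.

(** * Differentiable functions and the variational reduction *)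

Lemma diff_near (R : realType) (V W : normedModType R) (F G : V -> W) (x : V) :
  (\forall y \near x, F y = G y) -> differentiable F x ->
  differentiable G x /\ 'd G x = 'd F x :> (V -> W).
Proof.
move=> FG dF; have FGx := nbhs_singleton FG.
have [cd /eqaddoP H] := iffLR (diff_locallyP _ _) dF.
have HG : G \o shift x = cst (G x) + 'd F x +o_0 id.
  apply/eqaddoP => e e0; have := H e e0.
  have : \forall h \near 0, F (h + x) = G (h + x).
    have /nbhs_ballP[d /= d0 dP] := FG; apply/nbhs_ballP; exists d => //= h.
    rewrite -ball_normE /= sub0r normrN => hd; apply: dP.
    by rewrite -ball_normE /= opprD addrC -addrA addNr addr0 normrN.
  apply: filterS2 => h /= E; rewrite -FGx.
  by rewrite !fctE /= E.
have dG : 'd G x = 'd F x :> (V -> W) by exact: diff_unique cd HG.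
split; last exact: dG.
by apply/diff_locallyP; split; rewrite dG; [exact: cd|exact: HG].
Qed.

Section SpaceCalculus.
Variables (R : realType) (N : nat).
Local Notation V := 'rV[R]_N.
Implicit Types (F G : V -> R) (x y v w : V) (i j : 'I_N) (M c e h t : R).

Definition dotp v w : R := \sum_i v ord0 i * w ord0 i.
Definition nrm x : R := Num.sqrt (sqnorm x).

Definition gradat F x w := differentiable F x /\ forall v, 'd F x v = dotp w v.

Lemma dotp_delta w i : dotp w (delta_mx ord0 i) = w ord0 i.
Proof.
rewrite /dotp (bigD1 i)//= big1 => [|j /negbTE ji].
  by rewrite mxE !eqxx mulr1 addr0.
by rewrite mxE ji andbF mulr0.
Qed.

Lemma dotpDl v w u : dotp (v + w) u = dotp v u + dotp w u.
Proof. by rewrite /dotp -big_split; apply: eq_bigr => i _; rewrite mxE mulrDl. Qed.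

Lemma dotpZl c v u : dotp (c *: v) u = c * dotp v u.
Proof. by rewrite /dotp mulr_sumr; apply: eq_bigr => i _; rewrite mxE mulrA. Qed.

Lemma gradat_is_derive F x w i : gradat F x w -> is_derive x (delta_mx ord0 i) F (w ord0 i).
Proof.
move=> [dF FE]; apply: DeriveDef; first exact: diff_derivable.
by rewrite deriveE// FE dotp_delta.
Qed.

Lemma gradat_partial F x w i : gradat F x w -> partial i F x = w ord0 i.
Proof. by move=> /(@gradat_is_derive _ _ _ i)[]. Qed.

Lemma gradat_gradnorm F x w : gradat F x w -> gradnorm F x = nrm w.
Proof.
by move=> H; congr Num.sqrt; apply: eq_bigr => i _; rewrite (gradat_partial i H).
Qed.

Lemma gradat_continuous F x w : gradat F x w -> {for x, continuous F}.
Proof. by move=> [/differentiable_continuous]. Qed.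

Lemma gradat_near F G x w : (\forall y \near x, F y = G y) -> gradat F x w -> gradat G x w.
Proof.
move=> FG [dF FE]; have [dG E] := diff_near FG dF.
by split; [exact: dG|move=> v; rewrite E; exact: FE].
Qed.

Lemma gradat_cst c x : gradat (fun=> c) x 0.
Proof.
split; first exact: differentiable_cst.
by move=> v; rewrite diff_cst /dotp big1// => i _; rewrite mxE mul0r.
Qed.

Lemma gradatD F G x v w : gradat F x v -> gradat G x w ->
  gradat (fun y => F y + G y) x (v + w).
Proof.
move=> [dF FE] [dG GE]; split; first exact: (@differentiableD _ _ _ F G).
move=> u; rewrite dotpDl -FE -GE.
exact: (congr1 (fun f : V -> R => f u) (@diffD _ _ _ F G x dF dG)).
Qed.

Lemma gradatM F G x v w : gradat F x v -> gradat G x w ->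
  gradat (fun y => F y * G y) x (F x *: w + G x *: v).
Proof.
move=> [dF FE] [dG GE]; split; first exact: (@differentiableM _ _ F G).
move=> u; rewrite dotpDl !dotpZl -FE -GE.
exact: (congr1 (fun f : V -> R => f u) (@diffM _ _ F G x dF dG)).
Qed.

Lemma gradatZ F x v c : gradat F x v -> gradat (fun y => c * F y) x (c *: v).
Proof. by move=> H; have := gradatM (gradat_cst c x) H; rewrite scaler0 addr0. Qed.

Lemma gradat_comp F x w (f : R -> R) c : is_derive (F x) 1 f c -> gradat F x w ->
  gradat (fun y => f (F y)) x (c *: w).
Proof.
move=> [df fE] [dF FE]; have {}df : differentiable f (F x) by apply/derivable1_diffP.
split; first exact: (@differentiable_comp _ _ _ _ F f).
move=> u; rewrite (@diff_comp _ _ _ _ F f)//= dotpZl -FE diff1E//.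
by rewrite derive1E fE /GRing.scale/= mulrC.
Qed.

Lemma gradat_coord j x : gradat (fun y => y ord0 j) x (delta_mx ord0 j).
Proof.
have dj : differentiable (fun y : V => y ord0 j) x by exact: differentiable_coord.
split => // u.
have @f : {linear V -> R}.
  by exists (fun y : V => y ord0 j); do 2![eexists]; do ?[constructor];
     rewrite ?mxE// => ? *; rewrite ?mxE//; move=> ?; rewrite !mxE.
rewrite (_ : (fun _ => _) = f)// diff_lin; last exact: coord_continuous.
rewrite /dotp (bigD1 j)//= big1 => [|k /negbTE kj].
  by rewrite mxE !eqxx mul1r addr0.
by rewrite mxE kj andbF mul0r.
Qed.

Lemma gradat_sum (I : finType) (F : I -> V -> R) (w : I -> V) x :
  (forall a, gradat (F a) x (w a)) -> gradat (fun y => \sum_a F a y) x (\sum_a w a).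
Proof.
move=> H; rewrite unlock; elim: (index_enum I) => [|a s IH]; first exact: gradat_cst.
exact: gradatD.
Qed.

Lemma gradat_sqnorm x : gradat (@sqnorm R N) x (2 *: x).
Proof.
have H i : gradat (fun y => (y ord0 i) ^+ 2) x ((2 * x ord0 i) *: delta_mx ord0 i).
  have := gradat_comp (is_derive1_X 2 (x ord0 i)) (gradat_coord i x).
  by rewrite expr1.
have := gradat_sum H; congr gradat; apply/rowP => j; rewrite summxE (bigD1 j)//= big1.
  by rewrite !mxE !eqxx mulr1 addr0.
by move=> i /negbTE ij; rewrite !mxE [j == i]eq_sym ij andbF mulr0.
Qed.

Lemma gradat_shift F a x w : gradat F (x + a) w -> gradat (fun y => F (y + a)) x w.
Proof.
move=> [dF FE].
have ds : is_diff x (fun y : V => y + a) id.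
  have := @is_diffD _ _ _ id (cst a) id 0 x (is_diff_id x) (is_diff_cst a x).
  by rewrite addr0.
have [d1 d2] := ds; split; first exact: (@differentiable_comp _ _ _ _ (fun y => y + a) F).
move=> u; apply: etrans (congr1 (fun f : V -> R => f u)
  (@diff_comp _ _ _ _ (fun y => y + a) F x d1 dF)) _.
rewrite -FE; exact: (congr1 (fun f : V -> V => 'd F (x + a) (f u)) d2).
Qed.

Lemma sqnorm_ge0 x : 0 <= sqnorm x.
Proof. by apply: sumr_ge0 => i _; exact: sqr_ge0. Qed.

Lemma sqnormZ c x : sqnorm (c *: x) = c ^+ 2 * sqnorm x.
Proof. by rewrite /sqnorm mulr_sumr; apply: eq_bigr => i _; rewrite mxE exprMn. Qed.

Lemma sqr_nrm x : nrm x ^+ 2 = sqnorm x.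
Proof. by rewrite sqr_sqrtr// sqnorm_ge0. Qed.

Lemma nrm_ge0 x : 0 <= nrm x. Proof. exact: sqrtr_ge0. Qed.

Lemma nrmZ c x : nrm (c *: x) = `|c| * nrm x.
Proof. by rewrite /nrm sqnormZ sqrtrM ?sqr_ge0// sqrtr_sqr. Qed.

Lemma nrm0 : nrm 0 = 0.
Proof. by rewrite /nrm /sqnorm big1 ?sqrtr0// => i _; rewrite mxE expr0n. Qed.

Lemma nrmN x : nrm (- x) = nrm x.
Proof. by rewrite -scaleN1r nrmZ normrN1 mul1r. Qed.

Lemma coord_nrm x i : `|x ord0 i| <= nrm x.
Proof.
rewrite -(ger0_norm (nrm_ge0 x)) -ler_sqr ?nnegrE// !real_normK ?num_real// sqr_nrm.
by rewrite /sqnorm (bigD1 i)//= lerDl; apply: sumr_ge0 => j _; exact: sqr_ge0.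
Qed.

Lemma norm_nrm x : `|x| <= nrm x.
Proof. by apply: rV_norm_le => [|j]; [exact: nrm_ge0|exact: coord_nrm]. Qed.

End SpaceCalculus.

Section Continuity.
Variables (R : realType) (N : nat).
Local Notation V := 'rV[R]_N.
Implicit Types (F G : V -> R) (x y v w : V) (i j : 'I_N) (M c e h t : R).

Lemma cont_cst c : continuous (fun _ : V => c).
Proof. exact: cst_continuous. Qed.

Lemma contD F G : continuous F -> continuous G -> continuous (fun x => F x + G x).
Proof. by move=> cF cG x; apply: (@continuousD _ _ _ F G); [exact: cF|exact: cG]. Qed.

Lemma contM F G : continuous F -> continuous G -> continuous (fun x => F x * G x).
Proof. by move=> cF cG x; apply: (@continuousM _ _ F G); [exact: cF|exact: cG]. Qed.

Lemma contZ c F : continuous F -> continuous (fun x => c * F x).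
Proof. by move=> cF; exact: (@contM (fun=> c) F (@cont_cst c) cF). Qed.

Lemma contB F G : continuous F -> continuous G -> continuous (fun x => F x - G x).
Proof.
move=> cF cG; have := contD cF (@contZ (-1) G cG).
rewrite (_ : (fun x => F x + -1 * G x) = (fun x => F x - G x))//.
by apply/funext => x; rewrite mulN1r.
Qed.

Lemma cont_comp F (f : R -> R) : continuous F -> continuous f -> continuous (fun x => f (F x)).
Proof. by move=> cF cf x; apply: (@continuous_comp _ _ _ F f); [exact: cF|exact: cf]. Qed.

Lemma cont_coord i : continuous (fun x : V => x ord0 i).
Proof. exact: coord_continuous. Qed.

Lemma cont_sum (I : finType) (F : I -> V -> R) :
  (forall a, continuous (F a)) -> continuous (fun x => \sum_a F a x).
Proof.
move=> cF; rewrite unlock; elim: (index_enum I) => [|a s IH]; first exact: cont_cst.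
exact: contD.
Qed.

Lemma cont_nrm (g : V -> V) : (forall i, continuous (fun x => g x ord0 i)) ->
  continuous (fun x => nrm (g x)).
Proof.
move=> cg; apply: (@cont_comp (fun x => sqnorm (g x))); last exact: sqrt_continuous.
by apply: cont_sum => i; apply: (@cont_comp (fun x => g x ord0 i) (fun t => t ^+ 2)); [exact: cg|exact: exprn_continuous].
Qed.

Lemma cont_shift F a : continuous F -> continuous (fun x => F (x + a)).
Proof.
move=> cF x; apply: (@continuous_comp _ _ _ (fun x => x + a) F); last exact: cF.
by apply: nonexp_continuous => y z; rewrite opprD addrACA subrr addr0.
Qed.

End Continuity.

Section C1.
Variables (R : realType) (N : nat).
Local Notation V := 'rV[R]_N.
Implicit Types (F G : V -> R) (f g : V -> V) (x y v w : V) (i j : 'I_N) (M c e h t : R).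

Definition C1 F g := (forall x, gradat F x (g x)) /\
  forall i, continuous (fun x => g x ord0 i).

Lemma gradat_uniq F x v w : gradat F x v -> gradat F x w -> v = w.
Proof.
by move=> h1 h2; apply/rowP => i; rewrite -(gradat_partial i h1) (gradat_partial i h2).
Qed.

Lemma C1_continuous F g : C1 F g -> continuous F.
Proof. by move=> [H _] x; exact: gradat_continuous (H x). Qed.

Lemma C1D F G f g : C1 F f -> C1 G g -> C1 (fun x => F x + G x) (fun x => f x + g x).
Proof.
move=> [F1 F2] [G1 G2]; split=> [x|i]; first exact: gradatD.
rewrite (_ : (fun x => _) = (fun x => f x ord0 i + g x ord0 i)); first exact: contD.
by apply/funext => x; rewrite mxE.
Qed.

Lemma C1M F G f g : C1 F f -> C1 G g ->
  C1 (fun x => F x * G x) (fun x => F x *: g x + G x *: f x).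
Proof.
move=> F1 G1; split=> [x|i]; first by apply: gradatM; [exact: F1.1|exact: G1.1].
rewrite (_ : (fun x => _) = (fun x => F x * g x ord0 i + G x * f x ord0 i)).
  by apply: contD; apply: contM; [exact: C1_continuous F1|exact: G1.2|exact: C1_continuous G1|exact: F1.2].
by apply/funext => x; rewrite !mxE.
Qed.

Lemma C1Z F f c : C1 F f -> C1 (fun x => c * F x) (fun x => c *: f x).
Proof.
move=> F1; split=> [x|i]; first by apply: gradatZ; exact: F1.1.
rewrite (_ : (fun x => _) = (fun x => c * f x ord0 i)); first by apply: contZ; exact: F1.2.
by apply/funext => x; rewrite mxE.
Qed.

Lemma C1_comp F f (a da : R -> R) : (forall t, is_derive t 1 a (da t)) -> continuous da ->
  C1 F f -> C1 (fun x => a (F x)) (fun x => da (F x) *: f x).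
Proof.
move=> Da ca F1; split=> [x|i]; first exact: (gradat_comp (Da _) (F1.1 _)).
rewrite (_ : (fun x => _) = (fun x => da (F x) * f x ord0 i)).
  by apply: contM; [exact: cont_comp (C1_continuous F1) ca|exact: F1.2].
by apply/funext => x; rewrite mxE.
Qed.

Lemma C1_coord j : C1 (fun x => x ord0 j) (fun=> delta_mx ord0 j).
Proof. by split=> [x|i]; [exact: gradat_coord|exact: cont_cst]. Qed.

Lemma C1_shift F f a : C1 F f -> C1 (fun x => F (x + a)) (fun x => f (x + a)).
Proof.
move=> [F1 F2]; split=> [x|i]; first by apply: gradat_shift; exact: F1.
exact: (@cont_shift _ _ (fun x => f x ord0 i)).
Qed.

Lemma C1_sum (I : finType) (F : I -> V -> R) (f : I -> V -> V) :
  (forall a, C1 (F a) (f a)) -> C1 (fun x => \sum_a F a x) (fun x => \sum_a f a x).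
Proof.
move=> H; split=> [x|i]; first by apply: gradat_sum => a; exact: (H a).1.
rewrite (_ : (fun x => _) = (fun x => \sum_a f a x ord0 i)).
  by apply: cont_sum => a; exact: (H a).2.
by apply/funext => x; rewrite summxE.
Qed.

Lemma C1_near_cst F g x c : C1 F g -> (\forall y \near x, F y = c) -> g x = 0.
Proof.
move=> F1 E; apply: gradat_uniq (F1.1 x) _; apply: gradat_near (gradat_cst c x).
by apply: filterS E => y.
Qed.

Lemma C1_supp F g M : C1 F g -> (forall x, M < nrm x -> F x = 0) ->
  forall x, M < nrm x -> g x = 0.
Proof.
move=> F1 FM x xM; apply: (C1_near_cst F1) (filterS FM _).
have cn : continuous (@nrm R N) by exact: (@cont_nrm _ _ id (@cont_coord _ _)).
by have := @cn x [set r | M < r]; apply; exact: open_nbhs_nbhs (conj (@open_gt _ M) xM).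
Qed.

Lemma spacecc_nrm F M : continuous F -> (forall x, M < nrm x -> F x = 0) -> spacecc F.
Proof.
by move=> cF FM; split => //; exists M => x xM; apply: FM; exact: lt_le_trans xM (norm_nrm x).
Qed.

Lemma is_derive_min0 (a da : R -> R) t : (forall s : R, is_derive s 1 a (da s)) ->
  (forall s, a t <= a s) -> da t = 0.
Proof.
move=> Da amin; have [_ <-] := Da t.
have h : t - 1 <= t + 1 by lra.
have dd s : s \in `]t - 1, t + 1[ -> derivable a s 1 by have [] := Da s.
have tI : t \in `]t - 1, t + 1[ by rewrite in_itv/=; lra.
by have [] := derive1_at_min h dd tI (fun s _ => amin s).
Qed.

(** A nonnegative C^1 function is minimal at its zeros; hence disjointness of test functions passes
    to their gradients. *)
Lemma C1_min F g x : C1 F g -> (forall y, F x <= F y) -> g x = 0.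
Proof.
move=> F1 Fx; apply/rowP => i; rewrite mxE.
have D t := @is_derive_line R N F x (delta_mx ord0 i) (fun y => g y ord0 i) t
   (gradat_is_derive i (F1.1 _)).
by have := is_derive_min0 (t := 0) D; rewrite scale0r addr0; apply => s; exact: Fx.
Qed.

End C1.

(** * From disjoint test functions to an odd map of the sphere *)

Section Reduction.
Variables (R : realType) (N : nat).
Local Notation V := 'rV[R]_N.
Implicit Types (F G : V -> R) (f g : V -> V) (x y v w : V) (i j : 'I_N) (M c e h t : R).

Lemma spacecc_cst0 : spacecc (fun _ : V => 0).
Proof. by split; [exact: cont_cst|exists 0]. Qed.

Lemma spaceint0 : spaceint (fun _ : V => 0) = 0.
Proof.
have := spaceint_lin 0 0 spacecc_cst0 spacecc_cst0.
rewrite !mul0r addr0 => H; rewrite -[RHS]H; congr spaceint.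
Qed.

Lemma spaceint_sum (I : finType) (a : I -> R) (F : I -> V -> R) :
  (forall b, spacecc (F b)) -> spacecc (fun x => \sum_b a b * F b x) /\
  spaceint (fun x => \sum_b a b * F b x) = \sum_b a b * spaceint (F b).
Proof.
move=> cF; rewrite unlock; elim: (index_enum I) => [|b s [IH1 IH2]] /=.
  by split; [exact: spacecc_cst0|exact: spaceint0].
have E : (fun x => a b * F b x + reducebig 0 s (fun b => BigBody b +%R true (a b * F b x))) =
  (fun x => a b * F b x + 1 * reducebig 0 s (fun b => BigBody b +%R true (a b * F b x))).
  by apply/funext => x; rewrite mul1r.
split; first by rewrite E; exact: (spacecc_lin (a b) 1 (cF b) IH1).
by rewrite E (spaceint_lin (a b) 1 (cF b) IH1) IH2 mul1r.
Qed.

Lemma C1_Cc1 F g M : M < 1 -> C1 F g -> (forall x, M < nrm x -> F x = 0) -> Cc1 (@unit_ball R N) F.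
Proof.
move=> M1 F1 FM; split; first by move=> x; exact: (F1.1 x).1.
split=> [i|].
  rewrite (_ : partial i F = (fun x => g x ord0 i)); first exact: F1.2.
  by apply/funext => x; exact: gradat_partial (F1.1 x).
have cn : continuous (@nrm R N) by exact: (@cont_nrm _ _ id (@cont_coord _ _)).
exists [set x | nrm x <= M]; split.
- apply: (@subclosed_compact _ _ [set x : V | `|x| <= M]); last 2 first.
  + exact: closed_ball_compact.
  + by move=> x /=; apply: le_trans (norm_nrm x).
  apply: (@closed_comp _ _ (@nrm R N) [set r : R | r <= M]); last exact: closed_le.
  by move=> x _; exact: cn.
- move=> x /= xM; rewrite /unit_ball /= -sqr_nrm.
  by rewrite exprn_ilt1 ?nrm_ge0// (le_lt_trans xM).
- by move=> x /negP; rewrite -ltNge; exact: FM.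
Qed.

Lemma pow_spacecc (p M : R) (u : V -> R) : 1 < p -> continuous u ->
  (forall x, M < nrm x -> u x = 0) -> spacecc (fun x => `|u x| `^ p).
Proof.
move=> p1 cu uM; apply: (@spacecc_nrm _ _ _ M).
  exact: (@cont_comp _ _ u (fun t => `|t| `^ p) cu (powr_norm_continuous p1)).
move=> x /uM ->; rewrite normr0 powR0// gt_eqF//; exact: lt_trans p1.
Qed.

Lemma Lpp_spaceint (p M : R) (u : V -> R) : 1 < p -> continuous u ->
  (forall x, M < nrm x -> u x = 0) -> Lpp p u = (spaceint (fun x => `|u x| `^ p))%:E.
Proof. by move=> p1 cu uM; rewrite -(intRN_EFin (pow_spacecc p1 cu uM)). Qed.

Lemma grad_spacecc (p M : R) (u : V -> R) g : 1 < p -> C1 u g ->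
  (forall x, M < nrm x -> u x = 0) -> spacecc (fun x => nrm (g x) `^ p).
Proof.
move=> p1 u1 uM.
have := @pow_spacecc p M (fun x => nrm (g x)) p1 (cont_nrm u1.2).
rewrite (_ : (fun x => `|nrm (g x)| `^ p) = (fun x => nrm (g x) `^ p)).
  by apply => x xM; rewrite (C1_supp u1 uM xM) nrm0.
by apply/funext => x; rewrite ger0_norm ?nrm_ge0.
Qed.

Lemma energy_spaceint (p M : R) (u : V -> R) g : 1 < p -> C1 u g ->
  (forall x, M < nrm x -> u x = 0) -> energy p u = (spaceint (fun x => nrm (g x) `^ p))%:E.
Proof.
move=> p1 u1 uM; rewrite -(intRN_EFin (grad_spacecc p1 u1 uM)); congr intRN.
by apply/funext => x; rewrite (gradat_gradnorm (u1.1 x)).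
Qed.

Lemma single_sum (I : finType) (b : I) (T : nmodType) (h : I -> T) :
  (forall c : I, c != b -> h c = 0) -> \sum_c h c = h b.
Proof. by move=> H; rewrite (bigD1 b)//= big1 ?addr0. Qed.

Section Family.
Variables (p mu rho : R) (k : nat) (v : 'I_k -> V -> R) (g : 'I_k -> V -> V).
Hypotheses (p1 : 1 < p) (rho1 : rho < 1).
Hypothesis v1 : forall a, C1 (v a) (g a).
Hypothesis v_ge0 : forall a x, 0 <= v a x.
Hypothesis v_supp : forall a x, rho < nrm x -> v a x = 0.
Hypothesis v_disj : forall a b x, a != b -> v a x = 0 \/ v b x = 0.
Hypothesis v_neq0 : forall a, exists x, 0 < v a x.
Hypothesis v_energy : forall a,
  spaceint (fun x => nrm (g a x) `^ p) < mu * spaceint (fun x => `|v a x| `^ p).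

Let p0 : 0 < p. Proof. exact: lt_trans p1. Qed.
Let comb (a : 'I_k -> R) x := \sum_b a b * v b x.
Let gcomb (a : 'I_k -> R) x := \sum_b a b *: g b x.
Let L b := spaceint (fun x => `|v b x| `^ p).
Let E b := spaceint (fun x => nrm (g b x) `^ p).

Let g0 a x : v a x = 0 -> g a x = 0.
Proof. by move=> vx; apply: (C1_min (v1 a)) => y; rewrite vx. Qed.

Let comb1 a : C1 (comb a) (gcomb a).
Proof. by apply: C1_sum => b; exact: C1Z. Qed.

Let comb_supp a x : rho < nrm x -> comb a x = 0.
Proof. by move=> xr; rewrite /comb big1// => b _; rewrite v_supp// mulr0. Qed.

Let L_gt0 b : 0 < L b.
Proof.
have [x vx] := v_neq0 b.
apply: (@spaceint_gt0 _ _ _ x) => [|y|]; last by rewrite powR_gt0// normr_gt0 gt_eqF.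
  exact: (pow_spacecc p1 (C1_continuous (v1 b)) (@v_supp b)).
exact: powR_ge0.
Qed.

Let Lpp_comb a : Lpp p (comb a) = (\sum_b `|a b| `^ p * L b)%:E.
Proof.
rewrite (Lpp_spaceint p1 (C1_continuous (comb1 a)) (@comb_supp a)).
have [_ <-] := spaceint_sum (fun b => `|a b| `^ p)
  (fun b => pow_spacecc p1 (C1_continuous (v1 b)) (@v_supp b)).
congr (spaceint _)%:E; apply/funext => x.
have [/existsP[b vb]|/existsPn H] := boolP [exists b, v b x != 0].
  have H (c : 'I_k) : c != b -> v c x = 0.
    by move=> cb; case: (v_disj x cb) => // E1; rewrite E1 eqxx in vb.
  rewrite /comb (@single_sum _ b) => [|c /H ->]; last by rewrite mulr0.
  rewrite (@single_sum _ b) => [|c /H ->]; first by rewrite normrM powRM.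
  by rewrite normr0 powR0 ?mulr0// gt_eqF.
have {}H b : v b x = 0 by apply/eqP; have := H b; rewrite negbK.
rewrite /comb big1 => [|b _]; last by rewrite H mulr0.
rewrite big1 => [|b _]; first by rewrite normr0 powR0// gt_eqF.
by rewrite H normr0 powR0 ?mulr0// gt_eqF.
Qed.

Let energy_comb a : energy p (comb a) = (\sum_b `|a b| `^ p * E b)%:E.
Proof.
rewrite (energy_spaceint p1 (comb1 a) (@comb_supp a)).
have [_ <-] := spaceint_sum (fun b => `|a b| `^ p)
  (fun b => grad_spacecc p1 (v1 b) (@v_supp b)).
congr (spaceint _)%:E; apply/funext => x.
have [/existsP[b vb]|/existsPn H] := boolP [exists b, v b x != 0].
  have H (c : 'I_k) : c != b -> g c x = 0.
    by move=> cb; apply: g0; case: (v_disj x cb) => // E1; rewrite E1 eqxx in vb.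
  rewrite /gcomb (@single_sum _ b) => [|c /H ->]; last by rewrite scaler0.
  rewrite (@single_sum _ b) => [|c /H ->]; first by rewrite nrmZ powRM ?nrm_ge0.
  by rewrite nrm0 powR0 ?mulr0// gt_eqF.
have {}H b : g b x = 0 by apply: g0; apply/eqP; have := H b; rewrite negbK.
rewrite /gcomb big1 => [|b _]; last by rewrite H scaler0.
rewrite big1 => [|b _]; first by rewrite nrm0 powR0// gt_eqF.
by rewrite H nrm0 powR0 ?mulr0// gt_eqF.
Qed.

(** With this m, [phip m t] is sgn(t) |t|^(2/p): odd, continuous, and with |.|^p equal to t^2, so
    that the Euclidean unit sphere is mapped into the unit sphere of L^p. *)
Let m := 2 / p + 1.
Let m1 : 1 < m. Proof. by rewrite /m ltrDr divr_gt0. Qed.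
Let cf (y : 'rV[R]_k) b := phip m (y ord0 b) * L b `^ (- p^-1).

Let cf_pow (y : 'rV[R]_k) b : `|cf y b| `^ p * L b = (y ord0 b) ^+ 2.
Proof.
rewrite /cf normrM powRM// (ger0_norm (powR_ge0 _ _)) -powRrM mulNr mulVf ?gt_eqF//.
rewrite (powR_inv1 (ltW (L_gt0 b))) -mulrA mulVf ?gt_eqF// mulr1.
rewrite normr_phip// /m addrK -powRrM -mulrA mulVf ?gt_eqF// mulr1.
by rewrite powR_mulrn// real_normK ?num_real.
Qed.

Let cf_cont b : continuous (fun y : 'rV[R]_k => cf y b).
Proof.
apply: contM; last exact: cont_cst.
by apply: (@cont_comp _ _ (fun y : 'rV[R]_k => y ord0 b) (phip m)); [exact: cont_coord|exact: phip_continuous].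
Qed.

Let combB a a' x : comb a x - comb a' x = comb (fun b => a b - a' b) x.
Proof. by rewrite /comb -sumrB; apply: eq_bigr => b _; rewrite mulrBl. Qed.

Let E_ge0 b : 0 <= E b. Proof. by apply: boxint_ge0 => x; exact: powR_ge0. Qed.

Let Lpp0 : Lpp p (comb (fun=> 0)) = 0%:E.
Proof. by rewrite Lpp_comb big1// => b _; rewrite normr0 powR0 ?mul0r// gt_eqF. Qed.

Let energy0 : energy p (comb (fun=> 0)) = 0%:E.
Proof. by rewrite energy_comb big1// => b _; rewrite normr0 powR0 ?mul0r// gt_eqF. Qed.

(** Each y is sent to the constant sequence at the combination with coefficients [cf y]. On disjoint
    supports energies and p-th powers of norms add up, so the energy on the image is at most the
    largest of the k quotients. *)
Lemma lambda_var_lt : (lambda_var (@unit_ball R N) p k < mu%:E)%E.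
Proof.
(* The default mu - 1 keeps the maximum below mu even for an empty family. *)
pose th := \big[Num.max/mu - 1]_b (E b / L b).
have th_mu : th < mu.
  apply/bigmax_ltP; split; first by lra.
  by move=> b _; rewrite ltr_pdivrMr//; exact: v_energy.
have E_th b : E b <= th * L b.
  by rewrite -ler_pdivrMr//; exact: le_bigmax.
apply: (@le_lt_trans _ _ th%:E); last by rewrite lte_fin.
pose h (y : 'rV[R]_k) (n : nat) := comb (cf y).
apply: (@le_trans _ _ (ereal_sup [set W_energy p (h y) | y in @unit_sphere R k])).
  apply: ereal_inf_lbound; exists h => //; split.
  - move=> y _; split=> [n|e e0]; first exact: C1_Cc1 rho1 (comb1 _) (@comb_supp _).
    exists 0%N => a b _ _; rewrite /h.
    have -> : (fun x => comb (cf y) x - comb (cf y) x) = comb (fun=> 0).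
      by apply/funext => x; rewrite combB; congr comb; apply/funext => c; rewrite subrr.
    by rewrite Lpp0 energy0 lte_fin.
  - move=> y yS; rewrite /h (_ : (fun=> Lpp p _) = cst 1%:E); first exact: cvg_cst.
    apply/funext => n; rewrite Lpp_comb; congr _%:E; rewrite -[RHS]yS.
    by apply: eq_bigr => b _; rewrite cf_pow.
  - move=> y _ e e0.
    (* Phi dominates both [Lpp] and [energy] of the difference of the two combinations. *)
    pose Phi (z : 'rV[R]_k) := \sum_b `|cf y b - cf z b| `^ p * (L b + E b).
    have cPhi : continuous Phi.
      apply: cont_sum => b; apply: contM; last exact: cont_cst.
      apply: (@cont_comp _ _ (fun z => cf y b - cf z b) (fun t => `|t| `^ p)).
        by apply: contB; [exact: cont_cst|exact: cf_cont].
      exact: powr_norm_continuous.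
    have Phi0 : Phi y = 0.
      by rewrite /Phi big1// => b _; rewrite subrr normr0 powR0 ?mul0r// gt_eqF.
    have : nbhs y [set z | Phi z < e].
      apply: (cPhi y [set t | t < e]); rewrite Phi0.
      exact: open_nbhs_nbhs (conj (@open_lt _ e) e0).
    (* Squared because [admissible] measures closeness on the sphere by [sqnorm]. *)
    move=> /nbhs_ballP[d /= d0 dP]; exists (d ^+ 2); first by rewrite exprn_gt0.
    move=> z _; rewrite -sqr_nrm ltr_pXn2r ?nnegrE ?nrm_ge0 ?(ltW d0)// => yz.
    have Pz : Phi z < e.
      by apply: dP; rewrite -ball_normE /=; apply: le_lt_trans yz; exact: norm_nrm.
    exists 0%N => n _; rewrite /h.
    have -> : (fun x => comb (cf y) x - comb (cf z) x) = comb (fun b => cf y b - cf z b).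
      by apply/funext => x; rewrite combB.
    rewrite Lpp_comb energy_comb !lte_fin; split; apply: le_lt_trans Pz; apply: ler_sum => b _.
      by rewrite ler_wpM2l ?powR_ge0// lerDl.
    by rewrite ler_wpM2l ?powR_ge0// lerDr ltW.
  - move=> y _ e e0; exists 0%N => n _; rewrite /h.
    have -> : (fun x => comb (cf (- y)) x - (- comb (cf y)) x) = comb (fun=> 0).
      apply/funext => x; rewrite /comb opprK -big_split /=; apply: eq_bigr => b _.
      by rewrite /cf mxE phipN !mulNr addNr mul0r.
    by rewrite Lpp0 energy0 lte_fin.
apply: ge_ereal_sup => _ [y yS <-].
rewrite /W_energy /h lim_cst// energy_comb lee_fin.
apply: (@le_trans _ _ (\sum_b th * (y ord0 b) ^+ 2)).
  apply: ler_sum => b _; rewrite -cf_pow mulrCA ler_wpM2l ?powR_ge0//.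
rewrite -mulr_sumr (_ : \sum_b _ = 1) ?mulr1//; exact: yS.
Qed.

End Family.
End Reduction.

(** * Truncations and the weak radial equation *)

Section Truncation.
Variable R : realType.
Implicit Types (d r s t c : R).

Definition posp t := Num.max t 0.

Lemma posp_ge0 t : 0 <= posp t. Proof. by rewrite le_max lexx orbT. Qed.
Lemma posp_le t : t <= posp t. Proof. by rewrite le_max lexx. Qed.
Lemma posp_id t : 0 <= t -> posp t = t. Proof. by move=> h; exact/max_idPl. Qed.
Lemma posp_eq0 t : t <= 0 -> posp t = 0. Proof. by move=> h; exact/max_idPr. Qed.

Lemma posp_mono s t : s <= t -> posp s <= posp t.
Proof. by move=> st; rewrite ge_max !le_max st lexx orbT. Qed.

Lemma posp_lip s t : s <= t -> posp t - posp s <= t - s.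
Proof.
move=> st; have [t0|t0] := leP t 0.
  by rewrite !posp_eq0 ?subrr ?subr_ge0// (le_trans st).
have [s0|s0] := leP s 0; first by rewrite (posp_eq0 s0) posp_id ?(ltW t0)//; lra.
by rewrite (posp_id (ltW s0)) (posp_id (ltW t0)).
Qed.

Lemma mul_posp t : t * posp t = posp t ^+ 2.
Proof.
have [t0|t0] := leP t 0; first by rewrite posp_eq0// mulr0 expr0n.
by rewrite posp_id ?expr2// ltW.
Qed.

Lemma lip_continuous (f : R -> R) : (forall s t, s <= t -> `|f t - f s| <= t - s) -> continuous f.
Proof.
move=> fl t; apply/cvgrPdist_lt => e e0; near=> s.
apply: le_lt_trans (_ : `|t - s| < e); last by near: s; exact: near_dist.
have [st|ts] := leP t s.
  by rewrite distrC [leRHS]ler0_norm ?subr_le0// opprB; exact: fl.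
by rewrite [leRHS]ger0_norm ?subr_ge0 ?(ltW ts)//; exact: (fl _ _ (ltW ts)).
Unshelve. all: by end_near. Qed.

Lemma posp_continuous : continuous posp.
Proof.
apply: lip_continuous => s t st; rewrite ger0_norm ?posp_lip// subr_ge0.
exact: posp_mono.
Qed.

Lemma is_derive_posp2 t : is_derive t 1 (fun s => posp s ^+ 2) (2 * posp t).
Proof.
have [t0|t0|->] := ltrgtP t 0.
- rewrite posp_eq0 ?(ltW t0)// mulr0.
  apply: (@near_is_derive1 _ (fun=> 0) _ _ _ _ (is_derive1_cst 0 t)).
  by near=> s; rewrite posp_eq0 ?expr0n//; apply: ltW; near: s; exact: lt_nbhsl.
- rewrite posp_id ?(ltW t0)//.
  apply: (@near_is_derive1 _ (fun s => s ^+ 2)).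
    by near=> s; rewrite posp_id//; apply: ltW; near: s; exact: lt_nbhsr.
  by apply: is_derive1_val (is_derive1_X 2 t) _; rewrite expr1.
- rewrite posp_id// mulr0.
  have key : h^-1 *: ((posp (h *: (1 : R) + 0) ^+ 2 : R) - posp 0 ^+ 2) @[h --> (0:R)^'] --> (0 : R).
    apply: (@cvg_trans _ (posp x @[x --> (0:R)^'])).
      apply: near_eq_cvg; near=> h.
      have h0 : h != 0 by near: h; exact: nbhs_dnbhs_neq.
      rewrite addr0 (posp_id (lexx _)) expr0n subr0 [_%:A]mulr1.
      by rewrite -mul_posp /GRing.scale/= mulrA mulVf// mul1r.
    have c0 : posp x @[x --> (0:R)] --> (0 : R) by rewrite -{2}(posp_id (lexx 0)); exact: posp_continuous.
    by apply: (cvg_trans _ c0); apply: cvg_app; exact: cvg_within.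
  apply: DeriveDef; first by apply/cvg_ex; exists 0.
  exact/cvg_lim.
Unshelve. all: by end_near. Qed.

Lemma is_derive_shift_posp2 c t : is_derive t 1 (fun s => posp (s - c) ^+ 2) (2 * posp (t - c)).
Proof.
have D : is_derive t 1 (fun s => s - c) 1.
  by apply: is_derive1_val (is_derive1B (is_derive1_id t) (is_derive1_cst c t)) _; rewrite subr0.
by apply: is_derive1_val (is_derive1_comp' (is_derive_posp2 _) D) _; rewrite mulr1.
Qed.

(** A C^1 positive part at scale d: the slope rises linearly from 0 at d to 1 at 2 d. It vanishes
    for all t <= d, so a truncated continuous profile is 0 in a neighbourhood of each zero of the
    profile. *)
Definition fd d t := (posp (t - d) ^+ 2 - posp (t - 2 * d) ^+ 2) / (2 * d).
Definition dfd d t := (posp (t - d) - posp (t - 2 * d)) / d.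

Variable d : R.
Hypothesis d0 : 0 < d.

Lemma is_derive_fd t : is_derive t 1 (fd d) (dfd d t).
Proof.
have D := is_derive1_Mc (2 * d)^-1 (is_derive1B (is_derive_shift_posp2 d t) (is_derive_shift_posp2 (2 * d) t)).
rewrite (_ : fd d = fun s => (2 * d)^-1 * (posp (s - d) ^+ 2 - posp (s - 2 * d) ^+ 2)).
  by apply: is_derive1_val D _; rewrite /dfd; field; rewrite gt_eqF.
by apply/funext => s; rewrite mulrC.
Qed.

Lemma dfd_continuous : continuous (dfd d).
Proof.
move=> t; have c a : {for t, continuous (fun s => posp (s - a))}.
  apply: (@continuous_comp _ _ _ (fun s => s - a) posp); last exact: posp_continuous.
  by apply: continuousB; [exact: cvg_id|exact: cvg_cst].
apply: (@continuousM _ _ (fun s => posp (s - d) - posp (s - 2 * d)) (fun=> d^-1)); last exact: cvg_cst.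
by apply: continuousB; exact: c.
Qed.

Lemma dfd_ge0 t : 0 <= dfd d t.
Proof. by rewrite divr_ge0 ?(ltW d0)// subr_ge0 posp_mono//; move: d0; lra. Qed.

Lemma dfd_le1 t : dfd d t <= 1.
Proof.
have h : t - 2 * d <= t - d by move: d0; lra.
by rewrite ler_pdivrMr// mul1r (le_trans (posp_lip h))//; move: d0; lra.
Qed.

Lemma dfd_eq0 t : t <= d -> dfd d t = 0.
Proof. by move=> td; rewrite /dfd !posp_eq0 ?subrr ?mul0r//; move: d0; lra. Qed.

Lemma dfd_eq1 t : 2 * d <= t -> dfd d t = 1.
Proof. by move=> td; rewrite /dfd !posp_id; [field; rewrite gt_eqF|move: d0; lra|move: d0; lra]. Qed.

Lemma dfdE t : d <= t <= 2 * d -> dfd d t = (t - d) / d.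
Proof. by move=> td; rewrite /dfd posp_id ?posp_eq0 ?subr0//; move: d0; lra. Qed.

Lemma dfd_mono s t : s <= t -> dfd d s <= dfd d t.
Proof.
move=> st; have [sd|ds] := leP s d; first by rewrite (dfd_eq0 sd) dfd_ge0.
have [td|dt] := leP (2 * d) t; first by rewrite (dfd_eq1 td) dfd_le1.
by rewrite !dfdE ?ler_wpM2r ?invr_ge0 ?(ltW d0) ?lerB//; move: d0; lra.
Qed.

Lemma fd_eq0 t : t <= d -> fd d t = 0.
Proof. by move=> td; rewrite /fd !posp_eq0 ?subrr ?mul0r//; move: d0; lra. Qed.

Lemma fd_big t : 2 * d <= t -> fd d t = t - 3 / 2 * d.
Proof. by move=> td; rewrite /fd !posp_id; [field; rewrite gt_eqF|move: d0; lra|move: d0; lra]. Qed.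

Lemma fd_mono s t : s <= t -> fd d s <= fd d t.
Proof.
move=> st; apply: derive_ge0_le st (fun x _ => is_derive_fd x) (fun x _ => dfd_ge0 x).
Qed.

Lemma fd_lip s t : s <= t -> fd d t - fd d s <= t - s.
Proof.
move=> st; have [c _ ->] := MVT_closed st (fun x _ => is_derive_fd x).
by rewrite -[leRHS]mul1r ler_wpM2r ?dfd_le1// subr_ge0.
Qed.

Lemma fd_ge0 t : 0 <= fd d t.
Proof.
have [/fd_eq0 ->//|/ltW td] := leP t d.
by rewrite -(fd_eq0 (lexx d)) fd_mono.
Qed.

Lemma fd_posp t : posp t - 3 / 2 * d <= fd d t <= posp t.
Proof.
apply/andP; split.
  have [t0|t0] := leP t 0; first by rewrite posp_eq0//; have := fd_ge0 t; move: d0; lra.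
  rewrite posp_id ?(ltW t0)//.
  have [td|/ltW td] := leP (2 * d) t; first by rewrite fd_big.
  have := fd_lip td; rewrite (fd_big (lexx _)); move: d0; lra.
have [/fd_eq0 ->|/ltW td] := leP t d; first exact: posp_ge0.
have := fd_lip td; rewrite (fd_eq0 (lexx _)) posp_id; move: d0; lra.
Qed.

Lemma fd_dist t : `|fd d t - posp t| <= 3 / 2 * d.
Proof. by have /andP[h1 h2] := fd_posp t; rewrite ler_norml; move: d0; lra. Qed.

(** An even C^1 version of |t|, identically 0 on |t| <= d. *)
Definition psi t := fd d t + fd d (- t).
Definition dpsi t := dfd d t - dfd d (- t).

Lemma is_derive_psi t : is_derive t 1 psi (dpsi t).
Proof.
have D := is_derive1D (is_derive_fd t) (is_derive1_comp' (is_derive_fd (- t)) (is_derive1N (is_derive1_id t))).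
by apply: is_derive1_val D _; rewrite mulrN1.
Qed.

Lemma dpsi_continuous : continuous dpsi.
Proof.
move=> t; apply: continuousB; first exact: dfd_continuous.
apply: (@continuous_comp _ _ _ -%R (dfd d)); first exact: opp_continuous.
exact: dfd_continuous.
Qed.

Lemma psiN t : psi (- t) = psi t.
Proof. by rewrite /psi opprK addrC. Qed.

Lemma dpsiN t : dpsi (- t) = - dpsi t.
Proof. by rewrite /dpsi opprK opprB. Qed.

Lemma dpsi_range t : -1 <= dpsi t <= 1.
Proof.
have := dfd_le1 t; have := dfd_le1 (- t); have := dfd_ge0 t; have := dfd_ge0 (- t).
by rewrite /dpsi; move: d0; lra.
Qed.

Lemma dpsi_eq1 t : 2 * d <= t -> dpsi t = 1.
Proof. by move=> td; rewrite /dpsi dfd_eq1// dfd_eq0; move: d0; lra. Qed.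

Lemma psi_eq0 t : `|t| <= d -> psi t = 0.
Proof. by rewrite ler_norml => /andP[h1 h2]; rewrite /psi !fd_eq0 ?addr0//; move: d0; lra. Qed.

Lemma psi_norm t : `|t| - 3 / 2 * d <= psi t <= `|t|.
Proof.
wlog t0 : t / 0 <= t => [H|].
  have [/H//|t0] := leP 0 t; rewrite -psiN -normrN; apply: H; move: d0; lra.
rewrite ger0_norm// /psi (@fd_eq0 (- t)) ?addr0; last by move: d0; lra.
by have := fd_posp t; rewrite posp_id.
Qed.

End Truncation.

Section SmoothStep.
Variable R : realType.
Implicit Types (r s t : R).

Definition step t : R := fd 1 (t + 1) - fd 1 t.
Definition dstep t : R := dfd 1 (t + 1) - dfd 1 t.

Let l1 : (0 : R) < 1. Proof. exact: ltr01. Qed.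

Lemma is_derive_step t : is_derive t 1 step (dstep t).
Proof.
have D1 : is_derive t 1 (fun s : R => s + 1) 1.
  by apply: is_derive1_val (is_derive1D (is_derive1_id t) (is_derive1_cst 1 t)) _; rewrite addr0.
have D := is_derive1B (@is_derive1_comp' R (fd 1) (fun s => s + 1) t _ _ (is_derive_fd l1 (t + 1)) D1)
  (is_derive_fd l1 t).
by apply: is_derive1_val D _; rewrite mulr1.
Qed.

Lemma dstep_continuous : continuous dstep.
Proof.
move=> t; apply: (@continuousB _ _ _ (fun t => dfd 1 (t + 1)) (dfd 1)); last exact: dfd_continuous.
apply: (@continuous_comp _ _ _ (fun s : R => s + 1) (dfd 1)); last exact: dfd_continuous.
by apply: continuousD; [exact: cvg_id|exact: cvg_cst].
Qed.

Lemma dstep_range t : 0 <= dstep t <= 1.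
Proof.
have h : t <= t + 1 by lra.
have := dfd_mono l1 h; have := dfd_le1 l1 (t + 1); have := dfd_ge0 l1 t.
by rewrite /dstep; lra.
Qed.

Lemma step_eq0 t : t <= 0 -> step t = 0.
Proof. by move=> t0; rewrite /step !fd_eq0 ?subrr//; lra. Qed.

Lemma step_eq1 t : 2 <= t -> step t = 1.
Proof. by move=> t0; rewrite /step !fd_big//; lra. Qed.

Lemma dstep_eq0 t : t <= 0 \/ 2 <= t -> dstep t = 0.
Proof.
by case=> h; rewrite /dstep; [rewrite !dfd_eq0 ?subrr//|rewrite !dfd_eq1 ?subrr//]; lra.
Qed.

Lemma step_range t : 0 <= step t <= 1.
Proof.
have mono s r : s <= r -> step s <= step r.
  move=> sr; apply: derive_ge0_le sr (fun x _ => is_derive_step x) _ => x _.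
  by have /andP[] := dstep_range x.
have h0 : 0 <= step t.
  by have [/step_eq0 ->//|/ltW/mono] := leP t 0; rewrite step_eq0.
rewrite h0/=.
by have [/step_eq1 ->//|/ltW/mono] := leP 2 t; rewrite (step_eq1 (lexx _)).
Qed.

End SmoothStep.

Section Cut.
Variables (R : realType) (P : pred R) (F dF : R -> R).
Implicit Types (r s : R).

(** Extension by 0. By [FP], near every point either P holds throughout or F and dF vanish wherever
    P holds; truncated profiles satisfy this by falling below the truncation level at the ends. *)
Definition cut (F : R -> R) r := if P r then F r else 0.

Hypothesis FP : forall r,
  [/\ is_derive r 1 F (dF r), {for r, continuous dF} & \forall s \near r, P s] \/
  \forall s \near r, P s -> F s = 0 /\ dF s = 0.

Lemma cut_near0 r : (\forall s \near r, P s -> F s = 0 /\ dF s = 0) ->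
  \forall s \near r, cut F s = 0 /\ cut dF s = 0.
Proof. by apply: filterS => s H; rewrite /cut; case: ifP => // /H. Qed.

Lemma is_derive_cut r : is_derive r 1 (cut F) (cut dF r).
Proof.
have [[D _ nP]|/cut_near0 H] := FP r.
  rewrite {2}/cut (nbhs_singleton nP).
  by apply: near_is_derive1 D; apply: filterS nP => s; rewrite /cut => ->.
have [_ ->] := nbhs_singleton H.
by apply: near_is_derive1 (is_derive1_cst 0 r); apply: filterS H => s [->].
Qed.

Lemma cut_continuous : continuous (cut dF).
Proof.
move=> r; have [[_ c nP]|/cut_near0 H] := FP r; rewrite /continuous_at.
  rewrite {2}/cut (nbhs_singleton nP).
  by apply: (cvg_trans _ c); apply: near_eq_cvg; apply: filterS nP => s; rewrite /cut => ->.
have [_ ->] := nbhs_singleton H.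
by apply: (cvg_trans _ (@cst_continuous _ _ (0 : R) r)); apply: near_eq_cvg; apply: filterS H => s [_ ->].
Qed.

End Cut.

Section Radial.
Variables (R : realType) (N : nat).
Local Notation V := 'rV[R]_N.
Implicit Types (F G : V -> R) (f g : V -> V) (x y v w : V) (i j : 'I_N) (M c e a : R).

Lemma nrm_continuous : continuous (@nrm R N).
Proof. exact: (@cont_nrm _ _ id (@cont_coord _ _)). Qed.

Lemma dotpxx x : dotp x x = nrm x ^+ 2.
Proof. by rewrite sqr_nrm; apply: eq_bigr => i _; rewrite expr2. Qed.

Lemma dotpC v w : dotp v w = dotp w v.
Proof. by apply: eq_bigr => i _; rewrite mulrC. Qed.

Lemma dotpDr v w x : dotp x (v + w) = dotp x v + dotp x w.
Proof. by rewrite dotpC dotpDl !(dotpC x). Qed.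

Lemma dotpZr c v x : dotp x (c *: v) = c * dotp x v.
Proof. by rewrite dotpC dotpZl dotpC. Qed.

Lemma nrm_eq0 x : nrm x = 0 -> x = 0.
Proof.
move=> h; apply/rowP => i; rewrite mxE; apply/eqP; rewrite -normr_le0 -h.
exact: coord_nrm.
Qed.

Lemma dotp_nrm v w : dotp v w <= nrm v * nrm w.
Proof.
have [v0|v0] := eqVneq (nrm v) 0.
  by rewrite v0 mul0r (nrm_eq0 v0) /dotp big1// => i _; rewrite mxE mul0r.
have [w0|w0] := eqVneq (nrm w) 0.
  by rewrite w0 mulr0 (nrm_eq0 w0) /dotp big1// => i _; rewrite mxE mulr0.
have vw : 0 < nrm v * nrm w by rewrite mulr_gt0// lt_neqAle eq_sym ?v0 ?w0 nrm_ge0.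
have : 0 <= dotp (nrm w *: v - nrm v *: w) (nrm w *: v - nrm v *: w).
  by rewrite dotpxx sqr_ge0.
rewrite -scaleNr dotpDl !dotpDr !dotpZl !dotpZr !dotpxx (dotpC w v) => h.
rewrite -subr_ge0 -(pmulr_rge0 _ vw); nra.
Qed.

Lemma gradat_nrm x : 0 < nrm x -> gradat (@nrm R N) x ((nrm x)^-1 *: x).
Proof.
move=> x0; have q0 : 0 < sqnorm x by rewrite -sqr_nrm exprn_gt0.
have := gradat_comp (is_derive1_sqrt q0) (gradat_sqnorm x).
rewrite scalerA -/(nrm x) (_ : (2 * nrm x)^-1 * 2 = (nrm x)^-1)//.
by field; rewrite gt_eqF.
Qed.

Lemma gradat_radial (h : R -> R) x c : 0 < nrm x -> is_derive (nrm x) 1 h c ->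
  gradat (fun y => h (nrm y)) x ((c / nrm x) *: x).
Proof.
by move=> x0 D; have := gradat_comp D (gradat_nrm x0); rewrite scalerA.
Qed.

Lemma near_nrm_lt x a : nrm x < a -> \forall y \near x, nrm y < a.
Proof.
move=> xa; apply: (@nrm_continuous x [set t | t < a]).
exact: open_nbhs_nbhs (conj (@open_lt _ a) xa).
Qed.

Lemma near_nrm_gt x a : a < nrm x -> \forall y \near x, a < nrm y.
Proof.
move=> xa; apply: (@nrm_continuous x [set t | a < t]).
exact: open_nbhs_nbhs (conj (@open_gt _ a) xa).
Qed.

Lemma nrm_scale_radial c x : (nrm x = 0 -> c = 0) -> nrm ((c / nrm x) *: x) = `|c|.
Proof.
move=> cx; rewrite nrmZ normrM normfV (ger0_norm (nrm_ge0 x)).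
have [x0|x0] := eqVneq (nrm x) 0; last by rewrite mulfVK.
by rewrite x0 mulr0 cx// normr0.
Qed.

Lemma maxr_inv_cont a : 0 < a -> continuous (fun x => (Num.max a (nrm x))^-1).
Proof.
move=> a0.
have c : continuous (fun x : V => a + posp (nrm x - a)).
  apply: contD; first exact: cont_cst.
  have c1 : continuous (fun x : V => nrm x - a) by apply: contB; [exact: nrm_continuous|exact: cont_cst].
  exact: (@cont_comp R N (fun y => nrm y - a) (@posp R) c1 (@posp_continuous R)).
have E : (fun x => Num.max a (nrm x)) = (fun x => a + posp (nrm x - a)).
  apply/funext => y; have [ya|/ltW ay] := leP (nrm y) a.
    by rewrite posp_eq0 ?subr_le0// addr0.
  by rewrite posp_id ?subr_ge0// addrC subrK.
move=> x; apply: (@continuousV _ _ (fun x => Num.max a (nrm x))); last by rewrite E; exact: c.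
by rewrite gt_eqF// lt_max a0.
Qed.

(** Constancy of h on [0, a] removes the singularity of x/|x| at the origin. *)
Lemma C1_radial (h dh : R -> R) a : 0 < a -> (forall r : R, is_derive r 1 h (dh r)) ->
  continuous dh -> (forall r, 0 <= r <= a -> dh r = 0) ->
  C1 (fun x => h (nrm x)) (fun x => (dh (nrm x) / nrm x) *: x).
Proof.
move=> a0 Dh ch h0; split=> [x|i].
  have [xa|ax] := ltP (nrm x) a; last exact: gradat_radial (lt_le_trans a0 ax) (Dh _).
  rewrite h0 ?nrm_ge0 ?(ltW xa)// mul0r scale0r.
  apply: gradat_near (gradat_cst (h a) x); apply: filterS (near_nrm_lt xa) => y ya.
  apply: (derive0_eq (ltW ya)) => s /andP[ys sa].
  by rewrite -(h0 s) ?sa ?(le_trans (nrm_ge0 y)).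
rewrite (_ : (fun x => _) = (fun x => dh (nrm x) * (Num.max a (nrm x))^-1 * x ord0 i)).
  apply: contM; last exact: cont_coord.
  by apply: contM; [exact: (@cont_comp _ _ _ dh nrm_continuous)|exact: maxr_inv_cont].
apply/funext => x; rewrite !mxE; have [xa|/ltW ax] := leP (nrm x) a.
  by rewrite h0 ?nrm_ge0// !mul0r.
by [].
Qed.

End Radial.

(** * The weak form of the radial equation in R^N *)

Section WeakIdentity.
Variables (R : realType) (N : nat) (p mu : R) (u z : R -> R).
Local Notation V := 'rV[R]_N.
Hypothesis N0 : (0 < N)%N.
Hypothesis cu : continuous u.
Hypothesis cz : continuous z.
Hypothesis p1 : 1 < p.
Hypothesis Su : forall r, 0 < r -> rsol N.-1 p mu u z r.
Implicit Types (r a M : R) (x : V) (eta : V -> R) (geta : V -> V).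

(** The integrand is the divergence of eta z(|x|) x/|x|: the derivative of z and the term (N-1) z/r
    combine to - mu phi(u) by [Su], and each partial derivative has integral 0. *)
Lemma weak_identity eta geta a M : 0 < a -> C1 eta geta ->
  (forall x, nrm x <= a -> eta x = 0) -> (forall x, M < nrm x -> eta x = 0) ->
  let F x := z (nrm x) / nrm x * dotp (geta x) x - mu * phip p (u (nrm x)) * eta x in
  spacecc F /\ spaceint F = 0.
Proof.
move=> a0 e1 ea eM F; pose b := a / 2.
have b0 : 0 < b by rewrite /b; lra.
have ba : b < a by rewrite /b; lra.
(* Replacing |x| by max(b, |x|) with b < a removes the singularity at 0 and changes nothing where
   eta is nonzero. *)
pose m x := (Num.max b (nrm x))^-1.
have cm : continuous m by exact: maxr_inv_cont.
have mE x : b <= nrm x -> m x = (nrm x)^-1 by move=> h; rewrite /m (max_idPr h).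
have gea x : nrm x <= b -> geta x = 0.
  move=> xb; apply: (C1_near_cst (c := 0) e1).
  apply: filterS (near_nrm_lt (le_lt_trans xb ba)) => y /ltW; exact: ea.
have geM := C1_supp e1 eM.
pose K x := z (nrm x) * m x.
have cK : continuous K by apply: contM cm; exact: (@cont_comp _ _ _ z (@nrm_continuous _ _)).
pose dK x := (- (N%:R * K x) - mu * phip p (u (nrm x))) * m x.
have cphi : continuous (fun x : V => phip p (u (nrm x))).
  apply: (@cont_comp _ _ (fun x => u (nrm x)) (phip p)); last exact: phip_continuous.
  exact: (@cont_comp _ _ _ u (@nrm_continuous _ _)).
have cdK : continuous dK.
  apply: contM cm; apply: contB; last exact: contZ.
  rewrite (_ : (fun x => _) = (fun x => - N%:R * K x)); first exact: contZ.
  by apply/funext => x; rewrite mulNr.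
pose X i x := eta x * K x * x ord0 i.
pose D i x := geta x ord0 i * K x * x ord0 i + eta x * (dK x * m x * x ord0 i ^+ 2) + eta x * K x.
have ce := C1_continuous e1.
have cX i : spacecc (X i).
  apply: (@spacecc_nrm _ _ _ M) => [|x xM]; last by rewrite /X eM// !mul0r.
  by apply: contM; [exact: contM|exact: cont_coord].
have cD i : spacecc (D i).
  apply: (@spacecc_nrm _ _ _ M) => [|x xM].
    have cc := @cont_coord R N i.
    apply: contD; last exact: contM.
    apply: contD; first by apply: contM cc; apply: contM cK; exact: e1.2.
    apply: (contM ce); apply: contM; first exact: contM.
    by apply: (@cont_comp _ _ _ (fun t => t ^+ 2) cc); exact: exprn_continuous.
  by rewrite /D eM// geM// mxE !mul0r !addr0.
have XD i x : is_derive x (delta_mx ord0 i) (X i) (D i x).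
  have [xb|bx] := ltP (nrm x) a.
    have E0 : D i x = (0 : V) ord0 i.
      rewrite /D ea ?(ltW xb)// mxE !mul0r !addr0.
      rewrite (C1_near_cst (c := 0) e1) ?mxE ?mul0r//.
      by apply: filterS (near_nrm_lt xb) => y /ltW; exact: ea.
    rewrite E0; apply: gradat_is_derive; apply: gradat_near (gradat_cst 0 x).
    by apply: filterS (near_nrm_lt xb) => y /ltW ya; rewrite /X ea// !mul0r.
  have x0 : 0 < nrm x by exact: lt_le_trans bx.
  have xn0 : nrm x != 0 by rewrite gt_eqF.
  have [_ Hz] := Su x0.
  have D1 := is_derive1M Hz (@is_derive1_V R id _ _ xn0 (is_derive1_id (nrm x))).
  have G1 := gradatM (gradatM (e1.1 x) (gradat_radial x0 D1)) (gradat_coord i x).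
  have G2 := gradat_is_derive i (gradat_near (G := X i) _ G1).
  have [|d e] := G2.
    apply: filterS (near_nrm_gt (lt_le_trans ba bx)) => y yb.
    by rewrite /X /K /= mE// ltW.
  apply: DeriveDef => //; rewrite e !mxE !eqxx /D /dK /K mE; last first.
    by rewrite ltW// (lt_le_trans ba).
  have -> : N%:R = N.-1%:R + 1 :> R by rewrite natr1 prednK.
  rewrite /= mulr1.
  by field.
have sumD x : F x = \sum_i 1 * D i x.
  have [xb|bx] := leP (nrm x) b.
    rewrite big1 => [|i _].
      rewrite /F gea// ea ?(le_trans xb (ltW ba))//.
      by rewrite mulr0 subr0 /dotp big1 ?mulr0// => i _; rewrite mxE mul0r.
    by rewrite /D gea// ea ?(le_trans xb (ltW ba))// mxE !mul0r !addr0 mulr0.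
  have xn0 : nrm x != 0 by rewrite gt_eqF// (lt_trans b0).
  under eq_bigr do rewrite mul1r.
  rewrite /D !big_split/= -!mulr_sumr sumr_const card_ord -/(sqnorm x) -sqr_nrm.
  rewrite (_ : \sum_(i < N) _ = K x * dotp (geta x) x); last first.
    by rewrite /dotp mulr_sumr; apply: eq_bigr => i _; ring.
  rewrite /F /dK /K mE ?(ltW bx)// -mulr_natl; by field.
have [H1 H2] := spaceint_sum (fun=> 1) cD.
have -> : F = (fun x => \sum_i 1 * D i x) by apply/funext.
split => //; rewrite H2 big1// => i _; rewrite (spaceint_derive0 (cX i) (cD i) (XD i)) mulr0//.
Qed.

End WeakIdentity.

Section Approximation.
Variables (R : realType) (N : nat) (p : R).
Hypothesis p1 : 1 < p.
Local Notation V := 'rV[R]_N.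
Implicit Types (F G : V -> R) (x : V) (M c e : R).

Let p0 : 0 < p. Proof. exact: lt_trans p1. Qed.

Lemma spaceint_approx F G M c : spacecc F -> spacecc G -> 0 < M ->
  boxsupp M F -> boxsupp M G -> (forall x, `|F x - G x| <= c) ->
  `|spaceint F - spaceint G| <= (2 * M) ^+ N * c.
Proof.
move=> cF cG M0 bF bG FG.
have -> : spaceint F - spaceint G = 1 * spaceint F + (-1) * spaceint G by ring.
rewrite -spaceint_lin//; apply: spaceint_bound => //.
- exact: spacecc_lin.
- by move=> x j xj; rewrite (bF x j)// (bG x j)// !mulr0 addr0.
- by move=> x; rewrite mul1r mulN1r.
Qed.

Lemma spaceintB F G : spacecc F -> spacecc G ->
  spacecc (fun x => F x - G x) /\ spaceint (fun x => F x - G x) = spaceint F - spaceint G.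
Proof.
move=> cF cG.
have E : (fun x => F x - G x) = (fun x => 1 * F x + (-1) * G x).
  by apply/funext => x; rewrite mul1r mulN1r.
by rewrite E; split; [exact: spacecc_lin|rewrite spaceint_lin// mul1r mulN1r].
Qed.

Lemma spaceintZ F c : spacecc F ->
  spacecc (fun x => c * F x) /\ spaceint (fun x => c * F x) = c * spaceint F.
Proof.
move=> cF.
have E : (fun x => c * F x) = (fun x => c * F x + 0 * F x).
  by apply/funext => x; rewrite mul0r addr0.
by rewrite E; split; [exact: spacecc_lin|rewrite spaceint_lin// mul0r addr0].
Qed.

Lemma nrm_boxsupp F M : (forall x, M < nrm x -> F x = 0) -> boxsupp M F.
Proof. by move=> H x j xj; apply: H; exact: lt_le_trans xj (coord_nrm x j). Qed.

Lemma pow_uniform M e : 0 < e -> exists2 d, 0 < d & forall s t : R,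
  `|s| <= M -> `|t| <= M -> `|s - t| < d -> `| `|s| `^ p - `|t| `^ p| < e.
Proof.
move=> e0; have [d d0 dP] := @heine_itv R (fun t => `|t| `^ p) (- M) M
  (fun t _ => @powr_norm_continuous R p p1 t) e e0.
by exists d => // s t sM tM; apply: dP; rewrite -ler_norml.
Qed.

Lemma phip_uniform M e : 0 < e -> exists2 d, 0 < d & forall s t : R,
  `|s| <= M -> `|t| <= M -> `|s - t| < d -> `|phip p s - phip p t| < e.
Proof.
move=> e0; have [d d0 dP] := @heine_itv R (phip p) (- M) M
  (fun t _ => @phip_continuous R p p1 t) e e0.
by exists d => // s t sM tM; apply: dP; rewrite -ler_norml.
Qed.

Lemma spacecc_bounded F : spacecc F -> exists2 C, 0 < C & forall x, `|F x| <= C.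
Proof.
move=> cF; have [d d0 dP] := spacecc_ucont cF (@ltr01 R).
have [M M0 [_ FM]] := spacecc_box cF.
have [C [_ CP]] := compact_bounded (continuous_compact (continuous_subspaceT cF.1) (@closed_ball_compact R N M)).
exists (`|C| + 1); first by rewrite ltr_wpDl.
move=> x; have [xM|/FM ->] := leP `|x| M; last by rewrite normr0 addr_ge0.
by apply: (CP (`|C| + 1)) => /=; [rewrite (le_lt_trans (ler_norm C))// ltrDl|exists x].
Qed.

(* The profile integrand [v phi(u) - v^p] depends uniformly continuously on [v]. *)
Lemma reaction_stable (a W : V -> R) M : continuous a -> 0 < M -> spacecc W ->
  (forall x, M < nrm x -> W x = 0) ->
  spaceint (fun x => W x * a x - `|W x| `^ p) < 0 ->
  exists2 d, 0 < d & forall v : V -> R, continuous v -> (forall x, M < nrm x -> v x = 0) ->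
    (forall x, `|v x - W x| <= d) ->
    spaceint (fun x => v x * a x - `|v x| `^ p) < 0.
Proof.
move=> ca M0 cW WM Wneg.
have cc (v : V -> R) : continuous v -> (forall x, M < nrm x -> v x = 0) ->
    spacecc (fun x => v x * a x - `|v x| `^ p).
  move=> cv vM; apply: (@spacecc_nrm _ _ _ M).
    apply: contB; first exact: contM.
    exact: (@cont_comp _ _ v (fun t => `|t| `^ p) cv (powr_norm_continuous p1)).
  by move=> x xM; rewrite vM// mul0r normr0 powR0 ?subrr// gt_eqF.
have [C C0 CP] := spacecc_bounded cW.
have [A A0 AP] : exists2 A, 0 < A & forall x : V, nrm x <= M -> `|a x| <= A.
  have [A [_ AP]] := compact_bounded (continuous_compact (continuous_subspaceT ca) (@closed_ball_compact R N M)).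
  exists (`|A| + 1); first by rewrite ltr_wpDl.
  move=> x xM; apply: (AP (`|A| + 1)) => /=; first by rewrite (le_lt_trans (ler_norm A))// ltrDl.
  by exists x => //=; exact: le_trans (norm_nrm x) xM.
pose I := - spaceint (fun x => W x * a x - `|W x| `^ p).
have I0 : 0 < I by rewrite oppr_gt0.
pose K := (2 * M) ^+ N.
have K0 : 0 < K by rewrite exprn_gt0// mulr_gt0.
pose e := I / K / 4; have e0 : 0 < e by rewrite !divr_gt0.
have [d1 d10 d1P] := pow_uniform (C + 1) e0.
pose d := Num.min (Num.min 1 (d1 / 2)) (e / A).
have d0 : 0 < d by rewrite !lt_min ltr01 !divr_gt0.
exists d => // v cv vM vW.
have H : `|spaceint (fun x => v x * a x - `|v x| `^ p) - spaceint (fun x => W x * a x - `|W x| `^ p)|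
    <= K * (2 * e).
  apply: spaceint_approx => //; [exact: cc|exact: cc cW.1 WM| | |].
  - by apply: nrm_boxsupp => x xM; rewrite vM// mul0r normr0 powR0 ?subrr// gt_eqF.
  - by apply: nrm_boxsupp => x xM; rewrite WM// mul0r normr0 powR0 ?subrr// gt_eqF.
  move=> x; have [xM|xM] := leP (nrm x) M; last first.
    by rewrite vM// WM// subrr normr0 mulr_ge0// ltW.
  have h1 : `|v x - W x| <= 1 by apply: le_trans (vW x) _; rewrite !ge_min lexx.
  have h2 : `|v x - W x| < d1.
    apply: le_lt_trans (vW x) _; apply: (@le_lt_trans _ _ (d1 / 2)); last by lra.
    by rewrite !ge_min lexx orbT.
  have h3 : `|v x - W x| <= e / A by apply: le_trans (vW x) _; rewrite ge_min lexx orbT.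
  have vC : `|v x| <= C + 1.
    by have := CP x; have := ler_normD (v x - W x) (W x); rewrite subrK; lra.
  have WC : `|W x| <= C + 1 by have := CP x; lra.
  have h4 := d1P _ _ vC WC h2.
  have h5 : `|(v x - W x) * a x| <= e.
    rewrite normrM -[leRHS](divfK (lt0r_neq0 A0)) ler_pM//; exact: AP.
  have -> : v x * a x - `|v x| `^ p - (W x * a x - `|W x| `^ p) =
      (v x - W x) * a x - (`|v x| `^ p - `|W x| `^ p) by ring.
  by apply: le_trans (ler_normB _ _) _; lra.
have E : K * (2 * e) = I / 2 by rewrite /e; field; rewrite gt_eqF.
by move: H; rewrite E ler_norml /I; lra.
Qed.

End Approximation.

Lemma contR_comp (R : realType) (f g : R -> R) : continuous f -> continuous g ->
  continuous (fun r => g (f r)).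
Proof. by move=> cf cg r; apply: (@continuous_comp _ _ _ f g); [exact: cf|exact: cg]. Qed.

Lemma contRD (R : realType) (f g : R -> R) : continuous f -> continuous g ->
  continuous (fun r => f r + g r).
Proof. by move=> cf cg r; apply: (@continuousD _ _ _ f g); [exact: cf|exact: cg]. Qed.

Lemma contRM (R : realType) (f g : R -> R) : continuous f -> continuous g ->
  continuous (fun r => f r * g r).
Proof. by move=> cf cg r; apply: (@continuousM _ _ f g); [exact: cf|exact: cg]. Qed.

(** * Radial test functions built from the profile *)

Section RadialTest.
Variables (R : realType) (N : nat) (p mu : R) (u z : R -> R) (r0 B0 : R).
Local Notation V := 'rV[R]_N.
Local Notation phq := (phip (conjp p)).
Hypothesis N0 : (0 < N)%N.
Hypothesis p1 : 1 < p.
Hypothesis mu0 : 0 < mu.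
Hypothesis Du : forall r : R, is_derive r 1 u (phq (z r)).
Hypothesis cz : continuous z.
Hypothesis Su : forall r, 0 < r -> rsol N.-1 p mu u z r.
Hypothesis r00 : 0 < r0.
Hypothesis B00 : 0 < B0.
Hypothesis zB : forall r, 0 <= r <= r0 -> `|z r| <= r * B0.
Implicit Types (r a M : R) (x : V) (h dh s : R -> R).

Let p0 : 0 < p. Proof. exact: lt_trans p1. Qed.

Let cu : continuous u.
Proof. by move=> r; exact: is_derive_continuous (Du r). Qed.

(** Energy side of truncation, with b in the role of u': a slope that is a fraction s of u' has
    energy density at most s u' times the flux of u. *)
Lemma pow_contract (s b : R) : 0 <= s <= 1 -> `|s * b| `^ p <= s * b * phip p b.
Proof.
move=> /andP[s0 s1]; rewrite -mulrA mul_phip// normrM (ger0_norm s0) powRM//.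
rewrite ler_wpM2r ?powR_ge0//; move: s0; rewrite le_eqVlt => /predU1P[<-|s0].
  by rewrite powR0// gt_eqF.
have -> : s `^ p = s * s `^ (p - 1) by rewrite mulr_powRB1// ltW.
rewrite -[leRHS]mulr1 ler_wpM2l ?(ltW s0)//.
have := @ge0_ler_powR R (p - 1) _ s 1; rewrite powR1; apply; rewrite ?nnegrE ?(ltW s0)//.
by rewrite subr_ge0 ltW.
Qed.

(** Extends [weak_identity] to radial functions that are constant, not zero, near the origin. A
    cutoff rising between k and 3 k has slope of order 1/k, which |z r| <= r B0 compensates, so the
    error is bounded and supported in a ball of volume of order k^N. *)
Lemma weak_radial h dh a M : 0 < a -> (forall r : R, is_derive r 1 h (dh r)) ->
  continuous dh -> (forall r, 0 <= r <= a -> dh r = 0) -> 0 < M -> (forall r, M < r -> h r = 0) ->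
  let F x := z (nrm x) * dh (nrm x) - mu * phip p (u (nrm x)) * h (nrm x) in
  spacecc F /\ spaceint F = 0.
Proof.
move=> a0 Dh ch ha M0 hM F.
have ch0 : continuous h by move=> r; exact: is_derive_continuous (Dh r).
have dhM r : M < r -> dh r = 0.
  move=> rM; have D : is_derive r 1 h 0.
    apply: near_is_derive1 (is_derive1_cst 0 r).
    by near=> t; rewrite hM//; near: t; exact: lt_nbhsr.
  by have [_ <-] := Dh r; have [_ <-] := D.
have cn := @nrm_continuous R N.
have cphi : continuous (fun x : V => phip p (u (nrm x))).
  apply: (@cont_comp _ _ (fun x => u (nrm x)) (phip p)); last exact: phip_continuous.
  exact: (@cont_comp _ _ _ u cn).
have cF : spacecc F.
  apply: (@spacecc_nrm _ _ _ M) => [|x xM]; last by rewrite /F hM// dhM// !mulr0 subr0.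
  apply: contB; first by apply: contM; [exact: (@cont_comp _ _ _ z cn)|exact: (@cont_comp _ _ _ dh cn)].
  apply: contM; last exact: (@cont_comp _ _ _ h cn).
  exact: contZ.
split => //.
have [Ch Ch0 ChP] : exists2 C, 0 < C & forall r, 0 <= r <= M -> `|h r| <= C.
  exact: continuous_bounded_itv.
have [Cu Cu0 CuP] : exists2 C, 0 < C & forall r, 0 <= r <= M -> `|phip p (u r)| <= C.
  exact: (@continuous_bounded_itv R (fun r => phip p (u r)) 0 M (contR_comp cu (phip_continuous p1))).
(* Where |x| <= 3 k the quotient |z| / k is at most 3 B0; the second summand bounds the reaction
   term. *)
pose C := 3 * B0 * Ch + mu * Cu * Ch.
have C0 : 0 < C by rewrite addr_gt0// !mulr_gt0.
apply/eqP; rewrite -normr_le0; apply/ler_addgt0Pl => e e0; rewrite addr0.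
(* The bound 6 k <= 1 serves to replace (6 k)^N by 6 k at the end. *)
pose k := Num.min (Num.min (a / 3) (r0 / 3)) (Num.min (1 / 6) (Num.min (M / 3) (e / (6 * C)))).
have k0 : 0 < k by rewrite !lt_min !divr_gt0// mulr_gt0.
have [ka kr k1 kM ke] : [/\ 3 * k <= a, 3 * k <= r0, 6 * k <= 1, 3 * k <= M & 6 * k * C <= e].
  have h1 : k <= a / 3 by rewrite !ge_min lexx.
  have h2 : k <= r0 / 3 by rewrite !ge_min lexx ?orbT.
  have h3 : k <= 1 / 6 by rewrite !ge_min lexx ?orbT.
  have h4 : k <= M / 3 by rewrite !ge_min lexx ?orbT.
  have h5 : k <= e / (6 * C) by rewrite !ge_min lexx ?orbT.
  move: h5; rewrite ler_pdivlMr ?mulr_gt0// => h5.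
  by split; lra.
pose ch_ r := step (r / k - 1); pose dch r := dstep (r / k - 1) / k.
have Dch r : is_derive r 1 ch_ (dch r).
  have D : is_derive r 1 (fun t => t / k - 1) (k^-1).
    have := is_derive1B (is_derive1_Mc k^-1 (is_derive1_id r)) (is_derive1_cst 1 r).
    rewrite mulr1 subr0 (_ : (fun y => k^-1 * y - 1) = (fun t => t / k - 1))//.
    by apply/funext => t; rewrite mulrC.
  exact: (is_derive1_comp' (is_derive_step _) D).
have cdch : continuous dch.
  move=> r; apply: (@continuousM _ _ (fun r => dstep (r / k - 1)) (fun=> k^-1)); last exact: cvg_cst.
  apply: (@continuous_comp _ _ _ (fun r => r / k - 1) (@dstep R)); last exact: dstep_continuous.
  by apply: (@is_derive_continuous _ _ _ k^-1); have := is_derive1B (is_derive1_Mc k^-1 (is_derive1_id r)) (is_derive1_cst 1 r);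
    rewrite mulr1 subr0 (_ : (fun y => k^-1 * y - 1) = (fun t => t / k - 1))//; apply/funext => t; rewrite mulrC.
have small r : 0 <= r <= k -> ch_ r = 0 /\ dch r = 0.
  move=> /andP[_ rk]; have : r / k - 1 <= 0 by rewrite subr_le0 ler_pdivrMr// mul1r.
  by move=> h1; rewrite /ch_ /dch step_eq0// dstep_eq0 ?mul0r//; left.
have big r : 3 * k <= r -> ch_ r = 1 /\ dch r = 0.
  move=> rk; have : 2 <= r / k - 1 by rewrite lerBrDr ler_pdivlMr//; lra.
  by move=> h1; rewrite /ch_ /dch step_eq1// dstep_eq0 ?mul0r//; right.
pose eta r := h r * ch_ r; pose deta r := dh r * ch_ r + h r * dch r.
have cch : continuous ch_ by move=> r; exact: is_derive_continuous (Dch r).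
have k30 : 0 < 3 * k by rewrite mulr_gt0.
have E1 : C1 (fun x : V => eta (nrm x)) (fun x => (deta (nrm x) / nrm x) *: x).
  apply: (@C1_radial _ _ _ _ k) => //.
  - by move=> r; exact: is_derive1M.
  - by apply: contRD; exact: contRM.
  - by move=> r /small[h1 h2]; rewrite /deta h1 h2 !mulr0 addr0.
have ek (x : V) : nrm x <= k -> eta (nrm x) = 0.
  by move=> xk; have [h1 _] := small (nrm x) (introT andP (conj (nrm_ge0 x) xk)); rewrite /eta h1 mulr0.
have eM (x : V) : M < nrm x -> eta (nrm x) = 0 by move=> xM; rewrite /eta hM ?mul0r.
have [] := weak_identity N0 cu cz p1 Su k0 E1 ek eM.
set G := (fun x => _) => cG IG.
rewrite -[spaceint F]subr0 -IG.
have GE x : G x = z (nrm x) * deta (nrm x) - mu * phip p (u (nrm x)) * eta (nrm x).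
  rewrite /G dotpZl dotpxx; have [->|xn] := eqVneq (nrm x) 0.
    by have [h1 h2] := small 0 (introT andP (conj (lexx _) (ltW k0))); rewrite /deta h1 h2; ring.
  by field.
have bd x : `|F x - G x| <= C /\ (3 * k < nrm x -> F x - G x = 0).
  have [xk|kx] := ltP (3 * k) (nrm x).
    have [h1 h2] := big _ (ltW xk).
    have E : F x - G x = 0 by rewrite GE /F /eta /deta h1 h2; ring.
    by rewrite E normr0; split => //; exact: ltW.
  split => //.
  have xr : 0 <= nrm x <= r0 by rewrite nrm_ge0 (le_trans kx).
  have xM : 0 <= nrm x <= M by rewrite nrm_ge0 (le_trans kx).
  have E : F x - G x = - (z (nrm x) * (h (nrm x) * dch (nrm x))) -
      mu * phip p (u (nrm x)) * (h (nrm x) * (1 - ch_ (nrm x))).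
    rewrite GE /F /eta /deta ha ?nrm_ge0 ?(le_trans kx)//; ring.
  rewrite E; apply: le_trans (ler_normB _ _) _; rewrite normrN /C; apply: lerD.
    have -> : z (nrm x) * (h (nrm x) * dch (nrm x)) = (z (nrm x) / k) * h (nrm x) * dstep (nrm x / k - 1).
      by rewrite /dch; field; rewrite gt_eqF.
    have /andP[s0 s1] := dstep_range (nrm x / k - 1).
    rewrite normrM (ger0_norm s0) -[leRHS]mulr1 ler_pM// normrM ler_pM// ?ChP//.
    rewrite normrM normfV (gtr0_norm k0) ler_pdivrMr//.
    by apply: le_trans (zB xr) _; rewrite mulrAC ler_wpM2r// ltW.
  have /andP[s0 s1] := step_range (nrm x / k - 1).
  rewrite [leLHS]normrM; apply: ler_pM => //.
    by rewrite normrM (gtr0_norm mu0) ler_wpM2l ?(ltW mu0)// CuP.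
  rewrite [leLHS]normrM.
  rewrite -[leRHS]mulr1 ler_pM ?ChP//.
  by rewrite /ch_ ger0_norm; lra.
have [cFG IFG] := spaceintB cF cG; rewrite -IFG.
apply: (@le_trans _ _ ((2 * (3 * k)) ^+ N * C)).
  apply: spaceint_bound => //; last by move=> x; exact: (bd x).1.
  by apply: nrm_boxsupp => x; exact: (bd x).2.
apply: le_trans ke; rewrite mulrA -[2 * 3]/(2 * 3) (_ : 2 * 3 = 6 :> R); last by ring.
rewrite ler_wpM2r ?(ltW C0)// -[leRHS]expr1 ler_wiXn2l// mulr_ge0// ltW//.
Unshelve. all: by end_near. Qed.

(** The equation of u is tested with h itself: the density |s u'|^p is dominated by z h', whose
    integral is mu times that of h phi(u). *)
Lemma radial_energy_le h dh s a M : 0 < a -> (forall r : R, is_derive r 1 h (dh r)) ->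
  continuous dh -> (forall r, 0 <= r <= a -> dh r = 0) -> 0 < M -> (forall r, M < r -> h r = 0) ->
  (forall r, 0 <= r -> 0 <= s r <= 1 /\ dh r = s r * phq (z r)) ->
  C1 (fun x : V => h (nrm x)) (fun x => (dh (nrm x) / nrm x) *: x) /\
  spaceint (fun x : V => nrm ((dh (nrm x) / nrm x) *: x) `^ p) <=
    mu * spaceint (fun x : V => h (nrm x) * phip p (u (nrm x))).
Proof.
move=> a0 Dh ch ha M0 hM hs.
have E1 := @C1_radial R N h dh a a0 Dh ch ha; split => //.
have hMx (x : V) : M < nrm x -> h (nrm x) = 0 by exact: hM.
have [] := weak_radial a0 Dh ch ha M0 hM; set F := (fun x => _) => cF IF.
have cE := grad_spacecc p1 E1 hMx.
set A := (fun x => nrm _ `^ p) in cE *; set H := (fun x => h _ * _).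
have cphi : continuous (fun x : V => phip p (u (nrm x))).
  apply: (@cont_comp _ _ (fun x => u (nrm x)) (phip p)); last exact: phip_continuous.
  exact: (@cont_comp _ _ _ u (@nrm_continuous R N)).
have cH : spacecc H.
  apply: (@spacecc_nrm _ _ _ M) => [|x xM]; last by rewrite /H hM// mul0r.
  by apply: contM; [exact: C1_continuous E1|exact: cphi].
have -> : mu * spaceint H = 1 * spaceint F + mu * spaceint H by rewrite IF; ring.
rewrite -(spaceint_lin 1 mu cF cH); apply: spaceint_le => //; first exact: spacecc_lin.
move=> x; have [sr dE] := hs _ (nrm_ge0 x).
rewrite /A nrm_scale_radial; last by move=> x0; rewrite x0 ha// lexx ltW.
have := pow_contract (phq (z (nrm x))) sr; rewrite -dE phip_conjpK// => Hc.
by apply: le_trans Hc _; rewrite /F /H; lra.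
Qed.

(** Strictness is reduced to a condition without gradients: h has to exceed u in the mean, in the
    sense that the integral of h phi(u) is below that of h^p. *)
Lemma radial_test h dh s a M : 0 < a -> (forall r : R, is_derive r 1 h (dh r)) ->
  continuous dh -> (forall r, 0 <= r <= a -> dh r = 0) -> 0 < M -> (forall r, M < r -> h r = 0) ->
  (forall r, 0 <= r -> 0 <= s r <= 1 /\ dh r = s r * phq (z r)) ->
  spaceint (fun x : V => h (nrm x) * phip p (u (nrm x)) - `|h (nrm x)| `^ p) < 0 ->
  C1 (fun x : V => h (nrm x)) (fun x => (dh (nrm x) / nrm x) *: x) /\
  spaceint (fun x : V => nrm ((dh (nrm x) / nrm x) *: x) `^ p) <
    mu * spaceint (fun x : V => `|h (nrm x)| `^ p).
Proof.
move=> a0 Dh ch ha M0 hM hs.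
have [E1 H1] := radial_energy_le a0 Dh ch ha M0 hM hs.
have hMx (x : V) : M < nrm x -> h (nrm x) = 0 by exact: hM.
have cP := pow_spacecc p1 (C1_continuous E1) hMx.
have cphi : continuous (fun x : V => phip p (u (nrm x))).
  apply: (@cont_comp _ _ (fun x => u (nrm x)) (phip p)); last exact: phip_continuous.
  exact: (@cont_comp _ _ _ u (@nrm_continuous R N)).
have cH : spacecc (fun x : V => h (nrm x) * phip p (u (nrm x))).
  apply: (@spacecc_nrm _ _ _ M) => [|x xM]; last by rewrite hM// mul0r.
  by apply: contM; [exact: C1_continuous E1|exact: cphi].
have [_ ->] := spaceintB cH cP; rewrite subr_lt0 => Ineg; split => //.
by apply: le_lt_trans H1 _; rewrite ltr_pM2l.
Qed.

End RadialTest.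

(** * Test functions on balls and annuli *)

Section Clamp.
Variables (R : realType) (a b : R).
Hypothesis ab : a < b.
Implicit Types r s t : R.

(** Writes a truncated profile by one formula on the whole line: outside (a, b) the profile takes an
    end value, which truncation sends to 0 when that value is at most 0. *)
Definition clamp r := Num.min (Num.max r a) b.

Lemma clamp_id r : a < r < b -> clamp r = r.
Proof. by move=> /andP[r1 r2]; rewrite /clamp (max_idPl (ltW r1)) (min_idPl (ltW r2)). Qed.

Lemma clamp_out r : ~~ (a < r < b) -> clamp r = a \/ clamp r = b.
Proof.
rewrite negb_and -!leNgt /clamp => /orP[ra|br].
  by left; rewrite (max_idPr ra) (min_idPl (ltW ab)).
by right; apply/min_idPr; rewrite le_max br.
Qed.

Lemma clamp_continuous : continuous clamp.
Proof.
apply: lip_continuous => s t st; rewrite ler_norml.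
have h1 : Num.max s a <= Num.max t a by rewrite ge_max !le_max st lexx orbT.
have h2 : Num.max t a - Num.max s a <= t - s.
  by have [ha|ha] := leP s a; have [hb|hb] := leP t a; move: ab st; lra.
move: h1 h2; rewrite /clamp; move: (Num.max t a) (Num.max s a) => x y h1 h2.
by have [hx|hx] := leP x b; have [hy|hy] := leP y b; move: ab st; lra.
Qed.

End Clamp.

Section NodalTests.
Variables (R : realType) (N : nat) (p mu : R) (u z : R -> R) (r0 B0 : R).
Local Notation V := 'rV[R]_N.
Local Notation phq := (phip (conjp p)).
Hypothesis N0 : (0 < N)%N.
Hypothesis p1 : 1 < p.
Hypothesis mu0 : 0 < mu.
Hypothesis Du : forall r : R, is_derive r 1 u (phq (z r)).
Hypothesis cz : continuous z.
Hypothesis Su : forall r, 0 < r -> rsol N.-1 p mu u z r.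
Hypothesis r00 : 0 < r0.
Hypothesis B00 : 0 < B0.
Hypothesis zB : forall r, 0 <= r <= r0 -> `|z r| <= r * B0.
Implicit Types (r s t a c d e M : R) (x : V).

Let p0 : 0 < p. Proof. exact: lt_trans p1. Qed.

Let q1 : 1 < conjp p. Proof. exact: conjp_gt1. Qed.

Let cu : continuous u.
Proof. by move=> r; exact: is_derive_continuous (Du r). Qed.

Let cdu : continuous (fun r => phq (z r)).
Proof. exact: contR_comp cz (phip_continuous q1). Qed.

Ltac keep := clear -N0 p1 mu0 Du cz Su r00 B00 zB p0 q1 cu cdu.

Lemma near_lt (f : R -> R) r c : continuous f -> f r < c ->
  exists2 d, 0 < d & forall s, `|r - s| < d -> f s < c.
Proof.
move=> cf fr; have : nbhs r [set s | f s < c].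
  by apply: (cf r [set t | t < c]); exact: open_nbhs_nbhs (conj (@open_lt _ c) fr).
by move=> /nbhs_ballP[d d0 dP]; exists d => // s rs; exact: dP.
Qed.

Lemma near_gt (f : R -> R) r c : continuous f -> c < f r ->
  exists2 d, 0 < d & forall s, `|r - s| < d -> c < f s.
Proof.
move=> cf fr; have : nbhs r [set s | c < f s].
  by apply: (cf r [set t | c < t]); exact: open_nbhs_nbhs (conj (@open_gt _ c) fr).
by move=> /nbhs_ballP[d d0 dP]; exists d => // s rs; exact: dP.
Qed.

Lemma nrm_ray i r : 0 <= r -> nrm (r *: delta_mx ord0 i : V) = r.
Proof.
move=> hr; rewrite nrmZ (ger0_norm hr) /nrm /sqnorm (bigD1 i)//= big1 => [|j /negbTE ji].
  by rewrite mxE !eqxx expr1n addr0 sqrtr1 mulr1.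
by rewrite mxE ji andbF expr0n.
Qed.

(** The integrand is - W (phi(W) - phi(u)), with phi strictly increasing. *)
Lemma reaction_neg (W : V -> R) M x0 : 0 < M -> continuous W -> (forall x, M < nrm x -> W x = 0) ->
  (forall x, W x = 0 \/ u (nrm x) <= W x) -> (forall x, 0 <= W x) ->
  0 < W x0 -> u (nrm x0) < W x0 ->
  spaceint (fun x => W x * phip p (u (nrm x)) - `|W x| `^ p) < 0.
Proof.
move=> M0 cW WM Wu W0 Wx0 ux0.
have cphi : continuous (fun x : V => phip p (u (nrm x))).
  apply: (@cont_comp _ _ (fun x => u (nrm x)) (phip p)); last exact: phip_continuous.
  exact: (@cont_comp _ _ _ u (@nrm_continuous R N)).
have cH : spacecc (fun x => W x * phip p (u (nrm x)) - `|W x| `^ p).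
  apply: (@spacecc_nrm _ _ _ M) => [|x xM].
    apply: contB; first exact: contM.
    exact: (@cont_comp _ _ W (fun t => `|t| `^ p) cW (powr_norm_continuous p1)).
  by rewrite WM// mul0r normr0 powR0 ?subrr// gt_eqF.
have E x : W x * phip p (u (nrm x)) - `|W x| `^ p = - (W x * (phip p (W x) - phip p (u (nrm x)))).
  by rewrite -mul_phip//; ring.
have [cN IN] := spaceintZ (-1) cH.
rewrite -oppr_gt0 -mulN1r -IN; apply: (@spaceint_gt0 _ _ _ x0) => // [x|].
  rewrite E mulN1r opprK; have [->|uW] := Wu x; first by rewrite mul0r.
  by rewrite mulr_ge0// subr_ge0 phip_mono.
by rewrite E mulN1r opprK mulr_gt0// subr_gt0 phip_smono.
Qed.

(** The profile continues below zl with positive slope. W adds to u a small quadratic term on [A, c]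
    around zl: there W exceeds u for r < c, its slope is a fraction of u', and it is still negative
    at A, so it is a competitor that may start before zl. Truncation at level d' also ends the
    support before zr. *)
Lemma annulus_test (zl zr A0 : R) : 0 < A0 -> A0 < zl -> zl < zr ->
  u zl = 0 -> u zr = 0 -> (forall r, zl < r < zr -> 0 < u r) -> z zl != 0 ->
  exists (v : V -> R) (g : V -> V) (R' : R), [/\ C1 v g, forall x, 0 <= v x,
    A0 < R' < zr, forall x, nrm x <= A0 \/ R' <= nrm x -> v x = 0 &
    (exists x, 0 < v x) /\
    spaceint (fun x => nrm (g x) `^ p) < mu * spaceint (fun x => `|v x| `^ p)].
Proof.
move=> A00 A0l lr ul ur upos zl0.
have zpos : 0 < z zl.
  rewrite lt_neqAle eq_sym zl0/= leNgt; apply/negP => zn.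
  have [d d0 dP] := near_lt cz zn.
  pose t := Num.min (zl + d / 2) ((zl + zr) / 2).
  have tl : zl < t by rewrite lt_min; apply/andP; split; lra.
  have td : t <= zl + d / 2 by rewrite ge_min lexx.
  have tr : t <= (zl + zr) / 2 by rewrite ge_min lexx orbT.
  have : u t <= u zl.
    rewrite -lerN2; apply: (@derive_ge0_le R (fun r => - u r) (fun r => - phq (z r)) _ _ (ltW tl)
      (fun r _ => is_derive1N (Du r))).
    move=> r /andP[r1 r2]; rewrite oppr_ge0 ltW// phip_lt0// dP// ler0_norm ?subr_le0//.
    by lra.
  by rewrite ul leNgt upos// tl/=; lra.
have [d d0 dP] := near_gt cz zpos.
pose k := Num.min (d / 2) (Num.min ((zl - A0) / 2) ((zr - zl) / 2)).
have k0 : 0 < k by rewrite !lt_min; do ![apply/andP; split]; lra.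
have kd : k <= d / 2 by rewrite !ge_min lexx.
have kA : k <= (zl - A0) / 2 by rewrite !ge_min lexx orbT.
have kr : k <= (zr - zl) / 2 by rewrite !ge_min lexx !orbT.
pose A := zl - k; pose c := zl + k.
have zAc r : A <= r <= c -> 0 < z r.
  by rewrite /A /c => rAc; apply: dP; rewrite ltr_norml; lra.
have uA : u A < 0.
  rewrite -ul; apply: (@derive_gt0_lt R u (fun r => phq (z r))).
  - by rewrite /A; lra.
  - by move=> r r1; apply: phip_gt0; apply: zAc; rewrite /A /c in r1 *; lra.
have [m m0 mP] : exists2 m, 0 < m & forall r, A <= r <= c -> m <= phq (z r).
  have Ac : A <= c by rewrite /A /c; lra.
  have [r rI rm] := EVT_min Ac (continuous_subspaceT cdu).
  exists (phq (z r)); first by apply: phip_gt0; apply: zAc; rewrite in_itv in rI.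
  by move=> s sI; apply: rm; rewrite in_itv.
(* The first bound keeps the slope of W between 0 and u' on [A, c], the second keeps W(A)
   negative. *)
pose ep := Num.min (m / (2 * (c - A))) (- u A / (2 * (c - A) ^+ 2)).
have cA0 : 0 < c - A by rewrite /A /c; lra.
have cA2 : 0 < (c - A) ^+ 2 by rewrite exprn_gt0.
have ep0 : 0 < ep by rewrite lt_min !divr_gt0 ?mulr_gt0// oppr_gt0.
have ep1 : ep * (2 * (c - A)) <= m.
  by rewrite -ler_pdivlMr ?mulr_gt0// ge_min lexx.
have ep2 : ep * (2 * (c - A) ^+ 2) <= - u A.
  by rewrite -ler_pdivlMr ?mulr_gt0// ge_min lexx orbT.
pose W r := u r + ep * posp (c - r) ^+ 2.
pose dW r := phq (z r) - ep * (2 * posp (c - r)).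
have D1 r : is_derive r 1 (fun s => c - s) (-1).
  by apply: is_derive1_val (is_derive1B (is_derive1_cst c r) (is_derive1_id r)) _; rewrite sub0r.
have DW r : is_derive r 1 W (dW r).
  have D2 := @is_derive1_comp' R (fun t => posp t ^+ 2) (fun s => c - s) r _ _ (is_derive_posp2 (c - r)) (D1 r).
  apply: is_derive1_val (is_derive1D (Du r) (is_derive1_Mc ep D2)) _.
  by rewrite /dW; ring.
have cp : continuous (fun r => posp (c - r)).
  apply: (@contR_comp R (fun r => c - r)); last exact: posp_continuous.
  by move=> r; exact: is_derive_continuous (D1 r).
have cW : continuous W by move=> r; exact: is_derive_continuous (DW r).
have cdW : continuous dW.
  have := contRD cdu (contRM (fun r => @cst_continuous R R (- (ep * 2)) r) cp).
  rewrite (_ : (fun r => _) = dW)//; apply/funext => r; rewrite /dW /cst; ring.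
have WA : W A < 0 by rewrite /W posp_id ?(ltW cA0)//; lra.
have Wr : W zr = 0 by rewrite /W ur posp_eq0 ?expr0n ?mulr0 ?addr0// /c; lra.
have Wu r : u r <= W r by rewrite lerDl mulr_ge0 ?(ltW ep0)// sqr_ge0.
have Azr : A < zr by rewrite /A; lra.
pose cl := clamp A zr.
have clE r : A < r < zr -> cl r = r by exact: clamp_id.
have cl_out r : ~~ (A < r < zr) -> cl r = A \/ cl r = zr by exact: clamp_out.
have cut0 d' r : 0 < d' -> ~~ (A < r < zr) -> fd d' (W (cl r)) = 0.
  by move=> d'0 /cl_out[] ->; rewrite fd_eq0// ?Wr ltW// (lt_trans WA).
have pcut0 r : ~~ (A < r < zr) -> posp (W (cl r)) = 0.
  by move=> /cl_out[] ->; rewrite posp_eq0// ?Wr// ltW.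
pose Winf (x : V) := posp (W (cl (nrm x))).
have zr0 : 0 < zr by lra.
have ccl : continuous cl by exact: clamp_continuous.
have cWinf : continuous Winf.
  apply: (@cont_comp _ _ (fun x => W (cl (nrm x))) (@posp R)); last exact: posp_continuous.
  by apply: (@cont_comp _ _ _ (fun r => W (cl r)) (@nrm_continuous R N)); exact: contR_comp.
have WinfM (x : V) : zr < nrm x -> Winf x = 0.
  by move=> xz; apply: pcut0; rewrite negb_and -!leNgt (ltW xz) orbT.
pose x0 := (zl + k / 2) *: (delta_mx ord0 (Ordinal N0)) : V.
have nx0 : nrm x0 = zl + k / 2 by rewrite nrm_ray//; lra.
have x0I : A < nrm x0 < zr by rewrite nx0 /A; lra.
have ux0 : 0 < u (nrm x0) by apply: upos; rewrite nx0; lra.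
have Wx0 : u (nrm x0) < W (nrm x0).
  by rewrite ltrDl mulr_gt0// exprn_gt0// posp_id nx0 /c; move: k0; keep; lra.
have Winfx0 : Winf x0 = W (nrm x0) by rewrite /Winf clE// posp_id// ltW// (lt_trans ux0).
have Ineg : spaceint (fun x => Winf x * phip p (u (nrm x)) - `|Winf x| `^ p) < 0.
  apply: (@reaction_neg Winf zr x0) => //.
  - move=> x; have [xI|/pcut0] := boolP (A < nrm x < zr); last by left.
    by right; rewrite /Winf clE// (le_trans (Wu _))// posp_le.
  - by move=> x; exact: posp_ge0.
  - by rewrite Winfx0 (lt_trans ux0).
  - by rewrite Winfx0.
have cphi : continuous (fun x : V => phip p (u (nrm x))).
  apply: (@cont_comp _ _ (fun x => u (nrm x)) (phip p)); last exact: phip_continuous.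
  exact: (@cont_comp _ _ _ u (@nrm_continuous R N)).
have [dl dl0 dlP] := reaction_stable p1 cphi zr0 (spacecc_nrm cWinf WinfM) WinfM Ineg.
(* The first bound preserves the sign of the reaction integral, the second keeps the truncated
   function positive at x0. *)
pose d' := Num.min (2 / 3 * dl) (W (nrm x0) / 3).
have W00 : 0 < W (nrm x0) by rewrite (lt_trans ux0).
have d'0 : 0 < d' by rewrite lt_min mulr_gt0 ?divr_gt0.
have d'1 : 3 / 2 * d' <= dl.
  have : d' <= 2 / 3 * dl by rewrite ge_min lexx.
  by lra.
have d'2 : 3 * d' <= W (nrm x0).
  have : d' <= W (nrm x0) / 3 by rewrite ge_min lexx orbT.
  by lra.
have [eA eA0 eAP] := near_lt cW (lt_trans WA d'0).
have Wr' : W zr < d' by rewrite Wr.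
have [eB eB0 eBP] := near_lt cW Wr'.
pose P r := A < r < zr.
pose F r := fd d' (W r); pose dF r := dfd d' (W r) * dW r.
have DF r : is_derive r 1 F (dF r) by exact: (is_derive1_comp' (is_derive_fd d'0 (W r)) (DW r)).
have cdF : continuous dF.
  by apply: contRM cdW; apply: contR_comp cW _; exact: dfd_continuous.
have Fz r : W r < d' -> F r = 0 /\ dF r = 0.
  by move=> /ltW h; rewrite /F /dF fd_eq0// dfd_eq0// mul0r.
have FP r : [/\ is_derive r 1 F (dF r), {for r, continuous dF} & \forall s \near r, P s] \/
    \forall s \near r, P s -> F s = 0 /\ dF s = 0.
  have [rA|Ar|->] := ltrgtP r A; last first.
  - right; have H : \forall s \near A, `|A - s| < eA by exact: near_dist.
    by apply: filterS H => s /eAP/Fz.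
  - have [rB|Br|->] := ltrgtP r zr; last first.
    + right; have H : \forall s \near zr, `|zr - s| < eB by exact: near_dist.
      by apply: filterS H => s /eBP/Fz.
    + by right; near=> s => /andP[_]; rewrite ltNge ltW//; near: s; exact: lt_nbhsr.
    + left; split; [exact: DF|exact: cdF|].
      by near=> s; apply/andP; split; near: s; [exact: lt_nbhsr|exact: lt_nbhsl].
  - by right; near=> s => /andP[]; rewrite ltNge ltW//; near: s; exact: lt_nbhsl.
pose h := cut P F; pose dh := cut P dF.
have hE r : h r = fd d' (W (cl r)).
  by rewrite /h /cut /P; case: ifPn => [rI|/(cut0 d' _ d'0) ->//]; rewrite clE.
have A1 : 0 < A by move: kA A00 A0l; keep; rewrite /A; lra.
have [E1 E2] : C1 (fun x : V => h (nrm x)) (fun x => (dh (nrm x) / nrm x) *: x) /\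
  spaceint (fun x : V => nrm ((dh (nrm x) / nrm x) *: x) `^ p) <
    mu * spaceint (fun x : V => `|h (nrm x)| `^ p).
  apply: (@radial_test R N p mu u z r0 B0 N0 p1 mu0 Du cz Su r00 B00 zB h dh
    (fun r => if P r then dfd d' (W r) * (dW r / phq (z r)) else 0) A zr A1) => //.
  - by move=> r; exact: is_derive_cut FP r.
  - exact: cut_continuous FP.
  - by move=> r /andP[_ rA]; rewrite /dh /cut /P ltNge rA.
  - by move=> r rz; rewrite /h /cut /P [r < zr]ltNge (ltW rz) andbF.
  - move=> r _; rewrite /dh /cut; case: ifP => [/andP[r1 r2]|_]; last by rewrite lexx ler01 mul0r.
    have s1 := dfd_ge0 d'0 (W r); have s2 := dfd_le1 d'0 (W r).
    have [rc|cr] := leP r c.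
      have zr_ : m <= phq (z r) by apply: mP; rewrite ltW.
      have b0 : 0 < phq (z r) by exact: lt_le_trans zr_.
      have pc : 0 <= c - r <= c - A by move: r1 rc; keep; lra.
      have t0 : 0 <= dW r <= phq (z r).
        move: pc => /andP[pc0 pc1]; rewrite /dW posp_id//.
        have h1 : ep * (2 * (c - r)) <= ep * (2 * (c - A)) by rewrite !ler_wpM2l ?(ltW ep0).
        have h2 : 0 <= ep * (2 * (c - r)) by rewrite !mulr_ge0 ?(ltW ep0).
        by move: h1 h2 zr_ ep1; keep; lra.
      move: t0 => /andP[t0 t1].
      have q0 : 0 <= dW r / phq (z r) by rewrite divr_ge0// ltW.
      have q1' : dW r / phq (z r) <= 1 by rewrite ler_pdivrMr// mul1r.
      split; last by rewrite /dF; field; rewrite gt_eqF.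
      by rewrite mulr_ge0//= -[leRHS]mulr1 ler_pM.
    rewrite /dF /dW posp_eq0 ?mulr0 ?subr0; last by move: cr; keep; lra.
    have [->|zn] := eqVneq (phq (z r)) 0; first by rewrite mul0r !mulr0 lexx ler01.
    by rewrite divff// mulr1 s1 s2.
  - apply: (dlP (fun x => h (nrm x))).
    + by apply: (@cont_comp _ _ _ h (@nrm_continuous R N)) => r; exact: is_derive_continuous (is_derive_cut FP r).
    + by move=> x xz; rewrite /h /cut /P [_ < zr]ltNge (ltW xz) andbF.
    + by move=> x; rewrite hE; apply: le_trans (fd_dist d'0 _) d'1.
pose R' := Num.max ((A0 + zr) / 2) (zr - eB / 2).
exists (fun x => h (nrm x)), (fun x => (dh (nrm x) / nrm x) *: x), R'; split => //.
- by move=> x; rewrite hE fd_ge0.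
- have Azr' : A0 < zr by exact: lt_trans lr.
  rewrite lt_max gt_max !ltr_pdivrMr// ltr_pdivlMr//.
  by move: Azr' eB0; keep => h1 h2; apply/and3P; split; [apply/orP; left| |]; lra.
- move=> x [xA|xR]; rewrite /h /cut; case: ifP => // /andP[x1 x2].
    by move: x1; rewrite ltNge (le_trans xA)// /A; move: kA A0l; keep; lra.
  have [] := Fz (nrm x) => //; apply: eBP; rewrite gtr0_norm ?subr_gt0//.
  by move: xR; rewrite ge_max => /andP[_]; move: eB0; keep; lra.
- split => //; exists x0; rewrite hE clE// fd_big//; move: d'0 d'2; keep; lra.
Unshelve. all: by end_near. Qed.


Hypothesis u0 : u 0 = 1.

(** For the ball there is room outwards: u + ep is still positive slightly beyond z1. Clipping it at
    T, strictly between 1 and 1 + ep, makes it constant near the origin, as [C1_radial] requires,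
    and leaves it above u, which is at most 1. *)
Lemma ball_test (z1 rho : R) : 0 < z1 -> z1 < rho -> u z1 = 0 ->
  (forall r, 0 <= r < z1 -> 0 < u r) -> z z1 != 0 ->
  exists (v : V -> R) (g : V -> V) (B : R), [/\ C1 v g, forall x, 0 <= v x,
    z1 < B < rho, forall x, B <= nrm x -> v x = 0 &
    0 < v 0 /\ spaceint (fun x => nrm (g x) `^ p) < mu * spaceint (fun x => `|v x| `^ p)].
Proof.
move=> z10 z1r uz1 upos zz1.
(* The flux r^(N-1) z is nonincreasing on (0, z1] and tends to 0 at the origin by [zB]; s is a
   radius at which this already contradicts z r > 0. *)
have zle r : 0 < r <= z1 -> z r <= 0.
  move=> /andP[r1 r2]; rewrite leNgt; apply/negP => zr.
  have f0 : 0 < r ^+ N.-1 * z r by rewrite mulr_gt0// exprn_gt0.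
  pose s := Num.min (Num.min (r / 2) 1) (Num.min r0 (r ^+ N.-1 * z r / (2 * B0))).
  have s0 : 0 < s by rewrite !lt_min ltr01 r00 (divr_gt0 r1)// (divr_gt0 f0)// mulr_gt0.
  have s1 : s <= 1 by rewrite !ge_min lexx ?orbT.
  have s2 : s <= r / 2 by rewrite !ge_min lexx ?orbT.
  have s3 : s <= r0 by rewrite !ge_min lexx ?orbT.
  have s4 : s <= r ^+ N.-1 * z r / (2 * B0) by rewrite !ge_min lexx ?orbT.
  have sr : s <= r by move: s2 r1; keep; lra.
  have H : s ^+ N.-1 * - z s <= r ^+ N.-1 * - z r.
    have D t : s <= t <= r -> is_derive t 1 (fun t => t ^+ N.-1 * - z t) (mu * t ^+ N.-1 * phip p (u t)).
      move=> /andP[t1 t2]; have t0 := lt_le_trans s0 t1.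
      have := is_derive1N (is_derive_rflux t0 (Su t0)); rewrite opprK.
      by rewrite (_ : (fun y => - _) = (fun t => t ^+ N.-1 * - z t))//; apply/funext => y; rewrite mulrN.
    apply: (derive_ge0_le sr D) => t /andP[t1 t2]; have t0 := lt_le_trans s0 t1.
    apply: mulr_ge0; first by apply: mulr_ge0; rewrite ?exprn_ge0 ?ltW.
    have [->|tz] := eqVneq t z1; first by rewrite uz1 phip0.
    by rewrite ltW// phip_gt0// upos// (ltW t0) lt_neqAle tz (le_trans t2).
  have zs : `|z s| <= s * B0 by apply: zB; rewrite (ltW s0).
  have h1 : s ^+ N.-1 * `|z s| <= r ^+ N.-1 * z r / 2.
    apply: (@le_trans _ _ (1 * (s * B0))).
      by rewrite ler_pM// ?exprn_ge0 ?exprn_ile1 ?(ltW s0).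
    by move: s4; rewrite mul1r ler_pdivlMr ?mulr_gt0//; keep; lra.
  have h2 : s ^+ N.-1 * z s <= s ^+ N.-1 * `|z s|.
    by rewrite ler_wpM2l ?exprn_ge0 ?(ltW s0)// ler_norm.
  by move: H h1 h2 f0; rewrite !mulrN; keep; lra.
have zneg : z z1 < 0 by rewrite lt_neqAle zz1 zle// z10 lexx.
have ule1 r : 0 <= r <= z1 -> u r <= 1.
  move=> /andP[r1 r2]; rewrite -u0 -lerN2.
  apply: (@derive_ge0_le R (fun r => - u r) (fun r => - phq (z r)) _ _ r1
      (fun r _ => is_derive1N (Du r))) => t /andP[t1 t2].
  rewrite oppr_ge0 -(phip0 (conjp p)) phip_mono//.
  move: t1; rewrite le_eqVlt => /predU1P[<-|t0]; last by apply: zle; rewrite t0 (le_trans t2).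
  have := @zB 0; rewrite lexx ltW// mul0r normr_le0 => /(_ isT)/eqP ->; exact: lexx.
have [d d0 dP] := near_lt cz zneg.
pose B := Num.min (z1 + d / 2) ((z1 + rho) / 2).
have B1 : z1 < B by rewrite lt_min; apply/andP; split; move: d0 z1r; keep; lra.
have B2 : B <= z1 + d / 2 by rewrite ge_min lexx.
have B3 : B < rho.
  apply: (@le_lt_trans _ _ ((z1 + rho) / 2)); first by rewrite ge_min lexx orbT.
  by move: z1r; keep; lra.
have Bp : 0 < B by exact: lt_trans B1.
have udec r s : z1 <= r -> r < s -> s <= B -> u s < u r.
  move=> r1 rs sB; rewrite -ltrN2.
  apply: (@derive_gt0_lt R (fun r => - u r) (fun r => - phq (z r)) _ _ rs
      (fun r _ => is_derive1N (Du r))) => t /andP[t1 t2].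
  rewrite oppr_gt0 phip_lt0// dP// ler0_norm; move: d0 t1 t2 r1 sB B2; keep; lra.
have uB : u B < 0 by rewrite -uz1; exact: udec.
have uleB r : 0 <= r <= B -> u r <= 1.
  move=> /andP[r1 r2]; have [rz|zr] := leP r z1; first by apply: ule1; rewrite r1.
  by apply: le_trans (ltW (udec _ _ (lexx _) zr r2)) _; rewrite uz1 ler01.
(* Half of |u(B)|, so that u + ep is negative at B. *)
pose ep := - u B / 2.
have ep0 : 0 < ep by rewrite divr_gt0// oppr_gt0.
pose T := 1 + ep / 2.
have T1 : 1 < T by rewrite /T ltrDl divr_gt0.
pose W r := u r + ep.
have DW r : is_derive r 1 W (phq (z r)).
  by apply: is_derive1_val (is_derive1D (Du r) (is_derive1_cst ep r)) _; rewrite addr0.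
have DWT r : is_derive r 1 (fun r => W r - T) (phq (z r)).
  by apply: is_derive1_val (is_derive1B (DW r) (is_derive1_cst T r)) _; rewrite subr0.
have cW : continuous W by move=> r; exact: is_derive_continuous (DW r).
have cWT : continuous (fun r => W r - T) by move=> r; exact: is_derive_continuous (DWT r).
have WB : W B < 0 by rewrite /W /ep; move: uB; keep; lra.
pose cl := clamp (-1) B.
have mB : -1 < B by rewrite (lt_trans _ Bp)// oppr_lt0.
have clE r : 0 <= r < B -> cl r = r.
  by move=> /andP[r1 r2]; apply: clamp_id; rewrite r2 andbT (lt_le_trans _ r1)// oppr_lt0.
have cl_out r : B <= r -> cl r = B.
  by move=> Br; apply/min_idPr; rewrite le_max Br.
have ccl : continuous cl by exact: clamp_continuous.
pose tr t := posp t - posp (t - T).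
have ctr : continuous tr.
  have c1 : continuous (fun t : R => t - T).
    move=> t; apply: (@is_derive_continuous _ _ _ 1).
    by apply: is_derive1_val (is_derive1B (is_derive1_id t) (is_derive1_cst T t)) _; rewrite subr0.
  move=> t; apply: (@continuousB _ _ _ (@posp R) (fun t => posp (t - T))); first exact: posp_continuous.
  exact: (contR_comp c1 (@posp_continuous R)).
have tr_mono t : 0 <= tr t.
  by rewrite subr_ge0 posp_mono// gerBl ltW// (lt_trans ltr01).
pose Winf (x : V) := tr (W (cl (nrm x))).
have cWinf : continuous Winf.
  apply: (@cont_comp _ _ (fun x => W (cl (nrm x))) tr); last exact: ctr.
  by apply: (@cont_comp _ _ _ (fun r => W (cl r)) (@nrm_continuous R N)); exact: contR_comp.
have WBT : W B - T < 0 by move: WB T1; keep; lra.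
have trB : tr (W B) = 0 by rewrite /tr !posp_eq0 ?subrr// ltW.
have WinfM (x : V) : B < nrm x -> Winf x = 0.
  by move=> xB; rewrite /Winf cl_out ?trB// ltW.
have cphi : continuous (fun x : V => phip p (u (nrm x))).
  apply: (@cont_comp _ _ (fun x => u (nrm x)) (phip p)); last exact: phip_continuous.
  exact: (@cont_comp _ _ _ u (@nrm_continuous R N)).
have Winf0 : Winf 0 = T.
  rewrite /Winf nrm0 clE ?lexx// /W /tr u0 !posp_id /T; move: ep0; keep; lra.
have Ineg : spaceint (fun x => Winf x * phip p (u (nrm x)) - `|Winf x| `^ p) < 0.
  apply: (@reaction_neg Winf B 0) => //.
  - move=> x; have [Bx|xB] := leP B (nrm x); first by left; rewrite /Winf cl_out ?trB.
    have xI : 0 <= nrm x < B by rewrite nrm_ge0.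
    rewrite /Winf clE//; have [W0|W0] := leP (W (nrm x)) 0.
      by left; rewrite /tr !posp_eq0 ?subrr//; move: W0 T1; keep; lra.
    right; rewrite /tr (posp_id (ltW W0)).
    have [WT|WT] := leP (W (nrm x)) T.
      rewrite (posp_eq0 (t := _ - T)) ?subr_le0// subr0 /W lerDl ltW//.
    rewrite posp_id ?subr_ge0 ?(ltW WT)// subKr.
    by apply: le_trans (ltW T1); apply: uleB; rewrite nrm_ge0 ltW.
  - by move=> x; exact: tr_mono.
  - by rewrite Winf0 (lt_trans ltr01).
  - by rewrite Winf0 nrm0 u0.
have [dl dl0 dlP] := reaction_stable p1 cphi Bp (spacecc_nrm cWinf WinfM) WinfM Ineg.
pose d' := Num.min (dl / 3) (ep / 8).
have d'0 : 0 < d' by rewrite lt_min (divr_gt0 dl0)// (divr_gt0 ep0).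
have d'1 : d' <= dl / 3 by rewrite ge_min lexx.
have d'2 : d' <= ep / 8 by rewrite ge_min lexx orbT.
have [eB eB0 eBP] := near_lt cW (lt_trans WB d'0).
have u1 : 1 - ep / 4 < u 0 by rewrite u0 gtrDl oppr_lt0 divr_gt0.
have [ea ea0 eaP] := near_gt cu u1.
pose a := Num.min (ea / 2) (B / 2).
have a0 : 0 < a by rewrite lt_min !divr_gt0.
have aE : a <= ea / 2 by rewrite ge_min lexx.
have aB : a <= B / 2 by rewrite ge_min lexx orbT.
pose P r := r < B.
pose F r := fd d' (W r) - fd d' (W r - T).
pose dF r := dfd d' (W r) * phq (z r) - dfd d' (W r - T) * phq (z r).
have DF r : is_derive r 1 F (dF r).
  apply: is_derive1B; first exact: (is_derive1_comp' (is_derive_fd d'0 (W r)) (DW r)).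
  exact: (@is_derive1_comp' R (fd d') (fun r => W r - T) r _ _ (is_derive_fd d'0 (W r - T)) (DWT r)).
have cdF : continuous dF.
  have c1 := contRM (contR_comp cW (@dfd_continuous R d')) cdu.
  have c2 := contRM (contR_comp cWT (@dfd_continuous R d')) cdu.
  by move=> r; apply: (@continuousB _ _ _ (fun r => dfd d' (W r) * phq (z r))
    (fun r => dfd d' (W r - T) * phq (z r))); [exact: c1|exact: c2].
have Fz r : W r < d' -> F r = 0 /\ dF r = 0.
  move=> h1; have h2 : W r - T <= d' by move: h1 T1; keep; lra.
  by rewrite /F /dF !fd_eq0 ?(ltW h1)// !dfd_eq0 ?(ltW h1)// !mul0r subrr.
have FP r : [/\ is_derive r 1 F (dF r), {for r, continuous dF} & \forall s \near r, P s] \/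
    \forall s \near r, P s -> F s = 0 /\ dF s = 0.
  have [rB|Br|->] := ltrgtP r B; last first.
  - right; have H : \forall s \near B, `|B - s| < eB by exact: near_dist.
    by apply: filterS H => s /eBP/Fz.
  - right; have H : \forall s \near r, B < s by exact: lt_nbhsr.
    by apply: filterS H => s Bs; rewrite /P ltNge (ltW Bs).
  - by left; split; [exact: DF|exact: cdF|exact: lt_nbhsl].
pose h := cut P F; pose dh := cut P dF.
have hE r : 0 <= r -> h r = fd d' (W (cl r)) - fd d' (W (cl r) - T).
  move=> r1; rewrite /h /cut /P; case: ltP => [rB|Br]; first by rewrite clE// r1.
  by rewrite cl_out//; have [] := Fz B (lt_trans WB d'0).
have [E1 E2] : C1 (fun x : V => h (nrm x)) (fun x => (dh (nrm x) / nrm x) *: x) /\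
  spaceint (fun x : V => nrm ((dh (nrm x) / nrm x) *: x) `^ p) <
    mu * spaceint (fun x : V => `|h (nrm x)| `^ p).
  apply: (@radial_test R N p mu u z r0 B0 N0 p1 mu0 Du cz Su r00 B00 zB h dh
    (fun r => if P r then dfd d' (W r) - dfd d' (W r - T) else 0) a B a0) => //.
  - by move=> r; exact: is_derive_cut FP r.
  - exact: cut_continuous FP.
  - move=> r /andP[r1 r2]; rewrite /dh /cut; case: ifP => // _.
    have h1 : 1 - ep / 4 < u r.
      by apply: eaP; rewrite sub0r normrN ger0_norm//; move: r2 aE ea0; keep; lra.
    by rewrite /dF !dfd_eq1 ?subrr// /W /T; move: h1 d'2 ep0; keep; lra.
  - by move=> r rB; rewrite /h /cut /P ltNge ltW.
  - move=> r r1; rewrite /dh /cut; case: ifP => _; last by rewrite lexx ler01 mul0r.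
    split; last by rewrite /dF; ring.
    have h1 : W r - T <= W r by move: T1; keep; lra.
    have := dfd_mono d'0 h1; have := dfd_le1 d'0 (W r); have := dfd_ge0 d'0 (W r - T).
    by keep; lra.
  - apply: (dlP (fun x => h (nrm x))).
    + by apply: (@cont_comp _ _ _ h (@nrm_continuous R N)) => r; exact: is_derive_continuous (is_derive_cut FP r).
    + by move=> x xB; rewrite /h /cut /P ltNge ltW.
    + move=> x; rewrite hE ?nrm_ge0// /Winf /tr.
      have := fd_dist d'0 (W (cl (nrm x))); have := fd_dist d'0 (W (cl (nrm x)) - T).
      by rewrite !ler_norml; move: d'1; keep; lra.
exists (fun x => h (nrm x)), (fun x => (dh (nrm x) / nrm x) *: x), B; split => //.
- move=> x; rewrite hE ?nrm_ge0// subr_ge0 fd_mono//; move: T1; keep; lra.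
- by rewrite B1.
- by move=> x xB; rewrite /h /cut /P ltNge xB.
- split => //; rewrite nrm0 hE ?lexx// clE ?lexx// /W u0 !fd_big// /T; move: d'2 ep0; keep; lra.
Qed.

End NodalTests.

(** * Convexity and reflections *)

Section Vectors.
Variables (R : realType) (N : nat) (p : R).
Hypothesis p1 : 1 < p.
Local Notation V := 'rV[R]_N.
Implicit Types (F G : V -> R) (f g : V -> V) (x y v w : V) (i j : 'I_N) (M c e t : R).

Let p0 : 0 < p. Proof. exact: lt_trans p1. Qed.

Lemma dotpNr v w : dotp v (- w) = - dotp v w.
Proof. by rewrite -scaleN1r dotpZr mulN1r. Qed.

Lemma dotp_abs v w : `|dotp v w| <= nrm v * nrm w.
Proof.
rewrite ler_norml dotp_nrm andbT lerNl -dotpNr -(nrmN w); exact: dotp_nrm.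
Qed.

Lemma nrm_triangle v w : nrm (v + w) <= nrm v + nrm w.
Proof.
rewrite -(@ger0_norm _ (nrm v + nrm w)) ?addr_ge0 ?nrm_ge0//.
rewrite -(@ger0_norm _ (nrm (v + w))) ?nrm_ge0// -ler_sqr ?nnegrE// !real_normK ?num_real//.
rewrite -dotpxx dotpDl !dotpDr !dotpxx (dotpC w v).
have := dotp_nrm v w; lra.
Qed.

(* The vector [|w|^(p-2) w], with value [0] at [w = 0]. *)
Definition avec w : V := (phip p (nrm w) / nrm w) *: w.

Lemma phip_nrm_ge0 w : 0 <= phip p (nrm w).
Proof. by rewrite -(phip0 p) phip_mono// nrm_ge0. Qed.

Lemma nrm_avec w : nrm (avec w) = phip p (nrm w).
Proof.
rewrite nrm_scale_radial; first by rewrite ger0_norm// phip_nrm_ge0.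
by move=> ->; rewrite phip0.
Qed.

Lemma avec_self w : dotp (avec w) w = nrm w `^ p.
Proof.
rewrite dotpZl dotpxx; have [w0|w0] := eqVneq (nrm w) 0.
  by rewrite w0 powR0 ?gt_eqF// invr0 mulr0 mul0r.
have -> : phip p (nrm w) / nrm w * nrm w ^+ 2 = nrm w * phip p (nrm w) by field.
by rewrite mul_phip// ger0_norm// nrm_ge0.
Qed.

Lemma avec_radial c w : 0 < nrm w -> avec ((c / nrm w) *: w) = (phip p c / nrm w) *: w.
Proof.
move=> w0; rewrite /avec nrm_scale_radial; last by move=> h; rewrite h ltxx in w0.
rewrite scalerA; congr (_ *: _).
have [->|c0] := eqVneq c 0; first by rewrite normr0 phip0 !mul0r.
have -> : phip p `|c| = phip p c * Num.sg c.
  by rewrite /phip sgr_norm normr_id mulrAC -expr2 sqr_sg c0 mul1r.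
rewrite [in `|c|]normrEsg; have sc : Num.sg c * Num.sg c = 1 by rewrite -expr2 sqr_sg c0.
have sn : Num.sg c != 0 by rewrite sgr_eq0.
by field; rewrite gt_eqF// c0 sn.
Qed.

Lemma avec_tangent v w : nrm w `^ p + p * dotp (avec w) (v - w) <= nrm v `^ p.
Proof.
have := phip_tangent (nrm v) (nrm w) p1; rewrite !ger0_norm ?nrm_ge0//.
apply: le_trans; rewrite lerD2l ler_pM2l// dotpDr dotpNr avec_self mulrBr.
rewrite [phip p _ * nrm w]mulrC mul_phip// ger0_norm ?nrm_ge0// lerD2r.
by rewrite -nrm_avec; exact: dotp_nrm.
Qed.

Lemma nrm_convex t v w : 0 <= t <= 1 ->
  nrm (t *: v + (1 - t) *: w) `^ p <= t * nrm v `^ p + (1 - t) * nrm w `^ p.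
Proof.
move=> /andP[t0 t1]; set c := _ + _.
have h1 := avec_tangent v c; have h2 := avec_tangent w c.
have E : dotp (avec c) c = t * dotp (avec c) v + (1 - t) * dotp (avec c) w.
  by rewrite {2}/c dotpDr !dotpZr.
move: h1 h2; rewrite !dotpDr dotpNr; move: E.
set A := dotp _ v; set B := dotp _ w; set C := dotp _ c => E.
have t1' : 0 <= 1 - t by rewrite subr_ge0.
move=> /(ler_wpM2l t0) h1 /(ler_wpM2l t1') h2.
apply: le_trans (lerD h1 h2); rewrite E; lra.
Qed.

(** Polarization replaces the gradients at x and at its mirror image by two convex combinations with
    exchanged weights; convexity shows that the energy does not increase. *)
Lemma nrm_convex2 t v w : 0 <= t <= 1 ->
  nrm (t *: v + (1 - t) *: w) `^ p + nrm (t *: w + (1 - t) *: v) `^ p <=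
  nrm v `^ p + nrm w `^ p.
Proof.
move=> tI; apply: le_trans (lerD (nrm_convex v w tI) (nrm_convex w v tI)) _.
by move: (nrm v `^ p) (nrm w `^ p) => a b; lra.
Qed.

Lemma avec_continuous i : continuous (fun w => avec w ord0 i).
Proof.
move=> w; have cn := @nrm_continuous R N.
have cp : continuous (fun w : V => phip p (nrm w)).
  exact: (@cont_comp _ _ _ (phip p) cn (phip_continuous p1)).
have [w0|w0] := eqVneq (nrm w) 0; last first.
  have h : {for w, continuous (fun w : V => (nrm w)^-1)}.
    by apply: (@continuousV _ _ (@nrm R N)) => //; exact: cn.
  have -> : (fun w => avec w ord0 i) = (fun w => phip p (nrm w) * (nrm w)^-1 * w ord0 i).
    by apply/funext => v; rewrite mxE.
  apply: (@continuousM _ _ (fun w => phip p (nrm w) * (nrm w)^-1) (fun w => w ord0 i)).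
    by apply: (@continuousM _ _ (fun w => phip p (nrm w)) (fun w => (nrm w)^-1)); [exact: cp|exact: h].
  exact: cont_coord.
have aw : avec w ord0 i = 0 by rewrite /avec mxE w0 phip0 !mul0r.
move=> A; rewrite aw => /nbhs_ballP[e /= e0 eA].
have pw : phip p (nrm w) < e by rewrite w0 phip0.
have : nbhs w [set v | phip p (nrm v) < e].
  by apply: (cp w [set t | t < e]); exact: open_nbhs_nbhs (conj (@open_lt _ e) pw).
apply: filterS => v /= ve; apply: eA; rewrite /ball/= sub0r normrN.
by apply: le_lt_trans ve; rewrite -nrm_avec; exact: coord_nrm.
Qed.

Lemma avec_uniform c e : 0 < c -> 0 < e -> exists2 d, 0 < d & forall w h k : V,
  nrm w <= c -> nrm h <= d -> nrm k <= c -> `|dotp (avec (w + h)) k - dotp (avec w) k| <= e.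
Proof.
move=> c0 e0; pose e' := e / (N%:R * c + 1).
have nc : 0 < N%:R * c + 1 by rewrite ltr_wpDl// mulr_ge0// ltW.
have e'0 : 0 < e' by rewrite divr_gt0.
have /choice[d dP] : forall i : 'I_N, exists d : R, 0 < d /\
    forall w h : V, nrm w <= c -> nrm h < d -> `|avec w ord0 i - avec (w + h) ord0 i| < e'.
  move=> i; have [d d0 dP] := heine (@closed_ball_compact R N c) (fun x _ => @avec_continuous i x) e'0.
  exists d; split => // w h wc hd; apply: dP; first exact: le_trans (norm_nrm w) wc.
  by rewrite -ball_normE /= opprD addNKr normrN; exact: le_lt_trans (norm_nrm h) hd.
pose D := \big[Num.min/1]_i d i.
have D0 : 0 < D.
  rewrite /D; apply: (big_ind (fun t => 0 < t)) => // [a b ha hb|i _]; last exact: (dP i).1.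
  by rewrite lt_min ha hb.
exists (D / 2); first by rewrite divr_gt0.
move=> w h k wc hd kc.
have -> : dotp (avec (w + h)) k - dotp (avec w) k =
    \sum_i (avec (w + h) ord0 i - avec w ord0 i) * k ord0 i.
  by rewrite /dotp -sumrB; apply: eq_bigr => i _; rewrite mulrBl.
apply: le_trans (ler_norm_sum _ _ _) _.
apply: (@le_trans _ _ (\sum_(i < N) e' * c)).
  apply: ler_sum => i _; rewrite normrM ler_pM//.
    rewrite distrC ltW//; apply: (dP i).2 => //; apply: (le_lt_trans hd).
    apply: (@lt_le_trans _ _ D); first by lra.
    exact: bigmin_le_cond.
  exact: le_trans (coord_nrm k i) kc.
rewrite sumr_const card_ord -mulr_natl mulrCA /e' mulrAC ler_pdivrMr//.
by rewrite ler_pM2l// lerDl.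
Qed.

Lemma C1_glue (P : pred V) F G f g : C1 F f -> C1 G g ->
  (forall x, [\/ \forall y \near x, P y, \forall y \near x, ~~ P y |
                 \forall y \near x, F y = G y /\ f y = g y]) ->
  C1 (fun x => if P x then F x else G x) (fun x => if P x then f x else g x).
Proof.
move=> F1 G1 H; split=> [x|i x].
  case: (H x) => nP; have Px := nbhs_singleton nP.
  - rewrite Px; apply: gradat_near (F1.1 x); apply: filterS nP => y ->//.
  - rewrite (negbTE Px); apply: gradat_near (G1.1 x); apply: filterS nP => y /negbTE ->//.
  - have [_ fg] := Px; rewrite fg if_same; apply: gradat_near (G1.1 x).
    by apply: filterS nP => y [-> _]; rewrite if_same.
have key (k : V -> V) : {for x, continuous (fun y => k y ord0 i)} ->
    (\forall y \near x, (if P y then f y else g y) = k y) ->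
    {for x, continuous (fun y => (if P y then f y else g y) ord0 i)}.
  move=> ck nk; have E := nbhs_singleton nk; rewrite /prop_for /continuous_at E.
  by move=> A HA; apply: filterS2 nk (ck A HA) => y /= ->.
case: (H x) => nP.
- by apply: (key f); [exact: F1.2|apply: filterS nP => y ->].
- by apply: (key g); [exact: G1.2|apply: filterS nP => y /negbTE ->].
- by apply: (key g); [exact: G1.2|apply: filterS nP => y [_ ->]; rewrite if_same].
Qed.

End Vectors.

Section Reflection.
Variables (R : realType) (N : nat) (i0 : 'I_N) (s : R).
Local Notation V := 'rV[R]_N.
Implicit Types (F : V -> R) (x y v w : V) (c M : R).

Local Notation e := (delta_mx ord0 i0 : V).

Lemma flipcE x j : flipc i0 x ord0 j = if j == i0 then - x ord0 j else x ord0 j.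
Proof. by rewrite mxE. Qed.

Lemma flipcD x y : flipc i0 (x + y) = flipc i0 x + flipc i0 y.
Proof. by apply/rowP => j; rewrite !mxE; case: ifP => //; rewrite opprD. Qed.

Lemma flipcZ c x : flipc i0 (c *: x) = c *: flipc i0 x.
Proof. by apply/rowP => j; rewrite !mxE; case: ifP => //; rewrite mulrN. Qed.

Lemma flipcK x : flipc i0 (flipc i0 x) = x.
Proof. by apply/rowP => j; rewrite !flipcE; case: (j == i0); rewrite ?opprK. Qed.

Lemma flipc_e : flipc i0 e = - e.
Proof.
apply/rowP => j; rewrite !mxE eqxx/=; case: eqVneq => //= _.
by rewrite oppr0.
Qed.

Lemma nrm_flipc x : nrm (flipc i0 x) = nrm x.
Proof.
by congr Num.sqrt; apply: eq_bigr => j _; rewrite flipcE; case: ifP => //; rewrite sqrrN.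
Qed.

(** Reflection in the hyperplane where coordinate [i0] equals s/2; it exchanges |x| and |x - s
    e|. *)
Definition refl x := flipc i0 (x - s *: e).

Lemma refl_sub x : refl x - s *: e = flipc i0 x.
Proof. by rewrite /refl -scaleNr flipcD flipcZ flipc_e -addrA -scalerDr addNr scaler0 addr0. Qed.

Lemma reflK x : refl (refl x) = x.
Proof. by rewrite {1}/refl refl_sub flipcK. Qed.

Lemma nrm_refl x : nrm (refl x) = nrm (x - s *: e).
Proof. exact: nrm_flipc. Qed.

Lemma nrm_refl_sub x : nrm (refl x - s *: e) = nrm x.
Proof. by rewrite refl_sub nrm_flipc. Qed.

Lemma refl_coord x : (refl x) ord0 i0 = s - x ord0 i0.
Proof. by rewrite flipcE !mxE !eqxx/= mulr1 opprB. Qed.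

Lemma sqr_nrm_sub x : nrm (x - s *: e) ^+ 2 = nrm x ^+ 2 - 2 * s * x ord0 i0 + s ^+ 2.
Proof.
rewrite -!dotpxx -scaleNr dotpDl !dotpDr !dotpZl !dotpZr (dotpC e x) !dotp_delta mxE !eqxx.
by rewrite /=; ring.
Qed.

Lemma nrm_sub_le x : 0 <= s -> (nrm (x - s *: e) <= nrm x) = (s ^+ 2 <= 2 * s * x ord0 i0).
Proof.
move=> s0; rewrite -ler_sqr ?nnegrE ?nrm_ge0// sqr_nrm_sub.
by apply/idP/idP; lra.
Qed.

Lemma spacecc_refl F : spacecc F -> spacecc (fun x => F (refl x)) /\
  spaceint (fun x => F (refl x)) = spaceint F.
Proof.
move=> cF; have [M HM] := cF.2.
have fl x : `|flipc i0 x| = `|x|.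
  apply/eqP; rewrite eq_le; apply/andP; split; apply: rV_norm_le => // j.
    by rewrite flipcE; case: ifP => _; rewrite ?normrN rV_coord_le.
  rewrite -[x]flipcK [flipc i0 (flipc _ _) _ _]flipcE; case: ifP => _; rewrite ?normrN flipcK rV_coord_le//.
have cG : spacecc (fun x => F (flipc i0 x)).
  split; last by exists M => x xM; apply: HM; rewrite fl.
  move=> x; apply: (@continuous_comp _ _ _ (flipc i0) F); last exact: cF.1.
  apply: nonexp_continuous => y z.
  by rewrite -scaleN1r -flipcZ -flipcD fl scaleN1r.
have E : (fun x => F (refl x)) = (fun x => (fun y => F (flipc i0 y)) (shiftc i0 (- s) x)).
  by apply/funext => x; rewrite /shiftc scaleNr.
rewrite E; split; last by apply: etrans (spaceint_shift i0 (- s) cG) _; exact: spaceint_flip.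
split; first exact: (@cont_shift _ _ (fun y => F (flipc i0 y)) (- s *: e) cG.1).
have [L HL] := cG.2; exists (L + `|s *: e|) => x xL; apply: HL.
have := ler_normB (x + - s *: e) (- s *: e).
by rewrite addrK scaleNr normrN /shiftc scaleNr; lra.
Qed.

End Reflection.

(** * Polarization *)

Lemma spaceintD (R : realType) (N : nat) (F G : 'rV[R]_N -> R) : spacecc F -> spacecc G ->
  spacecc (fun x => F x + G x) /\ spaceint (fun x => F x + G x) = spaceint F + spaceint G.
Proof.
move=> cF cG; have E : (fun x => F x + G x) = (fun x => 1 * F x + 1 * G x).
  by apply/funext => x; rewrite !mul1r.
by rewrite E; split; [exact: spacecc_lin|rewrite spaceint_lin// !mul1r].
Qed.

Lemma double_le (R : realType) (x y : R) : x + x <= y + y -> x <= y.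
Proof. lra. Qed.

(** Polarized quantities compare only after summing over a point and its mirror image; as reflection
    preserves integrals, this is enough. *)
Lemma refl_sum_le (R : realType) (N : nat) (i0 : 'I_N) (s : R) (F G : 'rV[R]_N -> R) :
  spacecc F -> spacecc G -> (forall x, F x + F (refl i0 s x) <= G x + G (refl i0 s x)) ->
  spaceint F <= spaceint G.
Proof.
move=> cF cG FG; have [cFr IFr] := spacecc_refl i0 s cF; have [cGr IGr] := spacecc_refl i0 s cG.
have [cFF EF] := spaceintD cF cFr; have [cGG EG] := spaceintD cG cGr.
by have := spaceint_le cFF cGG FG; rewrite EF EG IFr IGr; exact: double_le.
Qed.

Section Polarize.
Variables (R : realType) (N : nat) (i0 : 'I_N) (p s d M : R) (h dh : R -> R).
Local Notation V := 'rV[R]_N.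
Local Notation e := (delta_mx ord0 i0 : V).
Hypothesis p1 : 1 < p.
Hypothesis s0 : 0 < s.
Hypothesis d0 : 0 < d.
Hypothesis h_ge0 : forall r, 0 <= h r.
Hypothesis hM : forall r, M < r -> h r = 0.
Implicit Types (x y : V).

Definition pga x : V := (dh (nrm x) / nrm x) *: x.
Definition pgb x : V := (dh (nrm (x - s *: e)) / nrm (x - s *: e)) *: (x - s *: e).
Definition pdiff x := (h (nrm x) - h (nrm (x - s *: e))) / 2.
Definition pmean x := (h (nrm x) + h (nrm (x - s *: e))) / 2.
Definition left_of x := x ord0 i0 < s / 2.

(* Smoothed polarization: the maximum of the bump and of its reflection on the
   left of [x_1 = s/2], their minimum on the right, with [|D|] replaced by [psi D]. *)
Definition polar x := if left_of x then pmean x + psi d (pdiff x) else pmean x - psi d (pdiff x).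
Definition ptheta x := if left_of x then (1 + dpsi d (pdiff x)) / 2 else (1 - dpsi d (pdiff x)) / 2.
Definition pgrad x := ptheta x *: pga x + (1 - ptheta x) *: pgb x.

Hypothesis Ea : C1 (fun x => h (nrm x)) pga.

Let Eb : C1 (fun x => h (nrm (x - s *: e))) pgb.
Proof. exact: (C1_shift (- (s *: e)) Ea). Qed.

Lemma pdiff_C1 : C1 pdiff (fun x => 2^-1 *: (pga x + (-1) *: pgb x)).
Proof.
rewrite (_ : pdiff = fun x => 2^-1 * (h (nrm x) + (-1) * h (nrm (x - s *: e)))).
  by apply: C1Z; apply: C1D => //; exact: C1Z.
by apply/funext => x; rewrite /pdiff mulrC mulN1r.
Qed.

Lemma pmean_C1 : C1 pmean (fun x => 2^-1 *: (pga x + pgb x)).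
Proof.
rewrite (_ : pmean = fun x => 2^-1 * (h (nrm x) + h (nrm (x - s *: e)))).
  by apply: C1Z; exact: C1D.
by apply/funext => x; rewrite /pmean mulrC.
Qed.

Let ppsi_C1 : C1 (fun x => psi d (pdiff x)) (fun x => dpsi d (pdiff x) *: (2^-1 *: (pga x + (-1) *: pgb x))).
Proof. exact: (C1_comp (is_derive_psi d0) (@dpsi_continuous R d) pdiff_C1). Qed.

Lemma pdiff_mid x : x ord0 i0 = s / 2 -> pdiff x = 0.
Proof.
move=> xs; suff E : nrm (x - s *: e) = nrm x by rewrite /pdiff E subrr mul0r.
apply/eqP; rewrite -(@eqrXn2 _ 2) ?nrm_ge0// sqr_nrm_sub xs; first by apply/eqP; field.
Qed.

(** On the hyperplane [pdiff] vanishes, and [psi] is 0 on |t| <= d, so the two branches coincide in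
    a neighbourhood of it. *)
Lemma polar_C1 : C1 polar pgrad.
Proof.
have Ep := C1D pmean_C1 ppsi_C1; have Em := C1D pmean_C1 (C1Z (-1) ppsi_C1).
have cx : continuous (fun x : V => x ord0 i0) by exact: cont_coord.
have cD := C1_continuous pdiff_C1.
have H x : [\/ \forall y \near x, left_of y, \forall y \near x, ~~ left_of y |
    \forall y \near x, pmean y + psi d (pdiff y) = pmean y + (-1) * psi d (pdiff y) /\
      2^-1 *: (pga y + pgb y) + dpsi d (pdiff y) *: (2^-1 *: (pga y + (-1) *: pgb y)) =
      2^-1 *: (pga y + pgb y) + (-1) *: (dpsi d (pdiff y) *: (2^-1 *: (pga y + (-1) *: pgb y)))].
  have [xl|xr|xm] := ltrgtP (x ord0 i0) (s / 2).
  - by constructor 1; apply: (cx x [set t | t < s / 2]); exact: open_nbhs_nbhs (conj (@open_lt _ _) xl).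
  - constructor 2.
    have : nbhs x [set y : V | s / 2 < y ord0 i0].
      by apply: (cx x [set t | s / 2 < t]); exact: open_nbhs_nbhs (conj (@open_gt _ _) xr).
    by apply: filterS => y /= yr; rewrite /left_of -leNgt ltW.
  constructor 3.
  have : nbhs x [set y : V | `|pdiff y| < d].
    have cN : continuous (fun y => `|pdiff y|).
      exact: (@cont_comp _ _ pdiff (fun t => `|t|) cD (@norm_continuous _ _)).
    apply: (cN x [set t | t < d]); rewrite pdiff_mid// normr0.
    exact: open_nbhs_nbhs (conj (@open_lt _ _) d0).
  apply: filterS => y /= yd.
  have yd' : - d < pdiff y < d by rewrite -ltr_norml.
  have -> : dpsi d (pdiff y) = 0.
    by rewrite /dpsi !dfd_eq0 ?subrr//; lra.
  by rewrite (psi_eq0 d0 (ltW yd)) !mulr0 !scale0r scaler0.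
have := C1_glue Ep Em H.
rewrite (_ : (fun x => if _ then _ else _) = polar); last first.
  by apply/funext => x; rewrite /polar mulN1r.
rewrite (_ : (fun x => if _ then _ else _) = pgrad)//.
apply/funext => x; rewrite /pgrad /ptheta; move: (pga x) (pgb x) => A B.
by case: ifP => _; apply/rowP => j; rewrite !mxE; field.
Qed.

Lemma ptheta_range x : 0 <= ptheta x <= 1.
Proof.
have := dpsi_range d0 (pdiff x); rewrite /ptheta; case: ifP => _; lra.
Qed.

Local Notation rf := (refl i0 s).

Lemma pdiff_refl x : pdiff (rf x) = - pdiff x.
Proof. by rewrite /pdiff nrm_refl nrm_refl_sub -mulNr opprB. Qed.

(** Reflection exchanges the sides and changes the sign of [pdiff], while [dpsi] is odd. Equal
    weights at both points, with the two gradients exchanged, are what [nrm_convex2] asks for. *)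
Lemma ptheta_refl x : ptheta (rf x) = ptheta x.
Proof.
rewrite /ptheta /left_of refl_coord pdiff_refl dpsiN opprK.
have [xl|xr|xm] := ltrgtP (x ord0 i0) (s / 2).
- by have -> : s - x ord0 i0 < s / 2 = false by apply/negbTE; rewrite -leNgt; lra.
- by have -> : s - x ord0 i0 < s / 2 by lra.
- have -> : s - x ord0 i0 < s / 2 = false by apply/negbTE; rewrite -leNgt xm; lra.
  by rewrite pdiff_mid// /dpsi oppr0 subrr oppr0.
Qed.

Lemma pga_refl x : pga (rf x) = flipc i0 (pgb x).
Proof. by rewrite /pga /pgb nrm_refl flipcZ. Qed.

Lemma pgb_refl x : pgb (rf x) = flipc i0 (pga x).
Proof. by rewrite /pgb /pga nrm_refl_sub refl_sub flipcZ. Qed.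

Lemma nrm_far x : M + s < nrm x -> M < nrm (x - s *: e).
Proof.
have := nrm_triangle (x - s *: e) (s *: e); rewrite subrK nrm_ray ?(ltW s0)//; lra.
Qed.

Lemma polar_supp x : M + s < nrm x -> polar x = 0.
Proof.
move=> xM; have h1 := hM (nrm_far xM); have h2 : h (nrm x) = 0 by apply: hM; move: s0 xM; lra.
rewrite /polar /pmean /pdiff h1 h2 subrr addr0 mul0r (psi_eq0 d0) ?normr0 ?(ltW d0)//.
by rewrite addr0 subr0 if_same.
Qed.

Lemma polar_energy : spaceint (fun x => nrm (pgrad x) `^ p) <= spaceint (fun x => nrm (pga x) `^ p).
Proof.
have hMx x : M < nrm x -> h (nrm x) = 0 by exact: hM.
have cF := grad_spacecc p1 polar_C1 polar_supp.
have cA := grad_spacecc p1 Ea hMx.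
have H := @refl_sum_le R N i0 s _ _ cF cA.
apply: H.
move=> x; rewrite /pgrad ptheta_refl pga_refl pgb_refl -!flipcZ -flipcD !nrm_flipc.
exact: nrm_convex2 (ptheta_range x).
Qed.

Lemma polar_approx x : `|polar x - (if left_of x then Num.max (h (nrm x)) (h (nrm (x - s *: e)))
   else Num.min (h (nrm x)) (h (nrm (x - s *: e))))| <= 3 / 2 * d.
Proof.
have := psi_norm d0 (pdiff x); rewrite /polar /pmean /pdiff.
move: (h (nrm x)) (h (nrm (x - s *: e))) => a b.
have n1 : a <= b -> `|(a - b) / 2| = (b - a) / 2 by move=> ?; rewrite ler0_norm; lra.
have n2 : b < a -> `|(a - b) / 2| = (a - b) / 2 by move=> ?; rewrite ger0_norm; lra.
case: ifP => _; rewrite ler_norml; have [ab|ba] := leP a b; rewrite ?(n1 ab) ?(n2 ba); move: d0; lra.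
Qed.

Lemma polar_ge0 x : 0 <= polar x.
Proof.
have := psi_norm d0 (pdiff x); have := h_ge0 (nrm x); have := h_ge0 (nrm (x - s *: e)).
rewrite /polar /pmean /pdiff; move: (h (nrm x)) (h (nrm (x - s *: e))) => a b b0 a0.
have n1 : a <= b -> `|(a - b) / 2| = (b - a) / 2 by move=> ?; rewrite ler0_norm; lra.
have n2 : b < a -> `|(a - b) / 2| = (a - b) / 2 by move=> ?; rewrite ger0_norm; lra.
have h1 := addr_ge0 (fd_ge0 d0 ((a - b) / 2)) (fd_ge0 d0 (- ((a - b) / 2))).
rewrite -/(psi d _) in h1.
case: ifP => _; have [ab|ba] := leP a b; rewrite ?(n1 ab) ?(n2 ba); move: d0; lra.
Qed.

End Polarize.

Lemma refl_sum_approx (R : realType) (N : nat) (i0 : 'I_N) (s L c : R) (F G : 'rV[R]_N -> R) :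
  spacecc F -> spacecc G -> 0 < L ->
  (forall x, L < nrm x -> [/\ F x = 0, F (refl i0 s x) = 0, G x = 0 & G (refl i0 s x) = 0]) ->
  (forall x, `|F x + F (refl i0 s x) - (G x + G (refl i0 s x))| <= c) ->
  `|spaceint F - spaceint G| <= (2 * L) ^+ N * (c / 2).
Proof.
move=> cF cG L0 H FG; have [cFr IFr] := spacecc_refl i0 s cF; have [cGr IGr] := spacecc_refl i0 s cG.
have [cFF EF] := spaceintD cF cFr; have [cGG EG] := spaceintD cG cGr.
have := spaceint_approx cFF cGG L0 _ _ FG; rewrite EF EG IFr IGr => K.
have {K} : `|spaceint F + spaceint F - (spaceint G + spaceint G)| <= (2 * L) ^+ N * c.
  by apply: K; apply: nrm_boxsupp => x /H[h1 h2 h3 h4]; rewrite ?h1 ?h2 ?h3 ?h4 addr0.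
move: (spaceint F) (spaceint G) (_ ^+ N) => a b k.
rewrite !ler_norml; have -> : k * (c / 2) = k * c / 2 by ring.
by move: (k * c) => t; lra.
Qed.

(** * A bump on a cap of the annulus *)

Section Bump.
Variables (R : realType) (N : nat) (i0 : 'I_N) (t0 ra rb : R).
Local Notation V := 'rV[R]_N.
Local Notation e := (delta_mx ord0 i0 : V).
Hypothesis ra0 : 0 < ra.
Hypothesis rab : ra < rb.

(** The function (-t0 - x_1)_+^2 is cut off radially between ra and rb. For |x| <= ra its gradient
    is a nonpositive multiple of e; this sign decides which of the two reflected copies has the
    larger flux against it. *)
Lemma bump_exists : exists (eta : V -> R) (g : V -> V), [/\ C1 eta g, forall x, 0 <= eta x,
  forall x : V, - t0 <= x ord0 i0 \/ rb <= nrm x -> eta x = 0 /\ g x = 0,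
  forall (x : V) t, t0 <= t -> x ord0 i0 <= - t -> nrm x <= ra -> (t - t0) ^+ 2 <= eta x &
  forall x : V, nrm x <= ra -> g x = (- 2 * posp (- t0 - x ord0 i0)) *: e].
Proof.
(* The transition of [step] has length 2; this factor fits it between ra and rb. *)
pose k := 2 / (rb - ra); have k0 : 0 < k by rewrite divr_gt0// subr_gt0.
pose kap r : R := 1 - step (k * (r - ra)); pose dkap r : R := - (dstep (k * (r - ra)) * k).
have Dl (r : R) : is_derive r 1 (fun t => k * (t - ra)) k.
  have := is_derive1_Mc k (is_derive1B (is_derive1_id r) (is_derive1_cst ra r)).
  by rewrite subr0 mulr1.
have Dk (r : R) : is_derive r 1 kap (dkap r).
  have D := @is_derive1_comp' R (@step R) (fun t => k * (t - ra)) r _ _ (is_derive_step _) (Dl r).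
  by apply: is_derive1_val (is_derive1B (is_derive1_cst 1 r) D) _; rewrite sub0r.
have ck : continuous dkap.
  have cl : continuous (fun t => k * (t - ra)) by move=> r; exact: is_derive_continuous (Dl r).
  have := contRM (contR_comp cl (@dstep_continuous R)) (fun r => @cst_continuous R R (- k) r).
  rewrite (_ : (fun r => _) = dkap)//; apply/funext => r.
  by rewrite /dkap /cst mulrN.
have ksmall (r : R) : r <= ra -> kap r = 1 /\ dkap r = 0.
  move=> rra; have h : k * (r - ra) <= 0 by rewrite pmulr_rle0// subr_le0.
  by rewrite /kap /dkap step_eq0// dstep_eq0; [rewrite subr0 mul0r oppr0|left].
have kbig (r : R) : rb <= r -> kap r = 0 /\ dkap r = 0.
  move=> rbr; have h : 2 <= k * (r - ra).
    by rewrite /k mulrAC ler_pdivlMr ?subr_gt0// ler_pM2l// lerB.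
  by rewrite /kap /dkap step_eq1// dstep_eq0; [rewrite subrr mul0r oppr0|right].
have E1 : C1 (fun x : V => kap (nrm x)) (fun x => (dkap (nrm x) / nrm x) *: x).
  by apply: (@C1_radial R N kap dkap ra) => // r /andP[_ /ksmall[]].
pose P t : R := posp (- t0 - t) ^+ 2; pose dP t : R := - (2 * posp (- t0 - t)).
have Dm (t : R) : is_derive t 1 (fun t => - t0 - t) (-1).
  by apply: is_derive1_val (is_derive1B (is_derive1_cst (- t0) t) (is_derive1_id t)) _; rewrite sub0r.
have DP (t : R) : is_derive t 1 P (dP t).
  have D := @is_derive1_comp' R (fun t => posp t ^+ 2) (fun t => - t0 - t) t _ _ (is_derive_posp2 _) (Dm t).
  by apply: is_derive1_val D _; rewrite /dP mulrN1.
have cP : continuous dP.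
  have cl : continuous (fun t => - t0 - t) by move=> r; exact: is_derive_continuous (Dm r).
  have := contRM (fun r => @cst_continuous R R (- 2) r) (contR_comp cl (@posp_continuous R)).
  by rewrite (_ : (fun r => _) = dP)//; apply/funext => r; rewrite /dP /cst mulNr.
have E2 : C1 (fun x : V => P (x ord0 i0)) (fun x => dP (x ord0 i0) *: e).
  exact: (C1_comp DP cP (@C1_coord R N i0)).
have E := C1M E2 E1.
exists (fun x : V => P (x ord0 i0) * kap (nrm x)),
  (fun x : V => P (x ord0 i0) *: ((dkap (nrm x) / nrm x) *: x) + kap (nrm x) *: (dP (x ord0 i0) *: e)).
split => //.
- move=> x; rewrite mulr_ge0 ?sqr_ge0// /kap; have := step_range (k * (nrm x - ra)); lra.
- move=> x [xt|/kbig[-> ->]]; last by rewrite mulr0 mul0r !scale0r scaler0 addr0.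
  by rewrite /P /dP posp_eq0 ?expr0n/= ?mul0r ?mulr0 ?oppr0 ?scale0r ?scaler0 ?addr0//; lra.
- move=> x t tt xt /ksmall[-> _]; rewrite mulr1 /P lerXn2r ?nnegrE ?posp_ge0 ?subr_ge0//.
  by apply: le_trans (posp_le _); lra.
- by move=> x /ksmall[-> ->]; rewrite mul0r scale0r scaler0 add0r scale1r /dP mulNr.
Qed.

End Bump.

(** * The profile on a nodal annulus *)

Section AnnularProfile.
Variables (R : realType) (N : nat) (p mu : R) (u z : R -> R) (r0 B0 zl zr : R).
Local Notation V := 'rV[R]_N.
Local Notation phq := (phip (conjp p)).
Hypothesis N0 : (0 < N)%N.
Hypothesis p1 : 1 < p.
Hypothesis mu0 : 0 < mu.
Hypothesis Du : forall r : R, is_derive r 1 u (phq (z r)).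
Hypothesis cz : continuous z.
Hypothesis Su : forall r, 0 < r -> rsol N.-1 p mu u z r.
Hypothesis r00 : 0 < r0.
Hypothesis B00 : 0 < B0.
Hypothesis zB : forall r, 0 <= r <= r0 -> `|z r| <= r * B0.
Hypothesis zl0 : 0 < zl.
Hypothesis zlr : zl < zr.
Hypothesis ul : u zl = 0.
Hypothesis ur : u zr = 0.
Hypothesis upos : forall r, zl < r < zr -> 0 < u r.
Implicit Types (r s t d : R) (x : V).

Let cu : continuous u.
Proof. by move=> r; exact: is_derive_continuous (Du r). Qed.

Let q1 : 1 < conjp p. Proof. exact: conjp_gt1. Qed.

Let cdu : continuous (fun r => phq (z r)).
Proof. exact: contR_comp cz (phip_continuous q1). Qed.

Lemma flux_decr r s : zl <= r -> r < s -> s <= zr ->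
  s ^+ N.-1 * z s < r ^+ N.-1 * z r.
Proof.
move=> zr_ rs sz; pose f t := - (t ^+ N.-1 * z t).
pose df t := - (- (mu * t ^+ N.-1 * phip p (u t))).
have D t : zl <= t -> is_derive t 1 f (df t).
  by move=> zt; have t0 := lt_le_trans zl0 zt; exact: is_derive1N (is_derive_rflux t0 (Su t0)).
have df_ge0 t : zl <= t <= zr -> 0 <= df t.
  move=> /andP[t1 t2]; rewrite /df opprK mulr_ge0//.
    by rewrite mulr_ge0 ?(ltW mu0)// exprn_ge0// (le_trans (ltW zl0)).
  move: t1; rewrite le_eqVlt => /predU1P[<-|t1]; first by rewrite ul phip0.
  move: t2; rewrite le_eqVlt => /predU1P[->|t2]; first by rewrite ur phip0.
  by rewrite ltW// phip_gt0// upos// t1.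
(* As u may vanish at zl and zr, strict decrease is taken from an interior subinterval. *)
pose a := (2 * r + s) / 3; pose b := (r + 2 * s) / 3.
have [ra ab bs] : [/\ r < a, a < b & b < s] by rewrite /a /b; split; lra.
have fle (x y : R) : zl <= x -> x <= y -> y <= zr -> f x <= f y.
  move=> zx xy yz; apply: (derive_ge0_le (df := df) xy) => t /andP[t1 t2].
  - by apply: D; exact: le_trans t1.
  - by apply: df_ge0; rewrite (le_trans zx)// (le_trans t2).
have flt : f a < f b.
  apply: (derive_gt0_lt (df := df) ab) => t /andP[t1 t2].
    by apply: D; apply: le_trans t1; exact: le_trans (ltW ra).
  have t3 : zl < t by apply: lt_le_trans t1; exact: le_lt_trans ra.
  have t4 : t < zr by apply: le_lt_trans t2 _; exact: lt_le_trans sz.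
  rewrite /df opprK mulr_gt0//; last by rewrite phip_gt0// upos// t3.
  by rewrite mulr_gt0// exprn_gt0// (lt_trans zl0).
have h1 := fle r a zr_ (ltW ra) (le_trans (ltW ab) (le_trans (ltW bs) sz)).
have h2 := fle b s (le_trans zr_ (ltW (lt_trans ra ab))) (ltW bs) sz.
by rewrite -ltrN2 -/(f r) -/(f s); exact: le_lt_trans h1 (lt_le_trans flt h2).
Qed.

Lemma u_incr r s : zl <= r -> r < s -> (forall t, r <= t < s -> 0 < z t) -> u r < u s.
Proof.
move=> zr_ rs zp; pose b := (r + s) / 2.
have [rb bs] : r < b /\ b < s by rewrite /b; split; lra.
have h1 : u r < u b.
  apply: (@derive_gt0_lt R u (fun r => phq (z r)) r b rb (fun t _ => Du t)) => t /andP[t1 t2].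
  by apply: phip_gt0; apply: zp; rewrite t1 (le_lt_trans t2).
apply: lt_le_trans h1 _.
apply: (@derive_ge0_le R u (fun r => phq (z r)) b s (ltW bs) (fun t _ => Du t)) => t /andP[t1 t2].
move: t2; rewrite le_eqVlt => /predU1P[->|t2].
  rewrite -(phip0 (conjp p)) phip_mono// leNgt; apply/negP => zs.
  have [d d0 dP] := near_lt cz zs.
  pose t' := Num.max r (s - d / 2).
  have ts : t' < s by rewrite gt_max rs/=; lra.
  have : 0 < z t' by apply: zp; rewrite le_max lexx.
  rewrite ltNge ltW// dP// ger0_norm ?subr_ge0 ?(ltW ts)//.
  have : s - d / 2 <= t' by rewrite le_max lexx orbT.
  lra.
by apply: ltW; apply: phip_gt0; apply: zp; rewrite (le_trans (ltW rb)).
Qed.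

Lemma u_decr r s : zl <= r -> r < s -> (forall t, r < t <= s -> z t < 0) -> u s < u r.
Proof.
move=> zr_ rs zn; pose b := (r + s) / 2.
have [rb bs] : r < b /\ b < s by rewrite /b; split; lra.
rewrite -ltrN2.
have D t : is_derive t 1 (fun r => - u r) (- phq (z t)) by exact: is_derive1N.
apply: le_lt_trans (_ : - u b < _).
  apply: (@derive_ge0_le R (fun r => - u r) (fun r => - phq (z r)) r b (ltW rb) (fun t _ => D t)) => t /andP[t1 t2].
  move: t1; rewrite le_eqVlt => /predU1P[<-|t1]; last first.
    by rewrite oppr_ge0 ltW// phip_lt0// zn// t1 (le_trans t2)// ltW.
  rewrite oppr_ge0 -(phip0 (conjp p)) phip_mono// leNgt; apply/negP => zr0.
  have [d d0 dP] := near_gt cz zr0.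
  pose t' := Num.min s (r + d / 2).
  have ts : r < t' by rewrite lt_min rs/=; lra.
  have : z t' < 0 by apply: zn; rewrite ts ge_min lexx.
  rewrite ltNge ltW// dP// ler0_norm ?subr_le0 ?(ltW ts)//.
  have : t' <= r + d / 2 by rewrite ge_min lexx orbT.
  lra.
apply: (@derive_gt0_lt R (fun r => - u r) (fun r => - phq (z r)) b s bs (fun t _ => D t)) => t /andP[t1 t2].
by rewrite oppr_gt0 phip_lt0// zn// t2 (lt_le_trans rb).
Qed.

(** Since r^(N-1) z decreases strictly, z changes sign exactly once, at rm. The radius tau is the
    midpoint of zl and rm, and sig comes from the intermediate value theorem on the other side. *)
Lemma levels : exists rm tau sig, [/\ zl < tau < rm, rm < sig < zr, u tau = u sig,
  forall r, zl <= r < rm -> 0 < z r & forall r, rm < r <= zr -> z r < 0].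
Proof.
have fpos r : zl <= r -> (0 < r ^+ N.-1 * z r) = (0 < z r).
  by move=> h; rewrite pmulr_rgt0// exprn_gt0// (lt_le_trans zl0).
have fneg r : zl <= r -> (r ^+ N.-1 * z r < 0) = (z r < 0).
  by move=> h; rewrite pmulr_rlt0// exprn_gt0// (lt_le_trans zl0).
have zl_pos : 0 < z zl.
  rewrite ltNge; apply/negP => zn.
  have zn' t : zl < t <= zr -> z t < 0.
    move=> /andP[t1 t2]; rewrite -fneg ?(ltW t1)//.
    apply: lt_le_trans (flux_decr (lexx _) t1 t2) _.
    by rewrite pmulr_rle0// exprn_gt0.
  by have := u_decr (lexx _) zlr zn'; rewrite ul ur ltxx.
have zr_neg : z zr < 0.
  rewrite ltNge; apply/negP => zp.
  have zp' t : zl <= t < zr -> 0 < z t.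
    move=> /andP[t1 t2]; rewrite -fpos//.
    apply: le_lt_trans (flux_decr t1 t2 (lexx _)).
    by rewrite mulr_ge0// exprn_ge0// (le_trans (ltW zl0) (ltW zlr)).
  by have := u_incr (lexx _) zlr zp'; rewrite ul ur ltxx.
have [rm rmI zrm] : exists2 r, r \in `[zl, zr] & z r = 0.
  apply: (IVT (ltW zlr) (continuous_subspaceT cz)).
  by rewrite ge_min le_max (ltW zr_neg) (ltW zl_pos) orbT.
move: rmI; rewrite in_itv /= => /andP[rm1 rm2].
have lrm : zl < rm by rewrite lt_neqAle rm1 andbT; apply/eqP => E; rewrite E zrm ltxx in zl_pos.
have rmr : rm < zr by rewrite lt_neqAle rm2 andbT; apply/eqP => E; rewrite -E zrm ltxx in zr_neg.
have zpos r : zl <= r < rm -> 0 < z r.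
  by move=> /andP[h1 h2]; rewrite -fpos//; have := flux_decr h1 h2 rm2; rewrite zrm mulr0.
have zneg r : rm < r <= zr -> z r < 0.
  move=> /andP[h1 h2]; rewrite -fneg ?(le_trans rm1 (ltW h1))//.
  by have := flux_decr rm1 h1 h2; rewrite zrm mulr0.
pose tau := (zl + rm) / 2.
have [t1 t2] : zl < tau /\ tau < rm by rewrite /tau; split; lra.
have ut : 0 < u tau by apply: upos; rewrite t1 (lt_trans t2).
have utm : u tau < u rm.
  by apply: u_incr (ltW t1) t2 _ => t /andP[h1 h2]; apply: zpos; rewrite h2 (le_trans (ltW t1)).
have [sig sI us] : exists2 r, r \in `[rm, zr] & u r = u tau.
  apply: (IVT rm2 (continuous_subspaceT cu)).
  by rewrite ge_min le_max ur (ltW ut) (ltW utm) orbT.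
move: sI; rewrite in_itv /= => /andP[s1 s2].
exists rm, tau, sig; split => //; first by rewrite t1.
apply/andP; split.
  by rewrite lt_neqAle s1 andbT; apply/eqP => E; rewrite -us -E ltxx in utm.
by rewrite lt_neqAle s2 andbT; apply/eqP => E; rewrite -us E ur ltxx in ut.
Qed.

(** Truncation of u at scale d. Its energy is at most mu times the integral of h phi(u), close to
    the integral of u^p over the annulus for small d, and it is 0 near both boundary spheres; this
    later gives the hole a radius above zl. *)
Lemma annulus_profile d : 0 < d -> exists (h dh : R -> R) (rho R2 : R),
  [/\ forall r, h r = fd d (u (clamp zl zr r)), zl < rho, R2 < zr,
      forall r, r <= rho \/ R2 <= r -> h r = 0 &
  [/\ forall r, zl < r < zr -> 2 * d <= u r -> dh r = phq (z r),
      C1 (fun x : V => h (nrm x)) (fun x => (dh (nrm x) / nrm x) *: x) &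
      spaceint (fun x : V => nrm ((dh (nrm x) / nrm x) *: x) `^ p) <=
      mu * spaceint (fun x : V => h (nrm x) * phip p (u (nrm x)))]].
Proof.
move=> d0.
have ul' : u zl < d by rewrite ul.
have ur' : u zr < d by rewrite ur.
have [eA eA0 eAP] := near_lt cu ul'.
have [eB eB0 eBP] := near_lt cu ur'.
pose P r := zl < r < zr.
pose F r := fd d (u r); pose dF r := dfd d (u r) * phq (z r).
have DF r : is_derive r 1 F (dF r) by exact: (is_derive1_comp' (is_derive_fd d0 (u r)) (Du r)).
have cdF : continuous dF by exact: contRM (contR_comp cu (@dfd_continuous R d)) cdu.
have Fz r : u r < d -> F r = 0 /\ dF r = 0.
  by move=> /ltW h; rewrite /F /dF fd_eq0// dfd_eq0// mul0r.
have FP r : [/\ is_derive r 1 F (dF r), {for r, continuous dF} & \forall s \near r, P s] \/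
    \forall s \near r, P s -> F s = 0 /\ dF s = 0.
  have [rA|Ar|->] := ltrgtP r zl; last first.
  - right; have H : \forall s \near zl, `|zl - s| < eA by exact: near_dist.
    by apply: filterS H => s /eAP/Fz.
  - have [rB|Br|->] := ltrgtP r zr; last first.
    + right; have H : \forall s \near zr, `|zr - s| < eB by exact: near_dist.
      by apply: filterS H => s /eBP/Fz.
    + by right; near=> s => /andP[_]; rewrite ltNge ltW//; near: s; exact: lt_nbhsr.
    + left; split; [exact: DF|exact: cdF|].
      by near=> s; apply/andP; split; near: s; [exact: lt_nbhsr|exact: lt_nbhsl].
  - by right; near=> s => /andP[]; rewrite ltNge ltW//; near: s; exact: lt_nbhsl.
pose h := cut P F; pose dh := cut P dF.
have hE r : h r = fd d (u (clamp zl zr r)).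
  rewrite /h /cut /P; case: ifPn => [rI|]; first by rewrite clamp_id.
  by move=> /(clamp_out zlr)[] ->; rewrite fd_eq0// ?ul ?ur ltW.
have zr0 : 0 < zr by exact: lt_trans zlr.
exists h, dh, (zl + eA / 2), (zr - eB / 2); split => //; try lra.
- move=> r rI; rewrite /h /cut; case: ifP => // /andP[r1 r2].
  case: rI => [ra|rb].
    by have [] := Fz r => //; apply: eAP; rewrite ler0_norm; lra.
  by have [] := Fz r => //; apply: eBP; rewrite ger0_norm; lra.
split.
- by move=> r rI ud; rewrite /dh /cut /P rI /dF dfd_eq1// mul1r.
- by case: (@radial_energy_le R N p mu u z r0 B0 N0 p1 mu0 Du cz Su r00 B00 zB h dh
    (fun r => if P r then dfd d (u r) else 0) zl zr zl0) => //;
  [move=> r; exact: is_derive_cut FP r|exact: cut_continuous FP|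
   move=> r /andP[_ rA]; rewrite /dh /cut /P ltNge rA|
   move=> r rz; rewrite /h /cut /P [r < zr]ltNge (ltW rz) andbF|
   move=> r _; rewrite /dh /cut; case: ifP => _; rewrite ?lexx ?ler01 ?mul0r// dfd_ge0// dfd_le1].
- by case: (@radial_energy_le R N p mu u z r0 B0 N0 p1 mu0 Du cz Su r00 B00 zB h dh
    (fun r => if P r then dfd d (u r) else 0) zl zr zl0) => //;
  [move=> r; exact: is_derive_cut FP r|exact: cut_continuous FP|
   move=> r /andP[_ rA]; rewrite /dh /cut /P ltNge rA|
   move=> r rz; rewrite /h /cut /P [r < zr]ltNge (ltW rz) andbF|
   move=> r _; rewrite /dh /cut; case: ifP => _; rewrite ?lexx ?ler01 ?mul0r// dfd_ge0// dfd_le1].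
Unshelve. all: by end_near. Qed.

End AnnularProfile.

(** * The cap where the two reflected copies cross *)

Section Cap.
Variables (R : realType) (N : nat) (i0 : 'I_N) (p : R) (u z h dh : R -> R).
Variables (zl zr rm s ta tb c0 d : R).
Local Notation V := 'rV[R]_N.
Local Notation e := (delta_mx ord0 i0 : V).
Local Notation phq := (phip (conjp p)).
Hypothesis p1 : 1 < p.
Hypothesis s0 : 0 < s.
Hypothesis d0 : 0 < d.
Hypothesis ta0 : 0 < ta.
Hypothesis zl_ta : zl < ta.
Hypothesis tb_rm : tb < rm.
Hypothesis rm_ta : rm < ta + s.
Hypothesis tb_zr : tb + s < zr.
Hypothesis zpos : forall r, zl <= r < rm -> 0 < z r.
Hypothesis zneg : forall r, rm < r <= zr -> z r < 0.
Hypothesis uc0 : forall r, ta <= r <= tb \/ ta + s <= r <= tb + s -> c0 <= u r.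
Hypothesis dc0 : 10 * d <= c0.
Hypothesis hE : forall r, h r = fd d (u (clamp zl zr r)).
Hypothesis dhE : forall r, zl < r < zr -> 2 * d <= u r -> dh r = phq (z r).
Implicit Types (x : V) (r t : R).

(** A cap in direction -e on which |x| lies on the increasing branch of u and |x - s e| on the
    decreasing one. *)
Definition in_cap x := x ord0 i0 <= - ta /\ nrm x <= tb.

Lemma cap_range x : in_cap x ->
  ta <= nrm x <= tb /\ ta + s <= nrm (x - s *: e) <= tb + s.
Proof.
move=> [x1 x2]; have h1 := coord_nrm x i0; have h2 := coord_nrm (x - s *: e) i0.
have h3 := nrm_triangle x (- (s *: e)); rewrite nrmN nrm_ray ?(ltW s0)// in h3.
rewrite !mxE !eqxx/= mulr1 in h2.
have h4 := ler_norm (- x ord0 i0); have h5 := ler_norm (- (x ord0 i0 - s)).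
rewrite !normrN in h4 h5.
by split; apply/andP; split; move: s0; lra.
Qed.

Lemma cap_h r : ta <= r <= tb \/ ta + s <= r <= tb + s -> h r = u r - 3 / 2 * d /\ dh r = phq (z r).
Proof.
move=> rI; have rI' : zl < r < zr.
  by move: s0 zl_ta tb_rm rm_ta tb_zr => *; case: rI => /andP[r1 r2]; apply/andP; split; lra.
have ud : 2 * d <= u r by apply: le_trans (uc0 rI); move: d0 dc0; lra.
by rewrite hE clamp_id// fd_big// dhE.
Qed.

Local Notation ga := (pga dh).
Local Notation gb := (pgb i0 s dh).
Local Notation D := (pdiff i0 s h).
Local Notation r1 x := (nrm x).
Local Notation r2 x := (nrm (x - s *: e)).

Lemma cap_left x : in_cap x -> left_of i0 s x.
Proof. by move=> [x1 _]; rewrite /left_of; move: s0 ta0; lra. Qed.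

Lemma cap_diff x : in_cap x -> D x = (u (r1 x) - u (r2 x)) / 2.
Proof.
move=> /cap_range[R1 R2]; have [h1 _] := cap_h (or_introl R1); have [h2 _] := cap_h (or_intror R2).
by rewrite /pdiff h1 h2; field.
Qed.

Lemma cap_ga x : in_cap x -> ga x = (phq (z (r1 x)) / r1 x) *: x.
Proof. by move=> /cap_range[R1 _]; have [_ h1] := cap_h (or_introl R1); rewrite /pga h1. Qed.

Lemma cap_gb x : in_cap x -> gb x = (phq (z (r2 x)) / r2 x) *: (x - s *: e).
Proof. by move=> /cap_range[_ R2]; have [_ h2] := cap_h (or_intror R2); rewrite /pgb h2. Qed.

Lemma cap_zs x : in_cap x -> 0 < z (r1 x) /\ z (r2 x) < 0.
Proof.
move=> /cap_range[/andP[a1 a2] /andP[b1 b2]]; split.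
  by apply: zpos; rewrite (le_lt_trans a2)// (le_trans (ltW zl_ta)).
by apply: zneg; rewrite (lt_le_trans rm_ta)// (le_trans b2)// ltW.
Qed.

Lemma cap_polar x : in_cap x ->
  `|polar i0 s d h x - Num.max (u (r1 x)) (u (r2 x))| <= 3 * d /\ 4 * d <= polar i0 s d h x.
Proof.
move=> xc; have [R1 R2] := cap_range xc.
have [h1 _] := cap_h (or_introl R1); have [h2 _] := cap_h (or_intror R2).
have c1 := uc0 (or_introl R1); have c2 := uc0 (or_intror R2).
have := polar_approx i0 s h d0 x; rewrite (cap_left xc) h1 h2.
move: (polar _ _ _ _ _) c1 c2 => P; move: (u _) (u _) => a b c1 c2; rewrite !ler_norml.
by have [ab|ba] := leP a b; have [ab'|ba'] := leP (a - 3 / 2 * d) (b - 3 / 2 * d);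
  move: d0 dc0; lra.
Qed.

(** Along -e both |x| and |x - s e| grow, so u(|x|) increases and u(|x - s e|) decreases: D crosses
    0 transversally, which makes the layer |D| <= 2 d thin. *)
Lemma cap_slope x q0 : in_cap x -> (forall r, ta <= r <= tb -> q0 <= phq (z r)) ->
  q0 * ta / tb / 2 <= - (2^-1 *: (ga x + (-1) *: gb x)) ord0 i0.
Proof.
move=> xc qP; have [R1 R2] := cap_range xc; have [z1 z2] := cap_zs xc.
have [x1 x2] := xc; have /andP[a1 a2] := R1.
have x0 : 0 < nrm x by exact: lt_le_trans a1.
have y0 : 0 < nrm (x - s *: e).
  by have /andP[b1 _] := R2; apply: lt_le_trans b1; rewrite addr_gt0.
have tb0 : 0 < tb by exact: lt_le_trans a2.
rewrite (cap_ga xc) (cap_gb xc) !mxE !eqxx/= mulr1.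
have h1 : q0 * ta / tb <= phq (z (nrm x)) / nrm x * - x ord0 i0.
  have q1 := qP _ R1; have [q0n|q0p] := leP q0 0.
    apply: (@le_trans _ _ 0).
      by rewrite -mulrA mulr_le0_ge0// divr_ge0// ltW.
    rewrite mulr_ge0 ?divr_ge0 ?(ltW x0) ?(ltW (phip_gt0 _ z1))//; move: ta0; lra.
  rewrite -mulrA mulrAC -mulrA ler_pM ?(ltW q0p)//.
    by rewrite divr_ge0// ltW.
  rewrite ler_pM ?(ltW ta0) ?invr_ge0 ?(ltW tb0)//; first by lra.
  by rewrite lef_pV2.
have h2 : 0 <= - phq (z (nrm (x - s *: e))) / nrm (x - s *: e) * - (x ord0 i0 - s).
  rewrite mulr_ge0 ?divr_ge0 ?(ltW y0)//.
    by rewrite oppr_ge0 ltW// phip_lt0.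
  by move: s0 ta0; lra.
rewrite mulNr mulNr in h2.
move: h1 h2; set A := phq _ / _ ; set B := phq _ / _; lra.
Qed.

Lemma cap_avec x : in_cap x -> avec p (ga x) = (z (r1 x) / r1 x) *: x /\
  avec p (gb x) = (z (r2 x) / r2 x) *: (x - s *: e).
Proof.
move=> xc; have [/andP[a1 _] /andP[b1 _]] := cap_range xc.
have x0 : 0 < nrm x by exact: lt_le_trans a1.
have y0 : 0 < nrm (x - s *: e) by apply: lt_le_trans b1; rewrite addr_gt0.
by rewrite (cap_ga xc) (cap_gb xc) !avec_radial// !phip_conjpK.
Qed.

(** Against the gradient of the bump, the flux of the polarized function is at most that of u up to
    errors. For D > 2 d the two agree; for D < - 2 d the copy centred at s e is active, and its flux
    has the opposite sign; in the layer between, only a crude bound by [phip p Cq * Cg] is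
    available. *)
Lemma cap_flux (t0 t2 t1 Cq Cg e1 ep : R) (geta : V -> V) x : in_cap x ->
  x ord0 i0 <= - t0 -> (t2 < nrm x -> 4 * d <= u (r1 x) - u (r2 x)) ->
  (nrm x <= t2 -> geta x = (- 2 * posp (- t0 - x ord0 i0)) *: e) ->
  (forall r, 0 <= r <= zr -> `|phq (z r)| <= Cq) -> nrm (geta x) <= Cg ->
  (forall w, nrm w <= Cq -> `|dotp (avec p (w + ep *: geta x)) (geta x) - dotp (avec p w) (geta x)| <= e1) ->
  dotp (avec p (pgrad i0 s d h dh x + ep *: geta x)) (geta x) <=
    z (r1 x) / r1 x * dotp (geta x) x + e1 +
    (if `|D x| <= 2 * d then 2 * (phip p Cq * Cg) else 0).
Proof.
move=> xc xt far near Cqb gC avm; have [a1 a2] := cap_avec xc; have [R1 R2] := cap_range xc.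
have /andP[R11 R12] := R1; have /andP[R21 R22] := R2; have [z1 z2] := cap_zs xc.
have x0 : 0 < nrm x by exact: lt_le_trans R11.
have y0 : 0 < nrm (x - s *: e) by apply: lt_le_trans R21; rewrite addr_gt0.
have ngaC : nrm (ga x) <= Cq.
  rewrite (cap_ga xc) nrm_scale_radial; last by move=> E; rewrite E ltxx in x0.
  apply: Cqb; rewrite nrm_ge0; move: s0 tb_zr R12; lra.
have ngbC : nrm (gb x) <= Cq.
  rewrite (cap_gb xc) nrm_scale_radial; last by move=> E; rewrite E ltxx in y0.
  by apply: Cqb; rewrite nrm_ge0; move: s0 tb_zr R22; lra.
have Cq0 : 0 <= Cq by exact: le_trans (nrm_ge0 _) ngaC.
have flux_ga : dotp (avec p (ga x)) (geta x) = z (r1 x) / r1 x * dotp (geta x) x.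
  by rewrite a1 dotpZl dotpC.
have dot_le w : nrm w <= Cq -> `|dotp (avec p w) (geta x)| <= phip p Cq * Cg.
  move=> wC; apply: le_trans (dotp_abs _ _) _; rewrite (nrm_avec p1).
  by apply: ler_pM => //; rewrite ?nrm_ge0 ?phip_nrm_ge0// phip_mono.
have [Dle|Dgt] := leP `|D x| (2 * d).
  have th := ptheta_range i0 s h d0 x.
  have gC' : nrm (pgrad i0 s d h dh x) <= Cq.
    apply: le_trans (nrm_triangle _ _) _.
    rewrite (nrmZ (ptheta i0 s d h x)) (nrmZ (1 - ptheta i0 s d h x)).
    move: th => /andP[th0 th1]; rewrite (ger0_norm th0) ger0_norm ?subr_ge0//.
    have -> : Cq = ptheta i0 s d h x * Cq + (1 - ptheta i0 s d h x) * Cq by ring.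
    by apply: lerD; apply: ler_wpM2l; rewrite ?subr_ge0.
  have := avm _ gC'; have := dot_le _ gC'; have := dot_le _ ngaC.
  rewrite flux_ga; move: (dotp (avec p (_ + _)) _) (dotp (avec p (pgrad _ _ _ _ _ _)) _) => A B.
  move: (z _ / _ * _) (phip p Cq * Cg) => C K; rewrite !ler_norml; lra.
rewrite addr0; have lf := cap_left xc.
have [D0|D0] := leP 0 (D x).
  have E : pgrad i0 s d h dh x = ga x.
    rewrite /pgrad /ptheta lf dpsi_eq1//; last by move: Dgt; rewrite ger0_norm// => /ltW.
    by rewrite (_ : (1 + 1) / 2 = 1) ?subrr ?scale1r ?scale0r ?addr0//; field.
  have := avm _ ngaC; rewrite E flux_ga ler_norml; move: (dotp (avec p (_ + _)) _) (z _ / _ * _) => A C; lra.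
have E : pgrad i0 s d h dh x = gb x.
  have := @dpsi_eq1 R d d0 (- D x); rewrite dpsiN => Hd.
  have {}Hd : dpsi d (D x) = -1.
    by rewrite -[LHS]opprK Hd// -(ltr0_norm D0) ltW.
  by rewrite /pgrad /ptheta lf Hd subrr mul0r scale0r add0r subr0 scale1r.
have xt2 : nrm x <= t2.
  rewrite leNgt; apply/negP => /far; rewrite (cap_diff xc) in D0; move: d0 D0; lra.
have gE := near xt2.
have := avm _ ngbC; rewrite E a2; set A := dotp (avec p _) _; rewrite ler_norml => /andP[_].
rewrite dotpZl gE dotpZr dotpZl (dotpC e) !dotp_delta !mxE !eqxx/= mulr1.
set c := -2 * _; have c0' : c <= 0 by rewrite mulr_le0_ge0 ?posp_ge0// oppr_le0.
have x10 : x ord0 i0 <= 0 by move: xc.1 ta0; lra.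
have h1 : 0 <= z (r1 x) / r1 x * (c * x ord0 i0).
  by apply: mulr_ge0; [rewrite divr_ge0 ?nrm_ge0 ?ltW|exact: mulr_le0].
have h2 : z (r2 x) / r2 x * (c * (x ord0 i0 - s)) <= 0.
  apply: mulr_le0_ge0; first by rewrite mulr_le0_ge0 ?invr_ge0 ?nrm_ge0 ?ltW.
  by apply: mulr_le0 => //; move: s0 x10; lra.
move: h1 h2; move: (z _ / _ * _) (z _ / _ * _) => B C; lra.
Qed.

Hypothesis Ea : C1 (fun x : V => h (nrm x)) ga.

(** A ramp with slope 1 on |t| <= 2 d and total height at most 6 d. *)
Let X t := fd d (t + 4 * d) - fd d (t - 2 * d).
Let dX t := dfd d (t + 4 * d) - dfd d (t - 2 * d).

Let dX_ge0 t : 0 <= dX t.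
Proof. by rewrite subr_ge0 dfd_mono//; move: d0; lra. Qed.

Let dX_eq1 t : `|t| <= 2 * d -> dX t = 1.
Proof.
by rewrite ler_norml => /andP[t1 t2]; rewrite /dX dfd_eq1 ?dfd_eq0 ?subr0//; move: d0; lra.
Qed.

Let X_range t : 0 <= X t <= 6 * d.
Proof.
have tt : t - 2 * d <= t + 4 * d by move: d0; lra.
by rewrite subr_ge0 fd_mono//= (le_trans (fd_lip d0 tt))//; lra.
Qed.

Let DX t : is_derive t 1 X (dX t).
Proof.
have D1 (c : R) : is_derive t 1 (fun y : R => y + c) 1.
  by apply: is_derive1_val (is_derive1D (is_derive1_id t) (is_derive1_cst c t)) _; rewrite addr0.
have := is_derive1B (@is_derive1_comp' R (fd d) (fun y => y + 4 * d) t _ _ (is_derive_fd d0 _) (D1 _))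
  (@is_derive1_comp' R (fd d) (fun y => y + - (2 * d)) t _ _ (is_derive_fd d0 _) (D1 _)).
by rewrite !mulr1.
Qed.

Let cdX : continuous dX.
Proof.
have c1 (c : R) : continuous (fun t : R => dfd d (t + c)).
  apply: (@contR_comp R (fun t => t + c)); last exact: dfd_continuous.
  by apply: contRD => // t; [exact: cvg_id|exact: cst_continuous].
have := contRD (c1 (4 * d)) (contRM (fun t => @cst_continuous R R (-1) t) (c1 (- (2 * d)))).
by rewrite (_ : (fun t => _) = dX)//; apply/funext => t; rewrite /dX /cst mulN1r.
Qed.

(* [I(zeta X'(D) (-d_1 D)) = I(X(D) d_1 zeta)] is small since [0 <= X <= 6 d]. *)
Lemma thin_layer (zeta : V -> R) (gz : V -> V) Cz q0 : C1 zeta gz -> (forall x, 0 <= zeta x) ->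
  (forall x, - ta <= x ord0 i0 \/ tb <= nrm x -> zeta x = 0 /\ gz x = 0) ->
  (forall x, `|gz x ord0 i0| <= Cz) -> 0 < tb -> 0 < q0 ->
  (forall r, ta <= r <= tb -> q0 <= phq (z r)) ->
  exists Z : V -> R, [/\ spacecc Z, forall x, 0 <= Z x,
    forall x, in_cap x -> `|D x| <= 2 * d -> zeta x * (q0 * ta / tb / 2) <= Z x &
    spaceint Z <= (2 * tb) ^+ N * (Cz * (6 * d))].
Proof.
move=> Ez z0 zsupp gzC tb0 q00 qP.
have ED := pdiff_C1 i0 s Ea.
pose gD x := 2^-1 *: (ga x + (-1) *: gb x).
have EX := C1_comp DX cdX ED; have EF := C1M Ez EX.
have cX := C1_continuous EX.
have zs x : tb < nrm x -> zeta x = 0 /\ gz x = 0 by move=> /ltW xb; apply: zsupp; right.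
pose Z x := zeta x * (dX (D x) * - gD x ord0 i0).
have cZ : spacecc Z.
  apply: (@spacecc_nrm _ _ _ tb) => [|x /zs[h1 _]]; last by rewrite /Z h1 mul0r.
  apply: contM; first exact: C1_continuous Ez.
  apply: contM; first exact: (@cont_comp _ _ D dX (C1_continuous ED) cdX).
  have := @contZ _ _ (-1) _ (ED.2 i0); rewrite (_ : (fun x => _) = (fun x => - gD x ord0 i0))//.
  by apply/funext => x; rewrite mulN1r.
have in_capP x : zeta x != 0 -> in_cap x.
  move=> zx; split; rewrite leNgt; apply/negP => xc.
    by have [] := zsupp x (or_introl (ltW xc)) => E _; rewrite E eqxx in zx.
  by have [E _] := zs x xc; rewrite E eqxx in zx.
have slope x : in_cap x -> q0 * ta / tb / 2 <= - gD x ord0 i0 by move=> xc; exact: cap_slope.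
have sl0 : 0 <= q0 * ta / tb / 2 by rewrite !divr_ge0 ?mulr_ge0 ?(ltW q00) ?(ltW tb0) ?(ltW ta0).
exists Z; split => //.
- move=> x; rewrite /Z; have [->|zx] := eqVneq (zeta x) 0; first by rewrite mul0r.
  by rewrite !mulr_ge0// (le_trans sl0)// slope//; exact: in_capP.
- by move=> x xc xD; rewrite /Z dX_eq1// mul1r ler_wpM2l// slope.
pose Y x := gz x ord0 i0 * X (D x).
have cY : spacecc Y.
  apply: (@spacecc_nrm _ _ _ tb) => [|x /zs[_ h1]]; last by rewrite /Y h1 mxE mul0r.
  by apply: contM; [exact: Ez.2|exact: cX].
have cF : spacecc (fun x => zeta x * X (D x)).
  apply: (@spacecc_nrm _ _ _ tb) => [|x /zs[h1 _]]; last by rewrite h1 mul0r.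
  by apply: contM; [exact: C1_continuous Ez|exact: cX].
have [cYZ IYZ] := spaceintB cY cZ.
have DZ x : is_derive x e (fun x => zeta x * X (D x)) (Y x - Z x).
  have := gradat_is_derive i0 (EF.1 x).
  set G := (_ + _); rewrite (_ : G ord0 i0 = Y x - Z x)//.
  by rewrite /G /Y /Z /gD !mxE; ring.
have I0 := spaceint_derive0 cF cYZ DZ.
have -> : spaceint Z = spaceint Y by apply/esym/subr0_eq; rewrite -IYZ.
apply: le_trans (ler_norm _) _; apply: spaceint_bound => //.
  by apply: nrm_boxsupp => x /zs[_ h1]; rewrite /Y h1 mxE mul0r.
move=> x; have /andP[X0 X6] := X_range (D x).
by rewrite /Y normrM ler_pM// ger0_norm.
Qed.

End Cap.

Lemma chain_bound (R : realType) (mu a b c k1 k2 e : R) : 0 < mu -> `|a - b| <= k1 ->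
  `|b - c| <= k2 -> mu * k1 <= e / 2 -> mu * k2 = e / 2 -> mu * a <= mu * c + e.
Proof.
move=> mu0; rewrite !ler_norml => /andP[_ /(ler_wpM2l (ltW mu0)) h1] /andP[_ /(ler_wpM2l (ltW mu0)) h2].
by rewrite !mulrBr in h1 h2; lra.
Qed.

Lemma half_swap (R : realType) (x s : R) : x != s / 2 -> (s - x < s / 2) = ~~ (x < s / 2).
Proof.
by rewrite -leNgt => /eqP xs; apply/idP/idP => h; [lra|rewrite lt_neqAle; apply/andP; split; [apply/eqP|]; lra].
Qed.

Lemma swap_near (R : realType) (c1 c2 : bool) (a b v1 v2 d : R) : c2 = ~~ c1 \/ a = b ->
  `|v1 - (if c1 then Num.max a b else Num.min a b)| <= d ->
  `|v2 - (if c2 then Num.max b a else Num.min b a)| <= d ->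
  (`|v1 - a| <= d /\ `|v2 - b| <= d) \/ (`|v1 - b| <= d /\ `|v2 - a| <= d).
Proof.
case=> [->|->]; last by rewrite maxxx minxx !if_same; left.
by rewrite maxC minC; case: c1 => /=; have [ab|ba] := leP b a; [left|right|right|left].
Qed.

Lemma bound_near (R : realType) (s t c d : R) : s <= c -> 0 <= t -> d <= 1 ->
  `|t - s| <= 6 * d -> `|t| <= c + 6.
Proof. by move=> sc t0 d1; rewrite (ger0_norm t0) ler_norml; lra. Qed.

Lemma minmax_approx (R : realType) (c : bool) (f q ha hb a b d : R) :
  `|q - (if c then Num.max ha hb else Num.min ha hb)| <= 3 / 2 * d ->
  `|f - q| <= 3 / 2 * (2 * d) -> `|ha - a| <= 3 / 2 * d -> `|hb - b| <= 3 / 2 * d ->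
  `|f - (if c then Num.max a b else Num.min a b)| <= 6 * d.
Proof.
rewrite !ler_norml; case: c; have [l1|l1] := leP ha hb; have [l2|l2] := leP a b; lra.
Qed.

Lemma dist_addD (R : realType) (a b w1 w2 c : R) : `|a - w1| < c -> `|b - w2| < c ->
  `|a + b - (w1 + w2)| <= 2 * c.
Proof. by rewrite !ltr_norml ler_norml; lra. Qed.

(** * The quotient of the polarized profile for small d *)

Section PolarTest.
Variables (R : realType) (N : nat) (p mu : R) (u z : R -> R) (r0 B0 zl zr : R).
Local Notation V := 'rV[R]_N.
Local Notation phq := (phip (conjp p)).
Hypothesis N0 : (0 < N)%N.
Hypothesis p1 : 1 < p.
Hypothesis mu0 : 0 < mu.
Hypothesis Du : forall r : R, is_derive r 1 u (phq (z r)).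
Hypothesis cz : continuous z.
Hypothesis Su : forall r, 0 < r -> rsol N.-1 p mu u z r.
Hypothesis r00 : 0 < r0.
Hypothesis B00 : 0 < B0.
Hypothesis zB : forall r, 0 <= r <= r0 -> `|z r| <= r * B0.
Hypothesis zl0 : 0 < zl.
Hypothesis zlr : zl < zr.
Hypothesis ul : u zl = 0.
Hypothesis ur : u zr = 0.
Hypothesis upos : forall r, zl < r < zr -> 0 < u r.
Variable i0 : 'I_N.
Local Notation e := (delta_mx ord0 i0 : V).
Implicit Types (r s t d : R) (x : V).

Let p0 : 0 < p. Proof. exact: lt_trans p1. Qed.

Let cu : continuous u.
Proof. by move=> r; exact: is_derive_continuous (Du r). Qed.

Let q1 : 1 < conjp p. Proof. exact: conjp_gt1. Qed.

Let cdu : continuous (fun r => phq (z r)).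
Proof. exact: contR_comp cz (phip_continuous q1). Qed.

Let zr0 : 0 < zr. Proof. exact: lt_trans zlr. Qed.

(** The limit of the truncated profile as d tends to 0, for which the reaction identity [A0_phi] is
    exact. *)
Let A0 x := posp (u (clamp zl zr (nrm x))).

Let cA0 : continuous A0.
Proof.
apply: (@cont_comp _ _ (fun x => u (clamp zl zr (nrm x))) (@posp R)); last exact: posp_continuous.
apply: (@cont_comp _ _ _ (fun r => u (clamp zl zr r)) (@nrm_continuous R N)).
exact: contR_comp (clamp_continuous zlr) cu.
Qed.

Let A0_out x : ~~ (zl < nrm x < zr) -> A0 x = 0.
Proof. by move=> /(clamp_out zlr); rewrite /A0 => -[] ->; rewrite posp_eq0// ?ul ?ur. Qed.

Let A0_supp x : zr < nrm x -> A0 x = 0.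
Proof. by move=> xz; apply: A0_out; rewrite negb_and -!leNgt (ltW xz) orbT. Qed.

Let A0_phi x : A0 x * phip p (u (nrm x)) = `|A0 x| `^ p.
Proof.
have [xI|/A0_out ->] := boolP (zl < nrm x < zr); last first.
  by rewrite mul0r normr0 powR0// gt_eqF.
by rewrite -mul_phip// /A0 clamp_id// posp_id// ltW// upos.
Qed.

(** Truncation at 2 d has slope at most 1, polarization does not raise the energy, and the energy of
    h is at most mu times the integral of h phi(u). The latter is close to that of A0^p, which exact
    polarization preserves because it only exchanges values at mirror points. *)
Lemma polar_small s ee : 0 < s -> 0 < ee -> exists2 d1, 0 < d1 &
  forall d (h dh : R -> R), 0 < d -> d < d1 ->
  (forall r, h r = fd d (u (clamp zl zr r))) ->
  C1 (fun x : V => h (nrm x)) (pga dh) ->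
  spaceint (fun x : V => nrm (pga dh x) `^ p) <=
    mu * spaceint (fun x : V => h (nrm x) * phip p (u (nrm x))) ->
  spaceint (fun x => nrm (dfd (2 * d) (polar i0 s d h x) *: pgrad i0 s d h dh x) `^ p) <=
    mu * spaceint (fun x => `|fd (2 * d) (polar i0 s d h x)| `^ p) + ee.
Proof.
move=> s0 ee0.
have [Cu Cu0 CuP] := @continuous_bounded_itv R u zl zr cu.
have [Cp Cp0 CpP] := @continuous_bounded_itv R (fun r => phip p (u r)) 0 zr (contR_comp cu (phip_continuous p1)).
pose L := zr + s; have L0 : 0 < L by rewrite addr_gt0.
pose K1 := (2 * zr) ^+ N; have K10 : 0 < K1 by rewrite exprn_gt0// mulr_gt0.
pose K2 := (2 * L) ^+ N; have K20 : 0 < K2 by rewrite exprn_gt0// mulr_gt0.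
pose e4 := ee / (2 * mu * K2); have e40 : 0 < e4 by rewrite divr_gt0// !mulr_gt0.
have [dp dp0 dpP] := pow_uniform p1 (Cu + 6) e40.
(* Below d1 the smoothed values stay in the range of the modulus [dpP], the total smoothing error 6
   d is below dp, and the error in the reaction term costs at most ee/2. *)
pose d1 := Num.min (Num.min 1 (dp / 6)) (ee / (3 * mu * K1 * Cp)).
have d10 : 0 < d1 by rewrite !lt_min ltr01 !divr_gt0// !mulr_gt0.
exists d1 => // d h dh d0 dd1 hE Ea Een.
have dle1 : d <= 1 by apply: (le_trans (ltW dd1)); rewrite !ge_min lexx.
have dle2 : 6 * d < dp.
  have : d < dp / 6 by apply: (lt_le_trans dd1); rewrite !ge_min lexx orbT.
  by rewrite ltr_pdivlMr// mulrC.
have dle3 : mu * (K1 * (3 / 2 * d * Cp)) <= ee / 2.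
  have : d <= ee / (3 * mu * K1 * Cp) by apply: (le_trans (ltW dd1)); rewrite !ge_min lexx orbT.
  rewrite ler_pdivlMr ?mulr_gt0// => H.
  have -> : mu * (K1 * (3 / 2 * d * Cp)) = d * (3 * mu * K1 * Cp) / 2 by ring.
  by rewrite ler_pM2r ?invr_gt0.
have h_ge0 r : 0 <= h r by rewrite hE fd_ge0.
have hM r : zr < r -> h r = 0.
  move=> rz; have rI : ~~ (zl < r < zr) by rewrite negb_and -!leNgt (ltW rz) orbT.
  by rewrite hE; case: (clamp_out zlr rI) => ->; rewrite fd_eq0// ?ul ?ur ltW.
have d20 : 0 < 2 * d by rewrite mulr_gt0.
have Ep := polar_C1 i0 s d0 Ea.
have psupp := polar_supp i0 s0 d0 hM.
have Ev := C1_comp (is_derive_fd d20) (@dfd_continuous R (2 * d)) Ep.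
have vsupp x : L < nrm x -> fd (2 * d) (polar i0 s d h x) = 0.
  by move=> /psupp ->; rewrite fd_eq0// ltW.
have c1 := grad_spacecc p1 Ep psupp.
have c2 := grad_spacecc p1 Ev vsupp.
have st1 : spaceint (fun x => nrm (dfd (2 * d) (polar i0 s d h x) *: pgrad i0 s d h dh x) `^ p) <=
    spaceint (fun x => nrm (pgrad i0 s d h dh x) `^ p).
  apply: spaceint_le c2 c1 _ => x.
  have := dfd_le1 d20 (polar i0 s d h x); have := dfd_ge0 d20 (polar i0 s d h x).
  move: (dfd _ _) (pgrad i0 s d h dh x) => t w t0 t1.
  rewrite ge0_ler_powR ?nnegrE ?nrm_ge0 ?(ltW p0)// nrmZ ger0_norm//.
  by rewrite -[leRHS]mul1r ler_wpM2r ?nrm_ge0.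
apply: le_trans st1 _.
have st2 := polar_energy i0 p1 s0 d0 hM Ea; apply: (le_trans st2); apply: (le_trans Een).
have cphi : continuous (fun x : V => phip p (u (nrm x))).
  apply: (@cont_comp _ _ (fun x => u (nrm x)) (phip p)); last exact: phip_continuous.
  exact: (@cont_comp _ _ _ u (@nrm_continuous R N)).
have cH : spacecc (fun x : V => h (nrm x) * phip p (u (nrm x))).
  apply: (@spacecc_nrm _ _ _ zr) => [|x xM]; last by rewrite hM// mul0r.
  by apply: contM; [exact: C1_continuous Ea|exact: cphi].
have cA := pow_spacecc p1 cA0 A0_supp.
have ah x : `|h (nrm x) - A0 x| <= 3 / 2 * d by rewrite hE; exact: fd_dist.
have st3 : `|spaceint (fun x : V => h (nrm x) * phip p (u (nrm x))) - spaceint (fun x => `|A0 x| `^ p)| <=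
    K1 * (3 / 2 * d * Cp).
  apply: spaceint_approx => //.
  - by apply: nrm_boxsupp => x /hM ->; rewrite mul0r.
  - by apply: nrm_boxsupp => x /A0_supp ->; rewrite normr0 powR0// gt_eqF.
  move=> x; rewrite -A0_phi -mulrBl; have [xz|xz] := leP (nrm x) zr.
    rewrite [leLHS]normrM; apply: (ler_pM _ _ (ah x)) => //.
    by apply: CpP; rewrite nrm_ge0.
  by rewrite hM// A0_supp// subrr mul0r normr0 !mulr_ge0// ltW.
have cv := pow_spacecc p1 (C1_continuous Ev) vsupp.
have st4 : `|spaceint (fun x => `|A0 x| `^ p) - spaceint (fun x => `|fd (2 * d) (polar i0 s d h x)| `^ p)| <=
    K2 * ((2 * e4) / 2).
  apply: (@refl_sum_approx _ _ i0 s) => // x.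
    move=> xL; have xz : zr < nrm x by apply: le_lt_trans xL; rewrite lerDl ltW.
    have xz2 := nrm_far i0 s0 xL.
    have z0 (t : R) : t = 0 -> `|t| `^ p = 0 by move=> ->; rewrite normr0 powR0// gt_eqF.
    have pr : polar i0 s d h (refl i0 s x) = 0.
      rewrite /polar /pmean /pdiff nrm_refl nrm_refl_sub !hM// subrr addr0 mul0r.
      by rewrite (psi_eq0 d0) ?normr0 ?(ltW d0)// addr0 subr0 if_same.
    split; apply: z0; first exact: A0_supp.
    - by apply: A0_supp; rewrite nrm_refl.
    - exact: vsupp.
    - by rewrite pr fd_eq0// ltW.
  set a := A0 x; set b := A0 (refl i0 s x).
  have aC : 0 <= a <= Cu /\ 0 <= b <= Cu.
    have H y : 0 <= A0 y <= Cu.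
      rewrite posp_ge0 /=; have [yI|/A0_out ->] := boolP (zl < nrm y < zr); last exact: ltW.
      have h1 : `|u (nrm y)| <= Cu by apply: CuP; move: yI => /andP[y1 y2]; rewrite !ltW.
      rewrite /A0 clamp_id// posp_id; last by rewrite ltW// upos.
      exact: le_trans (ler_norm _) h1.
    by split; exact: H.
  have key y : `|fd (2 * d) (polar i0 s d h y) -
     (if left_of i0 s y then Num.max (A0 y) (A0 (refl i0 s y)) else Num.min (A0 y) (A0 (refl i0 s y)))| <= 6 * d.
    have h1 := polar_approx i0 s h d0 y; have h2 := fd_dist d20 (polar i0 s d h y).
    rewrite posp_id ?(polar_ge0 i0 s d0 h_ge0)// in h2.
    have h4 := ah (refl i0 s y); rewrite nrm_refl in h4.
    exact: minmax_approx h1 h2 (ah y) h4.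
  have kx := key x; have kr := key (refl i0 s x); rewrite reflK -/a -/b in kx kr.
  set v1 := fd _ _ in kx *; set v2 := fd _ _ in kr *.
  have [[a1 a2] [b1 b2]] : (0 <= a /\ a <= Cu) /\ (0 <= b /\ b <= Cu).
    by move: aC => [/andP[? ?] /andP[? ?]].
  have v10 : 0 <= v1 by exact: fd_ge0.
  have v20 : 0 <= v2 by exact: fd_ge0.
  have pw (s' t' : R) : 0 <= s' <= Cu -> 0 <= t' -> `|t' - s'| <= 6 * d -> `| `|s'| `^ p - `|t'| `^ p| < e4.
    move=> /andP[h1 h2] h3 h4; apply: dpP.
    - by rewrite ger0_norm// ler_wpDr.
    - exact: bound_near h2 h3 dle1 h4.
    - by rewrite distrC; exact: le_lt_trans dle2.
  have fin (a' b' w1 w2 : R) : `|a' - w1| < e4 -> `|b' - w2| < e4 -> `|a' + b' - (w1 + w2)| <= 2 * e4.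
    exact: dist_addD.
  have fin' (a' b' w1 w2 : R) : `|a' - w2| < e4 -> `|b' - w1| < e4 -> `|a' + b' - (w1 + w2)| <= 2 * e4.
    by rewrite [w1 + w2]addrC; exact: dist_addD.
  have aI : 0 <= a <= Cu by rewrite a1.
  have bI : 0 <= b <= Cu by rewrite b1.
  (* Off the hyperplane exactly one of the two mirror points lies on the left; on it their values
     agree. In either case the pair of values is only permuted. *)
  have cc : left_of i0 s (refl i0 s x) = ~~ left_of i0 s x \/ a = b.
    rewrite /left_of refl_coord; have [xm|xm] := eqVneq (x ord0 i0) (s / 2); last first.
      by left; exact: half_swap.
    right; rewrite /a /b /A0 nrm_refl; congr (posp (u (clamp zl zr _))).
    by apply/eqP; rewrite -(@eqrXn2 _ 2) ?nrm_ge0// sqr_nrm_sub xm; apply/eqP; field.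
  have [[h1 h2]|[h1 h2]] := swap_near cc kx kr; last by apply: fin'; apply: pw.
  by apply: fin; apply: pw.
have E4 : mu * (K2 * ((2 * e4) / 2)) = ee / 2.
  by rewrite /e4; field; rewrite !gt_eqF.
exact: chain_bound mu0 st3 st4 dle3 E4.
Qed.

End PolarTest.

(** * The polarized annulus *)

Lemma posp_max (R : realType) (a b : R) : b + posp (a - b) = Num.max a b.
Proof.
by rewrite /posp; have [ab|ab] := leP (a - b) 0; have [h|h] := leP a b; move: ab h; lra.
Qed.

Lemma positive_lower_bound (R : realType) (f : R -> R) (a b : R) : a <= b -> continuous f ->
  (forall r, a <= r <= b -> 0 < f r) -> exists2 m, 0 < m & forall r, a <= r <= b -> m <= f r.
Proof.
move=> ab cf f0; have [r rI rm] := EVT_min ab (continuous_subspaceT cf).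
exists (f r); first by apply: f0; rewrite in_itv in rI.
by move=> s sI; apply: rm; rewrite in_itv.
Qed.

(** Convexity is used in opposite directions: the gradient term is bounded by its tangent at the
    perturbed gradient, the mass term by its tangent at the unperturbed value. No second-order
    remainder appears; only the errors e1, e2 and K are left to control. *)
Lemma first_variation (R : realType) (N : nat) (p mu ep e1 e2 Ce K : R) (gv0 ge : 'rV[R]_N)
  (v0 eta c m : R) : 1 < p -> 0 < ep -> 0 < mu -> 0 <= eta <= Ce ->
  dotp (avec p (gv0 + ep *: ge)) ge <= c + e1 + K -> `|phip p v0 - phip p m| <= e2 ->
  nrm (gv0 + ep *: ge) `^ p - mu * `|v0 + ep * eta| `^ p <=
  nrm gv0 `^ p - mu * `|v0| `^ p + p * ep * (c - mu * phip p m * eta + (e1 + mu * (e2 * Ce)) + K).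
Proof.
move=> p1 ep0 mu0 /andP[eta0 etaC] Hflux Hphi; have p0 : 0 < p by exact: lt_trans p1.
have h1 := avec_tangent p1 gv0 (gv0 + ep *: ge).
rewrite opprD addNKr -scaleN1r scalerA mulN1r dotpZr mulNr mulrN lerBlDr in h1.
have h2 := phip_tangent (v0 + ep * eta) v0 p1; rewrite addrAC subrr add0r in h2.
have h3 : - (phip p v0 * eta) <= - (phip p m * eta) + e2 * Ce.
  have : `|(phip p v0 - phip p m) * eta| <= e2 * Ce.
    by rewrite normrM (ger0_norm eta0); exact: ler_pM.
  by rewrite ler_norml mulrBl => /andP[+ _]; lra.
have h4 : p * ep * dotp (avec p (gv0 + ep *: ge)) ge <= p * ep * (c + e1 + K).
  by rewrite ler_wpM2l// mulr_ge0// ltW.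
have h5 : p * ep * mu * - (phip p v0 * eta) <= p * ep * mu * (- (phip p m * eta) + e2 * Ce).
  by apply: ler_wpM2l h3; rewrite !mulr_ge0// ltW.
have h6 : mu * (`|v0| `^ p + p * (phip p v0 * (ep * eta))) <= mu * `|v0 + ep * eta| `^ p.
  by rewrite ler_pM2l.
move: h1 h4 h5 h6; move: (nrm _ `^ p) (nrm gv0 `^ p) (`|v0 + _| `^ p) (`|v0| `^ p) (dotp _ _) => A B C D F.
by move: (phip p v0) (phip p m) => G H; lra.
Qed.

Lemma variation_integral (R : realType) (N : nat) (mu k a b : R) (F W F0 W0 T B Y Z : 'rV[R]_N -> R) :
  spacecc F -> spacecc W -> spacecc F0 -> spacecc W0 -> spacecc T -> spacecc B -> spacecc Y ->
  spacecc Z ->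
  (forall x, F x - mu * W x <= F0 x - mu * W0 x + k * (T x - B x + a * Y x + b * Z x)) ->
  spaceint F - mu * spaceint W <= spaceint F0 - mu * spaceint W0 +
    k * (spaceint T - spaceint B + a * spaceint Y + b * spaceint Z).
Proof.
move=> cF cW cF0 cW0 cT cB cY cZ H.
have J (f g : 'rV[R]_N -> R) : spacecc f -> spacecc g ->
    spacecc (fun x => f x - mu * g x) /\ spaceint (fun x => f x - mu * g x) = spaceint f - mu * spaceint g.
  by move=> cf cg; have [c1 <-] := spaceintZ mu cg; exact: spaceintB.
have [c1 I1] := J _ _ cF cW; have [c2 I2] := J _ _ cF0 cW0.
have [c3 I3] := spaceintB cT cB.
have [c4 I4] := spaceintZ a cY; have [c5 I5] := spaceintZ b cZ.
have [c6 I6] := spaceintD c3 c4; have [c7 I7] := spaceintD c6 c5.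
have [c8 I8] := spaceintZ k c7; have [c9 I9] := spaceintD c2 c8.
by have := spaceint_le c1 c9 H; rewrite I1 I9 I8 I7 I6 I5 I4 I3 I2.
Qed.

(** Where the exact minimum is 0, smoothing leaves a value of at most 3/2 d; truncation by
    [fd (2 * d)] restores exact vanishing. *)
Lemma polar_zero (R : realType) (N : nat) (i0 : 'I_N) (s d : R) (h : R -> R) (x : 'rV[R]_N) :
  0 < d -> (forall r, 0 <= h r) ->
  (left_of i0 s x -> h (nrm x) = 0 /\ h (nrm (x - s *: delta_mx ord0 i0)) = 0) ->
  h (nrm x) = 0 \/ h (nrm (x - s *: delta_mx ord0 i0)) = 0 -> fd (2 * d) (polar i0 s d h x) = 0.
Proof.
move=> d0 h0 hl hr; apply: fd_eq0; first by rewrite mulr_gt0.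
have /andP[+ _] := psi_norm d0 (pdiff i0 s h x); rewrite /polar /pmean.
have := h0 (nrm x); have := h0 (nrm (x - s *: delta_mx ord0 i0)).
case: ifP => [/hl[E1 E2]|_].
  by rewrite /pdiff E1 E2 subrr addr0 mul0r psi_eq0 ?normr0 ?(ltW d0)// addr0; move: d0; lra.
rewrite /pdiff; case: hr => ->; set q := psi _ _; set a := h _ => h1 h2.
  by rewrite sub0r mulNr normrN add0r ger0_norm ?divr_ge0//; move: d0; lra.
by rewrite subr0 addr0 ger0_norm ?divr_ge0//; move: d0; lra.
Qed.

(** Left of the hyperplane |x| < |x - s e|, so either condition annihilates both copies; on the
    right the minimum needs only one of them to vanish. The hole of the polarized annulus is thus a
    ball about s e. *)
Lemma polar_hole (R : realType) (N : nat) (i0 : 'I_N) (s d rho R2 : R) (h : R -> R) (x : 'rV[R]_N) :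
  0 < s -> 0 < d -> (forall r, 0 <= h r) -> (forall r, r <= rho \/ R2 <= r -> h r = 0) ->
  nrm (x - s *: delta_mx ord0 i0) <= rho \/ R2 <= nrm x -> fd (2 * d) (polar i0 s d h x) = 0.
Proof.
move=> s0 d0 h0 hz xI; apply: polar_zero => //.
  rewrite /left_of => xl; have : ~~ (nrm (x - s *: delta_mx ord0 i0) <= nrm x).
    by rewrite (nrm_sub_le _ _ (ltW s0)) -ltNge expr2 mulrAC -subr_gt0 -mulrBl pmulr_lgt0//; lra.
  rewrite -ltNge => /ltW l; case: xI => xI; split; apply: hz.
  - by left; exact: le_trans l xI.
  - by left.
  - by right.
  - by right; exact: le_trans xI l.
by case: xI => xI; [right; apply: hz; left|left; apply: hz; right].
Qed.

Lemma energy_balance (R : realType) (mu k I b G W G0 W0 T Y Z : R) : 0 < k -> 0 < b ->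
  G - mu * W <= G0 - mu * W0 + k * (T - b + Y + Z) -> G0 <= mu * W0 + k * (b / 4) ->
  T = 0 -> Y <= b / 4 -> Z <= b / 4 -> G < mu * W.
Proof.
move=> k0 b0 h1 h2 T0 h3 h4; have h5 : k * (T - b + Y + Z) <= k * (- b / 2).
  by rewrite ler_wpM2l ?(ltW k0)// T0; lra.
have h6 : 0 < k * b by rewrite mulr_gt0.
lra.
Qed.

Lemma fd_double (R : realType) (d t : R) : 0 < d -> 4 * d <= t ->
  fd (2 * d) t = t - 3 * d /\ dfd (2 * d) t = 1.
Proof.
move=> d0 dt; have d20 : 0 < 2 * d by rewrite mulr_gt0.
by rewrite fd_big ?dfd_eq1//; [split=> //; lra| |]; lra.
Qed.

Lemma dist_shift (R : realType) (a b d : R) : 0 < d -> `|a - b| <= 3 * d ->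
  `|a - 3 * d - b| <= 6 * d.
Proof. by rewrite !ler_norml; lra. Qed.

Lemma nrm_sub_coord (R : realType) (N : nat) (i0 : 'I_N) (s : R) (x : 'rV[R]_N) :
  s - x ord0 i0 <= nrm (x - s *: delta_mx ord0 i0).
Proof.
have := coord_nrm (x - s *: delta_mx ord0 i0) i0.
by rewrite !mxE !eqxx mulr1 distrC; apply: le_trans; exact: ler_norm.
Qed.

(** The last bound will keep the translated ball |x - s e| < r inside |x| < zr. *)
Lemma hole_radius (R : realType) (zl zr s a b : R) : zl < a -> zl < b -> zl + s < zr ->
  exists r, [/\ zl < r, r <= a, r <= b & s + r < zr].
Proof.
move=> la lb ls; exists (Num.min a (Num.min b ((zl + zr - s) / 2))).
split; rewrite ?ge_min ?lexx ?orbT//.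
  by rewrite !lt_min la lb /=; lra.
have : Num.min a (Num.min b ((zl + zr - s) / 2)) <= (zl + zr - s) / 2 by rewrite !ge_min lexx !orbT.
by move: (Num.min _ _) => m; lra.
Qed.

Lemma small_param (R : realType) (a b c e k m : R) : 0 < a -> 0 < b -> 0 < c -> 0 < e -> 0 < k ->
  0 < m -> exists d, [/\ 0 < d, d < a & [/\ 10 * d <= b, 4 * d <= c, 6 * d < e, d <= 1 & k * d <= m]].
Proof.
move=> a0 b0 c0 e0 k0 m0.
pose d := Num.min (Num.min (a / 2) (b / 10)) (Num.min (c / 4) (Num.min (Num.min (e / 7) 1) (m / k))).
have d0 : 0 < d by rewrite !lt_min ltr01 !divr_gt0.
have [d1 d2 d3 d4 [d5 d6]] : [/\ d <= a / 2, d <= b / 10, d <= c / 4, d <= e / 7 & d <= 1 /\ d <= m / k].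
  by rewrite /d !ge_min !lexx !orbT.
exists d; split => //; first by lra.
by split => //; try lra; rewrite mulrC -ler_pdivlMr.
Qed.

Lemma pointwise_balance (R : realType) (c mu m w eta e3 zm y q Cc Z : R) : 0 < e3 -> zm <= y ->
  q <= Cc * Z ->
  c - mu * m * eta + e3 * zm + q <= c - mu * w * eta - mu * (m - w) * eta + e3 * y + Cc * Z.
Proof. by move=> e0 zy qz; have := ler_wpM2l (ltW e0) zy; lra. Qed.

Section PolarFinal.
Variables (R : realType) (N : nat) (p mu : R) (u z : R -> R) (r0 B0 zl zr : R).
Local Notation V := 'rV[R]_N.
Local Notation phq := (phip (conjp p)).
Hypothesis N0 : (0 < N)%N.
Hypothesis p1 : 1 < p.
Hypothesis mu0 : 0 < mu.
Hypothesis Du : forall r : R, is_derive r 1 u (phq (z r)).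
Hypothesis cz : continuous z.
Hypothesis Su : forall r, 0 < r -> rsol N.-1 p mu u z r.
Hypothesis r00 : 0 < r0.
Hypothesis B00 : 0 < B0.
Hypothesis zB : forall r, 0 <= r <= r0 -> `|z r| <= r * B0.
Hypothesis zl0 : 0 < zl.
Hypothesis zlr : zl < zr.
Hypothesis ul : u zl = 0.
Hypothesis ur : u zr = 0.
Hypothesis upos : forall r, zl < r < zr -> 0 < u r.
Variable i0 : 'I_N.
Local Notation e := (delta_mx ord0 i0 : V).
Implicit Types (r s t d : R) (x : V).

Let p0 : 0 < p. Proof. exact: lt_trans p1. Qed.

Let cu : continuous u.
Proof. by move=> r; exact: is_derive_continuous (Du r). Qed.

Let q1 : 1 < conjp p. Proof. exact: conjp_gt1. Qed.

Let cdu : continuous (fun r => phq (z r)).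
Proof. exact: contR_comp cz (phip_continuous q1). Qed.

(** All radii lie around the equal levels u(tau) = u(sig), with s = sig - tau. Slightly below tau
    the translated copy is larger, u(tp) < u(tp + s); beyond t2 > tau the original copy wins by at
    least gap. The triple t0, t2, t1 serves the bump, and ta, t1, tb a wider one bounded below on
    its support. *)
Lemma cap_params : exists rm s ta tb gap c0 q0 : R, exists t0 tp t2 t1 : R,
  [/\ 0 < s, zl < ta, [/\ ta < t0, t0 < tp, tp < t2, t2 < t1 & t1 < tb], tb < rm &
   [/\ rm < ta + s, tb + s < zr,
       forall r, zl <= r < rm -> 0 < z r, forall r, rm < r <= zr -> z r < 0 &
    [/\ 0 < gap, forall a b, t2 < a <= tb -> t0 + s <= b <= tb + s -> gap <= u a - u b,
       u tp < u (tp + s),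
       0 < c0 /\ (forall r, ta <= r <= tb \/ ta + s <= r <= tb + s -> c0 <= u r) &
       0 < q0 /\ (forall r, ta <= r <= tb -> q0 <= phq (z r))]]].
Proof.
have [rm [tau [sig [/andP[l1 l2] /andP[l3 l4] uts zpos zneg]]]] :=
  levels p1 mu0 Du cz Su zl0 zlr ul ur upos.
pose s := sig - tau.
pose m := Num.min (Num.min (tau - zl) (rm - tau)) (Num.min (sig - rm) (zr - sig)) / 2.
have m0 : 0 < m by rewrite divr_gt0// !lt_min !subr_gt0 l1 l2 l3 l4.
have [m1 m2 m3 m4] : [/\ m <= (tau - zl) / 2, m <= (rm - tau) / 2, m <= (sig - rm) / 2 & m <= (zr - sig) / 2].
  by rewrite !ler_pM2r ?invr_gt0// !ge_min !lexx ?orbT.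
pose ta := tau - m; pose tb := tau + m; pose t2 := tau + m / 3; pose t1 := tau + 2 * m / 3.
have incr a b : zl <= a -> a < b -> b < rm -> u a < u b.
  move=> za ab br; apply: (u_incr p1 Du cz za ab) => t /andP[t3 t4].
  by apply: zpos; rewrite (le_trans za t3) (lt_trans t4 br).
have decr a b : rm <= a -> a < b -> b <= zr -> u b < u a.
  move=> ra ab bz; have za : zl <= a by apply: le_trans ra; move: l1 l2; lra.
  apply: (u_decr p1 Du cz za ab) => t /andP[t3 t4].
  by apply: zneg; rewrite (le_lt_trans ra t3) (le_trans t4).
have us2 : u sig < u t2 by rewrite -uts; apply: incr; rewrite /t2; move: m0 l1 l2 m2; lra.
have [dl dl0 dlP] := near_lt cu us2.
(* Small enough that u(t0 + s) < u(t2) for t0 = tau - k, which makes gap positive. *)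
pose k := Num.min (m / 2) (dl / 2).
have k0 : 0 < k by rewrite lt_min (divr_gt0 m0)// (divr_gt0 dl0).
have [k1 k2] : k <= m / 2 /\ k <= dl / 2 by rewrite !ge_min !lexx orbT.
pose t0 := tau - k; pose tp := tau - k / 2.
have ut0 : u (t0 + s) < u t2.
  by apply: dlP; rewrite /t0 /s ger0_norm; move: k0 k1 k2 dl0; lra.
have aI r : ta <= r <= tb -> zl < r < rm.
  by rewrite /ta /tb => /andP[? ?]; apply/andP; split; move: m0 m1 m2; lra.
have bI r : ta + s <= r <= tb + s -> rm < r < zr.
  by rewrite /ta /tb /s => /andP[? ?]; apply/andP; split; move: m0 m3 m4; lra.
have tab : ta <= tb by rewrite /ta /tb; move: m0; lra.
have [ca ca0 caP] : exists2 c, 0 < c & forall r, ta <= r <= tb -> c <= u r.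
  apply: positive_lower_bound => // r /aI/andP[r1 r2]; apply: upos; move: r1 r2 l3 l4; lra.
have [cb cb0 cbP] : exists2 c, 0 < c & forall r, ta + s <= r <= tb + s -> c <= u r.
  apply: positive_lower_bound => //; first by rewrite lerD2r.
  by move=> r /bI/andP[r1 r2]; apply: upos; move: r1 r2 l1 l2; lra.
have [q0 q00 qP] : exists2 q, 0 < q & forall r, ta <= r <= tb -> q <= phq (z r).
  apply: positive_lower_bound => // r /aI/andP[r1 r2]; apply: phip_gt0; apply: zpos.
  by rewrite r2 ltW.
exists rm, s, ta, tb, (u t2 - u (t0 + s)), (Num.min ca cb), q0, t0, tp, t2, t1.
split; rewrite ?subr_gt0.
- by move: l2 l3; rewrite /s; lra.
- by rewrite /ta; move: m0 m1; lra.
- by rewrite /ta /t0 /tp /t2 /t1 /tb; split; move: m0 k0 k1; lra.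
- by rewrite /tb; move: m0 m2; lra.
split => //; rewrite ?subr_gt0.
- by rewrite /ta /s; move: m0 m3; lra.
- by rewrite /tb /s; move: m0 m4; lra.
split => //; rewrite ?subr_gt0//.
- move=> a b /andP[a1 a2] /andP[b1 b2].
  have h1 : u t2 < u a.
    by apply: incr => //; move: a2; rewrite /t2 /tb; move: m0 m2 l1 l2; lra.
  have h2 : u b <= u (t0 + s).
    move: b1; rewrite le_eqVlt => /predU1P[<-//|b1]; apply: ltW; apply: decr => //.
      by rewrite /t0 /s; move: k1 m3; lra.
    by apply: le_trans b2 _; rewrite /tb /s; move: m0 m4; lra.
  by move: h1 h2; lra.
- apply: (@lt_trans _ _ (u tau)).
    by apply: incr; rewrite /tp; move: k0 k1 m0 m1 m2; lra.
  by rewrite uts; apply: decr; rewrite /tp /s; move: k0 k1 m0 m3 m4; lra.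
- split; first by rewrite lt_min ca0.
  by move=> r [/caP|/cbP] h; rewrite ge_min h ?orbT.
Qed.

(** The truncated polarization v0 is perturbed by ep * eta. The first-order change is p * ep times
    the integral of T0 - beta: T0 integrates to 0 because u solves the equation, and beta is the
    gain where the maximum is the other copy. Three errors remain, each at most a quarter of the
    gain: [ee] for polarization and truncation, the zeta term for the moduli of continuity, and the
    Z term for the crossing layer. *)
Lemma polar_test : exists (s rho R2 : R) (v : V -> R) (g : V -> V),
  [/\ 0 < s, zl < rho, s + rho <= R2, R2 < zr &
  [/\ C1 v g, forall x, 0 <= v x,
      forall x, nrm (x - s *: e) <= rho \/ R2 <= nrm x -> v x = 0, exists x, 0 < v x &
      spaceint (fun x => nrm (g x) `^ p) < mu * spaceint (fun x => `|v x| `^ p)]].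
Proof.
have [rm [s [ta [tb [gap [c0 [q0 [t0 [tp [t2 [t1 H]]]]]]]]]]] := cap_params.
case: H => s0 zlta [tat0 t0p tp2 t21 t1b] tbrm [rmta tbzr zpos zneg [gap0 gapP utp [c00 c0P] [q00 qP]]].
have ta0 : 0 < ta by exact: lt_trans zlta.
have tb0 : 0 < tb by rewrite (lt_trans ta0)//; do 4 (apply: lt_trans; [eassumption|]).
have t00 : 0 < t0 by exact: lt_trans tat0.
have t20 : 0 < t2 by do 2 (apply: lt_trans; [|eassumption]).
have t10 : 0 < t1 by exact: lt_trans t21.
have zr0 : 0 < zr by exact: lt_trans zlr.
have [eta [ge [Ee eta0 etas etal getaE]]] := @bump_exists R N i0 t0 t2 t1 t20 t21.
have [zeta [gz [Ez zeta0 zetas zetal _]]] := @bump_exists R N i0 ta t1 tb t10 t1b.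
(* Lower bound of zeta on the support of eta; it converts constant errors there into multiples of
   zeta. *)
pose zm := (t0 - ta) ^+ 2; have zm0 : 0 < zm by rewrite exprn_gt0// subr_gt0.
have etaS x : t1 < nrm x -> eta x = 0 by move=> /ltW h; have [] := etas x (or_intror h).
have zetaS x : tb < nrm x -> zeta x = 0 by move=> /ltW h; have [] := zetas x (or_intror h).
have gzS x : tb < nrm x -> gz x = 0 by move=> /ltW h; have [] := zetas x (or_intror h).
have ceta := spacecc_nrm (C1_continuous Ee) etaS.
have czeta := spacecc_nrm (C1_continuous Ez) zetaS.
have [Ce Ce0 CeP] := spacecc_bounded ceta.
have [Cg Cg0 CgP] : exists2 C, 0 < C & forall x, nrm (ge x) <= C.
  have cg : spacecc (fun x => nrm (ge x)).
    apply: (@spacecc_nrm _ _ _ t1) => [|x /ltW h]; first exact: cont_nrm Ee.2.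
    by have [_ ->] := etas x (or_intror h); rewrite nrm0.
  by have [C C0 CP] := spacecc_bounded cg; exists C => // x; apply: le_trans (CP x); exact: ler_norm.
have [Cz Cz0 CzP] : exists2 C, 0 < C & forall x, `|gz x ord0 i0| <= C.
  apply: spacecc_bounded; apply: (@spacecc_nrm _ _ _ tb) => [|x /gzS ->]; first exact: Ez.2.
  by rewrite mxE.
have [Cq Cq0 CqP] := @continuous_bounded_itv R (fun r => phq (z r)) 0 zr cdu.
have [Cu Cu0 CuP] := @continuous_bounded_itv R u 0 zr cu.
pose u1 x := u (nrm x); pose u2 x := u (nrm (x - s *: e)).
have cu1 : continuous u1 by exact: (@cont_comp _ _ _ u (@nrm_continuous R N)).
have cu2 : continuous u2 by exact: (@cont_shift R N u1 (- (s *: e))).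
pose mx x := u2 x + posp (u1 x - u2 x).
have mxE' x : mx x = Num.max (u1 x) (u2 x) by exact: posp_max.
have cmx : continuous mx.
  by apply: contD => //; apply: (@cont_comp _ _ _ (@posp R)); [exact: contB|exact: posp_continuous].
pose beta x := mu * (phip p (mx x) - phip p (u1 x)) * eta x.
have beta0 x : 0 <= beta x.
  by rewrite !mulr_ge0 ?(ltW mu0)// subr_ge0 phip_mono// mxE' le_max lexx.
have cbeta : spacecc beta.
  apply: (@spacecc_nrm _ _ _ t1) => [|x /etaS h]; last by rewrite /beta h mulr0.
  apply: contM; last exact: C1_continuous Ee.
  apply: (@contZ _ _ mu); apply: contB.
    exact: (@cont_comp _ _ _ (phip p) cmx (phip_continuous p1)).
  exact: (@cont_comp _ _ _ (phip p) cu1 (phip_continuous p1)).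
(* A point where eta > 0 and the translated copy exceeds u(|x|), so that the gain is not zero. *)
pose xp := (- tp) *: e.
have tp0 : 0 < tp by exact: lt_trans t0p.
have xp1 : xp ord0 i0 = - tp by rewrite !mxE !eqxx mulr1.
have nxp : nrm xp = tp by rewrite /xp scaleNr nrmN nrm_ray// ltW.
have nxps : nrm (xp - s *: e) = tp + s.
  by rewrite /xp -scalerBl -opprD scaleNr nrmN nrm_ray// ltW// addr_gt0.
have etaxp : 0 < eta xp.
  apply: lt_le_trans (etal xp tp (ltW t0p) _ _); first by rewrite exprn_gt0// subr_gt0.
    by rewrite xp1.
  by rewrite nxp ltW.
have I0 : 0 < spaceint beta.
  apply: (@spaceint_gt0 _ _ _ xp) => //; rewrite /beta !mulr_gt0// subr_gt0 phip_smono// mxE' lt_max.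
  by rewrite /u1 /u2 nxp nxps utp orbT.
have eta_t0 x : nrm x <= t0 -> eta x = 0.
  move=> xt; have [] := etas x _ => //; left; have := coord_nrm x i0; rewrite ler_norml; move: xt; lra.
have [cT0 IT0] := weak_identity N0 cu cz p1 Su t00 Ee eta_t0 etaS.
set T0 := (fun x => _) in cT0 IT0.
pose iz := spaceint zeta.
have iz0 : 0 <= iz.
  have [cz' Iz'] := spaceintZ 0 czeta; rewrite mul0r in Iz'.
  by rewrite -Iz'; apply: spaceint_le cz' czeta _ => x; rewrite mul0r.
(* Makes e3 times the integral of zeta at most a quarter of the gain; e1 and e2 below share the
   amount e3 * zm equally. *)
pose e3 := spaceint beta / (4 * (iz + 1)).
have iz1 : 0 < iz + 1 by rewrite ltr_wpDl.
have e30 : 0 < e3 by rewrite divr_gt0// mulr_gt0.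
have e3i : e3 * iz <= spaceint beta / 4.
  have -> : spaceint beta / 4 = e3 * (iz + 1) by rewrite /e3; field; rewrite gt_eqF.
  by rewrite ler_wpM2l ?(ltW e30)// lerDl.
pose e1 := e3 * zm / 2; have e10 : 0 < e1 by rewrite divr_gt0// mulr_gt0.
pose e2 := e3 * zm / (2 * mu * Ce); have e20 : 0 < e2 by exact: divr_gt0 (mulr_gt0 e30 zm0) (mulr_gt0 (mulr_gt0 (ltr0Sn R 1) mu0) Ce0).
have e12 : e1 + mu * (e2 * Ce) = e3 * zm by rewrite /e1 /e2; field; rewrite !gt_eqF.
pose K := q0 * ta / tb / 2; have K0 : 0 < K by rewrite !divr_gt0// mulr_gt0.
pose C2 := 2 * (phip p Cq * Cg); have C20 : 0 < C2 by exact: mulr_gt0 (ltr0Sn R 1) (mulr_gt0 (phip_gt0 _ Cq0) Cg0).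
(* On the layer Z is at least zm * K, so Cc * Z covers the crude flux bound C2. *)
pose Cc := C2 / (zm * K); have Cc0 : 0 < Cc by exact: divr_gt0 C20 (mulr_gt0 zm0 K0).
pose cm := Num.max Cq Cg; have cm0 : 0 < cm by rewrite lt_max Cq0.
have [da da0 daP] := @avec_uniform R N p p1 cm e1 cm0 e10.
(* The step is fixed by uniform continuity of the flux alone, before d; the smoothing error can
   therefore be made small compared with p * ep times the gain. *)
pose ep := da / Cg; have ep0 : 0 < ep by rewrite divr_gt0.
have [dp dp0 dpP] := phip_uniform p1 (Cu + 6) e20.
pose ee := p * ep * (spaceint beta / 4).
have ee0 : 0 < ee by exact: mulr_gt0 (mulr_gt0 p0 ep0) (divr_gt0 I0 (ltr0Sn R 3)).
have [d1 d10 d1P] := polar_small p1 mu0 Du zl0 zlr ul ur upos i0 s0 ee0.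
pose Kt := Cc * ((2 * tb) ^+ N * (Cz * 6)).
have Kt0 : 0 < Kt by apply: (mulr_gt0 Cc0); apply: mulr_gt0 (mulr_gt0 Cz0 (ltr0Sn R 5)); rewrite exprn_gt0// mulr_gt0.
have [d [d0 dd1 [dc dg d6 d1' dK]]] := small_param d10 c00 gap0 dp0 Kt0 (divr_gt0 I0 (ltr0Sn R 3)).
have d20 : 0 < 2 * d by rewrite mulr_gt0.
have [h [dh [rho0 [R20 [hE zrho R2z hz [dhE Ea Een]]]]]] :=
  annulus_profile N0 p1 mu0 Du cz Su r00 B00 zB zl0 zlr ul ur d0.
have Epol := d1P d h dh d0 dd1 hE Ea Een.
have h_ge0 r : 0 <= h r by rewrite hE fd_ge0.
have hM r : zr < r -> h r = 0 by move=> rz; apply: hz; right; rewrite (le_trans (ltW R2z))// ltW.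
have [Z [cZ Z0 ZK IZ]] := thin_layer s0 d0 ta0 zlta tbrm rmta tbzr zpos zneg c0P dc hE dhE
  Ea Ez zeta0 zetas CzP tb0 q00 qP.
have Ep := polar_C1 i0 s d0 Ea.
have Ev0 := C1_comp (is_derive_fd d20) (@dfd_continuous R (2 * d)) Ep.
set v0 := (fun x => fd (2 * d) (polar i0 s d h x)) in Ev0.
set g0 := (fun x => dfd (2 * d) (polar i0 s d h x) *: pgrad i0 s d h dh x) in Ev0.
have Ev := C1D Ev0 (C1Z ep Ee).
set v := (fun x => v0 x + ep * eta x) in Ev.
set g := (fun x => g0 x + ep *: ge x) in Ev.
have psupp := polar_supp i0 s0 d0 hM.
have v0supp x : zr + s < nrm x -> v0 x = 0 by move=> /psupp xs; rewrite /v0 xs fd_eq0// ltW.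
have vsupp x : zr + s < nrm x -> v x = 0.
  move=> xz; rewrite /v v0supp// etaS ?mulr0 ?addr0//; apply: lt_trans xz.
  by rewrite (lt_trans t1b)// (lt_trans _ (lt_trans tbzr _)) ?ltrDl.
(* Where eta and its gradient vanish nothing changes. Elsewhere x lies in the cap, v0 = polar - 3 d
   is within 6 d of the maximum [mx], and [first_variation] applies with [cap_flux]. *)
have P x : nrm (g x) `^ p - mu * `|v x| `^ p <= nrm (g0 x) `^ p - mu * `|v0 x| `^ p +
    p * ep * (T0 x - beta x + e3 * zeta x + Cc * Z x).
  have pe0 : 0 <= p * ep by rewrite mulr_ge0 ?(ltW p0) ?(ltW ep0).
  have [/andP[xt0 xt1]|xout] := boolP ((x ord0 i0 <= - t0) && (nrm x <= t1)); last first.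
    have [ex gx] : eta x = 0 /\ ge x = 0.
      by apply: etas; move: xout; rewrite negb_and -!ltNge => /orP[/ltW|/ltW]; [left|right].
    have -> : g x = g0 x by rewrite /g gx scaler0 addr0.
    have -> : v x = v0 x by rewrite /v ex mulr0 addr0.
    have -> : T0 x = 0 by rewrite /T0 ex gx mulr0 subr0 dotpC -(scale0r x) dotpZr mul0r mulr0.
    have -> : beta x = 0 by rewrite /beta ex mulr0.
    rewrite lerDl mulr_ge0// subrr add0r addr_ge0// mulr_ge0 ?zeta0 ?Z0 ?(ltW e30) ?(ltW Cc0)//.
  have xc : in_cap i0 ta tb x.
    by split; [rewrite (le_trans xt0)// lerN2 ltW|rewrite (le_trans xt1)// ltW].
  have [/andP[r11 r12] /andP[r21 r22]] := cap_range s0 xc.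
  have tbz : tb <= zr by rewrite (le_trans _ (ltW tbzr))// lerDl ltW.
  have [pol1 pol2] := cap_polar s0 d0 ta0 zlta tbrm rmta tbzr c0P dc hE dhE xc.
  rewrite -/(u1 x) -/(u2 x) -mxE' in pol1.
  have Eg0 : g0 x = pgrad i0 s d h dh x by rewrite /g0 (fd_double d0 pol2).2 scale1r.
  have Ev0x : v0 x = polar i0 s d h x - 3 * d by exact: (fd_double d0 pol2).1.
  have mxC : 0 <= mx x <= Cu.
    have b1 : `|u1 x| <= Cu by apply: CuP; rewrite nrm_ge0 (le_trans r12).
    have b2 : `|u2 x| <= Cu by apply: CuP; rewrite nrm_ge0 (le_trans r22)// ltW.
    have p1' : 0 <= u1 x by apply: le_trans (ltW c00) (c0P _ _); left; rewrite r11.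
    rewrite mxE' le_max p1' ge_max (le_trans (ler_norm _) b1) (le_trans (ler_norm _) b2).
    by [].
  have Hphi : `|phip p (v0 x) - phip p (mx x)| <= e2.
    move: mxC => /andP[m0 mC]; have v0x : 0 <= v0 x by rewrite fd_ge0.
    have dd : `|v0 x - mx x| <= 6 * d by rewrite Ev0x; exact: dist_shift.
    apply/ltW/dpP; last exact: le_lt_trans d6.
      exact: bound_near mC v0x d1' dd.
    by rewrite ger0_norm// ler_wpDr.
  have rb : t0 + s <= nrm (x - s *: e) <= tb + s.
    rewrite r22 andbT; apply: le_trans (nrm_sub_coord i0 s x).
    by rewrite [leRHS]addrC lerD2r lerNr.
  have flux : dotp (avec p (g0 x + ep *: ge x)) (ge x) <= z (nrm x) / nrm x * dotp (ge x) x + e1 +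
      (if `|pdiff i0 s h x| <= 2 * d then C2 else 0).
    rewrite Eg0; apply: (cap_flux p1 s0 d0 ta0 zlta tbrm rmta tbzr zpos zneg c0P dc hE dhE t1 xc xt0 (t2 := t2)) => //.
    - by move=> xt2; apply: le_trans dg (gapP _ _ _ rb); rewrite xt2.
    - exact: getaE.
    - move=> w wC; apply: daP; first by rewrite le_max wC.
        by rewrite nrmZ (ger0_norm (ltW ep0)) /ep mulrAC ler_pdivrMr// ler_wpM2l// ltW.
      by rewrite le_max CgP orbT.
  have etaI : 0 <= eta x <= Ce by rewrite eta0 (le_trans (ler_norm _) (CeP x)).
  apply: le_trans (first_variation p1 ep0 mu0 etaI flux Hphi) _.
  rewrite lerD2l; apply: ler_wpM2l => //; rewrite e12.
  have zmx : zm <= zeta x by apply: zetal => //; exact: ltW.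
  apply: pointwise_balance => //; case: ifP => [Dx|_]; last by rewrite mulr_ge0 ?(ltW Cc0).
  have -> : C2 = Cc * (zm * K) by rewrite /Cc mulfVK// gt_eqF// mulr_gt0.
  by rewrite ler_wpM2l ?(ltW Cc0)// (le_trans _ (ZK x xc Dx))// ler_wpM2r// ltW.
have cg := grad_spacecc p1 Ev vsupp; have cg0 := grad_spacecc p1 Ev0 v0supp.
have cv := pow_spacecc p1 (C1_continuous Ev) vsupp.
have cv0 := pow_spacecc p1 (C1_continuous Ev0) v0supp.
have Itot := variation_integral cg cv cg0 cv0 cT0 cbeta czeta cZ P.
have zlt0 : zl < t0 + s by rewrite (lt_trans zlta)// (lt_trans tat0)// ltrDl.
have zls : zl + s < zr.
  by apply: lt_trans tbzr; rewrite ltrD2r (lt_trans zlta)// (lt_trans tat0)// (lt_trans t0p)// (lt_trans tp2)// (lt_trans t21).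
have [rho [zlrho rho1 rho2 rho3]] := hole_radius zrho zlt0 zls.
(* Beyond the truncated annulus, the bump and the translated ball. *)
pose R2 := Num.max R20 (Num.max t1 (s + rho)).
exists s, rho, R2, v, g; split => //.
- by rewrite !le_max lexx !orbT.
- rewrite !gt_max R2z rho3 andbT /= (lt_trans t1b)// (lt_trans _ tbzr)// ltrDl//.
split => //.
- by move=> x; rewrite addr_ge0 ?fd_ge0// mulr_ge0 ?(ltW ep0).
- move=> x xI.
  have -> : v x = v0 x.
    rewrite /v (_ : eta x = 0) ?mulr0 ?addr0//; have [] := etas x _ => //.
    case: xI => xI; last by right; apply: le_trans xI; rewrite !le_max lexx orbT.
    left; have := le_trans (nrm_sub_coord i0 s x) (le_trans xI rho2).
    by rewrite [leLHS]addrC lerD2r lerNl.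
  apply: (polar_hole s0 d0 h_ge0 hz); case: xI => xI; [left|right].
    exact: le_trans xI rho1.
  by apply: le_trans xI; rewrite le_max lexx.
- exists xp; rewrite ltr_wpDl ?fd_ge0// mulr_gt0//.
have IZ' : Cc * spaceint Z <= spaceint beta / 4.
  apply: le_trans dK; rewrite (_ : Kt * d = Cc * ((2 * tb) ^+ N * (Cz * (6 * d)))).
    by rewrite ler_wpM2l// ltW.
  by rewrite /Kt; ring.
have pe0 : 0 < p * ep by rewrite mulr_gt0.
exact: energy_balance pe0 I0 Itot Epol IT0 e3i IZ'.
Qed.

End PolarFinal.


(** * Disjoint test functions *)

Definition test_pair (R : realType) (N : nat) (p mu : R) (v : 'rV[R]_N -> R) (g : 'rV[R]_N -> 'rV[R]_N) :=
  [/\ C1 v g, forall x, 0 <= v x, exists x, 0 < v x &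
  spaceint (fun x => nrm (g x) `^ p) < mu * spaceint (fun x => `|v x| `^ p)].

Section NodalChain.
Variables (R : realType) (N : nat) (p mu : R) (u z : R -> R) (r0 B0 : R) (zeta : nat -> R).
Local Notation V := 'rV[R]_N.
Local Notation phq := (phip (conjp p)).
Hypothesis N0 : (0 < N)%N.
Hypothesis p1 : 1 < p.
Hypothesis mu0 : 0 < mu.
Hypothesis Du : forall r : R, is_derive r 1 u (phq (z r)).
Hypothesis cz : continuous z.
Hypothesis Su : forall r, 0 < r -> rsol N.-1 p mu u z r.
Hypothesis r00 : 0 < r0.
Hypothesis B00 : 0 < B0.
Hypothesis zB : forall r, 0 <= r <= r0 -> `|z r| <= r * B0.
Hypothesis u0 : u 0 = 1.
Hypothesis zeta0 : 0 < zeta 0%N.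
Hypothesis zetaS : forall i, zeta i < zeta i.+1.
Hypothesis uzeta : forall i, u (zeta i) = 0.
Hypothesis zzeta : forall i, z (zeta i) != 0.
Hypothesis u_first : forall r, 0 < r < zeta 0%N -> u r != 0.
Hypothesis u_next : forall i r, zeta i < r < zeta i.+1 -> u r != 0.
Implicit Types (r s t A : R) (x : V).

Let cu : continuous u.
Proof. by move=> r; exact: is_derive_continuous (Du r). Qed.

Let DuN r : is_derive r 1 (fun t => - u t) (phq (- z r)).
Proof. by rewrite phipN; exact: is_derive1N. Qed.

Let czN : continuous (fun r => - z r).
Proof. by move=> r; apply: (@continuousN _ _ _ z); exact: cz. Qed.

Let SuN r : 0 < r -> rsol N.-1 p mu (fun t => - u t) (fun t => - z t) r.
Proof. by move=> /Su; exact: rsol_opp. Qed.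

Let zBN r : 0 <= r <= r0 -> `|- z r| <= r * B0.
Proof. by rewrite normrN; exact: zB. Qed.

Let const_sign a b : (forall r, a < r < b -> u r != 0) ->
  (forall r, a < r < b -> 0 < u r) \/ (forall r, a < r < b -> 0 < - u r).
Proof.
move=> un; apply: contrapT => /not_orP[/existsNP[r /not_implyP[rI ur]] /existsNP[s /not_implyP[sI us]]].
have {}ur : u r < 0 by rewrite lt_neqAle un//= leNgt; exact/negP.
have {}us : 0 < u s by rewrite lt_neqAle eq_sym un//= leNgt; apply/negP => us'; apply: us; rewrite oppr_gt0.
have key (x y : R) : a < x < b -> a < y < b -> x <= y -> u x * u y < 0 -> False.
  move=> /andP[x1 x2] /andP[y1 y2] xy uxy.
  have [t tI ut] : exists2 t, t \in `[x, y] & u t = 0.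
    apply: (IVT xy (continuous_subspaceT cu)); rewrite ge_min le_max.
    have [ux|ux] := leP (u x) 0; have [uy|uy] := leP (u y) 0 => //=; rewrite ?(ltW ux) ?(ltW uy) ?orbT//.
      by move: uxy; rewrite ltNge mulr_le0.
    by move: uxy; rewrite ltNge ltW// mulr_gt0.
  move: tI; rewrite in_itv/= => /andP[t1 t2].
  by have := un t; rewrite ut eqxx (lt_le_trans x1 t1) (le_lt_trans t2 y2) => /(_ isT).
have [rs|/ltW sr] := leP r s; [apply: (key r s)|apply: (key s r)] => //.
  by rewrite nmulr_rlt0.
by rewrite pmulr_rlt0.
Qed.

(** Where u is negative, the pair -u, -z is used; it satisfies the same system. *)
Lemma nodal_annulus i A : 0 < A < zeta i -> exists (v : V -> R) g (rho : R),
  [/\ test_pair p mu v g, A < rho < zeta i.+1 & forall x, nrm x <= A \/ rho <= nrm x -> v x = 0].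
Proof.
move=> /andP[A0 Ai].
have [H|H] := const_sign (@u_next i).
  have [v [g [rho [h1 h2 h3 h4 [h5 h6]]]]] := annulus_test N0 p1 mu0 Du cz Su r00 B00 zB
    A0 Ai (zetaS i) (uzeta i) (uzeta i.+1) H (zzeta i).
  by exists v, g, rho.
have uN j : - u (zeta j) = 0 by rewrite uzeta oppr0.
have zN : - z (zeta i) != 0 by rewrite oppr_eq0.
have [v [g [rho [h1 h2 h3 h4 [h5 h6]]]]] := annulus_test N0 p1 mu0 DuN czN SuN r00 B00 zBN
  A0 Ai (zetaS i) (uN i) (uN i.+1) H zN.
by exists v, g, rho.
Qed.

Lemma nodal_polar (i0 : 'I_N) : exists (s rho r2 : R) (v : V -> R) g,
  [/\ 0 < s, zeta 0%N < rho, s + rho <= r2, r2 < zeta 1%N & test_pair p mu v g /\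
      forall x, nrm (x - s *: delta_mx ord0 i0) <= rho \/ r2 <= nrm x -> v x = 0].
Proof.
have [H|H] := const_sign (@u_next 0%N).
  have [s [rho [r2 [v [g [h1 h2 h3 h4 [h5 h6 h7 h8 h9]]]]]]] := polar_test N0 p1 mu0 Du cz Su r00 B00 zB
    zeta0 (zetaS 0%N) (uzeta 0%N) (uzeta 1%N) H i0.
  by exists s, rho, r2, v, g.
have uN j : - u (zeta j) = 0 by rewrite uzeta oppr0.
have [s [rho [r2 [v [g [h1 h2 h3 h4 [h5 h6 h7 h8 h9]]]]]]] := polar_test N0 p1 mu0 DuN czN SuN r00 B00 zBN
  zeta0 (zetaS 0%N) (uN 0%N) (uN 1%N) H i0.
by exists s, rho, r2, v, g.
Qed.

Lemma test_pair_shift (i0 : 'I_N) s (v : V -> R) g M : test_pair p mu v g ->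
  (forall x, M < nrm x -> v x = 0) ->
  test_pair p mu (fun x => v (x - s *: delta_mx ord0 i0)) (fun x => g (x - s *: delta_mx ord0 i0)).
Proof.
move=> [h1 h2 [x hx] h4] vM; split => //.
- exact: (C1_shift (- (s *: delta_mx ord0 i0)) h1).
- by exists (x + s *: delta_mx ord0 i0); rewrite addrK.
have E (F : V -> R) : spacecc F -> spaceint (fun x => F (x - s *: delta_mx ord0 i0)) = spaceint F.
  by move=> cF; rewrite -(spaceint_shift i0 (- s) cF) /shiftc scaleNr.
have cg := grad_spacecc p1 h1 vM; have cv := pow_spacecc p1 (C1_continuous h1) vM.
by rewrite (E _ cg) (E _ cv).
Qed.

Lemma nodal_ball (i0 : 'I_N) s (rho : R) : zeta 0%N < rho -> exists (v : V -> R) g,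
  test_pair p mu v g /\ forall x, rho <= nrm (x - s *: delta_mx ord0 i0) -> v x = 0.
Proof.
move=> zr; have upos r : 0 <= r < zeta 0%N -> 0 < u r.
  move=> /andP[]; rewrite le_eqVlt => /predU1P[<-|r1] r2; first by rewrite u0 ltr01.
  have [H|H] := const_sign u_first; first by rewrite H// r1.
  have u00 : 0 < u 0 by rewrite u0 ltr01.
  have [d d0 dP] := near_gt cu u00.
  pose t := Num.min (d / 2) (zeta 0%N / 2).
  have t0 : 0 < t by rewrite lt_min (divr_gt0 d0)// divr_gt0.
  have td : t < d by rewrite gt_min ltr_pdivrMr// mulr_natr mulr2n ltrDl d0.
  have tz : 0 < t < zeta 0%N by rewrite t0 gt_min [X in _ || X]ltr_pdivrMr// mulr_natr mulr2n ltrDl zeta0 orbT.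
  have := dP t; rewrite sub0r normrN gtr0_norm// => /(_ td).
  by have := H t tz; rewrite oppr_gt0 => /lt_trans h /h; rewrite ltxx.
have [v [g [B [h1 h2 /andP[h3 h3'] h4 [h5 h6]]]]] :=
  ball_test N0 p1 mu0 Du cz Su r00 B00 zB u0 zeta0 zr (uzeta 0%N) upos (zzeta 0%N).
have T : test_pair p mu v g by split => //; exists 0.
have vM x : B < nrm x -> v x = 0 by move=> /ltW; exact: h4.
exists (fun x => v (x - s *: delta_mx ord0 i0)), (fun x => g (x - s *: delta_mx ord0 i0)).
split; first exact: test_pair_shift T vM.
by move=> x xr; apply: h4; rewrite (le_trans (ltW h3')).
Qed.

(* The translated ball fills the eccentric hole of the polarized annulus, and every further
   annulus starts beyond the supports already placed, inside the previous zero. *)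
Lemma nodal_chain j : exists (v : nat -> V -> R) (g : nat -> V -> V) (rho : R),
  [/\ 0 < rho < zeta j.+1, forall a, (a < j.+2)%N -> test_pair p mu (v a) (g a),
      forall a x, (a < j.+2)%N -> rho <= nrm x -> v a x = 0 &
      forall a b x, (a < b)%N -> (b < j.+2)%N -> v a x = 0 \/ v b x = 0].
Proof.
elim: j => [|j [v [g [rho [/andP[rho0 rhoz] Tv vsupp vdisj]]]]].
  have [s [rho [r2 [v [g [s0 zrho sr2 r2z [Tv vs]]]]]]] := nodal_polar (Ordinal N0).
  have [v1 [g1 [Tv1 v1s]]] := nodal_ball (Ordinal N0) s zrho.
  have rho0 : 0 < rho by exact: lt_trans zrho.
  exists (fun a => if a is 0%N then v1 else v), (fun a => if a is 0%N then g1 else g), r2; split.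
  - by rewrite r2z andbT; apply: lt_le_trans sr2; rewrite addr_gt0.
  - by case.
  - move=> [|a] x _ xr; last by apply: vs; right.
    apply: v1s; have := nrm_triangle (x - s *: delta_mx ord0 (Ordinal N0)) (s *: delta_mx ord0 (Ordinal N0)).
    by rewrite subrK nrm_ray ?(ltW s0)//; move: xr sr2; lra.
  - move=> a b x ab b2; have {ab b2}[-> ->] : a = 0%N /\ b = 1%N by case: b ab b2 => [|[|b]] //; case: a.
    have [xr|/ltW xr] := leP (nrm (x - s *: delta_mx ord0 (Ordinal N0))) rho.
      by right; apply: vs; left.
    by left; exact: v1s.
have [|v' [g' [rho' [Tv' /andP[rr' r'z] v's]]]] := @nodal_annulus j.+1 rho.
  by rewrite rho0.
exists (fun a => if (a < j.+2)%N then v a else v'), (fun a => if (a < j.+2)%N then g a else g'), rho'.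
split.
- by rewrite r'z andbT (lt_trans rho0).
- by move=> a _; case: ifP => // /Tv.
- move=> a x _ xr; case: ifP => [aj|_]; last by apply: v's; right.
  by apply: vsupp => //; rewrite (le_trans _ xr)// ltW.
- move=> a b x ab bj; have aj : (a < j.+2)%N by exact: leq_trans ab bj.
  rewrite aj; case: ifP => [bj'|_]; first exact: vdisj.
  have [xr|/ltW xr] := leP (nrm x) rho; first by right; apply: v's; left.
  by left; exact: vsupp.
Qed.

Lemma lambda_var_nodal j : zeta j.+1 = 1 -> (lambda_var (@unit_ball R N) p j.+2 < mu%:E)%E.
Proof.
move=> zj; have [v [g [rho [/andP[_ rz] Tv vs vd]]]] := nodal_chain j.
rewrite zj in rz.
apply: (@lambda_var_lt R N p mu rho j.+2 (fun a : 'I_j.+2 => v a) (fun a : 'I_j.+2 => g a) p1 rz).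
- by move=> a; have [] := Tv a (ltn_ord a).
- by move=> a; have [] := Tv a (ltn_ord a).
- by move=> a x /ltW; exact: vs.
- move=> a b x; rewrite neq_ltn => /orP[ab|ba]; first exact: vd.
  by apply/or_comm; exact: vd.
- by move=> a; have [] := Tv a (ltn_ord a).
- by move=> a; have [] := Tv a (ltn_ord a).
Qed.

End NodalChain.

Theorem theorem1p1 (R : realType) (N : nat) (p : R) (k : nat) :
  (2 <= N)%N -> 1 < p -> (2 <= k)%N ->
  exists mu : R, radial_kth N p k mu /\
    (lambda_var (@unit_ball R N) p k < mu%:E)%E.
Proof.
move=> N2 p1; case: k => [|[|j]] // _.
have N0 : (0 < N)%N by exact: ltnW.
have q1 := conjp_gt1 p1.
have [w [y [Dw cy wy0 Sw [B B0 yB]]]] := profile_exists p1 N.-1.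
have [z [z0 zS wz w0z wiz]] := profile_zeros p1 Dw wy0 Sw.
exists (z j.+1 `^ p); split; first exact: (radial_kth_zero p1 Dw cy wy0 Sw erefl z0 zS wz w0z wiz).
have zpos i : 0 < z i by elim: i => // i IH; exact: lt_trans (zS i).
(* Here k = j + 2 and zeros are numbered from 0, so c is the k-th zero. Rescaling by c moves it to
   the boundary r = 1 and changes the eigenvalue from 1 to c^p. *)
set c := z j.+1; have c0 : 0 < c := zpos j.+1.
have pc0 : 0 < phip p c by exact: phip_gt0.
have cE t : c * (t / c) = t by rewrite mulrC divfK// gt_eqF.
have cI a b r : (a / c < r < b / c) = (a < c * r < b).
  by rewrite ltr_pdivrMr// ltr_pdivlMr// (mulrC r).
pose u r := w (c * r); pose v r := phip p c * y (c * r).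
have Du (r : R) : is_derive r 1 u (phip (conjp p) (v r)).
  by rewrite /v phipM (phipK p1); exact: is_derive_profile_scaled.
have cv : continuous v.
  have cc : continuous (fun r : R => c * r) by move=> r; exact: is_derive_continuous (is_derive1_Mc c (is_derive1_id r)).
  by apply: contRM; [move=> r; exact: cst_continuous|exact: contR_comp].
have Su r : 0 < r -> rsol N.-1 p (c `^ p) u v r by move=> r0; exact: profile_scaled.
have vB r : 0 <= r <= c^-1 -> `|v r| <= r * (phip p c * c * B).
  move=> /andP[r0 r1]; rewrite normrM (gtr0_norm pc0).
  have cr : 0 <= c * r <= 1 by rewrite mulr_ge0 ?(ltW c0)//= mulrC -ler_pdivlMr// div1r.
  rewrite (_ : r * _ = phip p c * (c * r * B)); last by ring.
  by rewrite ler_pM2l// yB.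
apply: (@lambda_var_nodal R N p (c `^ p) u v c^-1 (phip p c * c * B) (fun i => z i / c)) => //.
- exact: powR_gt0.
- by rewrite invr_gt0.
- by rewrite mulr_gt0 ?(mulr_gt0 pc0).
- by rewrite /u mulr0; have [] := wy0 0 (lexx _).
- by rewrite divr_gt0.
- by move=> i; rewrite ltr_pM2r ?invr_gt0.
- by move=> i; rewrite /u cE.
- by move=> i; rewrite /v cE; exact: mulf_neq0 (lt0r_neq0 pc0) (profile_zero_simple p1 Dw wy0 Sw (zpos i) (wz i)).
- by move=> r; have := cI 0 (z 0%N) r; rewrite mul0r => ->; exact: w0z.
- by move=> i r; rewrite cI; exact: wiz.
- by rewrite divff// gt_eqF.
Qed.
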